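(* Consider a family in prenormal form $(x^2-\epsilon)y'=B(\epsilon,x)y$, with $r$ and then $\rho$ sufficiently small, and let $H_D,H_U$ be the associated normalizing matrices. There exist matrices $\hat C_R$ and $\hat C_L$ such that $$H_D(\hat\epsilon,x)^{-1}H_U(\hat\epsilon,x)=\begin{cases}F_D(\hat\epsilon,x)\hat C_R(F_D(\hat\epsilon,x))^{-1}&\text{on }\Omega_R^{\hat\epsilon},\\ F_D(\hat\epsilon,x)\hat C_L(F_D(\hat\epsilon,x))^{-1}&\text{on }\Omega_L^{\hat\epsilon},\\ I&\text{on }\Omega_C^{\hat\epsilon}.\end{cases}$$ The matrices $\hat C_R$ and $\hat C_L$ are respectively upper triangular and lower triangular unipotent. They depend analytically on $\hat\epsilon\in S$ and converge, when $\hat\epsilon\to0$ ($\hat\epsilon\in S$), to the Stokes matrices $C_R$ and $C_L$ of the system at $\epsilon=0$.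
   Context: Systems. A family in prenormal form is a family $(x^2-\epsilon)y'=B(\epsilon,x)y$, $y\in\mathbb{C}^n$, $n\ge2$, $'=d/dx$, with $B=\Lambda(\epsilon,x)+(x^2-\epsilon)R(\epsilon,x)$, $\Lambda(\epsilon,x)=\mathrm{diag}\{\lambda_1(\epsilon,x),\dots,\lambda_n(\epsilon,x)\}=\Lambda_0(\epsilon)+\Lambda_1(\epsilon)x$, $\Lambda_0,\Lambda_1$ diagonal and analytic in $\epsilon$ near $0$, $R$ a matrix of germs of analytic functions of $(\epsilon,x)$ at the origin, and $\Re(\lambda_q(0,0)-\lambda_j(0,0))>0$ for $q<j$. Model system: $(x^2-\epsilon)z'=\Lambda(\epsilon,x)z$. Parameter sector. Let $\theta_0$ be the largest angle (supremum) in $(0,\frac\pi2)$ with $\Re(e^{\pm i\theta_0}(\lambda_q(0,0)-\lambda_j(0,0)))\ge0$ for $q<j$. Fix $\gamma>0$ with $\gamma(1+\frac{2\gamma}{\pi})<\theta_0$ and let $S=\{\hat\epsilon:0<|\hat\epsilon|<\rho,\ \arg\hat\epsilon\in(\pi-2\gamma,3\pi+2\gamma)\}$ (on the universal covering of $\mathbb{C}^*$; $\epsilon$ is the projection of $\hat\epsilon$). Put $\arg\sqrt{\hat\epsilon}=\frac12\arg\hat\epsilon$, $\hat x_L=\sqrt{\hat\epsilon}$, $\hat x_R=-\sqrt{\hat\epsilon}$. The radius $\rho>0$ is small, in particular so that for some $C>0$, $\Re(e^{\pm i\gamma(1+2\gamma/\pi)}(\lambda_q(\epsilon,\hat x_l)-\lambda_j(\epsilon,\hat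 x_l)))>C$ for $q<j$, $l=L,R$, $\hat\epsilon\in S$. $S_\cap$ is the auto-intersection of $S$: it consists of the pairs $\bar\epsilon$, $\tilde\epsilon=\bar\epsilon e^{2\pi i}$ both in $S$. Sectorial domains. Fix $r>0$ small, $\mathbb{D}_r=\{|x|<r\}$, $\delta>0$ small, $\Omega_D=\{|x|<r,\,-(\pi+\delta)<\arg x<\delta\}$, $\Omega_U=\{|x|<r,\,-\delta<\arg x<\pi+\delta\}$, such that the closure of $\Omega_D$ (resp. $\Omega_U$) contains no ray $\Re((\lambda_q(0,0)-\lambda_j(0,0))/x)=0$, $q\ne j$, of the upper (resp. lower) half-plane. Use the time $t$ of $\dot x=x^2-\epsilon$: $x(t)=-\sqrt{\hat\epsilon}\coth(\sqrt{\hat\epsilon}\,t)$ if $\epsilon\neq0$ (period $\pi i/\sqrt{\hat\epsilon}$), $x(t)=-1/t$ if $\epsilon=0$. Fix small constants $c_0>0$, $h\in(0,1/r)$, $\kappa\in(0,\frac12)$ independent of $\hat\epsilon$. Let $N_{\hat\epsilon}$ be the connected component containing $t=0$ of $\{t:|x(t)|\ge r\}$, $P=-\pi i/\sqrt{\hat\epsilon}$, $\hat\theta=\frac{2\gamma}{\pi}(\pi-\arg\sqrt{\hat\epsilon})$, and $\sigma(u)=0$ if $|u|\le c_0/\sqrt{|\epsilon|}$, $\sigma(u)=(u-\mathrm{sgn}(u)c_0/\sqrt{|\epsilon|})\tan\hat\theta$ otherwise. $\Gamma_D^{\hat\epsilon}$ is the set of $t\notin N_{\hat\epsilon}$ with $\Im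 t<h+\sigma(\Re t)$ lying above the line $-(\frac12+\kappa)P+\mathbb{R}e^{i\hat\theta}$; $\Gamma_U^{\hat\epsilon}$ is the set of $t\notin N_{\hat\epsilon}$ with $\Im t>-h+\sigma(\Re t)$ lying below the line $(\frac12+\kappa)P+\mathbb{R}e^{i\hat\theta}$. For $\epsilon=0$: $\Gamma_D^0=\{|t|>1/r,\Im t<h\}$, $\Gamma_U^0=\{|t|>1/r,\Im t>-h\}$. $\Omega_s^{\hat\epsilon}=x(\Gamma_s^{\hat\epsilon})$, $s=D,U$ (with $\Omega^0_s\subset\Omega_s$). $\Omega_D^{\hat\epsilon}\cap\Omega_U^{\hat\epsilon}$ has three connected components $\Omega_L^{\hat\epsilon},\Omega_R^{\hat\epsilon},\Omega_C^{\hat\epsilon}$, images of the right and left components of $\Gamma_D^{\hat\epsilon}\cap\Gamma_U^{\hat\epsilon}$ and of $\Gamma_D^{\hat\epsilon}\cap(\Gamma_U^{\hat\epsilon}-P)$; their closures contain respectively $\hat x_L$, $\hat x_R$, and both; $0\in\Omega_C^{\hat\epsilon}$. For $\epsilon=0$, $\Omega_L^0$ and $\Omega_R^0$ are the left and right components of $\Omega_D^0\cap\Omega_U^0$. Model solutions. For $l=L,R$, $\mathcal U_l=\frac1{2\hat x_l}\Lambda(\epsilon,\hat x_l)$. $F(\epsilon,x)=(x-\hat x_R)^{\mathcal U_R}(x-\hat x_L)^{\mathcal U_L}$ for $\epsilon\ne0$ and $F(0,x)=x^{\Lambda_1(0)}e^{-\Lambda_0(0)/x}$ is a fundamental matrix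 of the model. $F_D(\hat\epsilon,\cdot)$ is its branch on $\Omega_D^{\hat\epsilon}$ (namely $e^{t\Lambda_0}(x^2-\epsilon)^{\Lambda_1/2}$ with $x=x(t)$, $t\in\Gamma_D^{\hat\epsilon}$, converging as $\hat\epsilon\to0$ to $F(0,x)$ with $-(\pi+\delta)<\arg x<\delta$), and $F_U(\hat\epsilon,\cdot)$ is the analytic continuation of $F_D$ to $\Omega_U^{\hat\epsilon}$ through $\Omega_R^{\hat\epsilon}$. Normalizing matrices. $H_s(\hat\epsilon,x)$, $s=D,U$, are the matrices, analytic for $\hat\epsilon\in S$, $x\in\Omega_s^{\hat\epsilon}$, such that $W_s=H_sF_s$ is a fundamental matrix of solutions of the family on $\Omega_s^{\hat\epsilon}$; $\lim_{x\to\hat x_l,x\in\Omega_s^{\hat\epsilon}}H_s(\hat\epsilon,x)$ ($l=L,R$) is an invertible diagonal matrix independent of $s$, analytic in $\hat\epsilon\in S$ with nonsingular limit at $\epsilon=0$; $|H_s(\bar\epsilon,0)-H_s(\tilde\epsilon,0)|\le c|\bar\epsilon|$ on $S_\cap$ for some $c\ge0$; $|H_s(\hat\epsilon,0)|$ and $|H_s(\hat\epsilon,0)^{-1}|$ are bounded on $S_\cap$; and they are normalized by $(H_s(\hat\epsilon,0))_{jj}=1$, $j=1,\dots,n$ (such matrices exist and are unique). Stokes matrices at $\epsilon=0$. $H_s(0,x)$, $s=D,U$, is the unique invertible analytic matrix on $\Omega_s$, asymptotic at the origin to a power series $\hat H(x)$ independent of $s$ with $\hat H(0)=I$, such that $y=H_s(0,x)z$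 conjugates the system $x^2y'=B(0,x)y$ to $x^2z'=(\Lambda_0(0)+\Lambda_1(0)x)z$. The Stokes matrices $C_R,C_L$ are the constant matrices with $H_D(0,x)^{-1}H_U(0,x)=F_D(0,x)C_lF_D(0,x)^{-1}$ on $\Omega_l^0$, $l=R,L$, where $F_D(0,x)=x^{\Lambda_1(0)}e^{-\Lambda_0(0)/x}$ with $-(\pi+\delta)<\arg x<\delta$. *)

(* Defs.v *)
From HB Require Import structures.
From mathcomp Require Import all_boot all_order all_algebra.
From mathcomp Require Import complex.
From mathcomp Require Import all_classical all_reals all_analysis.
Set Implicit Arguments.
Unset Strict Implicit.
Unset Printing Implicit Defensive.
Import Order.TTheory GRing.Theory Num.Theory numFieldNormedType.Exports.
Local Open Scope ring_scope.
Local Open Scope classical_set_scope.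

(* The field R[i], packed as a numClosedFieldType so that it inherits the
   generic norm, topology and differentiability of numFieldNormedType; over it,
   [differentiable] is complex differentiability. *)
Definition Cx (R : realType) : numClosedFieldType := R[i].

Section Complex.
Variable R : realType.
Local Notation C := (Cx R).

Definition mkC (a b : R) : C := (a +i* b)%C.
Definition rc (a : R) : C := mkC a 0.
Definition reC (z : C) : R := complex.Re z.
Definition imC (z : C) : R := complex.Im z.
Definition iC : C := mkC 0 1.

Definition cexp (z : C) : C :=
  mkC (expR (reC z) * cos (imC z)) (expR (reC z) * sin (imC z)).
Definition ccosh (z : C) : C := (cexp z + cexp (- z)) / 2.
Definition csinh (z : C) : C := (cexp z - cexp (- z)) / 2.

(* Only used for open A. *)
Definition holo (V W : normedModType C) (A : set V) (f : V -> W) : Prop :=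
  forall z, A z -> differentiable f z.

End Complex.

Variant sect := sD | sU.
Variant sing := pL | pR.

(* (x^2 - eps) y' = B(eps, x) y in prenormal form.  The germs are represented by
   total functions, constrained only near the origin; L0 eps and L1 eps are the
   diagonals of Lambda_0(eps) and Lambda_1(eps). *)
Record prenormal (R : realType) (n : nat) := Prenormal {
  L0 : Cx R -> 'rV[Cx R]_n;
  L1 : Cx R -> 'rV[Cx R]_n;
  Rem : Cx R -> Cx R -> 'M[Cx R]_n;
  L0_analytic : \forall e \near (0 : Cx R), differentiable L0 e;
  L1_analytic : \forall e \near (0 : Cx R), differentiable L1 e;
  Rem_analytic : \forall p \near ((0, 0) : Cx R * Cx R),
    differentiable (fun p : Cx R * Cx R => Rem p.1 p.2) p;
  L0_ordered : forall q j : 'I_n, (q < j)%N ->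
    0 < reC (L0 0 0 q - L0 0 0 j)
}.

Section Family.
Variables (R : realType) (n : nat) (y : prenormal R n).
Local Notation C := (Cx R).

Definition lam (j : 'I_n) (e x : C) : C := L0 y e 0 j + L1 y e 0 j * x.
Definition Lam (e x : C) : 'M[C]_n := diag_mx (\row_j lam j e x).
Definition Bmx (e x : C) : 'M[C]_n := Lam e x + (x ^+ 2 - e) *: Rem y e x.

(* e^{t Lambda_0} e^{m Lambda_1}, where m stands for a logarithm of
   (x^2 - e)^{1/2} (of x when e = 0) and t for the time of x' = x^2 - e. *)
Definition modelF (e t m : C) : 'M[C]_n :=
  diag_mx (\row_j cexp (t * L0 y e 0 j + m * L1 y e 0 j)).

Definition theta0 : R :=
  sup [set th : R | 0 < th < pi / 2 /\ forall q j : 'I_n, (q < j)%N ->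
         0 <= reC (cexp (iC R * rc th) * (lam q 0 0 - lam j 0 0)) /\
         0 <= reC (cexp (- (iC R * rc th)) * (lam q 0 0 - lam j 0 0))].

End Family.

(* The universal covering of C^* is realized as exp : C -> C^*.  A point
   \hat eps is its logarithm w, so that |eps| = e^{Re w}, arg \hat eps = Im w,
   \hat eps e^{2 pi i} is w + 2 pi i, and analyticity in \hat eps is analyticity
   in w. *)
Section UniversalCover.
Variables (R : realType) (gamma rho : R).
Local Notation C := (Cx R).

Definition eps (w : C) : C := cexp w.
Definition sqe (w : C) : C := cexp (w / 2).
Definition xs (l : sing) (w : C) : C := if l is pL then sqe w else - sqe w.

Definition Sdom : set C :=
  [set w | `|eps w| < rc rho /\ pi - 2 * gamma < imC w < 3 * pi + 2 * gamma].

Definition turn (w : C) : C := w + 2 * rc pi * iC R.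

(* w is \bar eps and turn w is \tilde eps. *)
Definition Scap : set C := [set w | Sdom w /\ Sdom (turn w)].

Definition eps_to0 : set_system C :=
  filter_from [set eta : R | 0 < eta]
              (fun eta => [set w | Sdom w /\ `|eps w| < rc eta]).

(* Holds automatically for small rho; part of the choice of rho. *)
Definition lam_gap (n : nat) (y : prenormal R n) : Prop :=
  exists2 K : R, 0 < K & forall w l (q j : 'I_n), Sdom w -> (q < j)%N ->
    let phi := rc (gamma * (1 + 2 * gamma / pi)) in
    let dl := lam y q (eps w) (xs l w) - lam y j (eps w) (xs l w) in
    K < reC (cexp (iC R * phi) * dl) /\ K < reC (cexp (- (iC R * phi)) * dl).

End UniversalCover.

Section Domains.
Variables (R : realType) (gamma rho r delta h kappa c0 : R).
Local Notation C := (Cx R).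

(* |x| < r with arg x in the range of the sector, in terms of a logarithm of x *)
Definition logsect (s : sect) : set C :=
  [set L | `|cexp L| < rc r /\
     if s is sD then - (pi + delta) < imC L < delta
     else - delta < imC L < pi + delta].
Definition Sect (s : sect) : set C := (@cexp R) @` logsect s.

(* The sectors are bounded: avoiding a ray means that the closure contains no
   nonzero point of it. *)
Definition ray_free (n : nat) (y : prenormal R n) : Prop :=
  forall q j : 'I_n, q != j -> forall x : C,
    reC ((lam y q 0 0 - lam y j 0 0) / x) = 0 ->
    (0 < imC x -> ~ closure (Sect sD) x) /\
    (imC x < 0 -> ~ closure (Sect sU) x).

Definition Gamma0 (s : sect) : set C :=
  [set t | rc r^-1 < `|t| /\ if s is sD then imC t < h else - h < imC t].
Definition x0 (t : C) : C := - t^-1.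
Definition Omega0 (s : sect) : set C := x0 @` Gamma0 s.
Definition Omega0_l (l : sing) : set C :=
  [set x | Omega0 sD x /\ Omega0 sU x /\
     if l is pL then reC x < 0 else 0 < reC x].

Definition xt (w t : C) : C := - (sqe w * ccosh (sqe w * t) / csinh (sqe w * t)).
Definition per (w : C) : C := - (rc pi * iC R / sqe w).

(* At the zeros of csinh the map xt w has a pole (|x| = oo), although the
   library's division makes xt w t = 0 there. *)
Definition Nset (w : C) : set C :=
  connected_component
    [set t | csinh (sqe w * t) = 0 \/ rc r <= `|xt w t|] 0.

Definition theta (w : C) : R := 2 * gamma / pi * (pi - imC w / 2).

Definition sigma (w : C) (u : R) : R :=
  let m := c0 / expR (reC w / 2) in
  if `|u| <= m then 0 else (u - Num.sg u * m) * tan (theta w).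

(* t lies above (below) the line p + R e^{i theta}, |theta| < pi/2, iff
   height w (t - p) is positive (negative). *)
Definition height (w t : C) : R := imC (t * cexp (- (iC R * rc (theta w)))).

Definition Gamma (s : sect) (w : C) : set C :=
  if s is sD then
    [set t | [/\ ~ Nset w t, imC t < h + sigma w (reC t) &
                 0 < height w (t + rc (1 / 2 + kappa) * per w)]]
  else
    [set t | [/\ ~ Nset w t, - h + sigma w (reC t) < imC t &
                 height w (t - rc (1 / 2 + kappa) * per w) < 0]].

Definition Omega (s : sect) (w : C) : set C := xt w @` Gamma s w.

(* The right component corresponds to \hat x_L and the left one to \hat x_R,
   since x(t) ~ -1/t. *)
Definition Gamma_l (l : sing) (w : C) : set C :=
  let A := Gamma sD w `&` Gamma sU w in
  [set t | A t /\ connected_component A t `<=`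
     [set u | if l is pL then 0 < reC u else reC u < 0]].
Definition Gamma_C (w : C) : set C :=
  [set t | Gamma sD w t /\ Gamma sU w (t + per w)].

Definition Omega_l (l : sing) (w : C) : set C := xt w @` Gamma_l l w.
Definition Omega_C (w : C) : set C := xt w @` Gamma_C w.

Section Solutions.
Variables (n : nat) (y : prenormal R n).
Local Notation S := (Sdom gamma rho).
Local Notation to0 := (eps_to0 gamma rho).

(* ell is the branch of log(x^2 - eps), x = x(t), t in Gamma_D, that tends to
   2 log x, - (pi + delta) < arg x < delta, as \hat eps -> 0. *)
Record logD (ell : C * C -> C) : Prop := LogD {
  logD_cont : {within [set p | S p.1 /\ Gamma sD p.1 p.2], continuous ell};
  logD_exp : forall w t, S w -> Gamma sD w t ->
    cexp (ell (w, t)) = xt w t ^+ 2 - eps w;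
  logD_lim : forall t L, Gamma0 sD t -> cexp L = x0 t -> logsect sD L ->
    (fun w => ell (w, t)) @ to0 --> 2 * L
}.

(* x(.) is injective on Gamma_D for small c0 and rho, so that F_D is a function
   of x; F_U is the continuation of F_D through Omega_R. *)
Record model_solutions (F : sect -> C -> C -> 'M[C]_n) : Prop := ModelSolutions {
  FD_branch : exists2 ell, logD ell & forall w t, S w -> Gamma sD w t ->
    F sD w (xt w t) = modelF y (eps w) t (ell (w, t) / 2);
  FU_holo : forall w, S w -> holo (Omega sU w) (F sU w);
  FU_cont : forall w x, S w -> Omega_l pR w x -> F sU w x = F sD w x
}.

Definition fundamental (A : set C) (e : C) (W : C -> 'M[C]_n) : Prop :=
  forall x, A x -> [/\ W x \in unitmx, derivable W x 1 &
    (x ^+ 2 - e) *: 'D_1 W x = Bmx y e x *m W x].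

Record normalizing (F H : sect -> C -> C -> 'M[C]_n) : Prop := Normalizing {
  H_analytic : forall s, holo [set p : C * C | S p.1 /\ Omega s p.1 p.2]
    (fun p : C * C => H s p.1 p.2);
  H_fundamental : forall s w, S w ->
    fundamental (Omega s w) (eps w) (fun x => H s w x *m F s w x);
  H_lim : exists K : sing -> C -> 'M[C]_n,
    [/\ forall l w, S w ->
          [/\ is_diag_mx (K l w), K l w \in unitmx &
              forall s, H s w @ within (Omega s w) (nbhs (xs l w)) --> K l w],
        forall l, holo S (K l) &
        forall l, exists2 K0 : 'M[C]_n, K0 \in unitmx & K l @ to0 --> K0];
  H_cap : forall s, exists2 c : C, 0 <= c & forall w, Scap gamma rho w ->
    `|H s w 0 - H s (turn w) 0| <= c * `|eps w|;
  H_bounded : forall s, exists c : C, forall w, Scap gamma rho w ->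
    [/\ `|H s w 0| <= c, `|H s (turn w) 0| <= c,
        `|invmx (H s w 0)| <= c & `|invmx (H s (turn w) 0)| <= c];
  H_normal : forall s w (j : 'I_n), S w -> H s w 0 j j = 1
}.

(* y = H z transforms x^2 z' = Lambda(0,x) z into x^2 y' = B(0,x) y. *)
Definition conjugates0 (A : set C) (H : C -> 'M[C]_n) : Prop :=
  forall x, A x ->
    x ^+ 2 *: 'D_1 H x = Bmx y 0 x *m H x - H x *m Lam y 0 x.

Definition asymptotic (A : set C) (H : C -> 'M[C]_n) (a : nat -> 'M[C]_n) : Prop :=
  forall m, exists c e : C, 0 < e /\ forall x, A x -> `|x| < e ->
    `|H x - \sum_(k < m) x ^+ k *: a k| <= c * `|x| ^+ m.

Record normalizing0 (H : sect -> C -> 'M[C]_n) : Prop := Normalizing0 {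
  H0_unit : forall s x, Sect s x -> H s x \in unitmx;
  H0_analytic : forall s, holo (Sect s) (H s);
  H0_conj : forall s, conjugates0 (Sect s) (H s);
  H0_asymp : exists2 a : nat -> 'M[C]_n, a 0%N = 1%:M &
    forall s, asymptotic (Sect s) (H s) a
}.

Definition F0 (L : C) : 'M[C]_n := modelF y 0 (- (cexp L)^-1) L.

Definition stokes_matrix (H : sect -> C -> 'M[C]_n) (l : sing) (Cl : 'M[C]_n) : Prop :=
  forall L, logsect sD L -> Omega0_l l (cexp L) ->
    invmx (H sD (cexp L)) *m H sU (cexp L) = F0 L *m Cl *m invmx (F0 L).

End Solutions.
End Domains.

Definition lower_unipotent (K : fieldType) (n : nat) (M : 'M[K]_n) : Prop :=
  is_trig_mx M /\ forall j, M j j = 1.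
Definition upper_unipotent (K : fieldType) (n : nat) (M : 'M[K]_n) : Prop :=
  lower_unipotent M^T.

(* Main.v *)
(** In the time t of x' = x^2 - eps the entries of a normalizing matrix H_s satisfy
    h_ij' = (lambda_i - lambda_j) h_ij + (x^2 - eps) (R H)_ij, and E = H_D^-1 H_U satisfies
    E' = [Lambda, E]; hence F_D^-1 E F_D is locally constant.  Along the rays of direction
    e^{i theta} that end at x_L or x_R, E tends to the identity, so that the entries of the
    constant matrix whose conjugates by F_D would grow are zero and the diagonal ones are 1.
    This gives unipotent triangular matrices on Omega_L and Omega_R and, both ends being in the
    closure of Omega_C, the identity on Omega_C.

    When eps tends to 0, H_s(eps, .) is compared with H_s(0, .) on a polygonal path of the
    t-plane that is horizontal on [-A, A] and has the direction e^{i theta} at both ends.  The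
    entries above, below and on the diagonal are integrated from the end at which the
    exponential kernel decays; since x^2 - eps is integrable along the path, uniformly in eps, the
    comparison error tends to 0 with eps and 1/A once the diagonal limits at x_L, x_R are known.
    These are close to 1 by the normalization (H_s(eps, 0))_jj = 1 on the line through +-P/2,
    where x = 0. *)
Require Import Defs.
From HB Require Import structures.
From mathcomp Require Import all_boot all_order all_algebra.
From mathcomp Require Import perm complex.
From mathcomp Require Import all_classical all_reals all_analysis.
From mathcomp Require Import ring lra.
Import Order.TTheory GRing.Theory Num.Theory numFieldNormedType.Exports.
Set Implicit Arguments.
Unset Strict Implicit.
Unset Printing Implicit Defensive.
Local Open Scope ring_scope.
Local Open Scope classical_set_scope.

(** Little is given about [F sU]: it is holomorphic on Omega_U and agrees with [F sD] on Omega_R.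
    That it is a diagonal invertible solution of the model elsewhere has to be continued from there,
    over N to the other side. This takes an identity theorem, which is derived from Goursat's
    theorem and a maximum principle. The continuation also needs the shape of N, a connected
    component given only through |x(t)| >= r; the comparison of x(t) with -1/t yields enough of it.
    The jump matrices are read at the fixed times t = L and t = -L, the same for all eps, so that
    their analyticity and limits reduce to those of H_s and F_D at two points. One gap has to serve
    all directions of the paths: |theta| < gamma (1 + 2 gamma / pi) < theta_0, so Re (v (lambda_i -
    lambda_j)), i < j, is bounded below for every v with Re v = 1 and |Im v| <= tan (gamma (1 + 2
    gamma / pi)). The horizontal part of the path and the period both have size 1 / |sqrt(eps)|: no
    choice of rho makes one small against the other, and this is the task of c0. The order of choice
    is r, then L, then c0, then rho. *)

(** * The modulus as a real number *)

Section ComplexNorm.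
Variable R : realType.
Local Notation C := (Cx R).
Implicit Types (z w : C) (a b : R).

(** The norm of [Cx R] has its values in [Cx R] itself, which is only partially ordered; [nc] moves
    it to the reals, where inequalities are decided by [lra]. *)
Definition nc z : R := reC `|z|.

Lemma Cext z w : reC z = reC w -> imC z = imC w -> z = w.
Proof. by case: z w => [a b] [a' b'] /= -> ->. Qed.

Lemma nc_sqrt z : nc z = Num.sqrt (reC z ^+ 2 + imC z ^+ 2).
Proof. by rewrite /nc /reC /imC (normc_def (z : R[i])). Qed.

Lemma norm_nc z : `|z| = rc (nc z).
Proof. by apply: Cext; rewrite /nc ?nc_sqrt /reC /imC ?(normc_def (z : R[i])). Qed.

Lemma rcD a b : rc (a + b) = rc a + rc b :> C.
Proof. by apply: Cext; rewrite /= ?addr0. Qed.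
Lemma rcN a : rc (- a) = - rc a :> C.
Proof. by apply: Cext; rewrite /= ?oppr0. Qed.
Lemma rcB a b : rc (a - b) = rc a - rc b :> C.
Proof. by rewrite rcD rcN. Qed.
Lemma rcM a b : rc (a * b) = rc a * rc b :> C.
Proof. by apply: Cext; rewrite /= ?mulr0 ?mul0r ?subr0 ?addr0. Qed.
Lemma rc0 : rc 0 = 0 :> C. Proof. by []. Qed.
Lemma rc1 : rc 1 = 1 :> C. Proof. by []. Qed.
Lemma rc_le a b : (rc a <= rc b :> C) = (a <= b).
Proof. by rewrite /rc /mkC lecE /= eqxx. Qed.
Lemma rc_lt a b : (rc a < rc b :> C) = (a < b).
Proof. by rewrite /rc /mkC ltcE /= eqxx. Qed.
Lemma rc_inj : injective (@rc R).
Proof. by move=> a b []. Qed.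
Lemma rcV a : rc a^-1 = (rc a)^-1 :> C.
Proof.
have [->|a0] := eqVneq a 0; first by rewrite !invr0.
have ra0 : rc a != 0 :> C by apply/eqP => /rc_inj /eqP; apply/negP.
by apply: (mulfI ra0); rewrite -rcM !divff.
Qed.
Lemma rcX a k : rc (a ^+ k) = rc a ^+ k :> C.
Proof. by elim: k => // k IH; rewrite !exprS rcM IH. Qed.
Lemma rc_nat k : rc k%:R = k%:R :> C.
Proof. by elim: k => // k IH; rewrite -!natr1 rcD IH. Qed.
Lemma rc_gt0P (e : C) : 0 < e -> exists2 d : R, 0 < d & e = rc d.
Proof.
case: e => d d'; rewrite ltcE /= => /andP[/eqP -> d0].
by exists d.
Qed.

Lemma nc_ge0 z : 0 <= nc z. Proof. by rewrite nc_sqrt sqrtr_ge0. Qed.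
Lemma nc0 : nc 0 = 0. Proof. by rewrite /nc normr0. Qed.
Lemma nc1 : nc 1 = 1. Proof. by rewrite /nc normr1. Qed.
Lemma nc_eq0 z : (nc z == 0) = (z == 0).
Proof.
rewrite -(normr_eq0 z) norm_nc; apply/eqP/eqP => [->//|].
by move=> h; apply: rc_inj; rewrite h.
Qed.
Lemma nc_gt0 z : (0 < nc z) = (z != 0).
Proof. by rewrite lt_def nc_ge0 andbT nc_eq0. Qed.
Lemma ncM z w : nc (z * w) = nc z * nc w.
Proof. by apply: rc_inj; rewrite rcM -!norm_nc normrM. Qed.
Lemma ncX z k : nc (z ^+ k) = nc z ^+ k.
Proof. by apply: rc_inj; rewrite rcX -!norm_nc normrX. Qed.
Lemma ncV z : nc z^-1 = (nc z)^-1.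
Proof. by apply: rc_inj; rewrite rcV -!norm_nc normfV. Qed.
Lemma ncN z : nc (- z) = nc z.
Proof. by rewrite /nc normrN. Qed.
Lemma ncBC z w : nc (z - w) = nc (w - z).
Proof. by rewrite -ncN opprB. Qed.
Lemma ncD z w : nc (z + w) <= nc z + nc w.
Proof. by rewrite -rc_le rcD -!norm_nc ler_normD. Qed.
Lemma ncB z w : nc (z - w) <= nc z + nc w.
Proof. by rewrite (le_trans (ncD _ _)) // ncN. Qed.
Lemma nc_lower z w : nc z - nc w <= nc (z - w).
Proof. by rewrite lerBlDr (le_trans _ (ncD _ _)) // subrK. Qed.
Lemma nc_lowerD z w : nc z - nc w <= nc (z + w).
Proof. by rewrite -(ncN w) -[X in z + X]opprK nc_lower. Qed.
Lemma nc_rc a : nc (rc a) = `|a|.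
Proof. by rewrite nc_sqrt /= expr0n /= addr0 sqrtr_sqr. Qed.
Lemma nc_sqr z : nc z ^+ 2 = reC z ^+ 2 + imC z ^+ 2.
Proof. by rewrite nc_sqrt sqr_sqrtr // addr_ge0 // sqr_ge0. Qed.
Lemma re_le_nc z : `|reC z| <= nc z.
Proof.
rewrite -(@ler_sqr _ `|_|) ?nnegrE ?nc_ge0 //.
by rewrite nc_sqr real_normK ?num_real // lerDl sqr_ge0.
Qed.
Lemma im_le_nc z : `|imC z| <= nc z.
Proof.
rewrite -(@ler_sqr _ `|_|) ?nnegrE ?nc_ge0 //.
by rewrite nc_sqr real_normK ?num_real // lerDr sqr_ge0.
Qed.
Lemma reC_le_nc z : reC z <= nc z.
Proof. exact: le_trans (ler_norm _) (re_le_nc z). Qed.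
Lemma nc_le_reim z : nc z <= `|reC z| + `|imC z|.
Proof.
rewrite -(@ler_sqr _ (nc z)) ?nnegrE ?nc_ge0 ?addr_ge0 //.
rewrite nc_sqr -(real_normK (num_real (reC z))) -(real_normK (num_real (imC z))).
have := normr_ge0 (reC z); have := normr_ge0 (imC z).
set x := `|_|; set x' := `|_| => h1 h2; nra.
Qed.
Lemma nc_sum (I : Type) (r : seq I) (P : pred I) (f : I -> C) :
  nc (\sum_(i <- r | P i) f i) <= \sum_(i <- r | P i) nc (f i).
Proof.
elim/big_rec2: _ => [|i a z _ h]; first by rewrite nc0.
by rewrite (le_trans (ncD _ _)) // lerD2l.
Qed.

Lemma reD z w : reC (z + w) = reC z + reC w. Proof. by case: z w => ? ? []. Qed.
Lemma imD z w : imC (z + w) = imC z + imC w. Proof. by case: z w => ? ? []. Qed.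
Lemma reN z : reC (- z) = - reC z. Proof. by case: z. Qed.
Lemma imN z : imC (- z) = - imC z. Proof. by case: z. Qed.
Lemma reB z w : reC (z - w) = reC z - reC w. Proof. by rewrite reD reN. Qed.
Lemma imB z w : imC (z - w) = imC z - imC w. Proof. by rewrite imD imN. Qed.
Lemma reM z w : reC (z * w) = reC z * reC w - imC z * imC w.
Proof. by case: z w => ? ? []. Qed.
Lemma imM z w : imC (z * w) = reC z * imC w + imC z * reC w.
Proof. by case: z w => ? ? []. Qed.
Lemma re_rc a : reC (rc a) = a. Proof. by []. Qed.
Lemma im_rc a : imC (rc a) = 0. Proof. by []. Qed.
Lemma re_iC : reC (iC R) = 0. Proof. by []. Qed.
Lemma im_iC : imC (iC R) = 1. Proof. by []. Qed.
Lemma reV z : reC z^-1 = reC z / nc z ^+ 2.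
Proof. by rewrite nc_sqr; case: z. Qed.
Lemma imV z : imC z^-1 = - imC z / nc z ^+ 2.
Proof. by rewrite nc_sqr; case: z => a b; rewrite mulNr. Qed.
Lemma Creim z : z = rc (reC z) + iC R * rc (imC z).
Proof.
by apply: Cext; rewrite ?reD ?imD ?reM ?imM /= ?mul0r ?mulr0 ?subr0 ?mul1r; lra.
Qed.
Lemma iCiC : iC R * iC R = -1.
Proof.
by apply: Cext; rewrite ?reM ?imM /= ?mul0r ?mulr0 ?mul1r ?mulr1; lra.
Qed.
Lemma nc_iC : nc (iC R) = 1.
Proof. by rewrite nc_sqrt /= expr0n expr1n add0r sqrtr1. Qed.
Lemma nc_conj z : nc z^* = nc z.
Proof. by rewrite !nc_sqrt; case: z => a b; rewrite /reC /imC /= sqrrN. Qed.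
Lemma re_conj z : reC z^* = reC z. Proof. by case: z. Qed.
Lemma im_conj z : imC z^* = - imC z. Proof. by case: z. Qed.
End ComplexNorm.

(** * Neighbourhoods and limits through the real modulus *)

Section Nbhs.
Variable R : realType.
Local Notation C := (Cx R).

Lemma nbhs_nc (z : C) (P : C -> Prop) :
  (\forall u \near z, P u) <->
  exists2 d : R, 0 < d & forall u, nc (u - z) < d -> P u.
Proof.
split.
  move=> /nbhs_normP[e /= /rc_gt0P[d d0 ->] h]; exists d => // u hu.
  by apply: h; rewrite /= distrC norm_nc rc_lt.
move=> [d d0 h]; apply/nbhs_normP; exists (rc d) => /=; first by rewrite rc_lt.
by move=> u /=; rewrite distrC norm_nc rc_lt; apply: h.
Qed.

Lemma cvg_nc {T : Type} (F : set_system T) {FF : Filter F} (f : T -> C) (l : C) :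
  f @ F --> l <-> forall e : R, 0 < e -> \forall x \near F, nc (f x - l) < e.
Proof.
split => [h e e0|h].
  have : \forall u \near l, nc (u - l) < e by apply/nbhs_nc; exists e.
  by move/h.
by move=> A /nbhs_nc[d d0 hA]; apply: filterS (h d d0) => x; apply: hA.
Qed.
End Nbhs.

(** * Complex derivatives with their value as an argument *)

Section Cdiff.
Variable R : realType.
Local Notation C := (Cx R).
Implicit Types (f g : C -> C) (z d : C).

(** The increment form of differentiability, with the derivative as an explicit argument, so that
    value and existence are obtained together. [derivable_cdiff] and [cdiff_is_derive] translate
    from and to [derivable]. *)
Definition cdiff f z d := forall e : R, 0 < e -> exists2 del : R, 0 < del &
  forall u, nc u < del -> nc (f (z + u) - f z - d * u) <= e * nc u.

Lemma cdiff_cont f z d : cdiff f z d -> forall e : R, 0 < e ->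
  exists2 del : R, 0 < del & forall u, nc (u - z) < del -> nc (f u - f z) < e.
Proof.
move=> h e e0; have [del del0 hd] := h 1 ltr01.
have K0 : 0 < 1 + nc d + 1 by have := nc_ge0 d; lra.
exists (Num.min del (e / (1 + nc d + 1))); first by rewrite lt_min del0 divr_gt0.
move=> u; rewrite lt_min => /andP[u1 u2].
have := hd _ u1; rewrite mul1r [z + _]addrC subrK => hh.
rewrite ltr_pdivlMr // in u2.
have -> : f u - f z = (f u - f z - d * (u - z)) + d * (u - z) by rewrite subrK.
apply: (le_lt_trans (ncD _ _)); rewrite ncM.
have h1 := nc_ge0 (u - z).
have h2 : nc (u - z) * (1 + nc d + 1) = nc (u - z) + nc (u - z) + nc d * nc (u - z) by ring.
lra.
Qed.

Lemma cdiff_continuous f z d : cdiff f z d -> f @ z --> f z.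
Proof.
move=> /cdiff_cont h A /nbhs_nc[e e0 hA].
have [del d0 hd] := h e e0; apply/nbhs_nc; exists del => // u /hd; exact: hA.
Qed.

Lemma cdiff_cst c z : cdiff (fun=> c) z 0.
Proof.
by move=> e e0; exists 1 => // u _; rewrite subrr mul0r subr0 nc0 mulr_ge0 ?nc_ge0 // ltW.
Qed.

Lemma cdiff_id z : cdiff id z 1.
Proof.
move=> e e0; exists 1 => // u _.
by rewrite mul1r [z + u]addrC addrK subrr nc0 mulr_ge0 ?nc_ge0 // ltW.
Qed.

Lemma cdiff_add f g z d d' : cdiff f z d -> cdiff g z d' ->
  cdiff (fun x => f x + g x) z (d + d').
Proof.
move=> hf hg e e0; have e20 : 0 < e / 2 by rewrite divr_gt0.
have [a a0 ha] := hf _ e20; have [b b0 hb] := hg _ e20.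
exists (Num.min a b) => [|u]; first by rewrite lt_min a0.
rewrite lt_min => /andP[/ha ua /hb ub].
have -> : f (z + u) + g (z + u) - (f z + g z) - (d + d') * u =
  (f (z + u) - f z - d * u) + (g (z + u) - g z - d' * u) by ring.
apply: (le_trans (ncD _ _)); lra.
Qed.

Lemma cdiff_scale f z d c : cdiff f z d -> cdiff (fun x => c * f x) z (c * d).
Proof.
move=> hf e e0; have K0 : 0 < nc c + 1 by rewrite ltr_wpDl ?nc_ge0.
have [|a a0 ha] := hf (e / (nc c + 1)); first by rewrite divr_gt0.
exists a => // u /ha hu.
have -> : c * f (z + u) - c * f z - c * d * u = c * (f (z + u) - f z - d * u) by ring.
rewrite ncM (le_trans (ler_wpM2l (nc_ge0 _) hu)) // mulrA.
apply: ler_wpM2r; first exact: nc_ge0.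
rewrite mulrCA ger_pMr // ler_pdivrMr // mul1r; lra.
Qed.

Lemma cdiff_opp f z d : cdiff f z d -> cdiff (fun x => - f x) z (- d).
Proof.
move=> /(cdiff_scale (-1)); rewrite mulN1r.
by under [fun x => -1 * _]eq_fun do rewrite mulN1r.
Qed.

Lemma cdiff_sub f g z d d' : cdiff f z d -> cdiff g z d' ->
  cdiff (fun x => f x - g x) z (d - d').
Proof. by move=> hf /cdiff_opp; apply: cdiff_add. Qed.

Lemma cdiff_comp f g z d d' : cdiff f z d -> cdiff g (f z) d' ->
  cdiff (fun x => g (f x)) z (d' * d).
Proof.
move=> hf hg e e0.
pose K := nc d + 1; pose K' := nc d' + 1.
have K0 : 0 < K by rewrite ltr_wpDl ?nc_ge0.
have K'0 : 0 < K' by rewrite ltr_wpDl ?nc_ge0.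
have [|b b0 hb] := hg (e / 2 / K); first by rewrite !divr_gt0.
have [|a a0 ha] := hf (Num.min 1 (e / 2 / K')); first by rewrite lt_min !divr_gt0 // ltr01.
exists (Num.min a (b / K)) => [|u]; first by rewrite lt_min a0 divr_gt0.
rewrite lt_min => /andP[/ha ua]; rewrite ltr_pdivlMr // => uK.
have n0 := nc_ge0 u.
set r := f (z + u) - f z - d * u in ua.
have r1 : nc r <= 1 * nc u by apply: (le_trans ua); rewrite ler_wpM2r // ge_min lexx.
have r2 : nc r <= e / 2 / K' * nc u.
  by apply: (le_trans ua); rewrite ler_wpM2r // ge_min lexx orbT.
pose v := f (z + u) - f z.
have vE : v = r + d * u by rewrite /r subrK.
have nv : nc v <= K * nc u.
  by rewrite vE (le_trans (ncD _ _)) // ncM /K mulrDl addrC lerD2l.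
have : nc v < b by apply: (le_lt_trans nv); rewrite mulrC.
move=> /hb; have -> : f z + v = f (z + u) by rewrite /v addrC subrK.
move=> hv.
have -> : g (f (z + u)) - g (f z) - d' * d * u =
  (g (f (z + u)) - g (f z) - d' * v) + d' * r by rewrite vE; ring.
apply: (le_trans (ncD _ _)); rewrite ncM.
have h1 : nc (g (f (z + u)) - g (f z) - d' * v) <= e / 2 * nc u.
  apply: (le_trans hv); apply: (le_trans (ler_wpM2l _ nv)).
    by rewrite !divr_ge0 // ltW.
  by rewrite mulrA divfK // gt_eqF.
have h2 : nc d' * nc r <= e / 2 * nc u.
  apply: (le_trans (ler_wpM2l (nc_ge0 _) r2)).
  rewrite mulrA ler_wpM2r // mulrCA ger_pMr ?divr_gt0 //.
  by rewrite ler_pdivrMr // mul1r /K'; lra.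
lra.
Qed.

Lemma cdiff_sqr z : cdiff (fun x => x ^+ 2) z (2 * z).
Proof.
move=> e e0; exists e => // u hu.
have -> : (z + u) ^+ 2 - z ^+ 2 - 2 * z * u = u * u by ring.
by rewrite ncM ler_wpM2r ?nc_ge0 // ltW.
Qed.

(* polarization: f g = ((f+g)^2 - (f-g)^2)/4 *)
Lemma cdiff_mul f g z d d' : cdiff f z d -> cdiff g z d' ->
  cdiff (fun x => f x * g x) z (d * g z + f z * d').
Proof.
move=> hf hg.
have h1 := cdiff_comp (cdiff_add hf hg) (cdiff_sqr _).
have h2 := cdiff_comp (cdiff_sub hf hg) (cdiff_sqr _).
have := cdiff_scale (4^-1) (cdiff_sub h1 h2).
have q0 : 4 != 0 :> C by rewrite pnatr_eq0.
under [fun x => 4^-1 * _]eq_fun => x.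
  rewrite (_ : 4^-1 * _ = f x * g x); last by field.
  over.
rewrite (_ : 4^-1 * _ = d * g z + f z * d') //; by field.
Qed.

Lemma cdiff_inv z : z != 0 -> cdiff (fun x => x^-1) z (- z^-1 ^+ 2).
Proof.
move=> z0 e e0; have nz : 0 < nc z by rewrite nc_gt0.
exists (Num.min (nc z / 2) (e * nc z ^+ 3 / 2)).
  by rewrite lt_min !divr_gt0 // mulr_gt0 // exprn_gt0.
move=> u; rewrite lt_min => /andP[u1 u2].
have zu : nc z / 2 <= nc (z + u).
  by have := nc_lowerD z u; lra.
have zu0 : z + u != 0 by rewrite -nc_gt0; lra.
have -> : (z + u)^-1 - z^-1 - - z^-1 ^+ 2 * u = (u * u) / (z ^+ 2 * (z + u)).
  by field; rewrite z0 zu0.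
rewrite !ncM ncV ncM ncX mulrAC -mulrA mulrC ler_wpM2r ?nc_ge0 //.
have h0 : 0 < nc z ^+ 2 * nc (z + u) by rewrite mulr_gt0 ?exprn_gt0 // nc_gt0.
rewrite mulrC ler_pdivrMr //.
apply: (le_trans (ltW u2)).
rewrite exprSr -!mulrA ler_pM2l //.
by rewrite !ler_pM2l.
Qed.

Lemma cdiff_invf f z d : f z != 0 -> cdiff f z d ->
  cdiff (fun x => (f x)^-1) z (- (f z)^-1 ^+ 2 * d).
Proof. by move=> f0 hf; apply: (cdiff_comp hf (cdiff_inv f0)). Qed.

Lemma cdiff_sum (I : Type) (r : seq I) (P : pred I) (f : I -> C -> C) z (d : I -> C) :
  (forall i, P i -> cdiff (f i) z (d i)) ->
  cdiff (fun x => \sum_(i <- r | P i) f i x) z (\sum_(i <- r | P i) d i).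
Proof.
move=> h; elim: r => [|i r IH].
  rewrite big_nil; under eq_fun do rewrite big_nil; exact: cdiff_cst.
rewrite big_cons; under eq_fun do rewrite big_cons.
by case Pi: (P i) => //; exact: cdiff_add (h _ Pi) IH.
Qed.

Lemma cdiff_prod_ex (I : Type) (r : seq I) (f : I -> C -> C) z :
  (forall i, exists d, cdiff (f i) z d) ->
  exists d, cdiff (fun x => \prod_(i <- r) f i x) z d.
Proof.
move=> h; elim: r => [|i r [d IH]].
  by exists 0; under eq_fun do rewrite big_nil; exact: cdiff_cst.
have [di hi] := h i; eexists.
under eq_fun do rewrite big_cons; exact: cdiff_mul hi IH.
Qed.

Lemma cdiff_near f g z d (del : R) : 0 < del ->
  (forall u, nc (u - z) < del -> f u = g u) -> cdiff f z d -> cdiff g z d.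
Proof.
move=> del0 h hf e /hf[a a0 ha].
exists (Num.min a del) => [|u]; first by rewrite lt_min a0.
rewrite lt_min => /andP[/ha ua ud].
by rewrite -!h ?subrr ?nc0 // addrC addKr.
Qed.

Lemma cdiff_ext f g z d : (forall u, f u = g u) -> cdiff f z d -> cdiff g z d.
Proof. by move=> h; apply: (@cdiff_near _ _ _ _ 1) => // u _. Qed.

Lemma cdiff_val f z d d' : d = d' -> cdiff f z d -> cdiff f z d'.
Proof. by move=> ->. Qed.

Lemma cdiff_uniq f z d d' : cdiff f z d -> cdiff f z d' -> d = d'.
Proof.
move=> h h'; apply/eqP; rewrite -subr_eq0 -nc_eq0; apply/eqP/le_anti.
rewrite nc_ge0 andbT; apply/ler_addgt0Pr => e e0; rewrite add0r.
have e20 : 0 < e / 2 by rewrite divr_gt0.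
have [a a0 ha] := h _ e20; have [b b0 hb] := h' _ e20.
pose s := Num.min a b / 2.
have s0 : 0 < s by rewrite divr_gt0 // lt_min a0.
have sn : nc (rc s) = s by rewrite nc_rc gtr0_norm.
have m0 : 0 < Num.min a b by rewrite lt_min a0.
have sab : s < Num.min a b by rewrite /s; lra.
have := ha (rc s); have := hb (rc s); rewrite sn.
move: sab; rewrite lt_min => /andP[sa sb] /(_ sb) h1 /(_ sa) h2.
have : nc ((d - d') * rc s) <= e * s.
  have -> : (d - d') * rc s = (f (z + rc s) - f z - d' * rc s) - (f (z + rc s) - f z - d * rc s) by ring.
  apply: (le_trans (ncB _ _)); lra.
by rewrite ncM sn ler_pM2r.
Qed.

Lemma derivable_cdiff f z : derivable f z 1 -> cdiff f z ('D_1 f z).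
Proof.
move=> h e e0.
have /cvg_nc/(_ e e0) := h; rewrite -[lim _]/('D_1 f z).
rewrite /dnbhs near_withinE => /nbhs_nc[del d0 hd].
exists del => // u hu; have [->|u0] := eqVneq u 0.
  by rewrite addr0 subrr mulr0 subr0 nc0 mulr0.
have := hd u; rewrite subr0 => /(_ hu u0) /ltW.
rewrite /GRing.scale /= mulr1 => hh.
have -> : f (z + u) - f z - 'D_1 f z * u = (u^-1 * (f (u + z) - f z) - 'D_1 f z) * u.
  by rewrite [u + z]addrC; field.
by rewrite ncM ler_wpM2r ?nc_ge0.
Qed.

Lemma cdiff_is_derive f z d : cdiff f z d -> derivable f z 1 /\ 'D_1 f z = d.
Proof.
move=> h.
have H : h^-1 *: ((f \o shift z) (h *: (1 : C^o)) - f z) @[h --> (0 : C)^'] --> d.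
  apply/cvg_nc => e e0; have e20 : 0 < e / 2 by rewrite divr_gt0.
  have [a a0 ha] := h _ e20.
  rewrite /dnbhs near_withinE; apply/nbhs_nc; exists a => // u; rewrite subr0 => /ha hu u0.
  rewrite /GRing.scale /= mulr1.
  have -> : u^-1 * (f (u + z) - f z) - d = (f (z + u) - f z - d * u) / u.
    by rewrite [u + z]addrC; field.
  have nu : 0 < nc u by rewrite nc_gt0.
  by rewrite ncM ncV ltr_pdivrMr // (le_lt_trans hu) // ltr_pM2r //; lra.
split; first by apply/cvg_ex; exists d.
exact: (cvg_lim (@norm_hausdorff _ _) H).
Qed.
End Cdiff.

(** * Real derivatives with their value as an argument *)

Section RealDiff.
Variable R : realType.
Implicit Types (f g : R -> R) (x d a b : R).

Definition rdiff f x d := forall e : R, 0 < e -> exists2 del : R, 0 < del &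
  forall u, `|u| < del -> `|f (x + u) - f x - d * u| <= e * `|u|.

Lemma rdiff_is_derive f x d : rdiff f x d -> is_derive x 1 f d.
Proof.
move=> h.
have H : h^-1 *: ((f \o shift x) (h *: (1 : R^o)) - f x) @[h --> (0 : R)^'] --> d.
  apply/cvgrPdist_lt => e e0; have e20 : 0 < e / 2 by rewrite divr_gt0.
  have [a a0 ha] := h _ e20.
  rewrite /dnbhs near_withinE; exists a => // u; rewrite /= sub0r normrN => /ha hu u0.
  rewrite /GRing.scale /= mulr1 distrC.
  have -> : u^-1 * (f (u + x) - f x) - d = (f (x + u) - f x - d * u) / u.
    by rewrite [u + x]addrC; field.
  have nu : 0 < `|u| by rewrite normr_gt0.
  by rewrite normrM normfV ltr_pdivrMr // (le_lt_trans hu) // ltr_pM2r //; lra.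
apply: DeriveDef; first by apply/cvg_ex; exists d.
exact: (cvg_lim (@norm_hausdorff _ _) H).
Qed.

Lemma is_derive_rdiff f x d : is_derive x 1 f d -> rdiff f x d.
Proof.
move=> [h hd] e e0.
have /cvgrPdist_lt/(_ e e0) := h; rewrite -[lim _]/('D_1 f x) hd.
rewrite /dnbhs near_withinE => -[del /= d0 hdel].
exists del => // u hu; have [->|u0] := eqVneq u 0.
  by rewrite addr0 subrr mulr0 subr0 normr0 mulr0.
have := hdel u; rewrite /= sub0r normrN => /(_ hu u0) /ltW.
rewrite /GRing.scale /= mulr1 distrC => hh.
have -> : f (x + u) - f x - d * u = (u^-1 * (f (u + x) - f x) - d) * u.
  by rewrite [u + x]addrC; field.
by rewrite normrM ler_wpM2r.
Qed.

Lemma rdiff_val f x d d' : d = d' -> rdiff f x d -> rdiff f x d'.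
Proof. by move=> ->. Qed.

Lemma rdiff_ext f g x d : (forall u, f u = g u) -> rdiff f x d -> rdiff g x d.
Proof. by move=> /funext ->. Qed.

Lemma rdiff_cst c x : rdiff (fun=> c) x 0.
Proof. by apply: is_derive_rdiff. Qed.
Lemma rdiff_id x : rdiff id x 1.
Proof. by apply: is_derive_rdiff. Qed.
Lemma rdiff_add f g x d d' : rdiff f x d -> rdiff g x d' ->
  rdiff (fun y => f y + g y) x (d + d').
Proof.
by move=> /rdiff_is_derive h /rdiff_is_derive h'; apply: is_derive_rdiff; exact: is_deriveD.
Qed.
Lemma rdiff_opp f x d : rdiff f x d -> rdiff (fun y => - f y) x (- d).
Proof.
by move=> /rdiff_is_derive h; apply: is_derive_rdiff; exact: is_deriveN.
Qed.
Lemma rdiff_sub f g x d d' : rdiff f x d -> rdiff g x d' ->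
  rdiff (fun y => f y - g y) x (d - d').
Proof. by move=> h /rdiff_opp; exact: rdiff_add. Qed.
Lemma rdiff_mul f g x d d' : rdiff f x d -> rdiff g x d' ->
  rdiff (fun y => f y * g y) x (d * g x + f x * d').
Proof.
move=> /rdiff_is_derive h /rdiff_is_derive h'; apply: is_derive_rdiff.
by apply: is_derive_eq; rewrite /GRing.scale /=; ring.
Qed.
Lemma rdiff_scale f x d c : rdiff f x d -> rdiff (fun y => c * f y) x (c * d).
Proof.
by move=> h; apply: rdiff_val (rdiff_mul (rdiff_cst c x) h); ring.
Qed.
Lemma rdiff_comp f g x d d' : rdiff f x d -> rdiff g (f x) d' ->
  rdiff (fun y => g (f y)) x (d' * d).
Proof.
move=> /rdiff_is_derive h /rdiff_is_derive h'; apply: is_derive_rdiff; exact: is_derive1_comp.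
Qed.
Lemma rdiff_inv x : x != 0 -> rdiff (fun y => y^-1) x (- x ^- 2).
Proof.
move=> x0; apply: is_derive_rdiff.
have := @is_deriveV _ id x 1 1 x0 (is_derive_id _ _).
by rewrite /GRing.scale /= mulr1.
Qed.

Lemma rdiff_within f (d : R -> R) a b : (forall x, a <= x <= b -> rdiff f x (d x)) ->
  {within `[a, b], continuous f}.
Proof.
move=> h; apply: derivable_within_continuous => x; rewrite in_itv /= => /h.
by move=> /rdiff_is_derive [].
Qed.

Lemma rdiff_mono f (d : R -> R) a b : a <= b -> (forall x, a <= x <= b -> rdiff f x (d x)) ->
  (forall x, a <= x <= b -> 0 <= d x) -> f a <= f b.
Proof.
move=> ab h h0.
have sub x : x \in `]a, b[%R -> a <= x <= b.
  by rewrite in_itv /= => /andP[/ltW -> /ltW ->].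
apply: (@ger0_derive1_le_cc _ f a b) => //.
- by move=> x /sub/h/rdiff_is_derive[].
- move=> x /sub xab; rewrite derive1E; have /rdiff_is_derive[_ ->] := h x xab; exact: h0.
- exact: rdiff_within h.
- by rewrite in_itv /= lexx.
- by rewrite in_itv /= lexx ab.
Qed.

Lemma rdiff_expR x : rdiff expR x (expR x).
Proof. by apply: is_derive_rdiff. Qed.
Lemma rdiff_cos x : rdiff cos x (- sin x).
Proof. by apply: is_derive_rdiff. Qed.
Lemma rdiff_sin x : rdiff sin x (cos x).
Proof. by apply: is_derive_rdiff. Qed.
End RealDiff.

(** * Functions along segments: mean value and growth bounds *)

Section Lines.
Variable R : realType.
Local Notation C := (Cx R).
Implicit Types (h : C -> C) (p v : C) (a b s : R).

Definition pt p v s : C := p + rc s * v.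

(** The factor [k] lets one statement serve for the real part (k = 1) and the imaginary part (k =
    -i). *)
Lemma rdiff_line h p v s d k : cdiff h (pt p v s) d ->
  rdiff (fun s => reC (k * h (pt p v s))) s (reC (k * (d * v))).
Proof.
move=> H e e0; pose K := nc k * nc v + 1.
have K0 : 0 < K by rewrite ltr_wpDl ?mulr_ge0 ?nc_ge0.
have [|a a0 ha] := H (e / K); first by rewrite divr_gt0.
exists (a / (nc v + 1)) => [|u]; first by rewrite divr_gt0 // ltr_wpDl ?nc_ge0.
rewrite ltr_pdivlMr ?ltr_wpDl ?nc_ge0 // => hu.
have nv := nc_ge0 v; have u0 := normr_ge0 u.
have /ha : nc (rc u * v) < a by rewrite ncM nc_rc; lra.
have -> : pt p v s + rc u * v = pt p v (s + u) by rewrite /pt rcD; ring.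
rewrite ncM nc_rc => hh.
have -> : reC (k * h (pt p v (s + u))) - reC (k * h (pt p v s)) - reC (k * (d * v)) * u
  = reC (k * (h (pt p v (s + u)) - h (pt p v s) - d * (rc u * v))).
  have -> : k * (h (pt p v (s + u)) - h (pt p v s) - d * (rc u * v)) =
    k * h (pt p v (s + u)) - k * h (pt p v s) - (k * (d * v)) * rc u by ring.
  by rewrite !reB [reC (k * (d * v) * _)]reM /= mulr0 subr0.
apply: (le_trans (re_le_nc _)); rewrite ncM.
apply: (le_trans (ler_wpM2l (nc_ge0 _) hh)).
have -> : nc k * (e / K * (`|u| * nc v)) = e * `|u| * ((nc k * nc v) / K).
  by field; rewrite gt_eqF.
apply: ler_piMr; first by rewrite mulr_ge0 // ltW.
by rewrite ler_pdivrMr // mul1r /K; lra.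
Qed.

Lemma reC_scale z s : reC (z * rc s) = reC z * s :> R.
Proof. by rewrite reM /= mulr0 subr0. Qed.

Lemma rdiff_line_nc2 h p v s d : cdiff h (pt p v s) d ->
  rdiff (fun s => nc (h (pt p v s)) ^+ 2) s (2 * reC ((h (pt p v s))^* * (d * v))).
Proof.
move=> H; have h1 := rdiff_line 1 H; have h2 := rdiff_line (- iC R) H.
have := rdiff_add (rdiff_mul h1 h1) (rdiff_mul h2 h2).
have reI z : reC (- iC R * z) = imC z by rewrite reM !reN !imN re_iC im_iC; lra.
move=> H3; apply: rdiff_ext (rdiff_val _ H3) => [u|].
  by rewrite nc_sqr reI mul1r !expr2.
rewrite !reI !mul1r [reC (_^* * _)]reM re_conj im_conj; ring.
Qed.

Lemma conj_nc2 (z : C) : reC (z^* * z) = nc z ^+ 2.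
Proof. by rewrite reM re_conj im_conj nc_sqr; ring. Qed.

Definition crd (P : R -> C) s (d : C) :=
  rdiff (fun x => reC (P x)) s (reC d) /\ rdiff (fun x => imC (P x)) s (imC d).

Lemma crd_line h p v s d : cdiff h (pt p v s) d ->
  crd (fun s => h (pt p v s)) s (d * v).
Proof.
move=> H; split.
  by have := rdiff_line 1 H; rewrite mul1r; apply: rdiff_ext => u; rewrite mul1r.
have reI z : reC (- iC R * z) = imC z by rewrite reM !reN !imN re_iC im_iC; lra.
by have := rdiff_line (- iC R) H; rewrite reI; apply: rdiff_ext => u; rewrite reI.
Qed.

Lemma crd_sub (P Q : R -> C) s d d' : crd P s d -> crd Q s d' ->
  crd (fun s => P s - Q s) s (d - d').
Proof.
move=> [h1 h2] [h3 h4]; split.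
  by rewrite reB; apply: rdiff_ext (rdiff_sub h1 h3) => u; rewrite reB.
by rewrite imB; apply: rdiff_ext (rdiff_sub h2 h4) => u; rewrite imB.
Qed.

(** With D = P b - P a, the real function |D| f - Re (conj D P) is nondecreasing; comparing its
    values at a and b and dividing by |D| gives the bound. *)
Lemma crd_mvt (P d : R -> C) (f f' : R -> R) a b : a <= b ->
  (forall s, a <= s <= b -> crd P s (d s)) ->
  (forall s, a <= s <= b -> rdiff f s (f' s)) ->
  (forall s, a <= s <= b -> nc (d s) <= f' s) ->
  nc (P b - P a) <= f b - f a.
Proof.
move=> ab H Hf hle; set D := P b - P a.
have [D0|D0] := eqVneq D 0.
  rewrite D0 nc0 subr_ge0; apply: (rdiff_mono ab Hf) => s /hle.
  by apply: le_trans; exact: nc_ge0.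
have nD : 0 < nc D by rewrite nc_gt0.
have : nc D * f a - reC (D^* * P a) <= nc D * f b - reC (D^* * P b).
  apply: (@rdiff_mono _ (fun s => nc D * f s - reC (D^* * P s))
    (fun s => nc D * f' s - reC (D^* * d s)) a b ab) => s hs.
    apply: rdiff_sub (rdiff_scale (nc D) (Hf s hs)) _.
    have [h1 h2] := H s hs.
    have := rdiff_sub (rdiff_scale (reC D^*) h1) (rdiff_scale (imC D^*) h2).
    rewrite -reM; apply: rdiff_ext => u; by rewrite reM.
  rewrite subr_ge0 (le_trans (reC_le_nc _)) // ncM nc_conj ler_wpM2l ?nc_ge0 //.
  exact: hle.
have := conj_nc2 D; rewrite {2}/D mulrBr reB => h1 h2.
have : nc D * nc D <= nc D * (f b - f a) by rewrite -expr2; lra.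
by rewrite ler_pM2l.
Qed.

Lemma line_mvt h p v (d : R -> C) (f f' : R -> R) a b : a <= b ->
  (forall s, a <= s <= b -> cdiff h (pt p v s) (d s)) ->
  (forall s, a <= s <= b -> rdiff f s (f' s)) ->
  (forall s, a <= s <= b -> nc (d s * v) <= f' s) ->
  nc (h (pt p v b) - h (pt p v a)) <= f b - f a.
Proof.
move=> ab H; apply: (@crd_mvt (fun s => h (pt p v s)) (fun s => d s * v)) => // s hs.
exact: crd_line (H s hs).
Qed.

Lemma line_const h p v a b : a <= b ->
  (forall s, a <= s <= b -> cdiff h (pt p v s) 0) ->
  h (pt p v b) = h (pt p v a).
Proof.
move=> ab H; apply/eqP; rewrite -subr_eq0 -nc_eq0; apply/eqP/le_anti.
rewrite nc_ge0 andbT -(subrr (0 : R)).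
apply: (@line_mvt h p v (fun=> 0) (fun=> 0) (fun=> 0) a b) => // s _.
  exact: rdiff_cst.
by rewrite mul0r nc0.
Qed.

(** Where |h| > B, the term m h outweighs the forcing g, since c |h| > c B >= A, and |h|^2 has
    positive derivative. A maximum of |h| on [s1, b] with a value above B could thus only be at b,
    where |h| <= B. No exponential kernel has to be integrated. *)
Lemma line_grow h p v (d m g : R -> C) (c A B : R) a b : 0 < c -> A <= c * B ->
  (forall s, a <= s <= b -> cdiff h (pt p v s) (d s)) ->
  (forall s, a <= s <= b -> d s * v = m s * h (pt p v s) + g s) ->
  (forall s, a <= s <= b -> c <= reC (m s)) ->
  (forall s, a <= s <= b -> nc (g s) <= A) ->
  nc (h (pt p v b)) <= B ->
  forall s, a <= s <= b -> nc (h (pt p v s)) <= B.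
Proof.
move=> c0 AB H Hd Hm Hg hb s1 /andP[as1 s1b]; rewrite leNgt; apply/negP => hs1.
have sub s : s1 <= s <= b -> a <= s <= b.
  by move=> /andP[h1 ->]; rewrite (le_trans as1).
have B0 : 0 <= B.
  have : 0 <= c * B.
    apply: le_trans AB; apply: le_trans (Hg s1 _); first exact: nc_ge0.
    by rewrite as1.
  by rewrite pmulr_rge0.
pose G s := nc (h (pt p v s)) ^+ 2.
have HG s : a <= s <= b -> rdiff G s (2 * reC ((h (pt p v s))^* * (d s * v))).
  by move=> /H; exact: rdiff_line_nc2.
have /(EVT_max s1b) [x] : {within `[s1, b], continuous G}.
  by apply: rdiff_within => s /sub; exact: HG.
rewrite in_itv /= => /[dup] /sub axb /andP[s1x xb] xmax.
have hx : B < nc (h (pt p v x)).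
  have := xmax s1; rewrite in_itv /= lexx s1b => /(_ isT).
  by rewrite /G ler_sqr ?nnegrE ?nc_ge0 //; exact: lt_le_trans.
have xltb : x < b.
  rewrite lt_neqAle xb andbT; apply/eqP => xE.
  by move: hb; rewrite -xE leNgt hx.
set D := 2 * reC ((h (pt p v x))^* * (d x * v)).
have D0 : 0 < D.
  rewrite /D (Hd _ axb) mulrDr mulrCA reD [reC (m x * _)]reM conj_nc2.
  have -> : imC ((h (pt p v x))^* * h (pt p v x)) = 0.
    by rewrite imM re_conj im_conj; ring.
  have h1 : - (nc (h (pt p v x)) * A) <= reC ((h (pt p v x))^* * g x).
    have := re_le_nc ((h (pt p v x))^* * g x); rewrite ncM nc_conj ler_norml => /andP[h1 _].
    have := ler_wpM2l (nc_ge0 (h (pt p v x))) (Hg x axb); lra.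
  have h2 := Hm x axb; set y := nc (h (pt p v x)) in h1 hx *.
  have y0 : 0 < y by lra.
  have h3 : c * y ^+ 2 <= reC (m x) * y ^+ 2 by rewrite ler_wpM2r ?sqr_ge0.
  have h4 : y * A < y * (c * y) by rewrite ltr_pM2l //; apply: le_lt_trans AB _; rewrite ltr_pM2l.
  have h5 : y * (c * y) = c * y ^+ 2 by ring.
  lra.
have [|del del0 hdel] := HG x axb (D / 2); first by rewrite divr_gt0.
pose u := Num.min (del / 2) (b - x).
have u0 : 0 < u by rewrite /u lt_min subr_gt0 xltb divr_gt0.
have udel : `|u| < del.
  rewrite gtr0_norm // /u; apply: (@le_lt_trans _ _ (del / 2)); first by rewrite ge_min lexx.
  lra.
have ub : u <= b - x by rewrite /u ge_min lexx orbT.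
have := hdel u udel; rewrite -/D (gtr0_norm u0) ler_norml => /andP[h1 _].
have : G (x + u) <= G x.
  by apply: xmax; rewrite in_itv /=; apply/andP; split; lra.
have h2 : 0 < D * u by rewrite mulr_gt0.
lra.
Qed.

(** The reversal s -> -s, v -> -v turns decay into growth. *)
Lemma line_decay h p v (d m g : R -> C) (c A B : R) a b : 0 < c -> A <= c * B ->
  (forall s, a <= s <= b -> cdiff h (pt p v s) (d s)) ->
  (forall s, a <= s <= b -> d s * v = m s * h (pt p v s) + g s) ->
  (forall s, a <= s <= b -> reC (m s) <= - c) ->
  (forall s, a <= s <= b -> nc (g s) <= A) ->
  nc (h (pt p v a)) <= B ->
  forall s, a <= s <= b -> nc (h (pt p v s)) <= B.
Proof.
move=> c0 AB H Hd Hm Hg ha s1 hs1.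
have E s : pt p (- v) s = pt p v (- s) by rewrite /pt rcN mulrN mulNr.
have O s : - b <= s <= - a -> a <= - s <= b by move=> /andP[? ?]; apply/andP; split; lra.
have := @line_grow h p (- v) (fun s => d (- s)) (fun s => - m (- s)) (fun s => - g (- s))
  c A B (- b) (- a) c0 AB _ _ _ _ _ (- s1).
rewrite !E !opprK; apply => //.
- by move=> s /O hs; rewrite E; exact: H.
- by move=> s /O hs; rewrite E mulrN (Hd _ hs) opprD mulNr.
- by move=> s /O hs; rewrite reN; have := Hm _ hs; lra.
- by move=> s /O hs; rewrite ncN; exact: Hg.
- by move: hs1 => /andP[? ?]; apply/andP; split; lra.
Qed.

(** Induction over a real interval: the supremum of the points up to which [P] holds has a
    neighbourhood inside which [P] passes from any point to any other, so it is b and is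
    attained. *)
Lemma segment_induction (P : R -> Prop) a b : a <= b -> P a ->
  (forall s, a <= s <= b -> exists2 del : R, 0 < del &
     forall s' s'', a <= s' <= b -> a <= s'' <= b ->
       `|s' - s| < del -> `|s'' - s| < del -> P s' -> P s'') ->
  forall s, a <= s <= b -> P s.
Proof.
move=> ab Pa H.
pose E : set R := [set s | a <= s <= b /\ forall s', a <= s' <= s -> P s'].
have Ea : E a.
  split; first by rewrite lexx.
  by move=> s' /andP[h1 h2]; have -> : s' = a by apply/le_anti; rewrite h1 h2.
have ubE : has_sup E by split; [exists a|exists b => s [/andP[]]].
set c := sup E.
have ac : a <= c by exact: (sup_upper_bound ubE Ea).
have cb : c <= b by apply: ge_sup => [|s [/andP[]]]; first by exists a.
have [|del del0 hdel] := H c; first by rewrite ac.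
have [s [/andP[as_ sb] Ps] cs] := sup_adherent del0 ubE.
have sc : s <= c by apply: (sup_upper_bound ubE); split=> //; rewrite as_.
have key s' : a <= s' -> s' <= b -> s' < c + del -> P s'.
  move=> h1 h2 h3; have [h4|h4] := leP s' s; first by apply: Ps; rewrite h1.
  have h5 : c - del < s by exact: cs.
  apply: (hdel s s'); rewrite ?as_ ?h1 //.
  - by rewrite ltr_norml; apply/andP; split; lra.
  - by rewrite ltr_norml; apply/andP; split; lra.
  - by apply: Ps; rewrite as_ lexx.
have cE : c = b.
  apply/le_anti; rewrite cb leNgt; apply/negP => cltb.
  pose s2 := Num.min b (c + del / 2).
  have h1 : c < s2 by rewrite /s2 lt_min cltb; lra.
  have h2 : s2 < c + del by rewrite /s2; apply: (@le_lt_trans _ _ (c + del / 2)); [rewrite ge_min lexx orbT|lra].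
  have h3 : s2 <= b by rewrite /s2 ge_min lexx.
  have : s2 <= c.
    apply: (sup_upper_bound ubE); split; first by apply/andP; split; lra.
    by move=> s' /andP[? ?]; apply: key; lra.
  by rewrite leNgt h1.
by move=> s' /andP[h1 h2]; apply: key => //; lra.
Qed.
End Lines.

(** * The complex exponential *)

Section Exp.
Variable R : realType.
Local Notation C := (Cx R).
Implicit Types (z w : C).

Lemma cexpD z w : cexp (z + w) = cexp z * cexp w.
Proof.
by apply: Cext; rewrite ?reM ?imM /= reD imD expRD ?cosD ?sinD; ring.
Qed.
Lemma cexp0 : cexp 0 = 1 :> C.
Proof. by apply: Cext; rewrite /= expR0 ?cos0 ?sin0; ring. Qed.
Lemma cexpN z : cexp (- z) = (cexp z)^-1.
Proof.
have h : cexp z * cexp (- z) = 1 by rewrite -cexpD subrr cexp0.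
have e0 : cexp z != 0.
  by apply: contra_eq_neq h => ->; rewrite mul0r eq_sym oner_eq0.
by apply: (mulfI e0); rewrite h divff.
Qed.
Lemma nc_cexp z : nc (cexp z) = expR (reC z).
Proof.
have h : nc (cexp z) ^+ 2 = expR (reC z) ^+ 2.
  rewrite nc_sqr /= !exprMn -mulrDr cos2Dsin2 mulr1 //.
by apply/eqP; rewrite -(eqrXn2 (n := 2)) ?nc_ge0 ?expR_ge0 //; apply/eqP.
Qed.
Lemma cexp_neq0 z : cexp z != 0.
Proof. by rewrite -nc_gt0 nc_cexp expR_gt0. Qed.

(** The functional equation reduces the derivative to the one at 0, which comes from the real
    derivatives of [expR], [cos] and [sin] there. *)
Lemma cdiff_cexp z : cdiff (@cexp R) z (cexp z).
Proof.
suff H0 : cdiff (@cexp R) 0 1.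
  have h1 : cdiff (fun u => u - z) z 1.
    by apply: cdiff_val (cdiff_sub (cdiff_id z) (cdiff_cst z z)); rewrite subr0.
  have h2 : cdiff (fun u => cexp (u - z)) z (1 * 1).
    by apply: cdiff_comp h1 _; rewrite subrr.
  have := cdiff_scale (cexp z) h2; rewrite !mulr1; apply: cdiff_ext => u.
  by rewrite -cexpD addrC subrK.
(* The real and imaginary parts contribute errors 4 e' |u| and 5 e' |u| below. *)
move=> e e0; pose e' := Num.min 1 (e / 10).
have e'0 : 0 < e' by rewrite lt_min ltr01 divr_gt0.
have e'1 : e' <= 1 by rewrite ge_min lexx.
have e'e : e' <= e / 10 by rewrite ge_min lexx orbT.
clearbody e'.
have [d1 d10 H1] := @rdiff_expR R 0 e' e'0.
have [d2 d20 H2] := @rdiff_cos R 0 e' e'0.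
have [d3 d30 H3] := @rdiff_sin R 0 e' e'0.
exists (Num.min (Num.min d1 e') (Num.min d2 d3)).
  by rewrite !lt_min d10 d20 d30 e'0.
move=> u; rewrite !lt_min add0r => /andP[/andP[n1 n4] /andP[n2 n3]].
have ra := re_le_nc u; have ib := im_le_nc u.
have := H1 (reC u) (le_lt_trans ra n1).
have := H2 (imC u) (le_lt_trans ib n2).
have := H3 (imC u) (le_lt_trans ib n3).
rewrite !add0r expR0 cos0 sin0 oppr0 !mul1r mul0r !subr0.
set a := reC u in ra *; set b := imC u in ib *.
set E := expR a; set c := cos b; set s := sin b; set N := nc u in n1 n2 n3 n4 ra ib *.
move=> hs hc hE.
have ae : `|a| <= 1 by apply: le_trans e'1; apply: le_trans ra _; exact: ltW.
have na := normr_ge0 a; have nb := normr_ge0 b.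
have hE' : `|E - 1| <= 2 * `|a|.
  have -> : E - 1 = (E - 1 - a) + a by ring.
  apply: (le_trans (ler_normD _ _)).
  have : e' * `|a| <= 1 * `|a| by rewrite ler_wpM2r.
  lra.
have E3 : 0 <= E <= 3.
  rewrite expR_ge0 /=; have := ler_norm (E - 1); lra.
rewrite addr0 in hs; rewrite cexp0; apply: (le_trans (nc_le_reim _)).
rewrite !reB !imB /= subr0 -/E -/c -/s -/a -/b.
have k1 : `|E * c - 1 - a| <= 4 * (e' * N).
  have -> : E * c - 1 - a = E * (c - 1) + (E - 1 - a) by ring.
  apply: (le_trans (ler_normD _ _)); rewrite normrM ger0_norm; last by case/andP: E3.
  have h1 : E * `|c - 1| <= 3 * (e' * N).
    case/andP: E3 => E0 E3; apply: ler_pM => //; apply: (le_trans hc).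
    by rewrite ler_wpM2l // ltW.
  have h2 : e' * `|a| <= e' * N by rewrite ler_wpM2l // ltW.
  lra.
have k2 : `|E * s - b| <= 5 * (e' * N).
  have -> : E * s - b = E * (s - b) + (E - 1) * b by ring.
  apply: (le_trans (ler_normD _ _)); rewrite !normrM [`|E|]ger0_norm; last by case/andP: E3.
  have h1 : E * `|s - b| <= 3 * (e' * N).
    case/andP: E3 => E0 E3; apply: ler_pM => //; apply: (le_trans hs).
    by rewrite ler_wpM2l // ltW.
  have h2 : `|E - 1| * `|b| <= 2 * (e' * N).
    apply: (@le_trans _ _ (2 * `|a| * N)); first by apply: ler_pM.
    rewrite -mulrA ler_pM2l // ler_wpM2r ?nc_ge0 //; lra.
  lra.
have h1 : e' * N <= e / 10 * N by rewrite ler_wpM2r ?nc_ge0.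
have h2 : 0 <= e * N by rewrite mulr_ge0 ?nc_ge0 // ltW.
clear -k1 k2 h1 h2; lra.
Qed.

Lemma cdiff_cexpf (f : C -> C) z d : cdiff f z d ->
  cdiff (fun x => cexp (f x)) z (cexp (f z) * d).
Proof. by move=> h; exact: cdiff_comp h (cdiff_cexp _). Qed.
End Exp.

(** * Primitives on intervals and tools for bisection *)

Section Goursat.
Variable R : realType.
Local Notation C := (Cx R).

Lemma continuous_primitive (g : R -> R) a b : continuous g ->
  exists P : R -> R, forall x, a < x < b -> rdiff P x (g x).
Proof.
move=> cg.
exists (fun x => (\int[lebesgue_measure]_(t in `[a, x]) g t)%R) => x /andP[ax xb].
have ig : lebesgue_measure.-integrable `[a, b] (EFin \o g).
  apply: continuous_compact_integrable; first exact: segment_compact.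
  exact: continuous_subspaceT.
have [h1 h2] := continuous_FTC1_closed xb ig ax (cg x).
by apply: is_derive_rdiff; apply: DeriveDef; [exact: h1|rewrite -derive1E; exact: h2].
Qed.

Lemma min_lipschitz (u x y : R) : `|Num.min x u - Num.min y u| <= `|x - y|.
Proof.
have := ler_norm (x - y); have := ler_norm (y - x); rewrite [`|y - x|]distrC => h1 h2.
by case: (leP x u) => ?; case: (leP y u) => ?; rewrite ler_norml; apply/andP; split; lra.
Qed.

Lemma max_lipschitz (u x y : R) : `|Num.max u x - Num.max u y| <= `|x - y|.
Proof.
have := ler_norm (x - y); have := ler_norm (y - x); rewrite [`|y - x|]distrC => h1 h2.
by case: (leP u x) => ?; case: (leP u y) => ?; rewrite ler_norml; apply/andP; split; lra.
Qed.

(** Composition with the retraction [cl] of the line onto [a, b] makes g continuous everywhere, as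
    [continuous_primitive] requires, and leaves it unchanged on the interval. [P0] is the answer for
    an empty interval. *)
Lemma local_primitive (P0 : R -> R) (g : R -> R) (a b : R) :
  (forall x, a <= x <= b -> exists d, rdiff g x d) ->
  exists P : R -> R, forall x, a < x < b -> rdiff P x (g x).
Proof.
move=> hg; have [ba|ab] := leP b a.
  by exists P0 => x /andP[h1 h2]; have := lt_trans h1 h2; rewrite ltNge ba.
pose cl x : R := Num.max a (Num.min x b).
have clE x : a <= x <= b -> cl x = x.
  by move=> /andP[h1 h2]; rewrite /cl (min_idPl h2) (max_idPr h1).
have cl_in x : a <= cl x <= b.
  by rewrite /cl le_max lexx /= ge_max (ltW ab) ge_min lexx orbT.
have cl_lip x y : `|cl x - cl y| <= `|x - y|.
  exact: le_trans (max_lipschitz _ _ _) (min_lipschitz _ _ _).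
have cg : continuous (fun x => g (cl x)).
  move=> x; apply/cvgrPdist_lt => e e0.
  have [d /rdiff_is_derive [/derivable1_diffP/differentiable_continuous]] := hg _ (cl_in x).
  move=> /cvgrPdist_lt/(_ e e0) [del /= del0 hdel] _.
  exists del => // y /= xy; apply: hdel => /=; exact: le_lt_trans (cl_lip _ _) xy.
have [P hP] := continuous_primitive a b cg.
exists P => x axb; have := hP x axb; rewrite clE //.
by case/andP: axb => /ltW -> /ltW ->.
Qed.

Lemma complex_primitive (g dg : R -> C) (a b : R) :
  (forall x, a <= x <= b -> crd g x (dg x)) ->
  exists P : R -> C, forall x, a < x < b -> crd P x (g x).
Proof.
move=> hg.
have [P1 h1] := @local_primitive (fun=> 0) (fun x => reC (g x)) a b
  (fun x h => ex_intro _ _ (hg x h).1).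
have [P2 h2] := @local_primitive (fun=> 0) (fun x => imC (g x)) a b
  (fun x h => ex_intro _ _ (hg x h).2).
by exists (fun x => mkC (P1 x) (P2 x)) => x hx; split; [exact: h1|exact: h2].
Qed.

Lemma crd_mvt_abs (P d : R -> C) (K : R) (a b : R) :
  (forall s, Num.min a b <= s <= Num.max a b -> crd P s (d s)) ->
  (forall s, Num.min a b <= s <= Num.max a b -> nc (d s) <= K) ->
  nc (P b - P a) <= K * `|b - a|.
Proof.
wlog ab : a b / a <= b => [H|].
  have [ab|ba] := orP (le_total a b); first exact: H.
  by rewrite ncBC distrC minC maxC; apply: H.
rewrite (min_idPl ab) (max_idPr ab) => h1 h2.
rewrite ger0_norm ?subr_ge0 // mulrBr.
apply: (@crd_mvt _ P d (fun s => K * s) (fun=> K)) => // s _.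
by apply: rdiff_val (rdiff_scale K (rdiff_id s)); rewrite mulr1.
Qed.

Lemma nested_intervals (u v : nat -> R) :
  (forall k, u k <= u k.+1) -> (forall k, v k.+1 <= v k) -> (forall k, u k <= v k) ->
  exists x, forall k, u k <= x <= v k.
Proof.
move=> hu hv huv.
have um k j : (k <= j)%N -> u k <= u j.
  elim: j => [|j IH]; first by rewrite leqn0 => /eqP ->.
  by rewrite leq_eqVlt => /orP[/eqP -> //|]; rewrite ltnS => /IH h; exact: le_trans h (hu _).
have vm k j : (k <= j)%N -> v j <= v k.
  elim: j => [|j IH]; first by rewrite leqn0 => /eqP ->.
  by rewrite leq_eqVlt => /orP[/eqP -> //|]; rewrite ltnS => /IH h; exact: le_trans (hv _) h.
have uv k j : u k <= v j.
  by apply: le_trans (um _ _ (leq_maxl k j)) (le_trans (huv _) (vm _ _ (leq_maxr k j))).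
pose E : set R := range u.
have hE : has_sup E by split; [exists (u 0%N), 0%N|exists (v 0%N) => _ [k _ <-]].
exists (sup E) => k; apply/andP; split; first by apply: (sup_upper_bound hE); exists k.
by apply: ge_sup; [exists (u 0%N), 0%N|move=> _ [j _ <-]].
Qed.

Lemma exists_half_lt (S e : R) : 0 < e -> exists k : nat, S / 2 ^+ k < e.
Proof.
move=> e0; have := @cvg_geometric R S (2^-1).
rewrite gtr0_norm // invf_lt1 // => /(_ _)/cvgrPdist_lt.
rewrite ltr1n => /(_ isT e e0) [k _ hk]; exists k.
have := hk k (leqnn k); rewrite /= sub0r normrN exprVn => /(le_lt_trans (ler_norm _)).
by [].
Qed.

Lemma crd_ext (P Q : R -> C) s d : (forall x, P x = Q x) -> crd P s d -> crd Q s d.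
Proof. by move=> /funext ->. Qed.

End Goursat.

(** * Goursat's theorem on rectangles *)

Section Rectangle.
Variable R : realType.
Local Notation C := (Cx R).
Variables (f : C -> C) (z0 : C) (D : R) (PX PY : R -> R -> C).

Definition ptxy x y : C := z0 + (rc x + iC R * rc y).

Hypothesis HX : forall y s, `|y| < D -> `|s| < D -> crd (PX y) s (f (ptxy s y)).
Hypothesis HY : forall x s, `|x| < D -> `|s| < D -> crd (PY x) s (iC R * f (ptxy x s)).
Hypothesis Hf : forall x y, `|x| < D -> `|y| < D -> exists d, cdiff f (ptxy x y) d.

(** The integral of f over the boundary of [a, b] x [c, e], without integrals: [PX y] and [PY x] are
    primitives of f along a horizontal and a vertical line. The terms are the bottom, right, top and
    left sides. *)
Definition loop a b c e : C :=
  (PX c b - PX c a) + (PY b e - PY b c) - (PX e b - PX e a) - (PY a e - PY a c).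

Lemma nc_ptxy x y x' y' : nc (ptxy x y - ptxy x' y') <= `|x - x'| + `|y - y'|.
Proof.
have -> : ptxy x y - ptxy x' y' = rc (x - x') + iC R * rc (y - y').
  by rewrite /ptxy !rcB; ring.
by apply: (le_trans (ncD _ _)); rewrite ncM nc_iC mul1r !nc_rc.
Qed.

Lemma crd_ptx h y s d : cdiff h (ptxy s y) d -> crd (fun s => h (ptxy s y)) s d.
Proof.
have E u : pt (z0 + iC R * rc y) 1 u = ptxy u y by rewrite /pt /ptxy; ring.
rewrite -E => /crd_line; rewrite mulr1; apply: crd_ext => u.
by rewrite E.
Qed.

Lemma crd_pty h x s d : cdiff h (ptxy x s) d -> crd (fun s => h (ptxy x s)) s (iC R * d).
Proof.
have E u : pt (z0 + rc x) (iC R) u = ptxy x u by rewrite /pt /ptxy; ring.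
rewrite -E => /crd_line; rewrite mulrC; apply: crd_ext => u.
by rewrite E.
Qed.

(* Near a point, f is affine up to a small error; the affine part has a primitive
   and contributes nothing to the loop. *)
Lemma loop_local x0 y0 : `|x0| < D -> `|y0| < D -> forall eta, 0 < eta ->
  exists2 del, 0 < del & forall a b c e, - D < a -> b < D -> - D < c -> e < D ->
    a <= x0 <= b -> c <= y0 <= e -> (b - a) + (e - c) < del ->
    nc (loop a b c e) <= 2 * eta * ((b - a) + (e - c)) ^+ 2.
Proof.
move=> hx0 hy0 eta eta0; have [dd Hd] := Hf hx0 hy0.
set p := ptxy x0 y0 in Hd.
have [del del0 hdel] := Hd eta eta0.
exists del => // a b c e Da Db Dc De /andP[ax xb] /andP[cy ye] small.
set S := (b - a) + (e - c).
pose L z := f p * z + dd / 2 * (z - p) ^+ 2.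
have HL z : cdiff L z (f p + dd * (z - p)).
  have h1 := cdiff_scale (f p) (cdiff_id z).
  have h2 : cdiff (fun z => (z - p) ^+ 2) z (2 * (z - p)).
    have := cdiff_comp (cdiff_sub (cdiff_id z) (cdiff_cst p z)) (cdiff_sqr (z - p)).
    by apply: cdiff_val; rewrite subr0 mulr1.
  apply: cdiff_val (cdiff_add h1 (cdiff_scale (dd / 2) h2)).
  by rewrite mulr1 mulrA divfK // pnatr_eq0.
have close x y : a <= x <= b -> c <= y <= e ->
    nc (f (ptxy x y) - (f p + dd * (ptxy x y - p))) <= eta * S.
  move=> /andP[h1 h2] /andP[h3 h4].
  have hS : nc (ptxy x y - p) <= S.
    apply: (le_trans (nc_ptxy _ _ _ _)); apply: lerD;
      by rewrite ler_norml; apply/andP; split; lra.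
  have := hdel _ (le_lt_trans hS small); rewrite [p + _]addrC subrK => h5.
  rewrite opprD addrA; apply: (le_trans h5).
  by rewrite ler_pM2l.
have inD x y : a <= x <= b -> c <= y <= e -> `|x| < D /\ `|y| < D.
  by move=> /andP[? ?] /andP[? ?]; rewrite !ltr_norml; split; apply/andP; split; lra.
have ab : a <= b by lra.
have ce : c <= e by lra.
have horiz y : c <= y <= e ->
    nc ((PX y b - L (ptxy b y)) - (PX y a - L (ptxy a y))) <= eta * S * (b - a).
  move=> hy; rewrite -(ger0_norm (x := b - a)); last by rewrite subr_ge0.
  apply: (@crd_mvt_abs _ (fun s => PX y s - L (ptxy s y))
    (fun s => f (ptxy s y) - (f p + dd * (ptxy s y - p)))) => s.
    rewrite (min_idPl ab) (max_idPr ab) => hs; have [h1 h2] := inD _ _ hs hy.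
    by apply: crd_sub; [exact: HX|exact: crd_ptx (HL _)].
  by rewrite (min_idPl ab) (max_idPr ab) => hs; exact: close.
have vert x : a <= x <= b ->
    nc ((PY x e - L (ptxy x e)) - (PY x c - L (ptxy x c))) <= eta * S * (e - c).
  move=> hx; rewrite -(ger0_norm (x := e - c)); last by rewrite subr_ge0.
  apply: (@crd_mvt_abs _ (fun s => PY x s - L (ptxy x s))
    (fun s => iC R * (f (ptxy x s) - (f p + dd * (ptxy x s - p))))) => s.
    rewrite (min_idPl ce) (max_idPr ce) => hs; have [h1 h2] := inD _ _ hx hs.
    by rewrite mulrBr; apply: crd_sub; [exact: HY|exact: crd_pty (HL _)].
  rewrite (min_idPl ce) (max_idPr ce) => hs; rewrite ncM nc_iC mul1r; exact: close.
have laa : a <= a <= b by rewrite lexx.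
have lbb : a <= b <= b by rewrite lexx ab.
have lcc : c <= c <= e by rewrite lexx.
have lee : c <= e <= e by rewrite lexx ce.
have := horiz c lcc; have := horiz e lee; have := vert a laa; have := vert b lbb.
set q1 := _ - _ - (_ - _) => k1; set q2 := _ - _ - (_ - _) => k2.
set q3 := _ - _ - (_ - _) => k3; set q4 := _ - _ - (_ - _) => k4.
have -> : loop a b c e = q4 + q1 - q3 - q2 by rewrite /loop /q1 /q2 /q3 /q4; ring.
have t1 := ncB (q4 + q1 - q3) q2; have t2 := ncB (q4 + q1) q3; have t3 := ncD q4 q1.
have -> : 2 * eta * S ^+ 2 = 2 * (eta * S * (b - a)) + 2 * (eta * S * (e - c)).
  by rewrite /S; ring.
clear -k1 k2 k3 k4 t1 t2 t3; lra.
Qed.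

Let rect := (R * R * R * R)%type.
Let lp (r : rect) := let: (a, b, c, e) := r in nc (loop a b c e).
Let mid (a b : R) := (a + b) / 2.
Let quad (k : nat) (r : rect) : rect := let: (a, b, c, e) := r in
  match k with
  | 0 => (a, mid a b, c, mid c e) | 1 => (mid a b, b, c, mid c e)
  | 2 => (a, mid a b, mid c e, e) | _ => (mid a b, b, mid c e, e) end.
(** The selected quarter carries at least a quarter of the modulus of the loop. The fourth needs no
    test, because the four loops add up to the whole one. *)
Let next r := let ok k := lp r <= 4 * lp (quad k r) in
  quad (if ok 0%N then 0 else if ok 1%N then 1 else if ok 2%N then 2 else 3)%N r.

Let lp_next r : lp r <= 4 * lp (next r).
Proof.
rewrite /next; case: ifPn => // /negP h0; case: ifPn => // /negP h1.
case: ifPn => // /negP h2; move: h0 h1 h2.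
rewrite /lp /quad; case: r => [[[a b] c] e].
set m := mid a b; set k := mid c e.
have : loop a b c e = loop a m c k + loop m b c k + loop a m k e + loop m b k e.
  by rewrite /loop; ring.
set q1 := loop a m c k; set q2 := loop m b c k; set q3 := loop a m k e; set q4 := loop m b k e.
move=> -> /negP; rewrite -ltNge => h1 /negP; rewrite -ltNge => h2 /negP; rewrite -ltNge => h3.
have := ncD (q1 + q2 + q3) q4; have := ncD (q1 + q2) q3; have := ncD q1 q2.
move: h1 h2 h3; set n := nc (_ + _ + _ + _); clearbody n; lra.
Qed.

Let next_in a b c e : a <= b -> c <= e -> forall a' b' c' e', next (a, b, c, e) = (a', b', c', e') ->
  [/\ a <= a', b' <= b, c <= c' & e' <= e] /\
  [/\ a' <= b', c' <= e', b' - a' = (b - a) / 2 & e' - c' = (e - c) / 2].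
Proof.
move=> ab ce a' b' c' e'; rewrite /next /quad.
have h1 : a <= mid a b <= b by rewrite /mid; apply/andP; split; lra.
have h2 : c <= mid c e <= e by rewrite /mid; apply/andP; split; lra.
case/andP: h1 h2 => h1 h1' /andP[h2 h2'].
by do 3?[case: ifP => _] => -[<- <- <- <-]; split; split=> //; rewrite /mid; lra.
Qed.

(** Goursat's bisection: the loop is at most 4^k times the one on the k-th rectangle, and
    [loop_local] at the common point bounds the latter by 2 eta (S / 2^k)^2. The powers cancel and
    eta is arbitrary. *)
Lemma loop0_ord a b c e : a <= b -> c <= e -> - D < a -> b < D -> - D < c -> e < D ->
  loop a b c e = 0.
Proof.
move=> ab ce Da Db Dc De.
pose r k := iter k next (a, b, c, e).
pose A k := (r k).1.1.1; pose B k := (r k).1.1.2; pose U k := (r k).1.2; pose V k := (r k).2.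
have rE k : r k = (A k, B k, U k, V k) by rewrite /A /B /U /V; case: (r k) => [[[? ?] ?] ?].
have step k : A k <= B k -> U k <= V k ->
  [/\ A k <= A k.+1, B k.+1 <= B k, U k <= U k.+1 & V k.+1 <= V k] /\
  [/\ A k.+1 <= B k.+1, U k.+1 <= V k.+1, B k.+1 - A k.+1 = (B k - A k) / 2 &
    V k.+1 - U k.+1 = (V k - U k) / 2].
  by move=> h1 h2; apply: next_in => //; rewrite -rE -rE.
have inv k : [/\ A k <= B k, U k <= V k, B k - A k = (b - a) / 2 ^+ k & V k - U k = (e - c) / 2 ^+ k].
  elim: k => [|k [h1 h2 h3 h4]]; first by rewrite /A /B /U /V /= expr0 !divr1.
  have [_ [h5 h6 h7 h8]] := step k h1 h2; split=> //.
    by rewrite h7 h3 exprSr invfM mulrA.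
  by rewrite h8 h4 exprSr invfM mulrA.
have st k : [/\ A k <= A k.+1, B k.+1 <= B k, U k <= U k.+1 & V k.+1 <= V k].
  by have [h1 h2 _ _] := inv k; have [] := step k h1 h2.
have [x hx] : exists x, forall k, A k <= x <= B k.
  by apply: nested_intervals => k; [case: (st k)|case: (st k)|case: (inv k)].
have [y hy] : exists y, forall k, U k <= y <= V k.
  by apply: nested_intervals => k; [case: (st k)|case: (st k)|case: (inv k)].
have sub k : [/\ a <= A k, B k <= b, c <= U k & V k <= e].
  elim: k => [|k [h1 h2 h3 h4]]; first by rewrite /A /B /U /V /=.
  by have [h5 h6 h7 h8] := st k; split; [exact: le_trans h5|exact: le_trans h2|exact: le_trans h7|exact: le_trans h4].
have hlp k : nc (loop a b c e) <= 4 ^+ k * lp (r k).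
  elim: k => [|k IH]; first by rewrite expr0 mul1r.
  apply: (le_trans IH); have h := lp_next (r k); rewrite exprSr -[_ * 4 * _]mulrA.
  by apply: ler_wpM2l h; rewrite exprn_ge0.
have hxD : `|x| < D.
  by have /andP[h1 h2] := hx 0%N; have [h3 h4 _ _] := sub 0%N; rewrite ltr_norml; apply/andP; split; lra.
have hyD : `|y| < D.
  by have /andP[h1 h2] := hy 0%N; have [_ _ h3 h4] := sub 0%N; rewrite ltr_norml; apply/andP; split; lra.
pose S := (b - a) + (e - c).
apply/eqP; rewrite -nc_eq0; apply/eqP/le_anti; rewrite nc_ge0 andbT.
apply/ler_addgt0Pr => e' e'0; rewrite add0r.
pose eta := e' / (2 * S ^+ 2 + 1).
have S0 : 0 < 2 * S ^+ 2 + 1 by have := sqr_ge0 S; lra.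
have eta0 : 0 < eta by rewrite divr_gt0.
have [del del0 hdel] := loop_local hxD hyD eta0.
have [k hk] := exists_half_lt S del0.
have [h1 h2 h3 h4] := inv k; have [h5 h6 h7 h8] := sub k.
have := hdel (A k) (B k) (U k) (V k); rewrite h3 h4 -mulrDl -/S => /(_ _ _ _ _ (hx k) (hy k) hk).
have hl := hlp k; rewrite /lp rE in hl.
move=> hh; apply: (le_trans hl); have {}hh := hh ltac:(lra) ltac:(lra) ltac:(lra) ltac:(lra).
apply: (@le_trans _ _ (4 ^+ k * (2 * eta * (S / 2 ^+ k) ^+ 2))).
  by rewrite ler_pM2l ?exprn_gt0.
have -> : 4 ^+ k * (2 * eta * (S / 2 ^+ k) ^+ 2) = 2 * eta * S ^+ 2.
  have -> : (4 : R) ^+ k = (2 ^+ k) ^+ 2 by rewrite -exprM mulnC exprM; congr (_ ^+ k); rewrite -natrX.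
  by field; rewrite expf_neq0 // pnatr_eq0.
rewrite /eta; have -> : 2 * (e' / (2 * S ^+ 2 + 1)) * S ^+ 2 = e' * ((2 * S ^+ 2) / (2 * S ^+ 2 + 1)).
  by field; rewrite gt_eqF.
by rewrite ger_pMr // ler_pdivrMr // mul1r; lra.
Qed.

Lemma loop0 a b c e : `|a| < D -> `|b| < D -> `|c| < D -> `|e| < D -> loop a b c e = 0.
Proof.
rewrite !ltr_norml => /andP[a1 a2] /andP[b1 b2] /andP[c1 c2] /andP[e1 e2].
have Eab : loop a b c e = - loop b a c e by rewrite /loop; ring.
have Ece : loop a b c e = - loop a b e c by rewrite /loop; ring.
have Eabce : loop a b c e = loop b a e c by rewrite /loop; ring.
have [ab|ab] := leP a b; have [ce|ce] := leP c e.
- exact: loop0_ord.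
- by rewrite Ece loop0_ord ?oppr0 // ltW.
- by rewrite Eab loop0_ord ?oppr0 // ltW.
- by rewrite Eabce loop0_ord // ltW.
Qed.

(** F integrates f from [z0], first horizontally and then vertically. Adding a vanishing loop moves
    the horizontal part from height 0 to height y, so that an increment of F involves only values of
    f near the point. *)
Lemma primitive_rect : exists F : C -> C, forall x y, `|x| < D -> `|y| < D ->
  cdiff F (ptxy x y) (f (ptxy x y)).
Proof.
pose F z := let x := reC (z - z0) in let y := imC (z - z0) in
  (PX 0 x - PX 0 0) + (PY x y - PY x 0).
have FE x y : F (ptxy x y) = (PX 0 x - PX 0 0) + (PY x y - PY x 0).
  rewrite /F /ptxy [z0 + _]addrC addrK reD imD reM imM /=.
  by rewrite !mul0r !mulr0 mul1r subr0 addr0 !add0r.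
exists F => x y hx hy e e0.
have [d0 Hd] := Hf hx hy; have e40 : 0 < e / 2 by rewrite divr_gt0.
have [del del0 hdel] := cdiff_cont Hd e40.
have D0 : 0 < D by exact: le_lt_trans hx.
pose m := Num.min (D - `|x|) (D - `|y|).
have m0 : 0 < m by rewrite lt_min !subr_gt0 hx.
exists (Num.min (del / 2) m) => [|u]; first by rewrite lt_min divr_gt0.
rewrite !lt_min => /andP[ud /andP[um1 um2]].
set h := reC u; set k := imC u.
have nh : `|h| <= nc u := re_le_nc u; have nk : `|k| <= nc u := im_le_nc u.
have uE : ptxy x y + u = ptxy (x + h) (y + k).
  by rewrite {1}(Creim u) /ptxy !rcD -/h -/k; ring.
have hxs s : Num.min x (x + h) <= s <= Num.max x (x + h) -> `|s - x| <= `|h|.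
  have := ler_norm h; have := ler_norm (- h); rewrite normrN => n1 n2.
  by case: (leP x (x + h)) => hh /andP[? ?]; rewrite ler_norml; apply/andP; split; lra.
have hys s : Num.min y (y + k) <= s <= Num.max y (y + k) -> `|s - y| <= `|k|.
  have := ler_norm k; have := ler_norm (- k); rewrite normrN => n1 n2.
  by case: (leP y (y + k)) => hh /andP[? ?]; rewrite ler_norml; apply/andP; split; lra.
have big s (a b : R) : `|s - a| <= `|b| -> `|b| < D - `|a| -> `|s| < D.
  by move=> h1 h2; have := ler_normD (s - a) a; rewrite subrK; lra.
have hxh s : `|s - x| <= `|h| -> `|s| < D by move=> h1; apply: (big s x h) => //; lra.
have hyk s : `|s - y| <= `|k| -> `|s| < D by move=> h1; apply: (big s y k) => //; lra.
have xh : `|x + h| < D by apply: hxh; rewrite [x + h]addrC addrK.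
have yk : `|y + k| < D by apply: hyk; rewrite [y + k]addrC addrK.
have D00 : `|0 : R| < D by rewrite normr0.
have L0 := @loop0 x (x + h) 0 y hx xh D00 hy.
have close s t : `|s - x| <= `|h| -> `|t - y| <= `|k| ->
    nc (f (ptxy s t) - f (ptxy x y)) <= e / 2.
  move=> h1 h2; apply/ltW/hdel; apply: (le_lt_trans (nc_ptxy _ _ _ _)); lra.
rewrite uE !FE.
set G := f (ptxy x y).
have -> : PX 0 (x + h) - PX 0 0 + (PY (x + h) (y + k) - PY (x + h) 0) -
   (PX 0 x - PX 0 0 + (PY x y - PY x 0)) - G * u =
   ((PX y (x + h) - G * rc (x + h)) - (PX y x - G * rc x)) +
   ((PY (x + h) (y + k) - iC R * G * rc (y + k)) - (PY (x + h) y - iC R * G * rc y)).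
  rewrite {1}(Creim u) -/h -/k -[LHS]subr0 -L0 /loop !rcD; ring.
have crdl (c : C) s : crd (fun s => c * rc s) s c.
  split; [apply: rdiff_ext (rdiff_val _ (rdiff_scale (reC c) (rdiff_id s)))
         |apply: rdiff_ext (rdiff_val _ (rdiff_scale (imC c) (rdiff_id s)))];
    rewrite ?mulr1 // => v; by rewrite ?reM ?imM /= ?mulr0 ?subr0 ?add0r.
apply: (le_trans (ncD _ _)).
have k1 : nc ((PX y (x + h) - G * rc (x + h)) - (PX y x - G * rc x)) <= e / 2 * `|h|.
  have := @crd_mvt_abs _ (fun s => PX y s - G * rc s) (fun s => f (ptxy s y) - G) (e / 2) x (x + h).
  rewrite [x + h - x]addrC addKr; apply => s /hxs hs.
    by apply: crd_sub; [apply: HX => //; exact: hxh|exact: crdl].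
  by apply: close; rewrite // subrr normr0.
have k2 : nc ((PY (x + h) (y + k) - iC R * G * rc (y + k)) - (PY (x + h) y - iC R * G * rc y)) <= e / 2 * `|k|.
  have := @crd_mvt_abs _ (fun s => PY (x + h) s - iC R * G * rc s) (fun s => iC R * (f (ptxy (x + h) s) - G)) (e / 2) y (y + k).
  rewrite [y + k - y]addrC addKr; apply => s /hys hs.
    by rewrite mulrBr; apply: crd_sub; [apply: HY => //; exact: hyk|exact: crdl].
  by rewrite ncM nc_iC mul1r; apply: close; rewrite // [x + h]addrC addrK.
have k3 : e / 2 * `|h| <= e / 2 * nc u by rewrite ler_pM2l.
have k4 : e / 2 * `|k| <= e / 2 * nc u by rewrite ler_pM2l.
clear -k1 k2 k3 k4; lra.
Qed.
End Rectangle.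

(** * Primitives of holomorphic functions on squares *)

Section Primitive.
Variable R : realType.
Local Notation C := (Cx R).

Definition square (z0 : C) (d : R) : set C :=
  [set z | `|reC (z - z0)| < d /\ `|imC (z - z0)| < d].

Lemma ptxyE (z0 z : C) : ptxy z0 (reC (z - z0)) (imC (z - z0)) = z.
Proof. by rewrite /ptxy -Creim addrC subrK. Qed.

Lemma square_ptxy z0 d x y : `|x| < d -> `|y| < d -> square z0 d (ptxy z0 x y).
Proof.
by rewrite /square /ptxy /= [z0 + _]addrC addrK reD imD reM imM /= !mul0r !mulr0 mul1r subr0 addr0 !add0r.
Qed.

(** The loss from d to d' pays for the primitives along lines: they exist on an open interval when
    the function is differentiable on the closed one. *)
Lemma primitive_square (f : C -> C) z0 d d' : d' < d ->
  (forall z, square z0 d z -> exists D, cdiff f z D) ->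
  exists F : C -> C, forall z, square z0 d' z -> cdiff F z (f z).
Proof.
move=> dd Hf.
have Hf' x y : `|x| < d -> `|y| < d -> exists D, cdiff f (ptxy z0 x y) D.
  by move=> hx hy; apply: Hf; exact: square_ptxy.
have lt_d x : - d' <= x <= d' -> `|x| < d.
  by move=> /andP[h1 h2]; rewrite ltr_norml; apply/andP; split; lra.
have /choice[PX HX] : forall y, exists P : R -> C, `|y| < d ->
    forall s, `|s| < d' -> crd P s (f (ptxy z0 s y)).
  move=> y; have [hy|] := boolP (`|y| < d); last by exists (fun=> 0).
  have /choice[D HD] : forall s, exists D, - d' <= s <= d' -> cdiff f (ptxy z0 s y) D.
    move=> s; have [/lt_d hs|_] := boolP (- d' <= s <= d'); last by exists 0.
    by have [D] := Hf' s y hs hy; exists D.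
  have [P HP] := @complex_primitive _ (fun s => f (ptxy z0 s y)) D (- d') d'
    (fun s hs => crd_ptx (HD s hs)).
  by exists P => _ s; rewrite ltr_norml; exact: HP.
have /choice[PY HY] : forall x, exists P : R -> C, `|x| < d ->
    forall s, `|s| < d' -> crd P s (iC R * f (ptxy z0 x s)).
  move=> x; have [hx|] := boolP (`|x| < d); last by exists (fun=> 0).
  have /choice[D HD] : forall s, exists D, - d' <= s <= d' -> cdiff f (ptxy z0 x s) D.
    move=> s; have [/lt_d hs|_] := boolP (- d' <= s <= d'); last by exists 0.
    by have [D] := Hf' x s hx hs; exists D.
  have [P HP] := @complex_primitive _ (fun s => iC R * f (ptxy z0 x s)) (fun s => iC R * (iC R * D s)) (- d') d'
    (fun s hs => crd_pty (cdiff_scale (iC R) (HD s hs))).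
  by exists P => _ s; rewrite ltr_norml; exact: HP.
have lt_d' (x : R) : `|x| < d' -> `|x| < d by move=> /lt_trans; apply.
have [F HF] := @primitive_rect _ f z0 d' PX PY
  (fun y s hy hs => HX y (lt_d' _ hy) s hs) (fun x s hx hs => HY x (lt_d' _ hx) s hs)
  (fun x y hx hy => Hf' x y (lt_d' _ hx) (lt_d' _ hy)).
by exists F => z [h1 h2]; rewrite -(ptxyE z0 z); exact: HF.
Qed.
End Primitive.

(** * Maximum principle and identity theorem *)

Section MaxPrinciple.
Variable R : realType.
Local Notation C := (Cx R).

Lemma second_derivative_max (k k' : R -> R) (D del : R) : 0 < del ->
  (forall s, `|s| < del -> rdiff k s (k' s)) -> rdiff k' 0 D ->
  (forall s, `|s| < del -> k s <= k 0) -> D <= 0.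
Proof.
move=> del0 Hk Hk' kmax; rewrite leNgt; apply/negP => D0.
have z0 : `|0 : R| < del by rewrite normr0.
have k'0 : k' 0 = 0.
  apply/eqP/negPn/negP => k'n.
  have [d d0 hd] := Hk 0 z0 (`|k' 0| / 2) ltac:(by rewrite divr_gt0 // normr_gt0).
  (* A small move in the direction of the sign of k' 0 would increase k. *)
  pose t := Num.min (d / 2) (del / 2); pose s := t * Num.sg (k' 0).
  have t0 : 0 < t by rewrite lt_min !divr_gt0.
  have td : t < d by rewrite /t; apply: (@le_lt_trans _ _ (d / 2)); [rewrite ge_min lexx|lra].
  have tdel : t < del by rewrite /t; apply: (@le_lt_trans _ _ (del / 2)); [rewrite ge_min lexx orbT|lra].
  have sn : `|s| = t by rewrite normrM normr_sg k'n mulr1 gtr0_norm.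
  have := hd s; rewrite sn add0r => /(_ td); rewrite ler_norml => /andP[h1 _].
  have := kmax s; rewrite sn => /(_ tdel) h2.
  have h3 : k' 0 * s = `|k' 0| * t by rewrite [`|k' 0|]normrEsg /s; ring.
  have h4 : 0 < `|k' 0| * t by rewrite mulr_gt0 ?normr_gt0.
  rewrite h3 in h1; clear -h1 h2 h4; lra.
have [d d0 hd] := Hk' (D / 2) ltac:(by rewrite divr_gt0).
pose t := Num.min (d / 2) (del / 2).
have t0 : 0 < t by rewrite lt_min !divr_gt0.
have td : t < d by rewrite /t; apply: (@le_lt_trans _ _ (d / 2)); [rewrite ge_min lexx|lra].
have tdel : t < del by rewrite /t; apply: (@le_lt_trans _ _ (del / 2)); [rewrite ge_min lexx orbT|lra].
have pos s : 0 <= s <= t -> D / 2 * s <= k' s.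
  move=> /andP[s0 st]; have := hd s; rewrite add0r k'0 subr0 (ger0_norm s0) => /(_ (le_lt_trans st td)).
  rewrite ler_norml => /andP[h1 _]; lra.
(* As k' s >= D s / 2, the function k s - D s^2 / 4 is nondecreasing, so k t would exceed k 0. *)
have inc : D / 4 * 0 ^+ 2 - k 0 >= D / 4 * t ^+ 2 - k t.
  rewrite -lerN2; apply: (@rdiff_mono _ (fun s => - (D / 4 * s ^+ 2 - k s)) (fun s => - (D / 4 * (2 * s) - k' s)) 0 t (ltW t0)).
    move=> s /andP[s0 st]; apply: rdiff_opp; apply: rdiff_sub.
      apply: rdiff_scale; apply: rdiff_ext (rdiff_val _ (rdiff_mul (rdiff_id s) (rdiff_id s))) => [u|].
        by rewrite expr2.
      by rewrite /=; ring.
    by apply: Hk; rewrite ger0_norm //; exact: le_lt_trans st tdel.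
  move=> s /pos h; rewrite opprB subr_ge0; apply: le_trans h.
  have -> : D / 4 * (2 * s) = D / 2 * s by field.
  by [].
have := kmax t; rewrite gtr0_norm // => /(_ tdel).
have : 0 < D / 4 * t ^+ 2 by rewrite mulr_gt0 ?divr_gt0 ?exprn_gt0.
rewrite expr0n /= mulr0 in inc; lra.
Qed.

Lemma square_max (k : C -> R) (b : R) : 0 <= b ->
  (forall z, `|reC z| <= b -> `|imC z| <= b -> {for z, continuous k}) ->
  exists2 z, (`|reC z| <= b /\ `|imC z| <= b) &
    forall u, `|reC u| <= b -> `|imC u| <= b -> k u <= k z.
Proof.
move=> b0 ck.
pose A : set (R * R) := `[- b, b] `*` `[- b, b].
have inA x y : A (x, y) <-> (`|x| <= b /\ `|y| <= b).
  by rewrite /A /setX /= !in_itv /= !ler_norml.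
have mk_cont : continuous (fun p : R * R => mkC p.1 p.2 : C).
  move=> [x y] U /nbhs_nc[d d0 hU].
  exists (ball x (d / 2), ball y (d / 2)); first by split; apply: nbhsx_ballx; rewrite divr_gt0.
  move=> [x' y'] /= [h1 h2]; apply: hU; apply: (le_lt_trans (nc_le_reim _)).
  rewrite reB imB /= distrC [`|y' - y|]distrC.
  by move: h1 h2; rewrite /ball /=; lra.
have [|||c cA cmax] := @compact_EVT_max (R * R)%type R (fun p => k (mkC p.1 p.2)) A.
- by exists (0, 0); apply/inA; rewrite normr0.
- by apply: compact_setX; exact: segment_compact.
- apply: continuous_in_subspaceT => -[x y] /set_mem/inA[h1 h2].
  apply: (@continuous_comp _ _ _ (fun p : R * R => mkC p.1 p.2 : C) k); first exact: mk_cont.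
  exact: ck.
case: c cA cmax => x y /set_mem/inA h cmax; exists (mkC x y) => // u h1 h2.
have := cmax (reC u, imC u); rewrite /=; have -> : mkC (reC u) (imC u) = u by case: u {h1 h2}.
by apply; apply/mem_set/inA.
Qed.

Lemma nc_cont (f : C -> C) z d : cdiff f z d -> {for z, continuous (fun x => nc (f x))}.
Proof.
move=> /cdiff_cont h U /nbhs_ballP[e /= /h[del del0 hd] hU].
apply/nbhs_nc; exists del => // u /hd hu; apply: hU; rewrite /ball /=.
apply: le_lt_trans hu; rewrite ler_norml.
have := nc_lower (f z) (f u); have := nc_lower (f u) (f z); rewrite (ncBC (f z)) => h1 h2.
by apply/andP; split; lra.
Qed.

Lemma dotC (z w : C) : reC (z^* * w) = reC (w^* * z).
Proof. by rewrite !reM !re_conj !im_conj; ring. Qed.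

Lemma crd_dot (P Q : R -> C) s p q : crd P s p -> crd Q s q ->
  rdiff (fun x => reC ((P x)^* * Q x)) s (reC (p^* * Q s) + reC ((P s)^* * q)).
Proof.
move=> [h1 h2] [h3 h4].
apply: rdiff_ext (rdiff_val _ (rdiff_add (rdiff_mul h1 h3) (rdiff_mul h2 h4))) => [u|].
  by rewrite reM re_conj im_conj; ring.
by rewrite !reM !re_conj !im_conj; ring.
Qed.

Lemma cdiff_ptline (p v : C) s : crd (pt p v) s v.
Proof. by have := crd_line (cdiff_id (pt p v s)); rewrite mul1r. Qed.

(* |phi|^2 + eta |z|^2 has positive Laplacian, so its maximum over the square is
   attained on the boundary. *)
Lemma max_principle (phi phi1 phi2 : C -> C) (b d M : R) : 0 <= b -> b < d ->
  (forall z, square 0 d z -> cdiff phi z (phi1 z)) ->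
  (forall z, square 0 d z -> cdiff phi1 z (phi2 z)) ->
  (forall z, `|reC z| <= b -> `|imC z| <= b -> b <= nc z -> nc (phi z) <= M) ->
  forall z, `|reC z| <= b -> `|imC z| <= b -> nc (phi z) <= M.
Proof.
move=> b0 bd H1 H2 hM z hz1 hz2.
have M0 : 0 <= M.
  apply: le_trans (hM (rc b) _ _ _); rewrite ?nc_ge0 ?re_rc ?im_rc ?nc_rc ?normr0 //.
    by rewrite ger0_norm.
  by rewrite ger0_norm.
rewrite -ler_sqr ?nnegrE ?nc_ge0 //; apply/ler_addgt0Pr => e e0.
(* On the square |u|^2 <= 2 b^2, so that the term eta |u|^2 costs at most e. *)
pose eta := e / (2 * b ^+ 2 + 1).
have S0 : 0 < 2 * b ^+ 2 + 1 by have := sqr_ge0 b; lra.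
have eta0 : 0 < eta by rewrite divr_gt0.
pose k u := nc (phi u) * nc (phi u) + eta * (nc u * nc u).
have sqd u (v : C) : `|reC u| <= b -> `|imC u| <= b -> nc v < d - b -> square 0 d (u + v).
  move=> h1 h2 hv; rewrite /square /= subr0 reD imD.
  have := ler_normD (reC u) (reC v); have := ler_normD (imC u) (imC v).
  by have := re_le_nc v; have := im_le_nc v; split; lra.
have E u : k u = reC ((phi u)^* * phi u) + eta * reC (u^* * u) by rewrite !conj_nc2 !expr2.
have insq u : `|reC u| <= b -> `|imC u| <= b -> square 0 d u.
  by move=> h1 h2; rewrite -[u]addr0; apply: sqd => //; rewrite nc0 subr_gt0.
have [|x [hx1 hx2] xmax] := @square_max k b b0.
  move=> u h1 h2; have c1 := nc_cont (H1 u (insq u h1 h2)); have c2 := nc_cont (cdiff_id u).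
  exact: (cvgD (cvgM c1 c1) (cvgM (cvg_cst eta) (cvgM c2 c2))).
have kz := xmax z hz1 hz2.
have [bx|xb] := leP b (nc x).
  have hx := hM x hx1 hx2 bx.
  have e1 : nc (phi x) ^+ 2 <= M ^+ 2 by rewrite ler_sqr ?nnegrE ?nc_ge0.
  have e2 : nc x ^+ 2 <= 2 * b ^+ 2.
    have h1 : reC x ^+ 2 <= b ^+ 2 by rewrite -real_normK ?num_real // ler_sqr ?nnegrE.
    have h2 : imC x ^+ 2 <= b ^+ 2 by rewrite -real_normK ?num_real // ler_sqr ?nnegrE.
    by rewrite nc_sqr; lra.
  have e3 : eta * nc x ^+ 2 <= e.
    apply: (@le_trans _ _ (eta * (2 * b ^+ 2))); first by rewrite ler_pM2l.
    rewrite /eta mulrAC -mulrA ger_pMr // ler_pdivrMr // mul1r; lra.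
  have e4 : 0 <= eta * nc z ^+ 2 by rewrite mulr_ge0 ?sqr_ge0 // ltW.
  by move: kz; rewrite /k -!expr2; clear -e1 e3 e4; lra.
exfalso; pose del := Num.min (d - b) (b - nc x).
have del0 : 0 < del by rewrite lt_min !subr_gt0 bd.
(* This is the second derivative along v. For v = 1 and v = i the terms in [phi2] cancel in the sum,
   because i^2 = -1, and |phi1|^2 + eta <= 0 remains. *)
have key (v : C) : nc v = 1 ->
    2 * (nc (phi1 x) ^+ 2 + reC ((phi x)^* * (phi2 x * v * v))) + 2 * eta <= 0.
  move=> nv; pose Phi s := phi (pt x v s).
  have small s : `|s| < del -> nc (rc s * v) < d - b /\ nc (rc s * v) < b - nc x.
    by rewrite lt_min ncM nc_rc nv mulr1 => /andP[].
  have inb s : `|s| < del -> square 0 d (pt x v s).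
    by move=> /small[h1 h2]; apply: sqd.
  have HP s : `|s| < del -> crd Phi s (phi1 (pt x v s) * v).
    by move=> /inb/H1; exact: crd_line.
  have z0 : `|0 : R| < del by rewrite normr0.
  have HP' : crd (fun s => phi1 (pt x v s) * v) 0 (phi2 x * v * v).
    have := cdiff_scale v (H2 _ (inb 0 z0)) => /crd_line.
    rewrite {2}/pt rc0 mul0r addr0 [v * _]mulrC; apply: crd_ext => u; exact: mulrC.
  have vv : reC (v^* * v) = 1 by rewrite conj_nc2 nv expr1n.
  apply: (@second_derivative_max (fun s => k (pt x v s))
    (fun s => 2 * reC ((Phi s)^* * (phi1 (pt x v s) * v)) + eta * (2 * reC ((pt x v s)^* * v))) _ del del0).
  - move=> s hs; have h1 := crd_dot (HP s hs) (HP s hs).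
    have h2 := crd_dot (cdiff_ptline x v s) (cdiff_ptline x v s).
    apply: rdiff_ext (rdiff_val _ (rdiff_add h1 (rdiff_scale eta h2))) => [u|].
      by rewrite E.
    rewrite [reC (_^* * Phi s)]dotC [reC (v^* * pt _ _ _)]dotC; ring.
  - have h1 := crd_dot (HP 0 z0) HP'.
    have h2 : crd (fun=> v) 0 0.
      by split; exact: rdiff_cst.
    have h3 := crd_dot (cdiff_ptline x v 0) h2.
    apply: rdiff_val (rdiff_add (rdiff_scale 2 h1) (rdiff_scale eta (rdiff_scale 2 h3))).
    rewrite mulr0 vv /Phi /pt rc0 mul0r addr0 conj_nc2 ncM nv.
    by rewrite mulr1 [reC 0]/=; ring.
  - move=> s hs; have [h1 h2] := small s hs; rewrite {2}/pt rc0 mul0r addr0; apply: xmax.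
      by rewrite /pt; apply: (le_trans (re_le_nc _)); apply: (le_trans (ncD _ _)); lra.
    by rewrite /pt; apply: (le_trans (im_le_nc _)); apply: (le_trans (ncD _ _)); lra.
have k1 := key 1 (nc1 R); have k2 := key (iC R) (nc_iC R).
rewrite !mulr1 in k1; rewrite -mulrA iCiC mulrN1 mulrN reN in k2.
have := sqr_ge0 (nc (phi1 x)).
by clear -k1 k2 eta0; lra.
Qed.

(* Dividing by z^N and letting N grow: a function that vanishes near 0 is bounded
   by M (|z|/b)^N for every N. *)
Lemma vanish_C2 (g g1 g2 : C -> C) (a b d : R) : 0 < a -> 0 < b -> b < d ->
  (forall z, square 0 d z -> cdiff g z (g1 z)) ->
  (forall z, square 0 d z -> cdiff g1 z (g2 z)) ->
  (forall z, nc z < a -> g z = 0) ->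
  forall z, nc z < b -> g z = 0.
Proof.
move=> a0 b0 bd H1 H2 Hz z zb.
have H N : exists phi phi1 phi2 : C -> C,
  [/\ forall z, square 0 d z -> cdiff phi z (phi1 z),
      forall z, square 0 d z -> cdiff phi1 z (phi2 z),
      forall z, nc z < a -> phi z = 0 & forall z, g z = z ^+ N * phi z].
  elim: N => [|N [p [p1 [p2 [h1 h2 h3 h4]]]]].
    by exists g, g1, g2; split=> // u; rewrite expr0 mul1r.
  have z0d : square (0 : C) d 0 by rewrite /square /= subr0 /= normr0; split; lra.
  have zero0 (q : C -> C) : (forall u, nc u < a -> q u = 0) -> cdiff q 0 0.
    move=> hq; apply: (cdiff_near a0 _ (cdiff_cst 0 0)) => u; rewrite subr0 => /hq ->.
    by [].
  pose e := Num.min a d.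
  have e0 : 0 < e by rewrite lt_min a0; lra.
  have p1z u : nc u < e -> p1 u = 0.
    rewrite lt_min => /andP[ua ud].
    have hsq : square 0 d u.
      by rewrite /square /= subr0; have := re_le_nc u; have := im_le_nc u; split; lra.
    apply: (cdiff_uniq (h1 u hsq)).
    have m0 : 0 < a - nc u by lra.
    apply: (cdiff_near m0 _ (cdiff_cst 0 u)) => v hv; rewrite h3 //.
    by have := ncD (v - u) u; rewrite subrK; lra.
  (* At z = 0 the division by zero yields 0, which is the right value of the quotient and of its
     derivatives, since p vanishes near 0. *)
  exists (fun z => p z / z), (fun z => p1 z / z - p z / z ^+ 2),
    (fun z => p2 z / z - 2 * p1 z / z ^+ 2 + 2 * p z / z ^+ 3); split.
  - move=> u hu; have [->|u0] := eqVneq u 0.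
      rewrite expr0n /= !invr0 !mulr0 subr0; apply: zero0 => v /h3 ->.
      by rewrite mul0r.
    apply: cdiff_val (cdiff_mul (h1 u hu) (cdiff_inv u0)).
    by field.
  - move=> u hu; have [->|u0] := eqVneq u 0.
      rewrite !expr0n /= !invr0 !mulr0 subr0 addr0.
      apply: (cdiff_near e0 _ (cdiff_cst 0 0)) => v; rewrite subr0 => hv.
      rewrite p1z // h3 ?mul0r ?subr0 //; apply: lt_le_trans hv _.
      by rewrite ge_min lexx.
    have hi := cdiff_inv u0.
    have hi2 : cdiff (fun x => (x ^+ 2)^-1) u (- 2 * u^-1 ^+ 3).
      have u20 : u ^+ 2 != 0 by rewrite expf_neq0.
      by apply: cdiff_val (@cdiff_invf R (fun x => x ^+ 2) u _ u20 (cdiff_sqr u)); field.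
    apply: cdiff_val (cdiff_sub (cdiff_mul (h2 u hu) hi) (cdiff_mul (h1 u hu) hi2)).
    by field.
  - by move=> u /h3 ->; rewrite mul0r.
  - move=> u; rewrite h4; have [->|u0] := eqVneq u 0.
      by rewrite h3 ?nc0 // !mul0r !mulr0.
    by rewrite exprSr; field.
have [|m _ hm] := @square_max (fun u => nc (g u)) b (ltW b0).
  move=> u h1 h2; apply: (@nc_cont g u (g1 u)); apply: H1.
  by rewrite /square /= subr0; split; lra.
set M := nc (g m) in hm.
have bound N : nc (g z) <= M * (nc z / b) ^+ N.
  have [p [p1 [p2 [h1 h2 h3 h4]]]] := H N.
  have hz : nc (p z) <= M / b ^+ N.
    apply: (max_principle (ltW b0) bd h1 h2).
    - move=> u hu1 hu2 bu; rewrite ler_pdivlMr ?exprn_gt0 //.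
      apply: le_trans (hm u hu1 hu2); rewrite h4 ncM ncX mulrC ler_wpM2r ?nc_ge0 //.
      by rewrite lerXn2r ?nnegrE ?nc_ge0 // ltW.
    - exact: le_trans (re_le_nc _) (ltW zb).
    - exact: le_trans (im_le_nc _) (ltW zb).
  rewrite h4 ncM ncX expr_div_n mulrCA.
  by apply: ler_wpM2l hz; rewrite exprn_ge0 ?nc_ge0.
apply/eqP; rewrite -nc_eq0; apply/eqP/le_anti; rewrite nc_ge0 andbT.
apply/ler_addgt0Pr => e e0; rewrite add0r.
have := @cvg_geometric R M (nc z / b).
rewrite ger0_norm ?divr_ge0 ?nc_ge0 ?(ltW b0) // ltr_pdivrMr // mul1r.
move=> /(_ zb)/cvgrPdist_lt/(_ e e0)[N _ hN].
have := hN N (leqnn N); rewrite /= sub0r normrN => /(le_lt_trans (ler_norm _)) /ltW.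
exact: le_trans (bound N).
Qed.

Lemma const_ball (F : C -> C) z0 a : (forall z, nc (z - z0) < a -> cdiff F z 0) ->
  forall z, nc (z - z0) < a -> F z = F z0.
Proof.
move=> H z hz; have := @line_const _ F z0 (z - z0) 0 1 ler01.
rewrite /pt rc0 rc1 mul0r mul1r addr0 [z0 + _]addrC subrK; apply => s /andP[s0 s1].
apply: H; rewrite addrC addKr ncM nc_rc ger0_norm //.
by apply: le_lt_trans hz; rewrite ler_piMl ?nc_ge0.
Qed.

(** [vanish_C2] wants two derivatives and f has one. It is therefore applied to a second primitive
    of f, normalized to vanish at the centre and hence near it; differentiating twice returns to
    f. *)
Lemma identity_disc (f : C -> C) z1 (a d : R) : 0 < a ->
  (forall z, square z1 d z -> exists D, cdiff f z D) ->
  (forall z, nc (z - z1) < a -> f z = 0) ->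
  forall z, nc (z - z1) < d -> f z = 0.
Proof.
move=> a0 Hf Hz z zd.
pose g u := f (z1 + u).
have Hg u : square 0 d u -> exists D, cdiff g u D.
  move=> hu; have [|D HD] := Hf (z1 + u).
    by move: hu; rewrite /square /= subr0 [z1 + u]addrC addrK.
  exists (D * 1).
  have h1 : cdiff (fun u => z1 + u) u 1.
    by apply: cdiff_val (cdiff_add (cdiff_cst z1 u) (cdiff_id u)); rewrite add0r.
  exact: cdiff_comp h1 HD.
have gz u : nc u < a -> g u = 0 by move=> hu; apply: Hz; rewrite addrC addKr.
set n := nc (z - z1) in zd.
(* Radii with n < b < d2 < d1 < d: each of the two primitives costs a margin of the square, and
   [vanish_C2] a third one. *)
pose b := (3 * n + d) / 4; pose d2 := (n + d) / 2; pose d1 := (n + 3 * d) / 4.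
have n0 : 0 <= n := nc_ge0 _.
have nE : nc (z - z1) = n by [].
have d1d : d1 < d by rewrite /d1; clear -zd; lra.
have d21 : d2 < d1 by rewrite /d1 /d2; clear -zd; lra.
have bd2 : b < d2 by rewrite /b /d2; clear -zd; lra.
have nb : n < b by rewrite /b; clear -zd; lra.
have b0 : 0 < b by exact: le_lt_trans nb.
clearbody b d1 d2 n.
have [F HF] := primitive_square d1d Hg.
pose al := Num.min a b.
have al0 : 0 < al by rewrite lt_min a0.
have ala : al <= a by rewrite ge_min lexx.
have alb : al <= b by rewrite ge_min lexx orbT.
have sq (u : C) e : nc u < e -> square 0 e u.
  by move=> hu; rewrite /square /= subr0; have := re_le_nc u; have := im_le_nc u; split; lra.
have sqle (u : C) e e' : e <= e' -> square 0 e u -> square 0 e' u.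
  by move=> he; rewrite /square /= => -[h1 h2]; split; exact: lt_le_trans he.
have bd1 : b < d1 by exact: lt_trans d21.
have Fz u : nc u < al -> F u = F 0.
  move=> hu; apply: (@const_ball F 0 al); last by rewrite subr0.
  move=> v; rewrite subr0 => hv; rewrite -(gz v); last by lra.
  by apply: HF; apply: sq; lra.
pose G1 u := F u - F 0.
have HG1 u : square 0 d1 u -> cdiff G1 u (g u).
  by move=> /HF h; apply: cdiff_val (cdiff_sub h (cdiff_cst (F 0) u)); rewrite subr0.
have [G0 HG0] := primitive_square (f := G1) (z0 := 0) d21
  (fun u hu => ex_intro _ _ (HG1 u hu)).
have G0z u : nc u < al -> G0 u = G0 0.
  move=> hu; apply: (@const_ball G0 0 al); last by rewrite subr0.
  move=> v; rewrite subr0 => hv; have <- : G1 v = 0 by rewrite /G1 Fz ?subrr.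
  by apply: HG0; apply: sq; lra.
pose G u := G0 u - G0 0.
have HG u : square 0 d2 u -> cdiff G u (G1 u).
  by move=> /HG0 h; apply: cdiff_val (cdiff_sub h (cdiff_cst (G0 0) u)); rewrite subr0.
have Gz u : nc u < b -> G u = 0.
  apply: (@vanish_C2 G G1 g al b d2 al0 b0 bd2 HG).
    by move=> v /(sqle _ _ _ (ltW d21)); exact: HG1.
  by move=> v hv; rewrite /G G0z ?subrr.
have der0 (q q1 : C -> C) : (forall u, nc u < b -> cdiff q u (q1 u)) ->
    (forall u, nc u < b -> q u = 0) -> forall u, nc u < b -> q1 u = 0.
  move=> hq hq0 u hu; apply: (cdiff_uniq (hq u hu)).
  have m0 : 0 < b - nc u by lra.
  apply: (cdiff_near m0 _ (cdiff_cst 0 u)) => v hv; rewrite hq0 //.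
  by have := ncD (v - u) u; rewrite subrK; lra.
have G1z : forall u, nc u < b -> G1 u = 0.
  by apply: der0 Gz => u hu; apply: HG; apply: sq; lra.
have gz' : forall u, nc u < b -> g u = 0.
  by apply: der0 G1z => u hu; apply: HG1; apply: sq; lra.
have := gz' (z - z1); rewrite /g [z1 + _]addrC subrK nE; exact.
Qed.
End MaxPrinciple.

(** * Derivatives and limits of matrix functions *)

Section MatrixDiff.
Variable R : realType.
Local Notation C := (Cx R).

Lemma mx_cvgP {T : Type} (F : set_system T) {FF : Filter F} m k
    (f : T -> 'M[C]_(m, k)) (l : 'M[C]_(m, k)) :
  f @ F --> l <-> forall i j, (fun x => f x i j) @ F --> l i j.
Proof.
split=> [h i j|h U /nbhs_ballP[e e0 hU]].
  move=> U hU; exact: (h _ (@coord_continuous C m k i j l U hU)).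
have [d d0 eE] := rc_gt0P e0.
have : \forall x \near F, forall ij : 'I_m * 'I_k, nc (f x ij.1 ij.2 - l ij.1 ij.2) < d.
  by apply: filter_forall => ij; exact: ((cvg_nc _ _).1 (h ij.1 ij.2) d d0).
apply: filterS => x hx; apply: hU; split=> // i j.
by rewrite /ball /= distrC norm_nc eE rc_lt; exact: (hx (i, j)).
Qed.

Definition mdiff m k (A : C -> 'M[C]_(m, k)) z (D : 'M[C]_(m, k)) :=
  forall i j, cdiff (fun x => A x i j) z (D i j).

Lemma mdiff_uniq m k (A : C -> 'M[C]_(m, k)) z D D' : mdiff A z D -> mdiff A z D' -> D = D'.
Proof. by move=> h h'; apply/matrixP => i j; exact: cdiff_uniq (h i j) (h' i j). Qed.

Lemma mdiff_mul m k p (A : C -> 'M[C]_(m, k)) (B : C -> 'M[C]_(k, p)) z DA DB :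
  mdiff A z DA -> mdiff B z DB ->
  mdiff (fun x => A x *m B x) z (DA *m B z + A z *m DB).
Proof.
move=> hA hB i j; rewrite !mxE -big_split /=.
apply: (@cdiff_ext _ (fun x => \sum_l A x i l * B x l j)) => [u|]; first by rewrite mxE.
by apply: cdiff_sum => l _; exact: cdiff_mul.
Qed.

Lemma mdiff_near m k (A B : C -> 'M[C]_(m, k)) z D (del : R) : 0 < del ->
  (forall u, nc (u - z) < del -> A u = B u) -> mdiff A z D -> mdiff B z D.
Proof. by move=> d0 h hA i j; apply: cdiff_near d0 _ (hA i j) => u /h ->. Qed.

Lemma cdiff_det_ex k (A : C -> 'M[C]_k) z :
  (forall i j, exists d, cdiff (fun x => A x i j) z d) ->
  exists d, cdiff (fun x => \det (A x)) z d.
Proof.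
move=> h.
have /choice[d hd] : forall s : 'S_k, exists d, cdiff (fun x => (-1) ^+ s * \prod_i A x i (s i)) z d.
  move=> s; have [d hd] : exists d, cdiff (fun x => \prod_i A x i (s i)) z d.
    by apply: cdiff_prod_ex => i; exact: h.
  by eexists; exact: cdiff_scale hd.
by eexists; apply: cdiff_sum => s _; exact: hd.
Qed.

(** Each entry of the inverse is a cofactor over the determinant. Existence is enough: the value is
    later recovered from the product rule and the uniqueness of derivatives. *)
Lemma mdiff_inv_ex k (A : C -> 'M[C]_k) z D : A z \in unitmx -> mdiff A z D ->
  exists D', mdiff (fun x => invmx (A x)) z D'.
Proof.
move=> uA hA.
have [dd hdet] : exists d, cdiff (fun x => \det (A x)) z d.
  by apply: cdiff_det_ex => i j; exists (D i j).
have det0 : \det (A z) != 0 by move: uA; rewrite unitmxE unitfE.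
have [del del0 hdel] := cdiff_cont hdet (e := nc (\det (A z))) ltac:(by rewrite nc_gt0).
have H i j : exists d, cdiff (fun x => invmx (A x) i j) z d.
  have [d hd] : exists d, cdiff (fun x => \det (row' j (col' i (A x)))) z d.
    apply: cdiff_det_ex => i' j'; exists (D (lift j i') (lift i j')).
    by under eq_fun do rewrite !mxE; exact: hA.
  have h1 := cdiff_mul (cdiff_invf det0 hdet) (cdiff_scale ((-1) ^+ (j + i)) hd).
  eexists; apply: cdiff_near del0 _ h1 => u hu.
  have du0 : \det (A u) != 0.
    apply/negP => /eqP du; move: (hdel u hu); rewrite du sub0r ncN ltxx //.
  by rewrite /invmx unitmxE unitfE du0 !mxE /cofactor.
have /choice[D' hD'] : forall ij : 'I_k * 'I_k, exists d, cdiff (fun x => invmx (A x) ij.1 ij.2) z d.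
  by move=> [i j]; exact: H.
by exists (\matrix_(i, j) D' (i, j)) => i j; rewrite mxE; exact: (hD' (i, j)).
Qed.

Lemma derivable_mdiff m k (W : C -> 'M[C]_(m, k)) z : derivable W z 1 -> mdiff W z ('D_1 W z).
Proof.
move=> h i j.
have H : h^-1 *: ((((fun x => W x i j) \o shift z) (h *: (1 : C^o))) - W z i j) @[h --> (0 : C)^']
    --> 'D_1 W z i j.
  have /mx_cvgP/(_ i j) := h; apply: cvg_trans; apply: near_eq_cvg; near=> x.
  by rewrite !mxE.
have d : derivable (fun x => W x i j) z 1 by apply/cvg_ex; exists ('D_1 W z i j).
by rewrite -(cvg_lim (@norm_hausdorff _ _) H); exact: derivable_cdiff.
Unshelve. all: by end_near. Qed.

Lemma mdiff_is_derive m k (W : C -> 'M[C]_(m, k)) z D : mdiff W z D ->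
  derivable W z 1 /\ 'D_1 W z = D.
Proof.
move=> h.
have H : h^-1 *: ((W \o shift z) (h *: (1 : C^o)) - W z) @[h --> (0 : C)^'] --> D.
  apply/mx_cvgP => i j.
  have [d1 d2] := cdiff_is_derive (h i j).
  have := d1; rewrite /derivable -[X in X -> _]/(cvg _) => H; rewrite -d2.
  apply: cvg_trans H; apply: near_eq_cvg; near=> x.
  by rewrite !mxE.
split; first by apply/cvg_ex; exists D.
exact: (cvg_lim (@norm_hausdorff _ _) H).
Unshelve. all: by end_near. Qed.

Lemma mdiff_comp m k (A : C -> 'M[C]_(m, k)) (f : C -> C) z D d :
  cdiff f z d -> mdiff A (f z) D -> mdiff (fun x => A (f x)) z (d *: D).
Proof. by move=> hf hA i j; rewrite mxE mulrC; exact: (cdiff_comp hf (hA i j)). Qed.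

Lemma mdiff_diag k (d : C -> 'I_k -> C) z (D : 'I_k -> C) :
  (forall j, cdiff (fun x => d x j) z (D j)) ->
  mdiff (fun x => diag_mx (\row_j d x j)) z (diag_mx (\row_j D j)).
Proof.
move=> h i j; rewrite !mxE; under eq_fun do rewrite !mxE.
by case: (eqVneq i j) => [->|_]; rewrite ?mulr1n ?mulr0n; [exact: h|exact: cdiff_cst].
Qed.

Lemma cvg_sum_fun {T : Type} (F : set_system T) {FF : Filter F} (I : Type) (r : seq I)
    (f : I -> T -> C) (a : I -> C) : (forall i, f i @ F --> a i) ->
  (fun x => \sum_(i <- r) f i x) @ F --> \sum_(i <- r) a i.
Proof.
move=> h; elim: r => [|i r IH].
  by rewrite big_nil; under eq_fun do rewrite big_nil; exact: cvg_cst.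
by rewrite big_cons; under eq_fun do rewrite big_cons; exact: (cvgD (h i) IH).
Qed.

Lemma mx_cvg_mul {T : Type} (F : set_system T) {FF : Filter F} m k p
    (f : T -> 'M[C]_(m, k)) (g : T -> 'M[C]_(k, p)) (a : 'M[C]_(m, k)) (b : 'M[C]_(k, p)) :
  f @ F --> a -> g @ F --> b -> (fun x => f x *m g x) @ F --> a *m b.
Proof.
move=> /mx_cvgP hf /mx_cvgP hg; apply/mx_cvgP => i j; rewrite mxE.
under eq_fun do rewrite mxE.
by apply: cvg_sum_fun => l; exact: (cvgM (hf i l) (hg l j)).
Qed.

Lemma cvg_prod_fun {T : Type} (F : set_system T) {FF : Filter F} (I : Type) (r : seq I)
    (f : I -> T -> C) (a : I -> C) : (forall i, f i @ F --> a i) ->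
  (fun x => \prod_(i <- r) f i x) @ F --> \prod_(i <- r) a i.
Proof.
move=> h; elim: r => [|i r IH].
  by rewrite big_nil; under eq_fun do rewrite big_nil; exact: cvg_cst.
by rewrite big_cons; under eq_fun do rewrite big_cons; exact: (cvgM (h i) IH).
Qed.

Lemma mx_cvg_det {T : Type} (F : set_system T) {FF : Filter F} k (f : T -> 'M[C]_k) (a : 'M[C]_k) :
  f @ F --> a -> (fun x => \det (f x)) @ F --> \det a.
Proof.
move=> /mx_cvgP hf; apply: cvg_sum_fun => s.
apply: (cvgM (cvg_cst _)); apply: cvg_prod_fun => i; exact: hf.
Qed.

Lemma mx_cvg_inv {T : Type} (F : set_system T) {FF : Filter F} k (f : T -> 'M[C]_k) (a : 'M[C]_k) :
  a \in unitmx -> f @ F --> a -> (fun x => invmx (f x)) @ F --> invmx a.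
Proof.
move=> ua hf; have det0 : \det a != 0 by move: ua; rewrite unitmxE unitfE.
have hd : (fun x => \det (f x)) @ F --> \det a by exact: mx_cvg_det.
apply/mx_cvgP => i j.
have hm : (fun x => \det (row' j (col' i (f x)))) @ F --> \det (row' j (col' i a)).
  apply: mx_cvg_det; apply/mx_cvgP => i' j'; rewrite !mxE; under eq_fun do rewrite !mxE.
  by move/mx_cvgP: hf; apply.
have -> : invmx a i j = (\det a)^-1 * ((-1) ^+ (j + i) * \det (row' j (col' i a))).
  by rewrite /invmx ua !mxE /cofactor.
have H : (fun x => (\det (f x))^-1 * ((-1) ^+ (j + i) * \det (row' j (col' i (f x))))) @ F -->
    (\det a)^-1 * ((-1) ^+ (j + i) * \det (row' j (col' i a))).
  exact: (cvgM (cvgV det0 hd) (cvgM (cvg_cst ((-1) ^+ (j + i) : C)) hm)).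
apply: cvg_trans H; apply: near_eq_cvg.
have /cvg_nc/(_ (nc (\det a))) := hd; rewrite nc_gt0 => /(_ det0).
apply: filterS => x hx.
have du0 : \det (f x) != 0.
  by apply/negP => /eqP du; move: hx; rewrite du sub0r ncN ltxx.
by rewrite /invmx unitmxE unitfE du0 !mxE /cofactor.
Qed.
End MatrixDiff.

(** * Real hyperbolic and trigonometric inequalities *)

Section RealHyp.
Variable R : realType.
Implicit Types x y : R.

Definition sh x := (expR x - expR (- x)) / 2.
Definition ch x := (expR x + expR (- x)) / 2.

Lemma ch2_sh2 x : ch x ^+ 2 = 1 + sh x ^+ 2.
Proof.
have h : expR x * expR (- x) = 1 by rewrite -expRD subrr expR0.
have -> : ch x ^+ 2 = sh x ^+ 2 + expR x * expR (- x) by rewrite /ch /sh; field.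
by rewrite h addrC.
Qed.
Lemma ch_ge1 x : 1 <= ch x.
Proof. by have := expR_ge1Dx x; have := expR_ge1Dx (- x); rewrite /ch; lra. Qed.
Lemma shN x : sh (- x) = - sh x.
Proof. by rewrite /sh opprK; field. Qed.
Lemma rdiff_sh x : rdiff sh x (ch x).
Proof.
have h : rdiff (fun x => expR (- x)) x (expR (- x) * (-1)).
  by apply: rdiff_comp (rdiff_opp (rdiff_id x)) (rdiff_expR _).
have := rdiff_scale (2^-1) (rdiff_sub (rdiff_expR x) h).
move=> H; apply: rdiff_ext (rdiff_val _ H) => [u|]; rewrite /sh /ch; by field.
Qed.
Lemma sh_ge x : 0 <= x -> x <= sh x.
Proof.
move=> x0; rewrite -subr_ge0.
have -> : 0 = sh 0 - 0 by rewrite subr0 /sh oppr0 subrr mul0r.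
apply: (@rdiff_mono _ (fun x => sh x - x) (fun x => ch x - 1)) => // u _.
  exact: rdiff_sub (rdiff_sh u) (rdiff_id u).
by rewrite subr_ge0 ch_ge1.
Qed.
Lemma norm_sh_ge x : `|x| <= `|sh x|.
Proof.
have [x0|x0] := leP 0 x.
  by rewrite !ger0_norm ?sh_ge // (le_trans x0) // sh_ge.
rewrite -normrN -[`|sh x|]normrN -shN.
have x0' : 0 <= - x by lra.
by rewrite !ger0_norm ?sh_ge // (le_trans x0') // sh_ge.
Qed.
Lemma sin_le_id y : 0 <= y -> sin y <= y.
Proof.
move=> y0; rewrite -subr_ge0.
have -> : 0 = 0 - sin 0 :> R by rewrite sin0 subrr.
apply: (@rdiff_mono _ (fun x => x - sin x) (fun x => 1 - cos x)) => [//|u _|u _].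
  exact: rdiff_sub (rdiff_id u) (rdiff_sin u).
by rewrite subr_ge0 cos_le1.
Qed.
Lemma cos_ge_quad y : 1 - y ^+ 2 / 2 <= cos y.
Proof.
wlog y0 : y / 0 <= y => [H|].
  have [|y0] := leP 0 y; first exact: H.
  by have := H (- y); rewrite cosN sqrrN; apply; lra.
rewrite -subr_ge0.
have -> : 0 = cos 0 - (1 - (0 : R) ^+ 2 / 2) by rewrite cos0 expr0n /=; lra.
apply: (@rdiff_mono _ (fun x => cos x - (1 - x ^+ 2 / 2)) (fun x => - sin x + x)) => //.
  move=> u _; have h := rdiff_mul (rdiff_id u) (rdiff_id u).
  have h2 := rdiff_sub (rdiff_cst 1 u) (rdiff_scale (2^-1) h).
  apply: rdiff_ext (rdiff_val _ (rdiff_sub (rdiff_cos u) h2)) => [v|] /=; by field.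
by move=> u /andP[u0 _]; have := sin_le_id u0; lra.
Qed.
Lemma cos_ge_half y : `|y| <= 1 -> 1 / 2 <= cos y.
Proof.
move=> y1; apply: le_trans (cos_ge_quad y).
have : y ^+ 2 <= 1 by rewrite -real_normK ?num_real // expr_le1.
lra.
Qed.
Lemma norm_sin_ge y : `|y| <= 1 -> `|y| / 2 <= `|sin y|.
Proof.
wlog y0 : y / 0 <= y => [H|].
  have [|y0] := leP 0 y; first exact: H.
  by have := H (- y); rewrite sinN !normrN; apply; lra.
rewrite (ger0_norm y0) => y1; apply: le_trans (ler_norm _); rewrite -subr_ge0.
have -> : 0 = sin 0 - 0 / 2 :> R by rewrite sin0 mul0r subrr.
apply: (@rdiff_mono _ (fun x => sin x - x / 2) (fun x => cos x - 1 / 2)) => // u.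
  move=> _; apply: rdiff_sub (rdiff_sin u) _.
  by apply: rdiff_ext (rdiff_val _ (rdiff_scale (2^-1) (rdiff_id u))) => [v|]; rewrite mulrC ?mul1r.
move=> /andP[u0 uy]; rewrite subr_ge0; apply: cos_ge_half; rewrite ger0_norm //; lra.
Qed.
End RealHyp.

(** * The time parametrization by the hyperbolic cotangent *)

Section Hyperbolic.
Variable R : realType.
Local Notation C := (Cx R).
Implicit Types z q t : C.

Lemma re_half z : reC (z / 2) = reC z / 2.
Proof. by rewrite -(rc_nat R 2) -rcV reC_scale. Qed.
Lemma im_half z : imC (z / 2) = imC z / 2.
Proof. by rewrite -(rc_nat R 2) -rcV imM /= mulr0 add0r mulrC mulrC. Qed.

Lemma cdiff_csinh z : cdiff (@csinh R) z (ccosh z).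
Proof.
have h := cdiff_cexpf (cdiff_opp (cdiff_id z)).
have := cdiff_scale (2^-1) (cdiff_sub (cdiff_cexp z) h).
move=> H; apply: cdiff_ext (cdiff_val _ H) => [u|]; rewrite /csinh /ccosh /=; by field.
Qed.
Lemma cdiff_ccosh z : cdiff (@ccosh R) z (csinh z).
Proof.
have h := cdiff_cexpf (cdiff_opp (cdiff_id z)).
have := cdiff_scale (2^-1) (cdiff_add (cdiff_cexp z) h).
move=> H; apply: cdiff_ext (cdiff_val _ H) => [u|]; rewrite /csinh /ccosh /=; by field.
Qed.
Lemma cexp_cexpN z : cexp z * cexp (- z) = 1.
Proof. by rewrite -cexpD subrr cexp0. Qed.
Lemma ccosh2 z : ccosh z ^+ 2 = csinh z ^+ 2 + 1.
Proof. by rewrite -(cexp_cexpN z) /ccosh /csinh; field. Qed.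
Lemma csinhN z : csinh (- z) = - csinh z.
Proof. by rewrite /csinh opprK; field. Qed.
Lemma ccoshN z : ccosh (- z) = ccosh z.
Proof. by rewrite /ccosh opprK addrC. Qed.
Lemma csinh0 : csinh 0 = 0 :> C.
Proof. by rewrite /csinh oppr0 subrr mul0r. Qed.
Lemma ccosh0 : ccosh 0 = 1 :> C.
Proof. by rewrite /ccosh oppr0 cexp0; field. Qed.

Lemma nc_csinh2 z : nc (csinh z) ^+ 2 = sh (reC z) ^+ 2 + sin (imC z) ^+ 2.
Proof.
rewrite nc_sqr /csinh re_half im_half reB imB /= -/(reC _) -/(imC _) reN imN cosN sinN.
have -> : (expR (reC z) * cos (imC z) - expR (- reC z) * cos (imC z)) / 2 = sh (reC z) * cos (imC z).
  by rewrite /sh; field.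
have -> : (expR (reC z) * sin (imC z) - expR (- reC z) * - sin (imC z)) / 2 = ch (reC z) * sin (imC z).
  by rewrite /ch; field.
by rewrite [(sh _ * _) ^+ 2]exprMn [(ch _ * _) ^+ 2]exprMn ch2_sh2 cos2sin2; ring.
Qed.
Lemma nc_ccosh2 z : nc (ccosh z) ^+ 2 = sh (reC z) ^+ 2 + cos (imC z) ^+ 2.
Proof.
rewrite nc_sqr /ccosh re_half im_half reD imD /= -/(reC _) -/(imC _) reN imN cosN sinN.
have -> : (expR (reC z) * cos (imC z) + expR (- reC z) * cos (imC z)) / 2 = ch (reC z) * cos (imC z).
  by rewrite /ch; field.
have -> : (expR (reC z) * sin (imC z) + expR (- reC z) * - sin (imC z)) / 2 = sh (reC z) * sin (imC z).
  by rewrite /sh; field.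
by rewrite [(sh _ * _) ^+ 2]exprMn [(ch _ * _) ^+ 2]exprMn ch2_sh2 sin2cos2; ring.
Qed.
Lemma csinh_ge_re z : `|reC z| <= nc (csinh z).
Proof.
rewrite -(@ler_sqr _ `|_|) ?nnegrE ?nc_ge0 // nc_csinh2.
apply: (@le_trans _ _ (sh (reC z) ^+ 2)); last by rewrite lerDl sqr_ge0.
by rewrite -[sh _ ^+ 2]real_normK ?num_real // ler_sqr ?nnegrE // norm_sh_ge.
Qed.
Lemma csinh_ge_small z : `|imC z| <= 1 -> nc z / 2 <= nc (csinh z).
Proof.
move=> h; rewrite -(@ler_sqr _ (nc z / 2)) ?nnegrE ?nc_ge0 ?divr_ge0 ?nc_ge0 //.
rewrite nc_csinh2 exprMn nc_sqr mulrDl; apply: lerD.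
  apply: (@le_trans _ _ (reC z ^+ 2)); first by rewrite ler_piMr ?sqr_ge0 // expr_le1 // ?invr_ge0 // invf_le1 // ler1n.
  rewrite -[X in X <= _]real_normK ?num_real // -[sh _ ^+ 2]real_normK ?num_real //.
  by rewrite ler_sqr ?nnegrE // norm_sh_ge.
rewrite -exprMn -real_normK ?num_real // -[sin _ ^+ 2]real_normK ?num_real //.
rewrite ler_sqr ?nnegrE // normrM [`|2^-1|]gtr0_norm ?invr_gt0 //.
exact: norm_sin_ge.
Qed.

Lemma cexp_pi : cexp (iC R * rc pi) = -1.
Proof.
have -> : iC R * rc pi = mkC 0 pi.
  by apply: Cext; rewrite ?reM ?imM re_iC im_iC re_rc im_rc /=; lra.
by apply: Cext; rewrite /= expR0 ?cospi ?sinpi mul1r ?oppr0.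
Qed.
Lemma csinhDpi z : csinh (z + iC R * rc pi) = - csinh z.
Proof.
rewrite /csinh opprD !cexpD [cexp (- (_ * _))]cexpN cexp_pi invrN invr1.
by field.
Qed.
Lemma ccoshDpi z : ccosh (z + iC R * rc pi) = - ccosh z.
Proof.
rewrite /ccosh opprD !cexpD [cexp (- (_ * _))]cexpN cexp_pi invrN invr1.
by field.
Qed.

(** [xt w] is [xq (sqe w)] by unfolding; here the square root q of eps is a free parameter. *)
Definition xq q t : C := - (q * ccosh (q * t) / csinh (q * t)).

Lemma xq2 q t : csinh (q * t) != 0 -> xq q t ^+ 2 - q ^+ 2 = q ^+ 2 / csinh (q * t) ^+ 2.
Proof.
move=> h; rewrite /xq sqrrN exprMn exprVn exprMn ccosh2.
by field.
Qed.

Lemma cdiff_xq q t : csinh (q * t) != 0 -> cdiff (xq q) t (xq q t ^+ 2 - q ^+ 2).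
Proof.
move=> h; rewrite (xq2 h).
have hq : cdiff (fun t => q * t) t q.
  by apply: cdiff_val (cdiff_scale q (cdiff_id t)); rewrite mulr1.
have h1 := cdiff_comp hq (cdiff_ccosh _).
have h2 := cdiff_comp hq (cdiff_csinh _).
have := cdiff_opp (cdiff_mul (cdiff_scale q h1) (@cdiff_invf R (fun x => csinh (q * x)) t _ h h2)).
apply: cdiff_val.
have E : csinh (q * t) ^+ 2 = ccosh (q * t) ^+ 2 - 1 by rewrite ccosh2 addrK.
have -> : - (q * (csinh (q * t) * q) / csinh (q * t) +
   q * ccosh (q * t) * (- (csinh (q * t))^-1 ^+ 2 * (ccosh (q * t) * q))) =
   q ^+ 2 * (ccosh (q * t) ^+ 2 - csinh (q * t) ^+ 2) / csinh (q * t) ^+ 2.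
  by field.
by rewrite E opprB addrC subrK mulr1.
Qed.

Lemma xqN q t : xq q (- t) = - xq q t.
Proof. by rewrite /xq mulrN csinhN ccoshN invrN mulrN opprK. Qed.

Lemma xq_per q t p : q * p = - (iC R * rc pi) -> xq q (t + p) = xq q t.
Proof.
move=> h; have E : q * t = q * (t + p) + iC R * rc pi by rewrite mulrDr h addrNK.
by rewrite /xq E csinhDpi ccoshDpi invrN; congr (- _); ring.
Qed.

Lemma coth_near0 (eta : R) : 0 < eta -> exists2 del : R, 0 < del &
  forall z, 0 < nc z < del -> csinh z != 0 /\ nc (z * ccosh z / csinh z - 1) <= eta.
Proof.
move=> eta0; pose e := Num.min (1 / 2) (eta / 4).
have e0 : 0 < e by rewrite lt_min !divr_gt0.
have e1 : e <= 1 / 2 by rewrite ge_min lexx.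
have e2 : e <= eta / 4 by rewrite ge_min lexx orbT.
have [d1 d10 h1] := cdiff_csinh 0 e0.
have [d2 d20 h2] := cdiff_cont (cdiff_ccosh 0) e0.
exists (Num.min d1 d2) => [|z]; first by rewrite lt_min d10.
rewrite lt_min => /and3P[z0 z1 z2]; clearbody e.
have := h1 z z1; rewrite add0r csinh0 ccosh0 mul1r subr0 => k1.
have := h2 z; rewrite subr0 ccosh0 => /(_ z2) k2.
have k3 : nc z / 2 <= nc (csinh z).
  have k4 := nc_lower z (z - csinh z); rewrite (_ : z - (z - csinh z) = csinh z) in k4; last by ring.
  rewrite (ncBC z) in k4.
  have : e * nc z <= 1 / 2 * nc z by rewrite ler_wpM2r // ltW.
  lra.
have s0 : csinh z != 0 by rewrite -nc_gt0; lra.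
split=> //.
have -> : z * ccosh z / csinh z - 1 = (z * (ccosh z - 1) - (csinh z - z)) / csinh z.
  by field.
rewrite ncM ncV ler_pdivrMr ?nc_gt0 //.
have k5 := ncB (z * (ccosh z - 1)) (csinh z - z); rewrite ncM in k5.
have k6 : nc z * nc (ccosh z - 1) <= nc z * e by rewrite ler_wpM2l // ltW.
have k7 : eta * (nc z / 2) <= eta * nc (csinh z) by rewrite ler_pM2l.
have k8 : e * nc z <= eta / 4 * nc z by rewrite ler_wpM2r // ltW.
clear -k5 k6 k7 k8 k1; lra.
Qed.

(** Since z coth z tends to 1 at 0, x(t) is close to its value -1/t for eps = 0 as long as sqrt(eps)
    t is small. *)
Lemma xq_near0 (eta : R) : 0 < eta -> exists2 del : R, 0 < del &
  forall q t, q != 0 -> t != 0 -> nc (q * t) < del ->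
    csinh (q * t) != 0 /\ nc (xq q t + t^-1) <= eta / nc t.
Proof.
move=> /coth_near0[del del0 h]; exists del => // q t q0 t0 hqt.
have [|h1 h2] := h (q * t); first by rewrite nc_gt0 mulf_neq0.
split=> //; have -> : xq q t + t^-1 = - (q * t * ccosh (q * t) / csinh (q * t) - 1) / t.
  by rewrite /xq; field; rewrite h1 t0.
by rewrite ncM ncN ncV ler_pdivlMr ?nc_gt0 // divfK ?gt_eqF ?nc_gt0.
Qed.

(** x - q = - q e^{q t} / sinh (q t), where the exponential is at most 1 and |sinh z| >= |Re z|. *)
Lemma xq_lim_left q t : reC (q * t) < 0 -> nc (xq q t - q) <= nc q / - reC (q * t).
Proof.
move=> h; have h1 := csinh_ge_re (q * t).
have h2 : - reC (q * t) <= nc (csinh (q * t)) by rewrite -normrN ger0_norm in h1; lra.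
have s0 : csinh (q * t) != 0 by rewrite -nc_gt0; lra.
have -> : xq q t - q = - (q * cexp (q * t) / csinh (q * t)).
  have -> : cexp (q * t) = ccosh (q * t) + csinh (q * t).
    by rewrite /ccosh /csinh; field.
  by rewrite /xq; field.
rewrite ncN !ncM ncV nc_cexp -mulrA ler_wpM2l ?nc_ge0 //.
have e1 : expR (reC (q * t)) <= 1 by rewrite expR_le1 ltW.
apply: (@le_trans _ _ (1 / nc (csinh (q * t)))).
  by rewrite ler_wpM2r ?invr_ge0 ?nc_ge0.
by rewrite mul1r lef_pV2 ?posrE; lra.
Qed.

Lemma xq_lim_right q t : 0 < reC (q * t) -> nc (xq q t + q) <= nc q / reC (q * t).
Proof.
move=> h; have := @xq_lim_left q (- t); rewrite mulrN reN oppr_lt0 => /(_ h).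
by rewrite xqN -opprD ncN opprK.
Qed.

End Hyperbolic.

(** * Lower bounds for sinh and cosh near a direction *)

Section SectorEstimates.
Variable R : realType.
Local Notation C := (Cx R).

(* G stands for sqrt(eps) e^{i theta}: along e^{i theta} the real part of
   sqrt(eps) t decreases at a definite rate. *)
Lemma sector_csinh_ge (G u : C) (k : R) : 0 < k <= 1 -> reC G <= - (k * nc G) ->
  nc G * `|imC u| <= k / 8 -> k / 4 * nc (G * u) <= nc (csinh (G * u)).
Proof.
move=> /andP[k0 k1] hG hu.
have n0 := nc_ge0 (G * u).
have [y1|y1] := leP `|imC (G * u)| 1.
  apply: le_trans (csinh_ge_small y1).
  have : k * nc (G * u) <= 1 * nc (G * u) by rewrite ler_wpM2r.
  lra.
(* Now |Im (G u)| > 1 while |G| |Im u| <= k / 8, so |G| |Re u| >= 7 / 8 and the real part of G u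
   dominates. *)
apply: le_trans (csinh_ge_re _).
have Q0 : 0 <= nc G := nc_ge0 _.
have g1 : k * nc G <= `|reC G| by rewrite -normrN; apply: le_trans (ler_norm _); lra.
set U := nc G * `|reC u|; set V := nc G * `|imC u| in hu.
have U0 : 0 <= U by rewrite mulr_ge0.
have V0 : 0 <= V by rewrite mulr_ge0.
have h1 : `|imC (G * u)| <= U + V.
  rewrite imM; apply: (le_trans (ler_normD _ _)); rewrite !normrM [X in _ <= X]addrC.
  by apply: lerD; rewrite ler_wpM2r ?re_le_nc ?im_le_nc.
have h2 : k * U - V <= `|reC (G * u)|.
  rewrite reM; apply: le_trans (lerB_dist _ _); rewrite !normrM; apply: lerB.
    by rewrite /U mulrA ler_wpM2r.
  by rewrite /V ler_wpM2r ?im_le_nc.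
have h3 : nc (G * u) <= U + V by rewrite ncM /U /V -mulrDr ler_wpM2l ?nc_le_reim.
apply: le_trans h2.
have h4 : k / 4 * nc (G * u) <= k / 4 * (U + V) by rewrite ler_wpM2l // divr_ge0 // ltW.
have h5 : k * (7 / 8) <= k * U by rewrite ler_wpM2l //; lra.
have h6 : k * V <= 1 * V by rewrite ler_wpM2r.
clear -k0 h4 h5 h6 hu; lra.
Qed.

(** For |Im (G s)| <= 1 the cosine is at least 1 / 2; otherwise |G| |s| >= 1 and the sinh term alone
    pays for both summands. *)
Lemma line_ccosh_ge (G : C) (k s : R) : 0 < k <= 1 -> reC G <= - (k * nc G) ->
  k ^+ 2 / 4 * (1 + (nc G * s) ^+ 2) <= nc (ccosh (G * rc s)) ^+ 2.
Proof.
move=> /andP[k0 k1] hG; rewrite nc_ccosh2.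
have g1 : k * nc G <= `|reC G| by rewrite -normrN; apply: le_trans (ler_norm _); lra.
have k2 : k ^+ 2 <= 1 by rewrite expr_le1 // ltW.
have kk0 : 0 <= k ^+ 2 := sqr_ge0 k.
have h1 : k ^+ 2 * (nc G * s) ^+ 2 <= sh (reC (G * rc s)) ^+ 2.
  rewrite -exprMn -[X in X <= _]real_normK ?num_real // -[sh _ ^+ 2]real_normK ?num_real //.
  rewrite ler_sqr ?nnegrE //; apply: le_trans (norm_sh_ge _).
  rewrite reC_scale !normrM mulrA ler_wpM2r // gtr0_norm // ger0_norm ?nc_ge0 //.
have s0 : 0 <= (nc G * s) ^+ 2 := sqr_ge0 _.
have ks0 : 0 <= k ^+ 2 * (nc G * s) ^+ 2 by rewrite mulr_ge0.
have [y1|y1] := leP `|imC (G * rc s)| 1.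
  have h2 := cos_ge_half y1.
  have h3 : 1 / 4 <= cos (imC (G * rc s)) ^+ 2 by rewrite expr2; nra.
  by rewrite mulrDr mulr1; lra.
have h2 : 1 <= (nc G * s) ^+ 2.
  rewrite -real_normK ?num_real // expr_ge1 // normrM ger0_norm ?nc_ge0 //.
  apply: (le_trans (ltW y1)); rewrite imM /= mulr0 add0r normrM.
  by rewrite ler_wpM2r ?im_le_nc.
have h3 := sqr_ge0 (cos (imC (G * rc s))).
have h4 : k ^+ 2 * 1 <= k ^+ 2 * (nc G * s) ^+ 2 by rewrite ler_wpM2l.
rewrite mulrDr; lra.
Qed.

Lemma rc_half (a : R) : rc (a / 2) = rc a / 2 :> C.
Proof. by rewrite rcM rcV rc_nat. Qed.

Lemma cexp_halfpi : cexp (iC R * rc (pi / 2)) = iC R.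
Proof.
have -> : iC R * rc (pi / 2) = mkC 0 (pi / 2).
  by apply: Cext; rewrite ?reM ?imM re_iC im_iC re_rc im_rc /=; lra.
by apply: Cext; rewrite /= expR0 ?cos_pihalf ?sin_pihalf ?mulr0 ?mulr1.
Qed.

Lemma nc_csinh_halfpi (z : C) : nc (csinh (z + iC R * rc (pi / 2))) = nc (ccosh z).
Proof.
have -> : csinh (z + iC R * rc (pi / 2)) = iC R * ccosh z.
  rewrite /csinh /ccosh opprD !cexpD [cexp (- (_ * _))]cexpN cexp_halfpi.
  have i0 : iC R != 0 by rewrite -nc_gt0 nc_iC.
  have -> : (iC R)^-1 = - iC R by apply: (mulfI i0); rewrite divff // mulrN iCiC opprK.
  by field.
by rewrite ncM nc_iC mul1r.
Qed.
Lemma nc_csinh_halfpiN (z : C) : nc (csinh (z - iC R * rc (pi / 2))) = nc (ccosh z).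
Proof.
by rewrite -ncN -csinhN opprB addrC -[in RHS]ccoshN nc_csinh_halfpi.
Qed.
End SectorEstimates.

(** * The sector S and the direction e^{i theta} *)

Section Cover.
Variables (R : realType) (gamma : R) (w : Cx R).
Local Notation C := (Cx R).
Let phi0 := gamma * (1 + 2 * gamma / pi).
Hypothesis gamma0 : 0 < gamma.
Hypothesis phi_lt : phi0 < pi / 2.
Hypothesis argw : pi - 2 * gamma < imC w < 3 * pi + 2 * gamma.
Local Notation q := (sqe w).
Local Notation Q := (nc (sqe w)).
Local Notation th := (theta gamma w).

(** The angle 2 gamma^2 / pi is the margin between arg (sqrt(eps) e^{i theta}) and the imaginary
    axis over the whole sector; see [re_Gdir]. *)
Definition kap : R := sin (2 * gamma ^+ 2 / pi).
Definition edir : C := cexp (iC R * rc th).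

Let p0 : (0 : R) < pi. Proof. exact: pi_gt0. Qed.
Let pn : pi != 0 :> R. Proof. by rewrite gt_eqF. Qed.
Let phiE : phi0 = gamma + 2 * gamma ^+ 2 / pi.
Proof. by rewrite /phi0; move: pn; move: (pi : R) => p pn'; field. Qed.
Let g2 : 0 < 2 * gamma ^+ 2 / pi.
Proof. by rewrite divr_gt0 // mulr_gt0 // exprn_gt0. Qed.
Let gpi : gamma < pi / 2.
Proof. by move: phi_lt g2 gamma0; rewrite phiE; lra. Qed.

Lemma kap_range : 0 < kap <= 1.
Proof.
rewrite /kap sin_le1 andbT; apply: sin_gt0_pihalf; rewrite g2 /=.
by move: phi_lt g2 gamma0; rewrite phiE; lra.
Qed.

(** On the sector arg sqrt(eps) is within pi / 2 + gamma of pi, and 2 gamma / pi times this distance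
    is gamma (1 + 2 gamma / pi). *)
Lemma theta_lt : `|th| < phi0.
Proof.
have a0 : 0 < 2 * gamma / pi by rewrite divr_gt0 // mulr_gt0.
rewrite /theta normrM gtr0_norm //.
have -> : phi0 = 2 * gamma / pi * (pi / 2 + gamma).
  by rewrite /phi0; move: pn; move: (pi : R) => p pn'; field.
rewrite ltr_pM2l // ltr_norml; move: argw => /andP[? ?]; apply/andP; split; lra.
Qed.

Lemma sqe_neq0 : q != 0. Proof. exact: cexp_neq0. Qed.
Lemma nc_sqe : Q = expR (reC w / 2).
Proof. by rewrite /sqe nc_cexp re_half. Qed.
Lemma eps_sqe : eps w = q ^+ 2.
Proof. by rewrite /eps /sqe expr2 -cexpD; congr cexp; field. Qed.
Lemma nc_edir : nc edir = 1.
Proof. by rewrite /edir nc_cexp reM re_iC im_rc mul0r mulr0 subr0 expR0. Qed.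
Lemma edirE : edir = mkC (cos th) (sin th).
Proof.
have -> : edir = cexp (mkC 0 th).
  by rewrite /edir; congr cexp; apply: Cext; rewrite ?reM ?imM re_iC im_iC re_rc im_rc /=; lra.
by apply: Cext; rewrite /= expR0 mul1r.
Qed.
Lemma edirN : cexp (- (iC R * rc th)) = mkC (cos th) (- sin th).
Proof.
have -> : - (iC R * rc th) = mkC 0 (- th).
  by apply: Cext; rewrite ?reN ?imN ?reM ?imM re_iC im_iC re_rc im_rc /=; lra.
by apply: Cext; rewrite /= expR0 mul1r ?cosN ?sinN.
Qed.
Lemma edirK : edir * cexp (- (iC R * rc th)) = 1.
Proof. exact: cexp_cexpN. Qed.

Lemma heightE t : height gamma w t = imC t * cos th - reC t * sin th.
Proof. by rewrite /height edirN imM /= mulrN addrC. Qed.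
Lemma heightD t u : height gamma w (t + u) = height gamma w t + height gamma w u.
Proof. by rewrite !heightE reD imD; ring. Qed.
Lemma heightN t : height gamma w (- t) = - height gamma w t.
Proof. by rewrite !heightE reN imN; ring. Qed.
Lemma heightZ a t : height gamma w (rc a * t) = a * height gamma w t.
Proof. by rewrite !heightE reM imM /=; ring. Qed.
Lemma height_edir : height gamma w edir = 0.
Proof. by rewrite heightE edirE /=; ring. Qed.
Lemma height_le t : `|height gamma w t| <= nc t.
Proof.
rewrite /height; apply: (le_trans (im_le_nc _)).
by rewrite ncM nc_cexp reN reM re_iC im_rc mul0r mulr0 subr0 oppr0 expR0 mulr1.
Qed.

Lemma cos_theta : cos phi0 <= cos th.
Proof.
rewrite -(cos_norm th); have h := theta_lt; apply/ltW.
have p1 := phi_lt; have p2 := p0; have l1 := normr_ge0 th.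
by rewrite ltr_cos ?in_itv /=; try (apply/andP; split); lra.
Qed.
Lemma cos_phi0_gt0 : 0 < cos phi0.
Proof. by apply: cos_gt0_pihalf; have := theta_lt; have := normr_ge0 th; have := phi_lt; have := p0; lra. Qed.
Lemma cos_theta_gt0 : 0 < cos th.
Proof. exact: lt_le_trans cos_phi0_gt0 cos_theta. Qed.
Lemma tan_theta : `|tan th| <= tan phi0.
Proof.
have h := theta_lt; have l1 := normr_ge0 th; have p1 := phi_lt; have p2 := p0; apply/ltW.
have -> : `|tan th| = `|tan `|th| |.
  have [t0|t0] := leP 0 th; first by rewrite (ger0_norm t0).
  by rewrite (ltr0_norm t0) /tan sinN cosN mulNr normrN.
rewrite ger0_norm; last first.
  by rewrite /tan cos_norm divr_ge0 ?(ltW cos_theta_gt0) // sin_ge0_pi //; lra.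
by rewrite ltr_tan ?in_itv /=; try (apply/andP; split); lra.
Qed.
(** The direction e^{i theta} rescaled to real part 1, the normalization under which paths are
    parametrized by Re t. *)
Lemma slope_edir : 1 + iC R * rc (tan th) = rc (cos th)^-1 * edir.
Proof.
have c0 := cos_theta_gt0.
rewrite edirE; apply: Cext; rewrite ?reD ?imD ?reM ?imM re_iC im_iC ?re_rc ?im_rc /= /tan.
  by field; rewrite gt_eqF.
by rewrite !mul0r mulrC; lra.
Qed.

Definition Gdir : C := q * edir.
Lemma nc_Gdir : nc Gdir = Q.
Proof. by rewrite /Gdir ncM nc_edir mulr1. Qed.
(** With b = arg sqrt(eps) - pi, the argument of sqrt(eps) e^{i theta} is pi + b (1 - 2 gamma / pi).
    The turn by theta thus contracts the argument towards pi, and (pi / 2 + gamma) (1 - 2 gamma /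
    pi) = pi / 2 - 2 gamma^2 / pi keeps it in the left half-plane, even where sqrt(eps) itself
    leaves it. *)
Lemma re_Gdir : reC Gdir <= - (kap * nc Gdir).
Proof.
rewrite nc_Gdir nc_sqe.
have -> : Gdir = cexp (w / 2 + iC R * rc th) by rewrite cexpD.
rewrite /= -/(reC _) -/(imC _) reD imD re_half im_half reM imM re_iC im_iC re_rc im_rc.
rewrite mul0r mulr0 subr0 addr0 mulr0 add0r mul1r.
rewrite [kap * _]mulrC -mulrN ler_wpM2l ?expR_ge0 //.
have p1 := phi_lt; have p2 := p0; have g3 := g2; have g4 := gpi; have g5 := gamma0.
pose b := imC w / 2 - pi; pose x := b * (1 - 2 * gamma / pi).
have -> : imC w / 2 + th = x + pi.
  by rewrite /x /b /theta; move: pn; move: (pi : R) => p pn'; field.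
rewrite cosDpi lerN2 /kap -(cos_norm x).
have -> : 2 * gamma ^+ 2 / pi = pi / 2 - (pi / 2 - 2 * gamma ^+ 2 / pi) by lra.
rewrite -[sin _]opprK -sinN opprB sinBpihalf opprK.
have f0 : 0 < 1 - 2 * gamma / pi by rewrite subr_gt0 ltr_pdivrMr //; lra.
have xb : `|x| < pi / 2 - 2 * gamma ^+ 2 / pi.
  rewrite /x normrM (gtr0_norm f0).
  have -> : pi / 2 - 2 * gamma ^+ 2 / pi = (pi / 2 + gamma) * (1 - 2 * gamma / pi).
    by move: pn; move: (pi : R) => p pn'; field.
  by rewrite ltr_pM2r // /b ltr_norml; move: argw => /andP[? ?]; apply/andP; split; lra.
have l1 := normr_ge0 x; apply/ltW.
by rewrite ltr_cos ?in_itv /=; try (apply/andP; split); lra.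
Qed.

Lemma sqe_mul t : q * t = Gdir * (t * cexp (- (iC R * rc th))).
Proof. by rewrite /Gdir mulrACA [edir * _]mulrC mulrA; have := edirK; rewrite [edir * _]mulrC -!mulrA => ->; rewrite mulr1. Qed.

Lemma sqe_per : q * per w = - (iC R * rc pi).
Proof. by rewrite /per mulrN mulrCA divff ?sqe_neq0 // mulr1 mulrC. Qed.

(** The distance between a line of direction e^{i theta} and its translate by the period, the unit
    for all vertical sizes. *)
Definition hP : R := height gamma w (per w).
Lemma hPE : hP = - pi * reC Gdir / Q ^+ 2.
Proof.
have -> : hP = imC (- (rc pi * iC R) / Gdir).
  rewrite /hP /height /per /Gdir /edir cexpN; congr imC.
  by field; rewrite cexp_neq0 sqe_neq0.
have N0 : nc Gdir != 0 by rewrite nc_eq0 mulf_neq0 ?sqe_neq0 ?cexp_neq0.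
rewrite -nc_Gdir imM reN imN reM imM reV imV re_iC im_iC re_rc im_rc.
by move: N0; move: (nc Gdir) (reC Gdir) (imC Gdir) => N a b N0; field.
Qed.
Lemma Q_gt0 : 0 < Q. Proof. by rewrite nc_gt0 sqe_neq0. Qed.
Lemma hP_range : pi * kap / Q <= hP <= pi / Q.
Proof.
have q0 := Q_gt0; rewrite hPE; have h := re_Gdir; rewrite nc_Gdir in h.
have h2 := re_le_nc Gdir; rewrite nc_Gdir ler_norml in h2.
have [->] : pi * kap / Q = pi * (kap * Q) / Q ^+ 2 by field; rewrite gt_eqF.
have [->] : pi / Q = pi * Q / Q ^+ 2 by field; rewrite gt_eqF.
have i0 : 0 <= (Q ^+ 2)^-1 by rewrite invr_ge0 sqr_ge0.
by apply/andP; split; rewrite ler_wpM2r // mulNr -mulrN ler_pM2l //; lra.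
Qed.
Lemma hP_gt0 : 0 < hP.
Proof.
have /andP[h _] := hP_range; apply: lt_le_trans h.
by have /andP[k0 _] := kap_range; rewrite divr_gt0 ?Q_gt0 // mulr_gt0.
Qed.

(** |x^2 - eps| = |eps| / |sinh (sqrt(eps) t)|^2, and in a strip about the line through 0 of
    direction e^{i theta} the sinh is at least a multiple of |sqrt(eps) t|. The powers of eps
    cancel, which makes the bound uniform. *)
Lemma strip_bound t : t != 0 -> Q * `|height gamma w t| <= kap / 8 ->
  csinh (q * t) != 0 /\ nc (xq q t ^+ 2 - q ^+ 2) <= 16 / kap ^+ 2 / nc t ^+ 2.
Proof.
move=> t0 ht; have := @sector_csinh_ge R Gdir (t * cexp (- (iC R * rc th))) kap kap_range re_Gdir.
rewrite nc_Gdir => /(_ ht); rewrite -sqe_mul ncM => h.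
have /andP[k0 _] := kap_range; have q0 := Q_gt0.
have nt : 0 < nc t by rewrite nc_gt0.
have p1 : 0 < kap / 4 * (Q * nc t) by rewrite mulr_gt0 ?divr_gt0 // mulr_gt0.
have s0 : csinh (q * t) != 0 by rewrite -nc_gt0; apply: lt_le_trans h.
split=> //; rewrite xq2 // ncM ncV !ncX.
rewrite ler_pdivrMr ?exprn_gt0 ?nc_gt0 //.
apply: (@le_trans _ _ (16 / kap ^+ 2 / nc t ^+ 2 * (kap / 4 * (Q * nc t)) ^+ 2)).
  have -> // : 16 / kap ^+ 2 / nc t ^+ 2 * (kap / 4 * (Q * nc t)) ^+ 2 = Q ^+ 2.
  by field; rewrite !gt_eqF.
rewrite ler_wpM2l ?divr_ge0 ?sqr_ge0 // ler_sqr ?nnegrE ?nc_ge0 ?(ltW p1) //.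
Qed.

(* sg = 1, -1: the lines through +-P/2, on which x passes through 0 at s = 0. *)
Lemma midline_bound (sg s : R) : sg = 1 \/ sg = - 1 ->
  let t := rc (sg / 2) * per w + rc s * edir in
  csinh (q * t) != 0 /\ nc (xq q t ^+ 2 - q ^+ 2) <= 4 / kap ^+ 2 * (Q ^+ 2 / (1 + (Q * s) ^+ 2)).
Proof.
move=> hsg t; have /andP[k0 _] := kap_range; have q0 := Q_gt0.
have E : nc (csinh (q * t)) = nc (ccosh (Gdir * rc s)).
  have qtE : q * t = Gdir * rc s - rc sg * (iC R * rc (pi / 2)).
    by rewrite /t mulrDr mulrCA sqe_per /Gdir !rc_half; field.
  rewrite qtE; case: hsg => ->; first by rewrite rc1 mul1r nc_csinh_halfpiN.
  by rewrite rcN rc1 mulN1r opprK nc_csinh_halfpi.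
have := @line_ccosh_ge R Gdir kap s kap_range re_Gdir; rewrite nc_Gdir -E => h.
have d0 : 0 < 1 + (Q * s) ^+ 2 by have := sqr_ge0 (Q * s); lra.
have p1 : 0 < kap ^+ 2 / 4 * (1 + (Q * s) ^+ 2) by rewrite mulr_gt0 // divr_gt0 // exprn_gt0.
have s0 : csinh (q * t) != 0.
  rewrite -nc_gt0 lt_def nc_ge0 andbT; apply/eqP => e0.
  by move: (lt_le_trans p1 h); rewrite e0 expr0n ltxx.
split=> //; rewrite xq2 // ncM ncV !ncX.
rewrite ler_pdivrMr ?exprn_gt0 ?nc_gt0 //.
apply: (@le_trans _ _ (4 / kap ^+ 2 * (Q ^+ 2 / (1 + (Q * s) ^+ 2)) * (kap ^+ 2 / 4 * (1 + (Q * s) ^+ 2)))).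
  have -> // : 4 / kap ^+ 2 * (Q ^+ 2 / (1 + (Q * s) ^+ 2)) * (kap ^+ 2 / 4 * (1 + (Q * s) ^+ 2)) = Q ^+ 2.
  by field; rewrite !gt_eqF // d0.
by rewrite ler_wpM2l // mulr_ge0 ?divr_ge0 ?sqr_ge0 // ltW.
Qed.

Lemma midline_zero (sg : R) : sg = 1 \/ sg = - 1 -> xq q (rc (sg / 2) * per w) = 0.
Proof.
move=> hsg; rewrite /xq.
have -> : q * (rc (sg / 2) * per w) = - (rc sg * (iC R * rc (pi / 2))).
  by rewrite mulrCA sqe_per !rc_half; field.
have c0 : ccosh (iC R * rc (pi / 2)) = 0.
  rewrite /ccosh cexpN cexp_halfpi.
  have i0 : iC R != 0 by rewrite -nc_gt0 nc_iC.
  have -> : (iC R)^-1 = - iC R by apply: (mulfI i0); rewrite divff // mulrN iCiC opprK.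
  by rewrite subrr mul0r.
by case: hsg => ->; rewrite ccoshN ?rcN rc1 ?mulN1r ?mul1r ?ccoshN c0 mulr0 mul0r oppr0.
Qed.

(** Along e^{i theta} the real part of sqrt(eps) t tends to minus infinity, where coth tends to -1.
    Hence the right end of a line goes to x_L and the left end to x_R. *)
Lemma ray_limit t (sg : R) : sg = 1 \/ sg = - 1 -> forall e : R, 0 < e ->
  exists S0 : R, forall s, S0 <= s -> nc (xq q (t + rc (sg * s) * edir) - rc sg * q) < e.
Proof.
move=> hsg e e0; have /andP[k0 _] := kap_range; have q0 := Q_gt0.
exists (Num.max 1 ((Q * nc t + Q / e + 1) / (kap * Q))) => s.
rewrite ge_max => /andP[s1]; rewrite ler_pdivrMr ?mulr_gt0 // => s2.
have hG := re_Gdir; rewrite nc_Gdir in hG.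
have E : reC (q * (t + rc (sg * s) * edir)) = reC (q * t) + sg * s * reC Gdir.
  have -> : q * (t + rc (sg * s) * edir) = q * t + Gdir * rc (sg * s) by rewrite /Gdir; ring.
  by rewrite reD reC_scale [reC _ * _]mulrC.
have qt := re_le_nc (q * t); rewrite ncM ler_norml in qt; case/andP: qt => qt1 qt2.
have Qe : 0 < Q / e by rewrite divr_gt0.
have big : Q / e + 1 <= - (s * reC Gdir) - Q * nc t.
  have : s * (kap * Q) <= s * - reC Gdir by rewrite ler_wpM2l //; lra.
  lra.
case: hsg E => -> E.
  rewrite !mul1r in E *.
  have neg : reC (q * (t + rc s * edir)) <= - (Q / e + 1) by rewrite E; lra.
  apply: (le_lt_trans (xq_lim_left _)); first lra.
  rewrite ltr_pdivrMr; last lra.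
  rewrite mulrC -ltr_pdivrMr //; lra.
rewrite !mulN1r in E *.
have pos : Q / e + 1 <= reC (q * (t + rc (- s) * edir)) by rewrite E; lra.
rewrite [rc (-1)]rcN rc1 mulN1r opprK; apply: (le_lt_trans (xq_lim_right _)); first lra.
rewrite ltr_pdivrMr; last lra.
rewrite mulrC -ltr_pdivrMr //; lra.
Qed.
End Cover.

(** * Connected sets in the t-plane *)

Section ConnectedSets.
Variable R : realType.
Local Notation C := (Cx R).

Lemma pt_continuous (p v : C) : continuous (pt p v).
Proof.
move=> s U /nbhs_nc[d d0 hU]; have K0 : 0 < nc v + 1 by rewrite ltr_wpDl ?nc_ge0.
exists (d / (nc v + 1)) => [|s' /=]; first by rewrite /= divr_gt0.
rewrite distrC ltr_pdivlMr // => hs; apply: hU; rewrite /pt.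
have -> : p + rc s' * v - (p + rc s * v) = rc (s' - s) * v by rewrite rcB; ring.
rewrite ncM nc_rc; have := normr_ge0 (s' - s); have := nc_ge0 v; nra.
Qed.

Lemma connected_ivt (A : set C) (f : C -> R) (p u : C) (c : R) : connected A -> continuous f ->
  A p -> A u -> f p <= c <= f u -> exists2 z, A z & f z = c.
Proof.
move=> cA cf Ap Au hc.
have : connected (f @` A).
  by apply: connected_continuous_connected => //; exact: continuous_subspaceT.
move/connected_intervalP => /(_ (f p) (f u)).
by case/(_ _ _ c hc) => [||z Az zc]; [exists p|exists u|exists z].
Qed.

Lemma reC_continuous : continuous (@reC R).
Proof.
move=> z U /nbhs_ballP[e /= e0 hU]; apply/nbhs_nc; exists e => // u hu; apply: hU.
by rewrite /ball /= -reB; apply: le_lt_trans (re_le_nc _) _; rewrite ncBC.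
Qed.
Lemma nc_continuous : continuous (@nc R).
Proof. by move=> z; exact: nc_cont (cdiff_id z). Qed.

Lemma component_segment (A : set C) (z p v : C) :
  connected_component A z p -> A z ->
  (forall s, 0 <= s <= 1 -> A (pt p v s)) -> connected_component A z (p + v).
Proof.
move=> hp Az hs.
pose B : set C := connected_component A z `|` (pt p v @` `[0, 1]).
have p0 : pt p v 0 = p by rewrite /pt rc0 mul0r addr0.
apply: (@connected_component_max _ A B z).
- by left; exact: connected_component_refl.
- move=> t [/connected_component_sub //|[s /=]]; rewrite in_itv /= => hs' <-; exact: hs.
- apply: connectedU.
  + exists p; split=> //; exists 0 => //=; by rewrite in_itv /= lexx ler01.
  + exact: component_connected.
  + apply: connected_continuous_connected; first exact: segment_connected.
    by apply: continuous_subspaceT; exact: pt_continuous.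
- right; exists 1; first by rewrite /= in_itv /= lexx ler01.
  by rewrite /pt rc1 mul1r.
Qed.
Lemma sign_bound (c x y e : R) : c = 1 \/ c = -1 -> `|x - y| < e ->
  c * y - e < c * x /\ c * x < c * y + e.
Proof. by move=> [] ->; rewrite ltr_norml => /andP[? ?]; split; lra. Qed.
End ConnectedSets.

(** * The shape of N and of the domains Gamma_D and Gamma_U *)

Section Geometry.
Variables (R : realType) (gamma r h kappa c0 : R) (w : Cx R).
Local Notation C := (Cx R).
Let phi0 := gamma * (1 + 2 * gamma / pi).
Local Notation q := (sqe w).
Local Notation Q := (nc (sqe w)).
Local Notation th := (theta gamma w).
Local Notation N := (Nset r w).
Local Notation ht := (height gamma w).
Local Notation sg := (sigma gamma c0 w).
Local Notation mm := (c0 / nc (sqe w)).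
Local Notation hh := (hP gamma w).
Hypothesis gamma0 : 0 < gamma.
Hypothesis phi_lt : phi0 < pi / 2.
Hypothesis argw : pi - 2 * gamma < imC w < 3 * pi + 2 * gamma.
Hypothesis r0 : 0 < r.
Hypothesis h_range : 0 < h < r^-1.
Hypothesis kappa_range : 0 < kappa < 1 / 2.
Hypothesis c0_gt0 : 0 < c0.

(** A radius strictly between h and 1/r. The disc of this radius lies in N, and a point outside it
    with |Im t| < h has |Re t| >= [amin]. *)
Definition hmid : R := (h + r^-1) / 2.
Definition amin : R := Num.sqrt (hmid ^+ 2 - h ^+ 2).
(** The relative accuracy of x(t) = -1/t that is required: 1/4 gives |x| < r on |t| = 2/r, the
    second term gives |x| >= r for |t| <= [hmid], and the third decides the sign of Re x in
    [not_N_move]. *)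
Definition eta0 : R := Num.min (1 / 4) (Num.min (1 - r * hmid) (amin * r / 4)).

Hypothesis approx : forall t, t != 0 -> nc t <= 2 / r ->
  csinh (q * t) != 0 /\ nc (xq q t + t^-1) <= eta0 / nc t.
Hypothesis Q_small : Q ^+ 2 <= amin * r ^+ 3 / 64.
Hypothesis m_big : 2 / r <= mm.
Hypothesis hh_big1 : h + mm * tan phi0 < (1 / 2 - kappa) * hh.
Hypothesis hh_big2 : 2 / r <= (1 / 2 - kappa) * hh.

Definition E_ : set C := [set t | csinh (q * t) = 0 \/ rc r <= `|xt w t|].

(** Without the denominator the poles of x are no longer an exception, and the set is given by an
    inequality between continuous functions. *)
Lemma EP t : E_ t <-> (r * nc (csinh (q * t)) <= nc (q * ccosh (q * t))).
Proof.
rewrite /E_ /= norm_nc rc_le /xt ncN ncM ncV; split.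
  case=> [->|]; first by rewrite nc0 mulr0 nc_ge0.
  have [->|s0] := eqVneq (csinh (q * t)) 0; first by rewrite nc0 mulr0 nc_ge0.
  by rewrite ler_pdivlMr ?nc_gt0.
have [->|s0] := eqVneq (csinh (q * t)) 0; first by left.
by move=> H; right; rewrite ler_pdivlMr ?nc_gt0.
Qed.

Lemma E_xq t : csinh (q * t) != 0 -> (E_ t <-> r <= nc (xq q t)).
Proof.
move=> s0; rewrite /E_ /= norm_nc rc_le; split=> [[/eqP|//]|]; last by right.
by rewrite (negbTE s0).
Qed.

Lemma E0 : E_ 0.
Proof. by left; rewrite mulr0 csinh0. Qed.

Lemma closed_E : closed E_.
Proof.
rewrite -[E_]setCK; apply: open_closedC; rewrite openE => t /= ht'.
have hq : cdiff (fun t => q * t) t (q * 1) := cdiff_scale q (cdiff_id t).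
have h1 := nc_cont (cdiff_comp hq (cdiff_csinh _)).
have h2 := nc_cont (cdiff_scale q (cdiff_comp hq (cdiff_ccosh _))).
have h3 : (fun u => r * nc (csinh (q * u)) - nc (q * ccosh (q * u))) @ t -->
    r * nc (csinh (q * t)) - nc (q * ccosh (q * t)).
  exact: (cvgB (cvgM (cvg_cst r) h1) h2).
have pos : 0 < r * nc (csinh (q * t)) - nc (q * ccosh (q * t)).
  by rewrite subr_gt0 ltNge; apply/negP => hle; apply: ht'; apply/EP.
have near0 (v : R) : 0 < v -> nbhs v [set y | 0 < y].
  move=> v0; exists v => //= y; rewrite /ball_ /= ltr_norml => /andP[_]; lra.
change (nbhs t (~` E_)); have /nbhs_nc[d d0 hd] := h3 _ (near0 _ pos).
apply/nbhs_nc; exists d => // u /hd /=; rewrite subr_gt0 ltNge => /negP hu.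
by move=> /EP.
Qed.

Lemma closed_N : closed N.
Proof. exact: component_closed closed_E. Qed.

Lemma N0 : N 0.
Proof. by apply: connected_component_refl; exact: E0. Qed.

Let hmid_gt : h < hmid < r^-1.
Proof. by move: h_range => /andP[? ?]; rewrite /hmid; apply/andP; split; lra. Qed.
Lemma amin_gt0 : 0 < amin.
Proof.
case/andP: hmid_gt h_range => h1 _ /andP[h2 _]; rewrite /amin sqrtr_gt0 subr_gt0.
by rewrite ltr_sqr ?nnegrE; lra.
Qed.
Lemma eta_range : [/\ 0 < eta0, eta0 <= 1 / 4, eta0 <= 1 - r * hmid & eta0 <= amin * r / 4].
Proof.
have h1 : 0 < 1 - r * hmid.
  by case/andP: hmid_gt => _ h2; rewrite subr_gt0 mulrC -ltr_pdivlMr // div1r.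
have a0 := amin_gt0; split; first by rewrite /eta0 !lt_min h1 !divr_gt0 // mulr_gt0.
- by rewrite /eta0 ge_min lexx.
- by rewrite /eta0 !ge_min lexx !orbT.
- by rewrite /eta0 !ge_min lexx !orbT.
Qed.

Let xq_upper t : t != 0 -> nc t <= 2 / r -> nc (xq q t) <= 5 / 4 / nc t.
Proof.
move=> t0 /(approx t0)[_ hx]; have [_ h1 _ _] := eta_range.
have nt : 0 < nc t by rewrite nc_gt0.
have := nc_lower (xq q t) (- t^-1); rewrite opprK (ncN t^-1) ncV => h2.
have h3 : eta0 / nc t <= 1 / 4 / nc t by rewrite ler_pM2r ?invr_gt0.
have -> : 5 / 4 / nc t = 1 / 4 / nc t + (nc t)^-1 by field; rewrite gt_eqF.
lra.
Qed.

Let xq_lower t : t != 0 -> nc t <= 2 / r -> (1 - eta0) / nc t <= nc (xq q t).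
Proof.
move=> t0 /(approx t0)[_ hx]; have nt : 0 < nc t by rewrite nc_gt0.
have := nc_lower (t^-1) (xq q t + t^-1); rewrite ncV.
have -> : t^-1 - (xq q t + t^-1) = - xq q t by ring.
by rewrite ncN mulrBl mul1r; lra.
Qed.

(** N is connected and contains 0. If it reached modulus 2/r, it would meet the circle |t| = 2/r,
    where |x| <= 5 r / 8 < r. *)
Lemma N_small t : N t -> nc t < 2 / r.
Proof.
move=> Nt; rewrite ltNge; apply/negP => ht'.
have rr0 : 0 < 2 / r by rewrite divr_gt0.
have cN : connected N := @component_connected _ _ _.
have [z Nz zr] := @connected_ivt _ N _ 0 t (2 / r) cN (@nc_continuous R) N0 Nt
  ltac:(by rewrite nc0 (ltW rr0)).
have z0 : z != 0 by rewrite -nc_gt0 zr.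
have zle : nc z <= 2 / r by rewrite zr.
have [s0 _] := approx z0 zle; have := xq_upper z0 zle; rewrite zr.
have := (E_xq s0).1 (connected_component_sub Nz) => h1 h2.
have : 5 / 4 / (2 / r) = 5 / 8 * r by field; rewrite gt_eqF.
by have := r0; lra.
Qed.

Lemma N_of_small t : nc t <= hmid -> N t.
Proof.
move=> ht'; rewrite -[t]add0r; apply: component_segment N0 E0 _ => s /andP[s0 s1].
rewrite /pt add0r; set u := rc s * t.
have nu : nc u <= hmid.
  by rewrite /u ncM nc_rc ger0_norm //; apply: le_trans ht'; rewrite ler_piMl ?nc_ge0.
have [->|u0] := eqVneq u 0; first exact: E0.
case/andP: hmid_gt => h1 h2.
have n0 : 0 < nc u by rewrite nc_gt0.
have ri : 0 < r^-1 by rewrite invr_gt0.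
have ur : nc u <= 2 / r by rewrite -[2 / r]mulrC; lra.
have [c0' _] := approx u0 ur; apply/(E_xq c0').
apply: le_trans (xq_lower u0 ur); rewrite ler_pdivlMr //.
have [_ _ h3 _] := eta_range.
have : r * nc u <= r * hmid by rewrite ler_pM2l.
lra.
Qed.

(* While |Re t| is bounded below, |x| decreases as t moves horizontally away from
   the imaginary axis, so that a path leaving N this way never comes back. *)
Lemma not_N_move t (sgn s : R) : sgn = 1 \/ sgn = - 1 -> ~ N t -> `|imC t| < h ->
  0 < sgn * reC t -> 0 <= s -> ~ N (t + rc (sgn * s)).
Proof.
move=> hsg Nt imt ret s0 Ns; apply: Nt.
have rr0 : 0 < 2 / r by rewrite divr_gt0.
have sg2 : sgn * sgn = 1 by case: hsg => ->; lra.
have nsg : nc (rc sgn) = 1 by rewrite nc_rc; case: hsg => ->; rewrite ?normrN normr1.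
have a_big (Nt : ~ N t) : amin <= sgn * reC t.
  have h1 : hmid < nc t by rewrite ltNge; apply/negP => /N_of_small.
  case/andP: hmid_gt h_range => h2 h3 /andP[h4 h5].
  rewrite /amin -(@ler_sqr _ (Num.sqrt _)) ?nnegrE ?sqrtr_ge0 ?(ltW ret) //.
  have h6 : hmid ^+ 2 < nc t ^+ 2 by rewrite ltr_sqr ?nnegrE ?nc_ge0 //; lra.
  have h7 : imC t ^+ 2 < h ^+ 2 by rewrite -real_normK ?num_real // ltr_sqr ?nnegrE // ltW.
  rewrite sqr_sqrtr; last by rewrite subr_ge0 ler_sqr ?nnegrE; lra.
  by rewrite [(sgn * _) ^+ 2]exprMn [sgn ^+ 2]expr2 sg2 mul1r; rewrite nc_sqr in h6; lra.
apply: contrapT => Nt; have {}a_big := a_big Nt; apply: Nt.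
have ap := amin_gt0.
set t1 := t + rc (sgn * s) in Ns.
(* A segment inside [E_] that leads from t1, a point of N, back to t puts t in N. *)
have -> : t = t1 + rc (- (sgn * s)) by rewrite /t1 rcN addrK.
apply: component_segment => //; first exact: E0.
move=> l /andP[l0 l1].
have ptE : pt t1 (rc (- (sgn * s))) l = pt t (rc sgn) ((1 - l) * s).
  by rewrite /pt /t1 -addrA -!rcM -rcD; congr (_ + rc _); ring.
rewrite ptE.
set s1 := (1 - l) * s.
have s1s : 0 <= s1 <= s.
  rewrite /s1; apply/andP; split; first by rewrite mulr_ge0 //; lra.
  by rewrite ler_piMl //; lra.
have rePt u : sgn * reC (pt t (rc sgn) u) = sgn * reC t + u.
  by rewrite /pt reD reM /= mulr0 subr0 mulrDr mulrCA sg2 mulr1.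
have imPt u : imC (pt t (rc sgn) u) = imC t.
  by rewrite /pt imD imM /= mulr0 mul0r !addr0.
have sqs (x : R) : x ^+ 2 = (sgn * x) ^+ 2 by rewrite exprMn [sgn ^+ 2]expr2 sg2 mul1r.
have mono u : 0 <= u <= s -> nc (pt t (rc sgn) u) <= nc t1.
  move=> /andP[u0 us].
  have -> : t1 = pt t (rc sgn) s by rewrite /pt /t1 rcM mulrC.
  rewrite -(@ler_sqr _ (nc (pt _ _ u))) ?nnegrE ?nc_ge0 // !nc_sqr !imPt lerD2r.
  rewrite [reC _ ^+ 2]sqs [X in _ <= X]sqs !rePt.
  by rewrite ler_sqr ?nnegrE; lra.
have small u : 0 <= u <= s -> nc (pt t (rc sgn) u) <= 2 / r.
  by move=> /mono hu; apply: (le_trans hu); apply/ltW; exact: N_small.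
have nz u : 0 <= u <= s -> pt t (rc sgn) u != 0.
  move=> /andP[u0 _]; apply/eqP => e0; have := rePt u; rewrite e0 /=; lra.
have snz u : 0 <= u <= s -> csinh (q * pt t (rc sgn) u) != 0.
  by move=> hu; have [] := approx (nz u hu) (small u hu).
have ends : 0 <= s <= s by rewrite s0 lexx.
have x1 : r <= nc (xq q (pt t (rc sgn) s)).
  apply/E_xq; first exact: snz.
  by have := connected_component_sub Ns; rewrite /t1 /pt rcM mulrC.
apply/E_xq; first exact: snz.
apply: (le_trans x1); rewrite -ler_sqr ?nnegrE ?nc_ge0 //.
rewrite -lerN2.
case/andP: s1s => s1a s1b.
have inn u : s1 <= u <= s -> 0 <= u <= s by move=> /andP[h1 ->]; rewrite (le_trans s1a).
apply: (@rdiff_mono _ (fun u => - nc (xq q (pt t (rc sgn) u)) ^+ 2) (fun u => - (2 * reC ((xq q (pt t (rc sgn) u))^* * ((xq q (pt t (rc sgn) u) ^+ 2 - q ^+ 2) * rc sgn)))) s1 s) => // u /inn hu.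
  by apply: rdiff_opp; apply: rdiff_line_nc2; apply: cdiff_xq; exact: snz.
rewrite oppr_ge0; set p := pt t (rc sgn) u.
set x := xq q p.
have p0 : p != 0 := nz u hu; have pr : nc p <= 2 / r := small u hu.
have [_ happ] := approx p0 pr; have low := xq_lower p0 pr; rewrite -/x in happ low.
have np : 0 < nc p by rewrite nc_gt0.
have [e1 e2 e3 e4] := eta_range.
have rep : amin <= sgn * reC p by rewrite rePt; case/andP: hu => ? ?; lra.
have inp : (2 / r)^-1 <= (nc p)^-1 by rewrite lef_pV2 ?posrE.
have rE : (2 / r)^-1 = r / 2 by field; rewrite gt_eqF.
have rex : sgn * reC x <= - (amin * r ^+ 2 / 8).
  have h1 : sgn * reC (x + p^-1) <= eta0 / nc p.
    apply: le_trans happ; apply: le_trans (ler_norm _) _.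
    rewrite normrM; have -> : `|sgn| = 1 by rewrite -nc_rc nsg.
    by rewrite mul1r; exact: re_le_nc.
  have h2 : sgn * reC p^-1 = sgn * reC p / nc p ^+ 2 by rewrite reV mulrA.
  rewrite reD mulrDr h2 in h1.
  have h3 : amin / nc p ^+ 2 <= sgn * reC p / nc p ^+ 2.
    by rewrite ler_wpM2r // invr_ge0 sqr_ge0.
  have h4 : eta0 / nc p <= amin / 2 / nc p ^+ 2.
    rewrite expr2 invfM mulrA ler_pM2r ?invr_gt0 //.
    rewrite -(@ler_pM2r _ (nc p)) // divfK ?gt_eqF //.
    have : eta0 * nc p <= (amin * r / 4) * (2 / r) by apply: ler_pM => //; exact: ltW.
    by rewrite (_ : amin * r / 4 * (2 / r) = amin / 2) //; field; rewrite gt_eqF.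
  have h5 : amin / 2 * (r / 2) ^+ 2 <= amin / 2 / nc p ^+ 2.
    rewrite -exprVn ler_pM2l ?divr_gt0 // ler_sqr ?nnegrE -?rE //.
      by rewrite invr_ge0 ltW.
    by rewrite invr_ge0 ltW.
  have h6 : amin / 2 * (r / 2) ^+ 2 = amin * r ^+ 2 / 8 by field.
  have h7 : amin / nc p ^+ 2 = amin / 2 / nc p ^+ 2 + amin / 2 / nc p ^+ 2 by field; rewrite gt_eqF.
  lra.
have xlow : 3 * r / 8 <= nc x.
  apply: le_trans low.
  apply: (@le_trans _ _ (3 / 4 * (r / 2))); first lra.
  by have r0' := r0; apply: ler_pM => //; rewrite -?rE //; lra.
(* Half the derivative of |x|^2. The first term is negative, as Re x and Re t have opposite signs,
   and it outweighs the term in eps by [Q_small]. *)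
have -> : reC (x^* * ((x ^+ 2 - q ^+ 2) * rc sgn)) = nc x ^+ 2 * (sgn * reC x) - reC (rc sgn * (x^* * q ^+ 2)).
  have -> : x^* * ((x ^+ 2 - q ^+ 2) * rc sgn) = (x^* * x) * (x * rc sgn) - rc sgn * (x^* * q ^+ 2) by ring.
  rewrite reB [reC (_ * (x * _))]reM conj_nc2 reC_scale.
  have -> : imC (x^* * x) = 0 by rewrite imM re_conj im_conj; ring.
  by rewrite mul0r subr0 [reC x * _]mulrC.
have h1 : - reC (rc sgn * (x^* * q ^+ 2)) <= nc x * Q ^+ 2.
  rewrite -reN; apply: le_trans (reC_le_nc _) _.
  by rewrite ncN ncM nsg mul1r ncM nc_conj ncX.
have h2 : nc x ^+ 2 * (sgn * reC x) <= nc x ^+ 2 * - (amin * r ^+ 2 / 8).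
  by rewrite ler_wpM2l // sqr_ge0.
have h3 : nc x * Q ^+ 2 <= nc x * (amin * r ^+ 3 / 64) by rewrite ler_wpM2l ?nc_ge0.
have h4 : nc x * (3 * r / 8 * (amin * r ^+ 2 / 8)) <= nc x * (nc x * (amin * r ^+ 2 / 8)).
  rewrite ler_wpM2l ?nc_ge0 // ler_wpM2r //.
  by rewrite divr_ge0 // mulr_ge0 ?sqr_ge0 // ltW.
have h5 : nc x * (amin * r ^+ 3 / 64) <= nc x * (3 * r / 8 * (amin * r ^+ 2 / 8)).
  rewrite ler_wpM2l ?nc_ge0 //.
  have h6 : 0 < amin * r ^+ 3 by rewrite mulr_gt0 // exprn_gt0.
  have -> : 3 * r / 8 * (amin * r ^+ 2 / 8) = 3 * (amin * r ^+ 3) / 64 by field.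
  lra.
have h6 : nc x ^+ 2 * - (amin * r ^+ 2 / 8) = - (nc x * (nc x * (amin * r ^+ 2 / 8))) by ring.
lra.
Qed.

(** Truncation to [-m, m]: [sigma] is (u - clamp u) tan theta, one formula for its three cases. *)
Let clamp (u : R) : R := Num.max (- mm) (Num.min u mm).
Let mm0 : 0 < mm.
Proof. by rewrite divr_gt0 // Q_gt0. Qed.

Lemma sigmaE u : sg u = (u - clamp u) * tan th.
Proof.
have m0 := mm0.
rewrite /sigma -re_half -/(sqe w); have -> : expR (reC (w / 2)) = Q by rewrite /sqe nc_cexp.
rewrite /clamp; case: leP => [|hu].
  by rewrite ler_norml => /andP[h1 h2]; rewrite (min_idPl h2) (max_idPr h1) subrr mul0r.
congr (_ * _); have [u0|u0] := ltP 0 u.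
  rewrite gtr0_norm // in hu; rewrite gtr0_sg // mul1r (min_idPr (ltW hu)).
  by rewrite (max_idPr _) //; lra.
have {}u0 : u < 0.
  rewrite lt_neqAle u0 andbT; apply/eqP => u00; move: hu; rewrite u00 normr0; lra.
rewrite ltr0_norm // in hu; rewrite ltr0_sg // mulN1r (min_idPl _); last by lra.
by rewrite (max_idPl _) //; lra.
Qed.

Lemma clamp_le u : `|clamp u| <= mm.
Proof.
have m0 := mm0; rewrite /clamp ler_norml le_max lexx ge_max ge_min lexx orbT andbT /=; lra.
Qed.

(** [sigma] differs from the linear function u tan theta by a truncated term only, so that heights
    on its graph stay bounded however far it runs. *)
Lemma sigma_slope u : `|sg u - u * tan th| <= mm * tan phi0.
Proof.
rewrite sigmaE -mulrBl normrM; apply: ler_pM => //; last exact: tan_theta.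
by rewrite addrAC subrr add0r normrN clamp_le.
Qed.

Lemma sigma_small u : `|u| <= mm -> sg u = 0.
Proof.
by rewrite ler_norml => /andP[h1 h2]; rewrite sigmaE /clamp (min_idPl h2) (max_idPr h1) subrr mul0r.
Qed.

Lemma sigma_right u : mm <= u -> sg u = (u - mm) * tan th.
Proof.
by have m0 := mm0; move=> hu; rewrite sigmaE /clamp (min_idPr hu) (max_idPr _) //; lra.
Qed.

Lemma sigma_left u : u <= - mm -> sg u = (u + mm) * tan th.
Proof.
have m0 := mm0; move=> hu; rewrite sigmaE /clamp (min_idPl _); last by lra.
by rewrite (max_idPl _) // opprK.
Qed.

Lemma sigma_lipschitz u v : `|sg u - sg v| <= 2 * tan phi0 * `|u - v|.
Proof.
rewrite !sigmaE -mulrBl normrM mulrC -mulrA mulrCA.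
apply: ler_pM => //; first exact: tan_theta.
have -> : u - clamp u - (v - clamp v) = (u - v) - (clamp u - clamp v) by ring.
apply: (le_trans (ler_normB _ _)).
have : `|clamp u - clamp v| <= `|u - v|.
  exact: le_trans (max_lipschitz _ _ _) (min_lipschitz _ _ _).
by rewrite mulr2n mulrDl mul1r; lra.
Qed.

(** The sign under which the conditions that define Gamma_D and Gamma_U become one, as [GammaP]
    records. *)
Definition sgs (s : sect) : R := if s is sD then -1 else 1.
Lemma sgsE s : sgs s = 1 \/ sgs s = -1.
Proof. by case: s; [right|left]. Qed.

Local Notation Gam := (Gamma gamma r h kappa c0).

Lemma GammaP s t : Gam s w t <->
  [/\ ~ N t, - h < sgs s * (imC t - sg (reC t)) & sgs s * ht t < (1 / 2 + kappa) * hh].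
Proof.
have e1 : ht (t + rc (1 / 2 + kappa) * per w) = ht t + (1 / 2 + kappa) * hh.
  by rewrite heightD heightZ.
have e2 : ht (t - rc (1 / 2 + kappa) * per w) = ht t - (1 / 2 + kappa) * hh.
  by rewrite heightD heightN heightZ.
case: s; rewrite /Gamma /sgs /= ?e1 ?e2 ?mulN1r ?mul1r; split=> -[a b c]; split=> //; lra.
Qed.

Lemma far_not_N t : 2 / r <= nc t -> ~ N t.
Proof. by move=> h1 /N_small; rewrite ltNge h1. Qed.

Lemma height_slope t : ht t = cos th * (imC t - reC t * tan th).
Proof.
have c0' := cos_theta_gt0 gamma0 phi_lt argw.
by rewrite heightE /tan; field; rewrite gt_eqF.
Qed.

Let cos1 : 0 < cos th <= 1.
Proof. by rewrite cos_theta_gt0 // cos_le1. Qed.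

(** The strip of half-width h about the graph of sigma has heights at most h + m tan phi0, which
    [hh_big1] makes smaller than those of the lines bounding Gamma_D and Gamma_U. *)
Lemma height_strip t : `|imC t - sg (reC t)| < h -> `|ht t| < (1 / 2 - kappa) * hh.
Proof.
move=> h1; apply: le_lt_trans hh_big1; rewrite height_slope normrM.
case/andP: cos1 => k0 k1; rewrite (gtr0_norm k0).
have h2 := sigma_slope (reC t).
have h3 : `|imC t - reC t * tan th| <= h + mm * tan phi0.
  have -> : imC t - reC t * tan th = (imC t - sg (reC t)) + (sg (reC t) - reC t * tan th) by ring.
  by apply: (le_trans (ler_normD _ _)); lra.
apply: le_trans h3; rewrite -[X in _ <= X]mul1r ler_wpM2r //.
Qed.

Let hh0 : 0 < hh. Proof. exact: hP_gt0. Qed.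

Lemma Gamma_strip s t : ~ N t -> `|imC t - sg (reC t)| < h -> Gam s w t.
Proof.
move=> Nt h1; apply/GammaP; have h2 := height_strip h1; have h0 := hh0.
case/andP: kappa_range => k0 k1.
have k3 : 0 < kappa * hh by rewrite mulr_gt0.
have hs x : `|x| < (1 / 2 - kappa) * hh -> sgs s * x < (1 / 2 + kappa) * hh.
  by rewrite ltr_norml => /andP[? ?]; case: s; rewrite /sgs; lra.
split=> //; last exact: hs.
by move: h1; rewrite ltr_norml => /andP[? ?]; case: s {hs}; rewrite /sgs; lra.
Qed.

Lemma Gamma_strip_conv t : Gam sD w t -> Gam sU w t -> ~ N t /\ `|imC t - sg (reC t)| < h.
Proof.
move=> /GammaP[Nt h1 _] /GammaP[_ h2 _]; split=> //.
by move: h1 h2; rewrite /sgs ltr_norml => h1 h2; apply/andP; split; lra.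
Qed.

Lemma Gamma_high s t : 2 / r <= nc t -> mm * tan phi0 <= sgs s * ht t ->
  sgs s * ht t < (1 / 2 + kappa) * hh -> Gam s w t.
Proof.
move=> h1 h2 h3; apply/GammaP; split=> //; first exact: far_not_N.
have := sigma_slope (reC t); rewrite ler_norml => /andP[h4 h5].
case/andP: cos1 => k0 k1; rewrite height_slope in h2.
have m0 : 0 <= mm * tan phi0 by exact: le_trans (normr_ge0 _) (sigma_slope 0).
have h6 : mm * tan phi0 <= sgs s * (imC t - reC t * tan th).
  set y := sgs s * (imC t - reC t * tan th).
  have e : sgs s * (cos th * (imC t - reC t * tan th)) = cos th * y by rewrite /y; ring.
  rewrite e in h2; have y0 : 0 <= y by rewrite -(@pmulr_rge0 _ (cos th)) //; lra.
  by apply: le_trans h2 _; rewrite ler_piMl.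
case/andP: h_range => h0 _.
by move: h6; case: s {h2 h3}; rewrite /sgs; lra.
Qed.

Lemma Gamma_open s t : Gam s w t ->
  exists2 d : R, 0 < d & forall u, nc (u - t) < d -> Gam s w u.
Proof.
move=> /GammaP[Nt h1 h2].
have : open (~` N) by apply: closed_openC; exact: closed_N.
rewrite openE => /(_ t Nt) /nbhs_nc[d1 d10 hd1].
have tp : 0 <= tan phi0 := le_trans (normr_ge0 _) (tan_theta gamma0 phi_lt argw).
pose e1 := sgs s * (imC t - sg (reC t)) + h; pose e2 := (1 / 2 + kappa) * hh - sgs s * ht t.
have e10 : 0 < e1 by rewrite /e1; lra.
have e20 : 0 < e2 by rewrite /e2; lra.
have K0 : 0 < 1 + 2 * tan phi0 + 1 by lra.
exists (Num.min d1 (Num.min (e1 / (1 + 2 * tan phi0 + 1)) e2)).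
  by rewrite !lt_min d10 e20 divr_gt0.
move=> u; rewrite !lt_min => /and3P[/hd1 hu1 hu2 hu3]; apply/GammaP.
rewrite ltr_pdivlMr // in hu2.
have k1 := im_le_nc (u - t); have k2 := re_le_nc (u - t); rewrite imB in k1; rewrite reB in k2.
have k3 := sigma_lipschitz (reC u) (reC t).
have k4 := height_le gamma w (u - t); rewrite heightD heightN in k4.
have k5 : 2 * tan phi0 * `|reC u - reC t| <= 2 * tan phi0 * nc (u - t).
  by rewrite ler_wpM2l // mulr_ge0.
have k6 := nc_ge0 (u - t).
have k7 : `|(imC u - sg (reC u)) - (imC t - sg (reC t))| < e1.
  have -> : (imC u - sg (reC u)) - (imC t - sg (reC t)) = (imC u - imC t) - (sg (reC u) - sg (reC t)) by ring.
  by apply: (le_lt_trans (ler_normB _ _)); lra.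
split=> //.
  by have [k8 _] := sign_bound (sgsE s) k7; move: k8; rewrite /e1; lra.
by have [_ k8] := sign_bound (sgsE s) (le_lt_trans k4 hu3); move: k8; rewrite /e2; lra.
Qed.

Lemma sin_eq0_small (y : R) : `|y| < pi -> sin y = 0 -> y = 0.
Proof.
move=> hy s0; apply/eqP/negPn/negP => y0.
have h1 : 0 < sin `|y|.
  by apply: sin_gt0_pi; rewrite normr_gt0 y0.
have : sin `|y| = 0.
  by have [y1|y1] := leP 0 y; [rewrite ger0_norm|rewrite ltr0_norm // sinN s0 oppr0].
by move=> e; move: h1; rewrite e ltxx.
Qed.

(** The zeros of sinh (sqrt(eps) t) are the multiples of the period, whose heights are the multiples
    of [hh]; between -hh and hh there is only t = 0. *)
Lemma csinh_neq0 t : t != 0 -> `|ht t| < hh -> csinh (q * t) != 0.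
Proof.
move=> t0 h1; apply/negP => /eqP c0'.
set G := Gdir gamma w; set u := t * cexp (- (iC R * rc th)).
have qE : q * t = G * u by exact: sqe_mul.
have := nc_csinh2 (q * t); rewrite c0' nc0 expr0n /= qE => e.
have s2 := sqr_ge0 (sh (reC (G * u))); have s3 := sqr_ge0 (sin (imC (G * u))).
have sh0 : sh (reC (G * u)) = 0 by apply/eqP; rewrite -sqrf_eq0; apply/eqP; lra.
have re0 : reC (G * u) = 0.
  have := norm_sh_ge (reC (G * u)); rewrite sh0 normr0 => h2.
  by apply/normr0_eq0/le_anti; rewrite h2 normr_ge0.
have sin0' : sin (imC (G * u)) = 0 by apply/eqP; rewrite -sqrf_eq0; apply/eqP; lra.
have /andP[k0 _] := kap_range gamma0 phi_lt.
have Q0 := Q_gt0 w.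
have g1 : reC G < 0.
  have := re_Gdir gamma0 phi_lt argw; rewrite nc_Gdir -/G.
  have : 0 < kap gamma * Q by rewrite mulr_gt0.
  lra.
have imE : imC (G * u) * reC G = imC u * Q ^+ 2.
  have -> : Q ^+ 2 = reC G ^+ 2 + imC G ^+ 2 by rewrite -nc_sqr nc_Gdir.
  have : reC G * reC u = imC G * imC u by move: re0; rewrite reM; lra.
  rewrite imM => e2; transitivity (reC G ^+ 2 * imC u + imC G * (reC G * reC u)); first ring.
  by rewrite e2; ring.
have hu : `|imC u| < hh by exact: h1.
have im0 : imC (G * u) = 0.
  apply: sin_eq0_small => //.
  rewrite -(@ltr_pM2r _ (- reC G)); last by lra.
  have -> : `|imC (G * u)| * - reC G = `|imC u| * Q ^+ 2.
    rewrite -(ltr0_norm g1) -normrM imE normrM; congr (_ * _).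
    by rewrite ger0_norm // sqr_ge0.
  have hE : pi * - reC G = hh * Q ^+ 2.
    by rewrite hPE -/G; field; rewrite gt_eqF.
  by rewrite hE ltr_pM2r // exprn_gt0.
have : nc (G * u) = 0.
  by apply/eqP; rewrite -sqrf_eq0 nc_sqr re0 im0 expr0n /= addr0.
by apply/eqP; rewrite -qE nc_eq0 mulf_neq0 // sqe_neq0.
Qed.

Lemma Gamma_height s t : Gam s w t -> `|ht t| < hh.
Proof.
move=> /GammaP[_ h1 h2]; have h0 := hh0; case/andP: kappa_range => k0 k1.
have k2 : (1 / 2 + kappa) * hh < hh by rewrite gtr_pMl //; lra.
have k3 : (1 / 2 - kappa) * hh < hh by rewrite gtr_pMl //; lra.
have := sigma_slope (reC t); rewrite ler_norml => /andP[h4 h5].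
case/andP: cos1 => c1 c2.
have m0 : 0 <= mm * tan phi0 by exact: le_trans (normr_ge0 _) (sigma_slope 0).
have h6 : - (h + mm * tan phi0) <= sgs s * (imC t - reC t * tan th).
  by move: h1; case: s h2; rewrite /sgs; lra.
have h7 : - (h + mm * tan phi0) <= sgs s * ht t.
  rewrite height_slope; set y := sgs s * (imC t - reC t * tan th) in h6.
  have -> : sgs s * (cos th * (imC t - reC t * tan th)) = cos th * y by rewrite /y; ring.
  apply: le_trans (_ : - (cos th * (h + mm * tan phi0)) <= _); last by rewrite -mulrN ler_pM2l.
  by rewrite lerN2 ler_piMl //; case/andP: h_range => ? ?; lra.
by have b1 := hh_big1; rewrite ltr_norml; case: s h2 {h1 h6} h7; rewrite /sgs => h2 h7; apply/andP; split; lra.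
Qed.

Lemma Gamma_neq0 s t : Gam s w t -> t != 0.
Proof. by move=> /GammaP[Nt _ _]; apply/eqP => t0; apply: Nt; rewrite t0; exact: N0. Qed.

Lemma Gamma_csinh s t : Gam s w t -> csinh (q * t) != 0.
Proof. by move=> H; apply: csinh_neq0; [exact: Gamma_neq0 H|exact: Gamma_height H]. Qed.

(** N cuts the strip: on the imaginary axis sigma is 0, and |Im t| < h puts t in the disc of radius
    [hmid]. A connected part of the strip therefore keeps the sign of Re t. *)
Lemma Gamma_l_left t : Gam sD w t -> Gam sU w t -> reC t < 0 -> Gamma_l gamma r h kappa c0 pR w t.
Proof.
move=> hD hU ret; split; first by split.
move=> u [B [Bt BA cB] Bu]; rewrite /= ltNge; apply/negP => u0.
have [z Bz z0] := @connected_ivt _ B (@reC R) t u 0 cB (@reC_continuous R) Bt Bu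
  ltac:(by rewrite (ltW ret)).
have [hzD hzU] := BA z Bz.
have [Nz hz] := Gamma_strip_conv hzD hzU.
have m0 := mm0; rewrite z0 sigma_small ?normr0 ?(ltW m0) // subr0 in hz.
apply: Nz; apply: N_of_small; apply: (le_trans (nc_le_reim _)).
rewrite z0 normr0 add0r; case/andP: hmid_gt => ? ?; lra.
Qed.

Lemma Gamma_l_sign l t : Gamma_l gamma r h kappa c0 l w t ->
  [/\ Gam sD w t, Gam sU w t & if l is pL then 0 < reC t else reC t < 0].
Proof.
move=> [[hD hU] hc]; split=> //; case: l hc => hc; apply: hc;
  by apply: connected_component_refl.
Qed.
End Geometry.

(** * Derivative of a continuous logarithm *)

Section LogDerivative.
Variable R : realType.
Local Notation C := (Cx R).

Lemma cexp_inj_near0 : exists2 del : R, 0 < del &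
  forall z : C, nc z < del -> nc z <= 2 * nc (cexp z - 1).
Proof.
have [del del0 h] := @cdiff_cexp R 0 (1 / 2) ltac:(by rewrite divr_gt0).
exists del => // z /h; rewrite add0r cexp0 mul1r => h1.
have := nc_lower z (z - (cexp z - 1)); rewrite (ncBC z).
have -> : z - (z - (cexp z - 1)) = cexp z - 1 by ring.
lra.
Qed.

(** Near 0 the exponential satisfies |v| <= 2 |e^v - 1|. By continuity the increment v of L is small
    enough for this, so it is controlled by e^v - 1, the relative increment of g. *)
Lemma log_cdiff (L g : C -> C) (z g' : C) (rad : R) : 0 < rad ->
  (forall e : R, 0 < e -> exists2 d : R, 0 < d & forall u, nc (u - z) < d -> nc (L u - L z) < e) ->
  (forall u, nc (u - z) < rad -> cexp (L u) = g u) ->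
  cdiff g z g' -> cdiff L z (g' / g z).
Proof.
move=> rad0 Lc Lg Hg.
have gz : cexp (L z) = g z by apply: Lg; rewrite subrr nc0.
have g0 : g z != 0 by rewrite -gz cexp_neq0.
have Hq : cdiff (fun u => g u / g z) z (g' / g z).
  by have := cdiff_scale (g z)^-1 Hg; rewrite mulrC; apply: cdiff_ext => u; rewrite mulrC.
move=> e e0.
have [d1 d10 inj] := cexp_inj_near0.
pose K := nc (g' / g z) + 1.
have K0 : 0 < K by rewrite ltr_wpDl ?nc_ge0.
pose e1 := Num.min (1 : R) (e / (4 * K)).
have e10 : 0 < e1 by rewrite lt_min ltr01 divr_gt0 // mulr_gt0.
have [d2 d20 h2] := @cdiff_cexp R 0 e1 e10.
have e20 : 0 < Num.min 1 (e / 2) by rewrite lt_min ltr01 divr_gt0.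
have [d3 d30 h3] := Hq _ e20.
have d120 : 0 < Num.min d1 d2 by rewrite lt_min d10.
have [d4 d40 h4] := Lc _ d120.
exists (Num.min rad (Num.min d3 d4)) => [|u]; first by rewrite !lt_min rad0 d30.
rewrite !lt_min => /and3P[u1 u2 u3].
have zu v : z + v - z = v :> C by rewrite addrC addKr.
have := h4 (z + u); rewrite zu => /(_ u3); set v := L (z + u) - L z; rewrite lt_min => /andP[v1 v2].
have Ev : cexp v - 1 = g (z + u) / g z - g z / g z.
  rewrite divff // /v cexpD cexpN gz Lg // zu //.
have := h3 u u2; rewrite -Ev; set y := cexp v - 1 => hy.
have nu := nc_ge0 u.
have hy1 : nc y <= K * nc u.
  have := nc_lower y (g' / g z * u); rewrite ncM /K => k1.
  have k2 : Num.min 1 (e / 2) * nc u <= 1 * nc u by rewrite ler_wpM2r // ge_min lexx.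
  have -> : (nc (g' / g z) + 1) * nc u = nc (g' / g z) * nc u + nc u by ring.
  lra.
have hy2 : nc (y - g' / g z * u) <= e / 2 * nc u.
  by apply: (le_trans hy); rewrite ler_wpM2r // ge_min lexx orbT.
have hv := inj v v1; rewrite -/y in hv.
have := h2 v v2; rewrite add0r cexp0 mul1r -/y => hyv.
have k3 : e1 * nc v <= e / 2 * nc u.
  have k4 : nc v <= 2 * (K * nc u) by lra.
  apply: (@le_trans _ _ (e / (4 * K) * (2 * (K * nc u)))).
    by apply: ler_pM => //; rewrite ?nc_ge0 ?(ltW e10) // ge_min lexx orbT.
  by rewrite (_ : e / (4 * K) * (2 * (K * nc u)) = e / 2 * nc u) //; field; rewrite gt_eqF.
have -> : v - g' / g z * u = (y - g' / g z * u) - (y - v) by ring.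
apply: (le_trans (ncB _ _)); lra.
Qed.
End LogDerivative.

(** * Quotients of solutions of matrix equations *)

Section MatrixODE.
Variables (R : realType) (n : nat).
Local Notation C := (Cx R).
Local Notation M := 'M[C]_n.

Lemma mdiff_unit_near (A : C -> M) (t : C) (D : M) : A t \in unitmx -> mdiff A t D ->
  exists2 rad : R, 0 < rad & forall u, nc (u - t) < rad -> A u \in unitmx.
Proof.
move=> uA hA.
have [dd hdet] : exists d, cdiff (fun x => \det (A x)) t d.
  by apply: cdiff_det_ex => i j; eexists; exact: hA.
have det0 : \det (A t) != 0 by move: uA; rewrite unitmxE unitfE.
have [del del0 hdel] := cdiff_cont hdet (e := nc (\det (A t))) ltac:(by rewrite nc_gt0).
exists del; first exact: del0.
move=> u hu; rewrite unitmxE unitfE.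
by apply: contraTneq (hdel u hu) => ->; rewrite sub0r ncN ltxx.
Qed.

(** The quotient E is differentiable; its derivative is found by differentiating H1 E = H2 and
    cancelling H1, with no formula for the derivative of an inverse. *)
Lemma mdiff_conj_ode (H1 H2 : C -> M) (B L : M) (t : C) : H1 t \in unitmx ->
  mdiff H1 t (B *m H1 t - H1 t *m L) -> mdiff H2 t (B *m H2 t - H2 t *m L) ->
  mdiff (fun u => invmx (H1 u) *m H2 u) t
    (L *m (invmx (H1 t) *m H2 t) - invmx (H1 t) *m H2 t *m L).
Proof.
move=> u1 h1 h2; have [D' hD'] := mdiff_inv_ex u1 h1.
have := mdiff_mul hD' h2; set E := (X in mdiff _ _ X) => he; clearbody E.
have [rad rad0 hrad] := mdiff_unit_near u1 h1.
have hp := mdiff_mul h1 he.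
have hp2 : mdiff (fun u => H1 u *m (invmx (H1 u) *m H2 u)) t (B *m H2 t - H2 t *m L).
  by apply: mdiff_near rad0 _ h2 => u /hrad hu; rewrite mulmxA mulmxV ?mul1mx.
have := mdiff_uniq hp hp2 => e.
have E0 : E = L *m (invmx (H1 t) *m H2 t) - invmx (H1 t) *m H2 t *m L; last by rewrite E0 in he.
have inj : injective (mulmx (H1 t) : M -> M) by exact: can_inj (mulKmx u1).
apply: inj; have -> : H1 t *m E = B *m H2 t - H2 t *m L - (B *m H1 t - H1 t *m L) *m (invmx (H1 t) *m H2 t).
  by rewrite -e addrC addKr.
rewrite mulmxBl mulmxBr -!mulmxA !(mulmxA (H1 t) (invmx (H1 t))) mulmxV // !mul1mx.
rewrite opprB addrC -!addrA; congr (_ + _).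
by rewrite addKr.
Qed.

(** The same device, applied to F c = e F for the conjugate c of e. *)
Lemma mdiff_conj_const (F e : C -> M) (L : M) (t : C) (rad : R) : 0 < rad ->
  (forall u, nc (u - t) < rad -> F u \in unitmx) ->
  mdiff F t (L *m F t) -> mdiff e t (L *m e t - e t *m L) ->
  mdiff (fun u => invmx (F u) *m e u *m F u) t 0.
Proof.
move=> rad0 hu hF he.
have ut : F t \in unitmx by apply: hu; rewrite subrr nc0.
have [D' hD'] := mdiff_inv_ex ut hF.
have := mdiff_mul (mdiff_mul hD' he) hF; set E := (X in mdiff _ _ X) => hc; clearbody E.
have hp := mdiff_mul hF hc; have hq := mdiff_mul he hF.
have hp2 : mdiff (fun u => F u *m (invmx (F u) *m e u *m F u)) t
   ((L *m e t - e t *m L) *m F t + e t *m (L *m F t)).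
  by apply: mdiff_near rad0 _ hq => u /hu uu; rewrite !mulmxA mulmxV ?mul1mx.
have := mdiff_uniq hp hp2 => e1.
have E0 : E = 0; last by rewrite E0 in hc.
have inj : injective (mulmx (F t) : M -> M) by exact: can_inj (mulKmx ut).
apply: inj; rewrite mulmx0.
have -> : F t *m E = (L *m e t - e t *m L) *m F t + e t *m (L *m F t) - L *m F t *m (invmx (F t) *m e t *m F t).
  by rewrite -e1 addrC addKr.
by rewrite !mulmxA (mulmxK ut) mulmxBl subrK subrr.
Qed.

Lemma mdiff_line_const (A : C -> M) (p v : C) (a b : R) : a <= b ->
  (forall s, a <= s <= b -> mdiff A (pt p v s) 0) -> A (pt p v b) = A (pt p v a).
Proof.
move=> ab h; apply/matrixP => i j.
apply: (@line_const _ (fun u => A u i j)) => // s /h hs.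
by have := hs i j; rewrite mxE.
Qed.

Lemma diag_unit (A : M) : (forall i j, i != j -> A i j = 0) -> (forall j, A j j != 0) -> A \in unitmx.
Proof.
move=> h1 h2.
have -> : A = diag_mx (\row_j A j j).
  apply/matrixP => i j; rewrite !mxE; have [->|ij] := eqVneq i j; first by rewrite mulr1n.
  by rewrite h1 // mulr0n.
by rewrite unitmxE unitfE det_diag; apply/prodf_neq0 => i _; rewrite mxE h2.
Qed.

Lemma diag_inv (A : M) : (forall i j, i != j -> A i j = 0) -> (forall j, A j j != 0) ->
  forall i j, invmx A i j = if i == j then (A j j)^-1 else 0.
Proof.
move=> h1 h2 i j; have uA := diag_unit h1 h2.
have AE : A = diag_mx (\row_j A j j).
  apply/matrixP => i' j'; rewrite !mxE; have [->|ij] := eqVneq i' j'; first by rewrite mulr1n.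
  by rewrite h1 // mulr0n.
have <- : diag_mx (\row_j (A j j)^-1) = invmx A.
  apply: (can_inj (mulKmx uA)); rewrite mulmxV // AE mul_diag_mx.
  apply/matrixP => i' j'; rewrite !mxE; have [->|ij] := eqVneq i' j'.
    by rewrite !eqxx !mulr1n divff.
  by rewrite !mulr0n mulr0.
by rewrite !mxE; case: eqVneq => [->|_]; rewrite ?mulr1n ?mulr0n.
Qed.

Lemma diag_conj (A E : M) : (forall i j, i != j -> A i j = 0) -> (forall j, A j j != 0) ->
  forall i j, (invmx A *m E *m A) i j = (A i i)^-1 * E i j * A j j.
Proof.
move=> h1 h2 i j; rewrite !mxE (bigD1 j) //= big1 ?addr0; last first.
  by move=> k kj; rewrite h1 // mulr0.
congr (_ * _); rewrite mxE (bigD1 i) //= big1 ?addr0; last first.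
  by move=> k ki; rewrite diag_inv // eq_sym (negbTE ki) mul0r.
by rewrite diag_inv // eqxx.
Qed.
End MatrixODE.

(** * The equations of F_s and H_s in the time t, and the jump along rays *)

Section System.
Variables (R : realType) (n : nat) (y : prenormal R n).
Variables (gamma rho r delta h kappa c0 : R).
Local Notation C := (Cx R).
Local Notation M := 'M[C]_n.
Local Notation S := (Sdom gamma rho).
Local Notation Gam := (Gamma gamma r h kappa c0).
Local Notation Om := (Omega gamma r h kappa c0).
Variables (F H : sect -> C -> C -> M).
Hypothesis HF : model_solutions gamma rho r delta h kappa c0 y F.
Hypothesis HH : normalizing gamma rho r h kappa c0 y F H.
Variable w : C.
Hypothesis Sw : S w.
Hypothesis Gam_open : forall s t, Gam s w t ->
  exists2 d : R, 0 < d & forall u, nc (u - t) < d -> Gam s w u.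
Hypothesis Gam_csinh : forall s t, Gam s w t -> csinh (sqe w * t) != 0.
Hypothesis Gam_left : forall t, Gam sD w t -> Gam sU w t -> reC t < 0 ->
  Gamma_l gamma r h kappa c0 pR w t.

Definition Fs s (t : C) : M := F s w (xt w t).
Definition Hs s (t : C) : M := H s w (xt w t).
Local Notation x_ := (xt w).
Local Notation Lm t := (Lam y (eps w) (xt w t)).
Local Notation Bm t := (Bmx y (eps w) (xt w t)).

(** What is used of F_s at a time t: a diagonal invertible solution of the model. For F_D it is read
    off from the explicit branch; for F_U it has to be propagated from the left side, where F_U =
    F_D. *)
Definition good_pt s t := [/\ forall i j, i != j -> Fs s t i j = 0, forall j, Fs s t j j != 0 &
  forall j, cdiff (fun u => Fs s u j j) t (lam y j (eps w) (x_ t) * Fs s t j j)].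
Definition good s t := exists2 d : R, 0 < d & forall u, nc (u - t) < d -> good_pt s u.

Lemma cdiff_xt s t : Gam s w t -> cdiff x_ t (x_ t ^+ 2 - eps w).
Proof. by move=> /Gam_csinh h0; rewrite eps_sqe; exact: cdiff_xq. Qed.

Lemma xt_neq s t : Gam s w t -> x_ t ^+ 2 - eps w != 0.
Proof.
move=> /Gam_csinh h0; rewrite eps_sqe; have := xq2 h0; rewrite -/(xt w t) => ->.
by rewrite mulf_neq0 ?invr_neq0 // expf_neq0 // sqe_neq0.
Qed.

(** The branch [ell] is only continuous by hypothesis. It is a logarithm of x^2 - eps, whose time
    derivative is 2 x (x^2 - eps), so [log_cdiff] gives it the derivative 2 x. *)
Lemma good_D t : Gam sD w t -> good sD t.
Proof.
move=> ht; have [ell [lc le _] HFD] := FD_branch HF.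
have [d d0 hd] := Gam_open ht.
have FE u : nc (u - t) < d -> Fs sD u = modelF y (eps w) u (ell (w, u) / 2).
  by move=> /hd hu; exact: HFD.
exists (d / 2) => [|u hu]; first by rewrite divr_gt0.
have hud : nc (u - t) < d by lra.
have Gu := hd u hud.
have lcu (e : R) : 0 < e -> exists2 del : R, 0 < del & forall v, nc (v - u) < del -> nc (ell (w, v) - ell (w, u)) < e.
  move=> e0; pose A := [set p : C * C | S p.1 /\ Gam sD p.1 p.2].
  have Au : A (w, u) by split.
  have : (ell @ within A (nbhs (w, u))) [set z | nc (z - ell (w, u)) < e].
    by rewrite (nbhs_subspace_in Au); apply: (lc (w, u)); apply/nbhs_nc; exists e.
  move=> -[[U V] /= [hU hV] hUV].
  have /nbhs_nc[d1 d10 hd1] := hV.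
  exists (Num.min d1 (d / 2)) => [|v]; first by rewrite lt_min d10 divr_gt0.
  rewrite lt_min => /andP[/hd1 Vv hv].
  apply: (hUV (w, v)); first by split=> //=; exact: nbhs_singleton.
  split=> //=; apply: hd; have := ncD (v - u) (u - t); rewrite addrA subrK; lra.
have Hell : cdiff (fun v => ell (w, v)) u (2 * x_ u).
  have hg : cdiff (fun v => x_ v ^+ 2 - eps w) u (2 * x_ u * (x_ u ^+ 2 - eps w)).
    have h1 := cdiff_xt Gu.
    by apply: cdiff_val (cdiff_sub (cdiff_comp h1 (cdiff_sqr _)) (cdiff_cst (eps w) u)); rewrite subr0.
  apply: cdiff_val (log_cdiff (rad := d / 2) _ lcu _ hg); rewrite ?divr_gt0 //.
    by rewrite mulfK // (xt_neq Gu).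
  move=> v hv; apply: le => //; apply: hd.
  by have := ncD (v - u) (u - t); rewrite addrA subrK; lra.
have FEe v i j : nc (v - t) < d -> Fs sD v i j =
    if i == j then cexp (v * L0 y (eps w) 0 j + ell (w, v) / 2 * L1 y (eps w) 0 j) else 0.
  move=> /FE ->; rewrite /modelF !mxE; case: eqVneq => [->|_]; rewrite ?mulr1n ?mulr0n //.
split.
- by move=> i j ij; rewrite FEe // (negbTE ij).
- by move=> j; rewrite FEe // eqxx cexp_neq0.
- move=> j; rewrite FEe // eqxx.
  have d20 : 0 < d / 2 by rewrite divr_gt0.
  apply: (@cdiff_near _ (fun v => cexp (v * L0 y (eps w) 0 j + ell (w, v) / 2 * L1 y (eps w) 0 j)) _ _ _ _ d20).
    move=> v hv; rewrite FEe ?eqxx //.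
    by have := ncD (v - u) (u - t); rewrite addrA subrK; lra.
  have h1 := cdiff_mul (cdiff_id u) (cdiff_cst (L0 y (eps w) 0 j) u).
  have h2 := cdiff_mul (cdiff_mul Hell (cdiff_cst 2^-1 u)) (cdiff_cst (L1 y (eps w) 0 j) u).
  apply: cdiff_val (cdiff_cexpf (cdiff_add h1 h2)).
  by rewrite /lam; field.
Qed.

Lemma good_near s t : good s t -> exists2 d : R, 0 < d & forall u, nc (u - t) < d -> good s u.
Proof.
move=> [d d0 hd]; exists (d / 2) => [|u hu]; first by rewrite divr_gt0.
exists (d / 2) => [|v hv]; first by rewrite divr_gt0.
by apply: hd; have := ncD (v - u) (u - t); rewrite addrA subrK; lra.
Qed.

Lemma good_here s t : good s t -> good_pt s t.
Proof. by case=> d d0; apply; rewrite subrr nc0. Qed.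

Lemma good_mdiff s t : good s t -> mdiff (Fs s) t (Lm t *m Fs s t).
Proof.
move=> gt i j; rewrite /Lam mul_diag_mx mxE mxE.
have [->|ij] := eqVneq i j; first by have [_ _] := good_here gt; apply.
have [d d0 hd] := gt; have [h1 _ _] := good_here gt.
rewrite h1 // mulr0; apply: (cdiff_near d0 _ (cdiff_cst 0 t)) => u /hd [h2 _ _].
by rewrite h2.
Qed.

Lemma good_unit s t : good s t -> Fs s t \in unitmx.
Proof. by move=> /good_here[h1 h2 _]; exact: diag_unit. Qed.

Lemma good_U_left t : Gam sD w t -> Gam sU w t -> reC t < 0 -> good sU t.
Proof.
move=> hD hU ht; have [d1 d10 h1] := Gam_open hD; have [d2 d20 h2] := Gam_open hU.
have [d3 d30 h3] := good_D hD.
have m0 : 0 < - reC t by lra.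
pose d := Num.min (Num.min d1 d2) (Num.min d3 (- reC t)) / 2.
have d'0 : 0 < d by rewrite divr_gt0 // !lt_min d10 d20 d30.
have lt2 (x : R) : x < 2 * d -> [/\ x < d1, x < d2, x < d3 & x < - reC t].
  by rewrite /d mulrC divfK // !lt_min => /andP[/andP[-> ->] /andP[-> ->]].
have eqF u : nc (u - t) < 2 * d -> Fs sU u = Fs sD u.
  move=> /lt2[k1 k2 k3 k4]; apply: (FU_cont HF Sw); exists u => //; apply: Gam_left.
  - exact: h1.
  - exact: h2.
  - by have := reC_le_nc (u - t); rewrite reB; lra.
exists d => // u hu; have hu2 : nc (u - t) < 2 * d by lra.
have [k1 k2 k3 _] := lt2 _ hu2; have [g1 g2 g3] := h3 u k3.
split=> [i j ij|j|j].
- by rewrite eqF // g1.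
- by rewrite eqF // g2.
rewrite (eqF u) //; apply: cdiff_near d'0 _ (g3 j) => v hv; rewrite eqF //.
by have := ncD (v - u) (u - t); rewrite addrA subrK; lra.
Qed.

(** Let m be a primitive of x near t0 and [D j] the explicit solution exp (t L0 + m L1) of the
    model. Near a good time t1 the quotients [Psi] of the entries of F_U by [D j] are constant;
    [identity_disc] extends this to a disc that contains a neighbourhood of t2. *)
Lemma good_U_local t0 : Gam sU w t0 -> exists2 d : R, 0 < d & forall t1 t2,
  nc (t1 - t0) < d -> nc (t2 - t0) < d -> good sU t1 -> good sU t2.
Proof.
move=> ht0; have [d0 d00 hd0] := Gam_open ht0.
have FUc u : nc (u - t0) < d0 -> forall i j, exists D, cdiff (fun v => Fs sU v i j) u D.
  move=> /hd0 hu i j.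
  have := FU_holo HF Sw (z := x_ u) (ex_intro2 _ _ u hu erefl) => /derivable1_diffP/derivable_mdiff hF.
  by eexists; exact: cdiff_comp (cdiff_xt hu) (hF i j).
have sq u d : square t0 d u -> nc (u - t0) < 2 * d.
  by move=> [h1 h2]; apply: (le_lt_trans (nc_le_reim _)); lra.
have [m Hm] := @primitive_square R x_ t0 (d0 / 2) (d0 / 3) ltac:(lra)
  (fun u hu => ex_intro _ _ (cdiff_xt (hd0 u ltac:(have := sq u _ hu; lra)))).
pose D j u := cexp (u * L0 y (eps w) 0 j + m u * L1 y (eps w) 0 j).
have D0 j u : D j u != 0 by exact: cexp_neq0.
have HD j u : square t0 (d0 / 3) u -> cdiff (D j) u (lam y j (eps w) (x_ u) * D j u).
  move=> hu; have h1 := cdiff_mul (cdiff_id u) (cdiff_cst (L0 y (eps w) 0 j) u).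
  have h2 := cdiff_mul (Hm u hu) (cdiff_cst (L1 y (eps w) 0 j) u).
  by apply: cdiff_val (cdiff_cexpf (cdiff_add h1 h2)); rewrite /lam -/(D j u); ring.
(* Then the disc of radius d0/8 about t2 lies in that of radius d0/4 about t1, and the square of
   half-side d0/4 about t1 in that of half-side d0/3 about t0. *)
exists (d0 / 24) => [|t1 t2 ht1 ht2 [a a0 ha]]; first by rewrite divr_gt0.
have sub u : square t1 (d0 / 4) u -> square t0 (d0 / 3) u.
  move=> [h1 h2]; have k1 := re_le_nc (t1 - t0); have k2 := im_le_nc (t1 - t0).
  have e1 : u - t0 = (u - t1) + (t1 - t0) by ring.
  rewrite /square /= e1 reD imD; split; apply: (le_lt_trans (ler_normD _ _)); lra.
have near1 u : nc (u - t1) < d0 / 4 -> square t1 (d0 / 4) u.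
  by move=> hu; split; [apply: le_lt_trans (re_le_nc _) hu|apply: le_lt_trans (im_le_nc _) hu].
have inball u : square t0 (d0 / 3) u -> nc (u - t0) < d0 by move=> /sq; lra.
pose Psi i j u := Fs sU u i j / D j u.
have HPsi i j u : square t1 (d0 / 4) u -> exists Dd, cdiff (Psi i j) u Dd.
  move=> /sub hu; have [D1 hD1] := FUc u (inball u hu) i j.
  by eexists; exact: cdiff_mul hD1 (cdiff_invf (D0 j u) (HD j u hu)).
pose a' := Num.min a (d0 / 4).
have a'0 : 0 < a' by rewrite lt_min a0 divr_gt0.
have Pconst i j u : nc (u - t1) < a' -> Psi i j u = Psi i j t1.
  apply: const_ball => v; rewrite lt_min => /andP[hva /near1/sub hv].
  have [g1 g2 g3] := ha v hva.
  have [->|ij] := eqVneq i j.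
    apply: cdiff_val (cdiff_mul (g3 j) (cdiff_invf (D0 j v) (HD j v hv))).
    by field; exact: D0.
  have [D1 hD1] := FUc v (inball v hv) i j.
  have D10 : D1 = 0.
    have [b b0 hb] : exists2 b : R, 0 < b & forall v', nc (v' - v) < b -> Fs sU v' i j = 0.
      exists (a - nc (v - t1)) => [|v' hv']; first by rewrite subr_gt0.
      have [] := ha v' ltac:(by have := ncD (v' - v) (v - t1); rewrite addrA subrK; lra).
      by move=> ->.
    apply: (cdiff_uniq hD1); apply: (cdiff_near b0 _ (cdiff_cst 0 v)) => v' /hb ->.
    by [].
  apply: cdiff_val (cdiff_mul hD1 (cdiff_invf (D0 j v) (HD j v hv))).
  by rewrite D10 g1 // !mul0r addr0.
have Pall i j u : nc (u - t1) < d0 / 4 -> Psi i j u = Psi i j t1.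
  move=> hu; apply/eqP; rewrite -subr_eq0; apply/eqP.
  apply: (@identity_disc R (fun u => Psi i j u - Psi i j t1) t1 a' (d0 / 4) a'0) => // v.
    move=> /(HPsi i j)[Dd hDd]; eexists; exact: cdiff_sub hDd (cdiff_cst _ _).
  by move=> /Pconst ->; rewrite subrr.
have t1t1 : nc (t1 - t1) < a by rewrite subrr nc0.
have [f1 f2 f3] := ha t1 t1t1.
have FE i j u : nc (u - t1) < d0 / 4 -> Fs sU u i j = Psi i j t1 * D j u.
  by move=> /(Pall i j) <-; rewrite /Psi divfK // D0.
have d80 : 0 < d0 / 8 by rewrite divr_gt0.
have t12 u : nc (u - t2) < d0 / 8 -> nc (u - t1) < d0 / 4.
  move=> hu; have -> : u - t1 = (u - t2) + ((t2 - t0) - (t1 - t0)) by ring.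
  by apply: (le_lt_trans (ncD _ _)); have := ncB (t2 - t0) (t1 - t0); lra.
exists (d0 / 16) => [|u hu]; first by rewrite divr_gt0.
have hu1 : nc (u - t1) < d0 / 4 by apply: t12; lra.
split.
- by move=> i j ij; rewrite FE // /Psi f1 // !mul0r.
- by move=> j; rewrite FE // /Psi mulf_neq0 // ?D0 // mulf_neq0 ?f2 // invr_neq0.
- move=> j; rewrite FE //.
  have d160 : 0 < d0 / 16 by rewrite divr_gt0.
  apply: (cdiff_near d160 _ (cdiff_val _ (cdiff_scale (Psi j j t1) (HD j u (sub u (near1 u hu1)))))).
    by move=> v hv; rewrite FE //; apply: t12; have := ncD (v - u) (u - t2); rewrite addrA subrK; lra.
  by rewrite mulrCA.
Qed.

Lemma good_U_segment p v : (forall s, 0 <= s <= 1 -> Gam sU w (pt p v s)) ->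
  good sU p -> forall s, 0 <= s <= 1 -> good sU (pt p v s).
Proof.
move=> hG gp; apply: segment_induction; first exact: ler01.
  by rewrite /pt rc0 mul0r addr0.
move=> s /hG /good_U_local[d d0 hd].
have K0 : 0 < nc v + 1 by rewrite ltr_wpDl ?nc_ge0.
exists (d / (nc v + 1)) => [|s' s'' _ _ h1 h2]; first by rewrite divr_gt0.
have key u : `|u - s| < d / (nc v + 1) -> nc (pt p v u - pt p v s) < d.
  rewrite ltr_pdivlMr // /pt; have -> : p + rc u * v - (p + rc s * v) = rc (u - s) * v by rewrite rcB; ring.
  by rewrite ncM nc_rc; have := normr_ge0 (u - s); have := nc_ge0 v; nra.
by apply: hd; exact: key.
Qed.

(** H_s inherits invertibility from W_s = H_s F_s. Its equation follows by differentiating this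
    product, comparing with the equation of W_s and cancelling F_s. *)
Lemma Hs_ode s t : Gam s w t -> good s t ->
  Hs s t \in unitmx /\ mdiff (Hs s) t (Bm t *m Hs s t - Hs s t *m Lm t).
Proof.
move=> ht gt; have Ox : Om s w (x_ t) by exists t.
have [uW dW eW] := H_fundamental HH Sw Ox.
have uH : Hs s t \in unitmx by move: uW; rewrite unitmx_mul => /andP[].
split=> //.
have dH : derivable (H s w) (x_ t) 1.
  have dp : differentiable (fun x : C => (w, x)) (x_ t).
    by apply: differentiable_pair; [exact: differentiable_cst|exact/derivable1_diffP/derivable_id].
  have hj : differentiable (fun p : C * C => H s p.1 p.2) (w, x_ t).
    by apply: (H_analytic HH); split.
  apply/derivable1_diffP.
  exact: (@differentiable_comp _ _ _ _ (fun x : C => (w, x)) (fun p : C * C => H s p.1 p.2)).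
have hH := mdiff_comp (cdiff_xt ht) (derivable_mdiff dH).
have hW := mdiff_comp (cdiff_xt ht) (derivable_mdiff dW).
rewrite eW in hW.
have := mdiff_mul hH (good_mdiff gt); set DH := _ *: _ in hH *.
move=> /(mdiff_uniq hW) e.
have <- // : DH = Bm t *m Hs s t - Hs s t *m Lm t.
have uF := good_unit gt.
have inj : injective (mulmx^~ (Fs s t) : M -> M) by exact: can_inj (mulmxK uF).
apply: inj; rewrite /= mulmxBl -!mulmxA e addrK //.
Qed.

(** The quotient H_D^-1 H_U with H_U taken at the time t + p: p = 0 on the two sides, and p = P on
    the central component, where the same x is reached in Gamma_U one period later. [cc] is its
    conjugate by F_D, the candidate for the jump matrix. *)
Definition ec p t : M := invmx (Hs sD t) *m Hs sU (t + p).
Definition cc p t : M := invmx (Fs sD t) *m ec p t *m Fs sD t.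
Definition ok p t := [/\ Gam sD w t, Gam sU w (t + p) & good sU (t + p)].

Lemma ec_mdiff p t : (forall u, x_ (u + p) = x_ u) -> ok p t ->
  mdiff (ec p) t (Lm t *m ec p t - ec p t *m Lm t).
Proof.
move=> per_p [hD hU gU]; have [u1 h1] := Hs_ode hD (good_D hD).
have [u2 h2] := Hs_ode hU gU; rewrite !per_p in h2.
have hs : cdiff (fun u => u + p) t 1.
  by apply: cdiff_val (cdiff_add (cdiff_id t) (cdiff_cst p t)); rewrite addr0.
have h2' := mdiff_comp hs h2; rewrite scale1r in h2'.
exact: (mdiff_conj_ode u1 h1 h2').
Qed.

Lemma cc_mdiff p t : (forall u, x_ (u + p) = x_ u) -> ok p t -> mdiff (cc p) t 0.
Proof.
move=> per_p okt; have [hD _ _] := okt; have gD := good_D hD.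
have [d d0 hd] := good_near gD.
apply: mdiff_conj_const d0 _ (good_mdiff gD) (ec_mdiff per_p okt) => u /hd.
exact: good_unit.
Qed.

Lemma cc_segment p t v a b : (forall u, x_ (u + p) = x_ u) -> a <= b ->
  (forall s, a <= s <= b -> ok p (pt t v s)) -> cc p (pt t v b) = cc p (pt t v a).
Proof.
by move=> per_p ab hok; apply: mdiff_line_const ab _ => s /hok; exact: cc_mdiff.
Qed.

Lemma ec_entry p t i j : (forall u, x_ (u + p) = x_ u) -> ok p t ->
  cdiff (fun u => ec p u i j) t ((lam y i (eps w) (x_ t) - lam y j (eps w) (x_ t)) * ec p t i j).
Proof.
move=> per_p okt; have := ec_mdiff per_p okt i j; apply: cdiff_val.
rewrite /Lam mul_diag_mx mul_mx_diag !mxE; ring.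
Qed.

Lemma cc_entry p t i j : ok p t -> cc p t i j = (Fs sD t i i)^-1 * ec p t i j * Fs sD t j j.
Proof.
move=> [hD _ _]; have [h1 h2 _] := good_here (good_D hD).
exact: diag_conj.
Qed.

Lemma cc_ec p t : ok p t -> ec p t = Fs sD t *m cc p t *m invmx (Fs sD t).
Proof.
move=> [hD _ _]; have uF := good_unit (good_D hD).
by rewrite /cc !mulmxA mulmxV // mul1mx -mulmxA mulmxV // mulmx1.
Qed.

Lemma Hs_ray s l (K : M) (t v : C) : (forall a, 0 <= a -> Gam s w (pt t v a)) ->
  (forall e : R, 0 < e -> exists S0 : R, forall a, S0 <= a -> nc (x_ (pt t v a) - xs l w) < e) ->
  H s w @ within (Om s w) (nbhs (xs l w)) --> K ->
  (fun a => Hs s (pt t v a)) @ +oo --> K.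
Proof.
move=> hG hx hK U hU; have /nbhs_nc[e e0 he] := hK U hU.
have [S0 hS] := hx e e0; exists (Num.max 0 S0); split; first exact: num_real.
move=> a; rewrite gt_max => /andP[a0 /ltW aS].
by apply: he; [exact: hS|exists (pt t v a) => //; apply: hG; exact: ltW].
Qed.

(** H_D and H_U have the same invertible limit [K l w] at the end of the ray. *)
Lemma ec_ray p l (t v : C) : (forall u, x_ (u + p) = x_ u) ->
  (forall a, 0 <= a -> ok p (pt t v a)) ->
  (forall e : R, 0 < e -> exists S0 : R, forall a, S0 <= a -> nc (x_ (pt t v a) - xs l w) < e) ->
  (fun a => ec p (pt t v a)) @ +oo --> (1%:M : M).
Proof.
move=> per_p hok hx; have [K [HK _ _]] := H_lim HH; have [_ uK hK] := HK l w Sw.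
have ptp a : pt t v a + p = pt (t + p) v a by rewrite /pt; ring.
have h1 := @Hs_ray sD l (K l w) t v (fun a a0 => let: And3 h _ _ := hok a a0 in h) hx (hK sD).
have hxp : forall e : R, 0 < e -> exists S0 : R, forall a, S0 <= a -> nc (x_ (pt (t + p) v a) - xs l w) < e.
  by move=> e /hx[S0 hS]; exists S0 => a /hS; rewrite -ptp per_p.
have h2 := @Hs_ray sU l (K l w) (t + p) v
  (fun a a0 => let: And3 _ h _ := hok a a0 in eq_ind _ (fun u => Gam sU w u) h _ (ptp a)) hxp (hK sU).
have -> : (1%:M : M) = invmx (K l w) *m K l w by rewrite mulVmx.
have -> : (fun a => ec p (pt t v a)) = (fun a => invmx (Hs sD (pt t v a)) *m Hs sU (pt (t + p) v a)).
  by apply/funext => a; rewrite /ec ptp.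
by apply: mx_cvg_mul h2; exact: mx_cvg_inv uK h1.
Qed.

Variables cg rg : R.
Hypothesis cg0 : 0 < cg.
Hypothesis gap : forall x, nc x < rg -> forall i j : 'I_n, (i < j)%N ->
  cg <= reC (edir gamma w * (lam y i (eps w) x - lam y j (eps w) x)).
Hypothesis q_small : nc (sqe w) < rg.
Hypothesis ray_lim : forall t (sgn : R), sgn = 1 \/ sgn = - 1 -> forall e : R, 0 < e ->
  exists S0 : R, forall s, S0 <= s -> nc (x_ (t + rc (sgn * s) * edir gamma w) - rc sgn * sqe w) < e.

(** An entry of [ec] solves a scalar equation without forcing. In the growing case [line_grow]
    bounds it on the ray by its values arbitrarily far out, which tend to 0. On the diagonal the
    conjugation by F_D has no effect, so the constant is the limit 1. *)
Lemma ray_triangular p t (sgn : R) : sgn = 1 \/ sgn = -1 -> (forall u, x_ (u + p) = x_ u) ->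
  (forall s, 0 <= s -> ok p (pt t (rc sgn * edir gamma w) s)) ->
  (forall i, cc p t i i = 1) /\
  (forall i j : 'I_n, (if sgn == 1 then (i < j)%N else (j < i)%N) -> cc p t i j = 0).
Proof.
move=> hsg per_p; set v := rc sgn * edir gamma w => hok.
pose l := if sgn == 1 then pL else pR.
have nsg : nc (rc sgn) = 1 by rewrite nc_rc; case: hsg => ->; rewrite ?normrN normr1.
have xsE : xs l w = rc sgn * sqe w.
  rewrite /l; case: hsg => ->; first by rewrite eqxx rc1 mul1r.
  have -> : (-1 == 1 :> R) = false by apply/negbTE; rewrite lt_eqF //; lra.
  by rewrite rcN rc1 mulN1r.
have hx (e : R) : 0 < e -> exists S0 : R, forall a, S0 <= a -> nc (x_ (pt t v a) - xs l w) < e.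
  move=> /(ray_lim t hsg)[S0 hS]; exists S0 => a /hS; rewrite xsE /pt /v rcM.
  by have -> : rc a * (rc sgn * edir gamma w) = rc sgn * rc a * edir gamma w by ring.
have hlim := ec_ray per_p hok hx.
have ptt : pt t v 0 = t by rewrite /pt rc0 mul0r addr0.
have ccs s : 0 <= s -> cc p (pt t v s) = cc p t.
  move=> s0; rewrite -[in RHS]ptt; apply: cc_segment => // a /andP[a0 _]; exact: hok.
have ent i j (e : R) : 0 < e -> exists2 S0 : R, 0 <= S0 & forall a, S0 < a ->
    nc (ec p (pt t v a) i j - (i == j)%:R) < e.
  move=> e0; have /mx_cvgP/(_ i j)/cvg_nc/(_ e e0) [S0 [_ hS]] := hlim.
  exists (Num.max 0 S0); first by rewrite le_max lexx.
  by move=> a; rewrite gt_max => /andP[_ /hS]; rewrite [1%:M i j]mxE.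
split=> [i|i j hij].
  apply/eqP; rewrite -subr_eq0 -nc_eq0; apply/eqP/le_anti; rewrite nc_ge0 andbT.
  apply/ler_addgt0Pr => e e0; rewrite add0r; have [S0 S00 hS] := ent i i e e0.
  have S1 : 0 <= S0 + 1 by lra.
  rewrite -(ccs _ S1) (cc_entry _ _ (hok _ S1)).
  have [hD _ _] := hok _ S1; have [_ f0 _] := good_here (good_D hD).
  rewrite mulrAC mulVf ?mul1r //.
  have := hS (S0 + 1) ltac:(lra); rewrite eqxx => /ltW //.
have ij : i != j by move: hij; case: ifP => _ hh; apply/eqP => e; move: hh; rewrite e ltnn.
have e0 : 0 < rg - nc (sqe w) by rewrite subr_gt0.
have [S0 hS] := hx _ e0.
pose S1 := Num.max 0 S0.
have S10 : 0 <= S1 by rewrite le_max lexx.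
have gr s : S1 <= s -> cg <= reC (v * (lam y i (eps w) (x_ (pt t v s)) - lam y j (eps w) (x_ (pt t v s)))).
  rewrite ge_max => /andP[s0 /hS hs].
  have hxs : nc (x_ (pt t v s)) < rg.
    have := nc_lower (x_ (pt t v s)) (xs l w); rewrite xsE ncM nsg mul1r => h1.
    by rewrite xsE in hs; lra.
  move: (x_ (pt t v s)) hxs => X hxs; rewrite /v; case: hsg hij => ->.
    by rewrite eqxx rc1 mul1r => /(gap hxs).
  have -> : (-1 == 1 :> R) = false by apply/negbTE; rewrite lt_eqF //; lra.
  move=> /(gap hxs); rewrite rcN rc1 mulN1r mulNr -mulrN opprB.
  by [].
have z0 : ec p (pt t v S1) i j = 0.
  apply/eqP; rewrite -nc_eq0; apply/eqP/le_anti; rewrite nc_ge0 andbT.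
  apply/ler_addgt0Pr => e ee0; rewrite add0r; have [S2 S20 hS2] := ent i j e ee0.
  pose b := Num.max S1 (S2 + 1).
  have S1b : S1 <= b by rewrite le_max lexx.
  have pos s : S1 <= s <= b -> 0 <= s by move=> /andP[h1 _]; exact: le_trans h1.
  apply: (@line_grow _ (fun u => ec p u i j) t v
    (fun s => (lam y i (eps w) (x_ (pt t v s)) - lam y j (eps w) (x_ (pt t v s))) * ec p (pt t v s) i j)
    (fun s => v * (lam y i (eps w) (x_ (pt t v s)) - lam y j (eps w) (x_ (pt t v s))))
    (fun=> 0) cg 0 e S1 b cg0).
  - by rewrite mulr_ge0 // ltW.
  - by move=> s /pos s0; exact: ec_entry (hok s s0).
  - by move=> s _; rewrite addr0; ring.
  - by move=> s /andP[h1 _]; exact: gr.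
  - by move=> s _; rewrite nc0.
  - have := hS2 b; rewrite (negbTE ij) subr0 => /(_ _)/ltW; apply.
    by rewrite lt_max; apply/orP; right; lra.
  - by rewrite lexx.
by rewrite -(ccs _ S10) (cc_entry _ _ (hok _ S10)) z0 mulr0 mul0r.
Qed.
End System.

(** * Polygonal chains *)

Section Chains.
Variable R : realType.
Local Notation C := (Cx R).

(** An edge is given by its vector, in the form in which [pt] and [cc_segment] take segments; a
    property constant along segments is then carried by induction. *)
Inductive chain (A : set C) : C -> C -> Prop :=
| chain_nil t : chain A t t
| chain_cons t v u : (forall s, 0 <= s <= 1 -> A (pt t v s)) -> chain A (t + v) u -> chain A t u.

Lemma chain_seg (A : set C) (t u : C) : (forall s, 0 <= s <= 1 -> A (pt t (u - t) s)) -> chain A t u.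
Proof. by move=> hA; apply: chain_cons hA _; rewrite addrC subrK; exact: chain_nil. Qed.

Lemma chain_trans (A : set C) (t u v : C) : chain A t u -> chain A u v -> chain A t v.
Proof. by elim=> // t' w u' hA _ IH /IH; exact: chain_cons. Qed.

Lemma chain_sym (A : set C) (t u : C) : chain A t u -> chain A u t.
Proof.
elim=> [t'|t' v u' hA _ IH]; first exact: chain_nil.
apply: (chain_trans IH); apply: chain_seg => s /andP[s0 s1].
have -> : pt (t' + v) (t' - (t' + v)) s = pt t' v (1 - s) by rewrite /pt rcB rc1; ring.
by apply: hA; apply/andP; split; lra.
Qed.

Lemma chain_sub (A B : set C) (t u : C) : A `<=` B -> chain A t u -> chain B t u.
Proof.
by move=> AB; elim=> [t'|t' v u' hA _]; [exact: chain_nil|apply: chain_cons => s /hA/AB].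
Qed.

Lemma reC_pt (p v : C) s : reC (pt p v s) = reC p + s * reC v.
Proof. by rewrite /pt reD reM re_rc im_rc mul0r subr0. Qed.
Lemma imC_pt (p v : C) s : imC (pt p v s) = imC p + s * imC v.
Proof. by rewrite /pt imD imM re_rc im_rc mul0r addr0. Qed.
End Chains.

(** * Continuation of F_U and the jump on the three components *)

Section Paths.
Variables (R : realType) (gamma r h kappa c0 : R) (w : Cx R).
Local Notation C := (Cx R).
Local Notation phi0 := (gamma * (1 + 2 * gamma / pi)).
Local Notation q := (sqe w).
Local Notation Q := (nc (sqe w)).
Local Notation th := (theta gamma w).
Local Notation N := (Nset r w).
Local Notation ht := (height gamma w).
Local Notation sg := (sigma gamma c0 w).
Local Notation mm := (c0 / nc (sqe w)).
Local Notation hh := (hP gamma w).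
Hypothesis gamma0 : 0 < gamma.
Hypothesis phi_lt : phi0 < pi / 2.
Hypothesis argw : pi - 2 * gamma < imC w < 3 * pi + 2 * gamma.
Hypothesis r0 : 0 < r.
Hypothesis h_range : 0 < h < r^-1.
Hypothesis kappa_range : 0 < kappa < 1 / 2.
Hypothesis c0_gt0 : 0 < c0.
Hypothesis approx : forall t, t != 0 -> nc t <= 2 / r ->
  csinh (q * t) != 0 /\ nc (xq q t + t^-1) <= eta0 r h / nc t.
Hypothesis Q_small : Q ^+ 2 <= amin r h * r ^+ 3 / 64.
Hypothesis m_big : 2 / r <= mm.
Hypothesis hh_big1 : h + mm * tan phi0 < (1 / 2 - kappa) * hh.
Hypothesis hh_big2 : 2 / r <= (1 / 2 - kappa) * hh.
Local Notation Gam := (Gamma gamma r h kappa c0).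

(** The part of Gamma_D and Gamma_U in common on the right (sgn = 1, towards x_L) or on the left
    (sgn = -1, towards x_R). *)
Definition side (sgn : R) : set C := [set t | [/\ Gam sD w t, Gam sU w t & 0 < sgn * reC t]].

Let hh0 : 0 < hh := hP_gt0 gamma0 phi_lt argw.
Let mm0 : 0 < mm.
Proof. by rewrite divr_gt0 // Q_gt0. Qed.
Let cth : 0 < cos th := cos_theta_gt0 gamma0 phi_lt argw.
Let cthn : cos th != 0.
Proof. by rewrite gt_eqF. Qed.

Lemma side_strip sgn t : ~ N t -> `|imC t - sg (reC t)| < h -> 0 < sgn * reC t -> side sgn t.
Proof.
by move=> Nt h1 h2; split=> //; apply: Gamma_strip.
Qed.

Lemma side_conv sgn t : side sgn t -> [/\ ~ N t, `|imC t - sg (reC t)| < h & 0 < sgn * reC t].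
Proof. by case=> h1 h2 h3; have [h4 h5] := Gamma_strip_conv h1 h2. Qed.

Let not_N_re sgn t : sgn = 1 \/ sgn = -1 -> 2 / r <= sgn * reC t -> ~ N t.
Proof.
move=> hsg ht'; apply: (far_not_N (h := h)) => //; apply: le_trans ht' _.
apply: le_trans (re_le_nc t); case: hsg => ->; first by rewrite mul1r ler_norm.
by rewrite mulN1r -normrN ler_norm.
Qed.

Let far_side sgn t : sgn = 1 \/ sgn = -1 -> mm <= sgn * reC t -> `|imC t - sg (reC t)| < h -> side sgn t.
Proof.
move=> hsg h1 h2; have hm := m_big; have m0 := mm0; apply: side_strip => //; last by lra.
by apply: (not_N_re hsg); lra.
Qed.

Let sgm sgn (u : R) : sgn = 1 \/ sgn = -1 -> mm <= sgn * u -> sg u = (u - sgn * mm) * tan th.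
Proof.
case=> ->; first by rewrite !mul1r; exact: sigma_right.
by rewrite !mulN1r opprK lerNr; exact: sigma_left.
Qed.

Lemma side_base sgn L : sgn = 1 \/ sgn = -1 -> 2 / r <= L <= mm -> side sgn (rc (sgn * L)).
Proof.
move=> hsg /andP[h1 h2]; have rr : 0 < 2 / r by rewrite divr_gt0.
have sg2 : sgn * sgn = 1 by case: hsg => ->; lra.
have sl : sgn * (sgn * L) = L by rewrite mulrA sg2 mul1r.
apply: side_strip; rewrite ?re_rc ?im_rc ?sl; last lra.
- by apply: (not_N_re hsg); rewrite re_rc sl.
- rewrite sigma_small ?subrr ?normr0 //; first by case/andP: h_range.
  by rewrite normrM; case: hsg => ->; rewrite ?normrN normr1 mul1r ger0_norm //; lra.
Qed.

Lemma side_ray sgn s : sgn = 1 \/ sgn = -1 -> 0 <= s ->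
  side sgn (pt (rc (sgn * mm)) (rc sgn * edir gamma w) s).
Proof.
move=> hsg s0; set t := pt _ _ _.
have sg2 : sgn * sgn = 1 by case: hsg => ->; lra.
have et : reC t = sgn * (mm + s * cos th).
  by rewrite /t reC_pt re_rc edirE reM re_rc im_rc /=; ring.
have ei : imC t = sgn * s * sin th.
  by rewrite /t imC_pt im_rc edirE imM re_rc im_rc /=; ring.
have k0 : 0 <= s * cos th by rewrite mulr_ge0 // ltW.
have h1 : mm <= sgn * reC t by rewrite et mulrA sg2 mul1r; lra.
apply: far_side => //; rewrite (sgm hsg h1) et ei.
have -> : sgn * s * sin th - (sgn * (mm + s * cos th) - sgn * mm) * tan th = 0.
  by rewrite /tan; move: mm => m; field; exact: cthn.
by rewrite normr0; case/andP: h_range.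
Qed.

(** Beyond |Re t| = m a vertical segment leads to the graph of sigma, straight there, and the graph
    leads to sgn m. A point closer to the axis first moves outwards horizontally, and [not_N_move]
    keeps it off N. *)
Lemma side_chain sgn t : sgn = 1 \/ sgn = -1 -> side sgn t -> chain (side sgn) t (rc (sgn * mm)).
Proof.
move=> hsg.
have sg2 : sgn * sgn = 1 by case: hsg => ->; lra.
have h0 : 0 < h by case/andP: h_range.
have far u : mm <= sgn * reC u -> side sgn u -> chain (side sgn) u (rc (sgn * mm)).
  move=> hu /side_conv[_ su _].
  pose v := mkC (reC u) (sg (reC u)).
  apply: (@chain_trans _ _ _ v).
    apply: chain_seg => s /andP[s0 s1].
    have e1 : reC (pt u (v - u) s) = reC u by rewrite reC_pt reB /= subrr mulr0 addr0.
    apply: far_side => //; first by rewrite e1.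
    rewrite e1 imC_pt imB /=.
    have -> : imC u + s * (sg (reC u) - imC u) - sg (reC u) = (1 - s) * (imC u - sg (reC u)) by ring.
    rewrite normrM ger0_norm; last lra.
    by apply: le_lt_trans su; rewrite ler_piMl //; lra.
  apply: chain_seg => s /andP[s0 s1].
  have e1 : sgn * reC (pt v (rc (sgn * mm) - v) s) = sgn * reC u + s * (mm - sgn * reC u).
    by rewrite reC_pt reB re_rc /=; rewrite mulrDr mulrCA mulrBr mulrA sg2; ring.
  have e2 : mm <= sgn * reC (pt v (rc (sgn * mm) - v) s).
    have : 0 <= (1 - s) * (sgn * reC u - mm) by rewrite mulr_ge0; lra.
    by rewrite e1; lra.
  apply: far_side => //; rewrite (sgm hsg e2) imC_pt reC_pt imB reB im_rc re_rc /= (sgm hsg hu).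
  by rewrite (_ : _ - _ = 0) ?normr0 //; ring.
move=> St; have [lt|ge] := leP mm (sgn * reC t); first exact: far.
have [Nt st rt] := side_conv St.
have s0t : sg (reC t) = 0.
  apply: sigma_small => //; rewrite -[`|_|]mul1r; have <- : `|sgn| = 1.
    by case: hsg => ->; rewrite ?normrN normr1.
  by rewrite -normrM gtr0_norm // ltW.
rewrite s0t subr0 in st.
pose u := mkC (sgn * mm) (imC t).
have Su : side sgn u.
  have e : sgn * reC u = mm by rewrite /= mulrA sg2 mul1r.
  apply: far_side => //; first by rewrite e.
  by rewrite (sgm hsg) ?e //= subrr mul0r subr0.
apply: (@chain_trans _ _ _ u); last by apply: far Su; rewrite /= mulrA sg2 mul1r.
apply: chain_seg => s /andP[s0 s1].
have d0 : 0 <= s * (mm - sgn * reC t) by rewrite mulr_ge0; lra.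
have E : pt t (u - t) s = t + rc (sgn * (s * (mm - sgn * reC t))).
  apply: Cext; rewrite ?reC_pt ?imC_pt ?reD ?imD ?re_rc ?im_rc ?reN ?imN /=; last by ring.
  rewrite -[X in s * (sgn * mm - X)]mul1r -sg2; ring.
have e1 : sgn * reC (pt t (u - t) s) = sgn * reC t + s * (mm - sgn * reC t).
  by rewrite E reD re_rc mulrDr mulrA sg2 mul1r.
have i1 : imC (pt t (u - t) s) = imC t by rewrite E imD im_rc addr0.
apply: side_strip.
- by rewrite E; apply: (not_N_move (h := h)) => //.
- rewrite i1 sigma_small ?subr0 //.
  rewrite -[`|_|]mul1r; have <- : `|sgn| = 1 by case: hsg => ->; rewrite ?normrN normr1.
  rewrite -normrM e1 ger0_norm; last lra.
  have : 0 <= (1 - s) * (mm - sgn * reC t) by rewrite mulr_ge0; lra.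
  lra.
- by rewrite e1; lra.
Qed.

Lemma side_chain_base sgn L t : sgn = 1 \/ sgn = -1 -> 2 / r <= L <= mm -> side sgn t ->
  chain (side sgn) t (rc (sgn * L)).
Proof.
move=> hsg hL St; apply: (chain_trans (side_chain hsg St)); apply: chain_sym.
exact: side_chain hsg (side_base hsg hL).
Qed.

(** The convex strip about the line at half the height of the period; Gamma_C is its translate by
    -P. *)
Definition high : set C := [set t | (1 / 2 - kappa) * hh < ht t < (1 / 2 + kappa) * hh].

Lemma high_U t : high t -> Gam sU w t.
Proof.
move=> /andP[h1 h2]; have hb1 := hh_big1; have hb2 := hh_big2; have := height_le gamma w t.
case/andP: h_range => h0 _.
by move=> k; apply: Gamma_high => //; rewrite /sgs ?mul1r //; have := ler_norm (ht t); lra.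
Qed.

Lemma high_D t : high (t + per w) -> Gam sD w t.
Proof.
rewrite /high /= heightD -/(hP gamma w) => /andP[h1 h2]; have hb1 := hh_big1; have hb2 := hh_big2.
have := height_le gamma w t; case/andP: h_range => h0 _.
move=> k; have k' := ler_norm (- ht t); rewrite normrN in k'.
by apply: (fun h1 h2 => @Gamma_high _ _ _ _ kappa _ _ gamma0 phi_lt argw r0 h_range c0_gt0 approx sD t h1 h2) => //; rewrite /sgs ?mulN1r; lra.
Qed.

Lemma high_convex t u : high t -> high u -> forall s, 0 <= s <= 1 -> high (pt t (u - t) s).
Proof.
move=> /andP[h1 h2] /andP[h3 h4] s /andP[s0 s1]; rewrite /high /= /pt heightD heightZ heightD heightN.
have -> : ht t + s * (ht u - ht t) = (1 - s) * ht t + s * ht u by ring.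
move: ((1 / 2 - kappa) * hh) ((1 / 2 + kappa) * hh) h1 h2 h3 h4 => a b h1 h2 h3 h4.
have : 0 <= (1 - s) * (ht t - a) by rewrite mulr_ge0; lra.
have : 0 <= s * (ht u - a) by rewrite mulr_ge0; lra.
have : 0 <= (1 - s) * (b - ht t) by rewrite mulr_ge0; lra.
have : 0 <= s * (b - ht u) by rewrite mulr_ge0; lra.
have [s2|s2] := ltP 0 s.
  have : 0 < s * (ht u - a) by rewrite mulr_gt0; lra.
  have : 0 < s * (b - ht u) by rewrite mulr_gt0; lra.
  by move=> *; apply/andP; split; lra.
have -> : s = 0 by lra.
by move=> *; apply/andP; split; lra.
Qed.

Lemma high_shift t a : high t -> high (t + rc a * edir gamma w).
Proof. by rewrite /high /= heightD heightZ height_edir mulr0 addr0. Qed.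

(** The vertical segment above sgn m links a side to [high] within Gamma_U. Through these links F_U
    is continued from the left side, over N, to the right side. *)
Lemma base_high sgn : sgn = 1 \/ sgn = -1 -> exists2 b, high b & chain (Gam sU w) (rc (sgn * mm)) b.
Proof.
move=> hsg; have sg2 : sgn * sgn = 1 by case: hsg => ->; lra.
case/andP: h_range => h0 _; case/andP: kappa_range => k0 k1.
have kh : 0 < kappa * hh by rewrite mulr_gt0.
have hb1 := hh_big1; have m0 := mm0; have hm := m_big.
pose a := sgn * mm.
have ha : ht (rc a) <= mm * tan phi0.
  have := sigma_slope gamma0 phi_lt argw c0_gt0 a.
  rewrite (sgm hsg); last by rewrite /a mulrA sg2 mul1r.
  rewrite subrr mul0r sub0r normrN => h1; rewrite (height_slope gamma0 phi_lt argw) im_rc re_rc sub0r.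
  apply: (@le_trans _ _ `|a * tan th|); last exact: h1.
  apply: le_trans (ler_norm _) _; rewrite normrM normrN ler_piMl //.
  by rewrite gtr0_norm // cos_le1.
pose d := (hh / 2 - ht (rc a)) / cos th.
have hd : 0 <= d by rewrite divr_ge0 ?(ltW cth) //; lra.
pose b := rc a + iC R * rc d.
have hv u : ht (rc a + iC R * rc u) = ht (rc a) + u * cos th.
  by rewrite heightD [in X in _ + X]heightE imM reM re_iC im_iC !re_rc !im_rc; ring.
have hb : ht b = hh / 2 by rewrite /b hv /d divfK ?gt_eqF //; ring.
exists b; first by rewrite /high /= hb; apply/andP; split; lra.
apply: chain_seg => s /andP[s0 s1].
have E : pt (rc a) (b - rc a) s = rc a + iC R * rc (s * d).
  by rewrite /b /pt (rcM s d) [rc a + _ - rc a]addrAC subrr add0r mulrCA.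
have E2 : s * d * cos th = s * (hh / 2 - ht (rc a)).
  by rewrite /d; field; exact: cthn.
rewrite E; apply/GammaP => //; split.
- apply: (@not_N_re sgn) => //; rewrite reD reM re_iC im_iC im_rc re_rc mul0r mulr0 subr0 addr0.
  by rewrite /a mulrA sg2 mul1r.
- have -> : reC (rc a + iC R * rc (s * d)) = a.
    by rewrite reD reM re_iC im_iC im_rc !re_rc mul0r mulr0 subr0 addr0.
  have -> : imC (rc a + iC R * rc (s * d)) = s * d.
    by rewrite imD imM re_iC im_iC im_rc re_rc im_rc mul0r mul1r !add0r.
  rewrite /sgs (sgm hsg); last first.
    by rewrite /a mulrA sg2 mul1r.
  have : 0 <= s * d by rewrite mulr_ge0.
  by rewrite subrr mul0r; lra.
- rewrite /sgs mul1r hv E2.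
  have : 0 <= (1 - s) * (hh / 2 - ht (rc a)) by rewrite mulr_ge0; lra.
  lra.
Qed.

Variables (n : nat) (y : prenormal R n) (rho delta : R).
Local Notation M := 'M[C]_n.
Variables (F H : sect -> C -> C -> M).
Hypothesis HF : model_solutions gamma rho r delta h kappa c0 y F.
Hypothesis HH : normalizing gamma rho r h kappa c0 y F H.
Hypothesis Sw : Sdom gamma rho w.
Variables cg rg : R.
Hypothesis cg0 : 0 < cg.
Hypothesis gap : forall x, nc x < rg -> forall i j : 'I_n, (i < j)%N ->
  cg <= reC (edir gamma w * (lam y i (eps w) x - lam y j (eps w) x)).
Hypothesis q_small : nc (sqe w) < rg.
Local Notation ok_ := (ok y gamma r h kappa c0 F w).
Local Notation good_ := (good y F w).
Local Notation cc_ := (cc F H w).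
Local Notation ec_ := (ec H w).

Let Gopen := @Gamma_open _ _ r h kappa _ _ gamma0 phi_lt argw c0_gt0.
Let Gcsinh := @Gamma_csinh _ _ _ _ _ _ _ gamma0 phi_lt argw h_range kappa_range c0_gt0 hh_big1.
Let Gleft := @Gamma_l_left _ gamma _ _ kappa _ _ r0 h_range c0_gt0 approx.

Let good_chain t u : chain (Gam sU w) t u -> good_ sU t -> good_ sU u.
Proof.
elim=> // t' v u' hs _ IH gt; apply: IH.
have p1 : pt t' v 1 = t' + v by rewrite /pt rc1 mul1r.
rewrite -p1; apply: (good_U_segment HF Sw Gopen Gcsinh hs gt).
by rewrite ler01 lexx.
Qed.

Let good_left t : side (-1) t -> good_ sU t.
Proof. by move=> [hD hU ht']; apply: (good_U_left HF Sw Gopen Gcsinh Gleft hD hU); lra. Qed.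

Let mm_range : 2 / r <= mm <= mm.
Proof. by rewrite m_big lexx. Qed.

Lemma good_high t : high t -> good_ sU t.
Proof.
move=> ht'; have h1 : (-1 : R) = 1 \/ (-1 : R) = -1 by right.
have [b hb cb] := base_high h1.
have gb := good_chain cb (good_left (side_base h1 mm_range)).
apply: good_chain gb; apply: chain_seg => s hs; apply: high_U; exact: high_convex.
Qed.

(** Upwards from t the modulus increases, so the vertical segment from t to [high] stays off N. The
    part of the path of Gamma_U that passes over N consists of such points. *)
Lemma good_above t : 2 / r <= nc t -> 0 <= imC t -> sg (reC t) <= imC t -> ht t <= hh / 2 -> good_ sU t.
Proof.
move=> h1 h2 h3 h4; have hb1 := hh_big1; case/andP: kappa_range => k0 k1; have kh := mulr_gt0 k0 hh0.
have kh2 : kappa * hh < 1 / 2 * hh by rewrite ltr_pM2r.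
case/andP: h_range => h0 _.
pose d := (hh / 2 - ht t) / cos th.
have hd : 0 <= d by rewrite divr_ge0 ?(ltW cth) //; lra.
have hv u : ht (t + iC R * rc u) = ht t + u * cos th.
  by rewrite heightD [in X in _ + X]heightE imM reM re_iC im_iC !re_rc !im_rc; ring.
pose b := t + iC R * rc d.
have hb : ht b = hh / 2 by rewrite /b hv /d divfK ?gt_eqF //; ring.
have gb : good_ sU b by apply: good_high; rewrite /high /= hb; apply/andP; split; lra.
apply: good_chain gb; apply: chain_sym; apply: chain_seg => s /andP[s0 s1].
have sd : 0 <= s * d by rewrite mulr_ge0.
have E : pt t (b - t) s = t + iC R * rc (s * d).
  by rewrite /b /pt (rcM s d) [t + _ - t]addrAC subrr add0r mulrCA.
have Er : reC (t + iC R * rc (s * d)) = reC t.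
  by rewrite reD reM re_iC im_iC re_rc im_rc mul0r mulr0 subr0 addr0.
have Ei : imC (t + iC R * rc (s * d)) = imC t + s * d.
  by rewrite imD imM re_iC im_iC re_rc im_rc mul0r mul1r add0r.
have E2 : s * d * cos th = s * (hh / 2 - ht t) by rewrite /d; field; exact: cthn.
rewrite E; apply/GammaP; split.
- apply: (far_not_N (h := h)) => //; apply: le_trans h1 _.
  rewrite -ler_sqr ?nnegrE ?nc_ge0 // !nc_sqr Er Ei lerD2l ler_sqr ?nnegrE ?addr_ge0 //; lra.
- by rewrite Er Ei /sgs; lra.
- rewrite /sgs mul1r hv E2.
  have : 0 <= (1 - s) * (hh / 2 - ht t) by rewrite mulr_ge0; lra.
  lra.
Qed.

Lemma good_side sgn t : sgn = 1 \/ sgn = -1 -> side sgn t -> good_ sU t.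
Proof.
move=> hsg St; have [b hb cb] := base_high hsg.
have gm := good_chain (chain_sym cb) (good_high hb).
apply: good_chain gm; apply: chain_sym; apply: chain_sub (side_chain hsg St).
by move=> u [].
Qed.

Lemma ok_side sgn t : sgn = 1 \/ sgn = -1 -> side sgn t -> ok_ 0 t.
Proof. by move=> hsg St; have [h1 h2 _] := St; split; rewrite ?addr0 //; exact: good_side St. Qed.

Lemma cc_chain p (A : set C) t u : (forall v, xt w (v + p) = xt w v) -> A `<=` ok_ p ->
  chain A t u -> cc_ p t = cc_ p u.
Proof.
move=> hp Aok; elim=> [//|t' v u' hs _ <-].
have p1 : pt t' v 1 = t' + v by rewrite /pt rc1 mul1r.
have p0 : pt t' v 0 = t' by rewrite /pt rc0 mul0r addr0.
rewrite -p1 -[in LHS]p0; symmetry; apply: (cc_segment HF HH Sw Gopen Gcsinh hp ler01).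
by move=> s /hs/Aok.
Qed.

Let per0 v : xt w (v + 0) = xt w v.
Proof. by rewrite addr0. Qed.

(** The constant matrix may be read at the time sgn L, which does not depend on eps. *)
Lemma jump_base sgn L t : sgn = 1 \/ sgn = -1 -> 2 / r <= L <= mm -> side sgn t ->
  cc_ 0 t = cc_ 0 (rc (sgn * L)).
Proof.
move=> hsg hL St; apply: (@cc_chain _ (side sgn)) => //; last exact: side_chain_base.
by move=> u; exact: ok_side.
Qed.

Let rlim t (sgn : R) : sgn = 1 \/ sgn = - 1 -> forall e : R, 0 < e ->
  exists S0 : R, forall s, S0 <= s -> nc (xt w (t + rc (sgn * s) * edir gamma w) - rc sgn * q) < e.
Proof. exact: (ray_limit gamma0 phi_lt argw). Qed.

Lemma jump_triangular sgn t : sgn = 1 \/ sgn = -1 -> side sgn t ->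
  (forall i, cc_ 0 t i i = 1) /\
  (forall i j : 'I_n, (if sgn == 1 then (i < j)%N else (j < i)%N) -> cc_ 0 t i j = 0).
Proof.
move=> hsg St; rewrite (jump_base hsg mm_range St).
apply: (ray_triangular HF HH Sw Gopen Gcsinh cg0 gap q_small rlim hsg per0) => s s0.
by apply: (ok_side hsg); exact: side_ray.
Qed.

Lemma jump_center t : Gam sD w t -> Gam sU w (t + per w) -> ec_ (per w) t = 1%:M.
Proof.
move=> hD hU; have hper v : xt w (v + per w) = xt w v := xq_per v (sqe_per w).
have hi : high (t + per w).
  have [_ _] := (GammaP gamma r h kappa c0 w sD t).1 hD.
  have [_ _] := (GammaP gamma r h kappa c0 w sU (t + per w)).1 hU.
  rewrite /sgs mul1r /high /= heightD -/(hP gamma w) => h1 h2; apply/andP; split; lra.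
have okh u : high (u + per w) -> ok_ (per w) u.
  by move=> hu; split; [exact: high_D|exact: high_U|exact: good_high].
have rays sgn : sgn = 1 \/ sgn = -1 ->
    forall s, 0 <= s -> ok_ (per w) (pt t (rc sgn * edir gamma w) s).
  move=> _ s _; apply: okh; rewrite /pt mulrA -rcM addrAC; exact: high_shift.
have s1 : (1 : R) = 1 \/ (1 : R) = -1 by left.
have s2 : (-1 : R) = 1 \/ (-1 : R) = -1 by right.
have [d1 o1] := ray_triangular HF HH Sw Gopen Gcsinh cg0 gap q_small rlim s1 hper (rays _ s1).
have [_ o2] := ray_triangular HF HH Sw Gopen Gcsinh cg0 gap q_small rlim s2 hper (rays _ s2).
have okt : ok_ (per w) t by exact: okh.
have c1 : cc_ (per w) t = 1%:M.
  apply/matrixP => i j; rewrite [RHS]mxE; have [->|ij] := eqVneq i j; first exact: d1.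
  have [lt|] := ltnP i j; first by apply: o1; rewrite eqxx.
  rewrite leq_eqVlt eq_sym => /orP[/eqP/val_inj e|lt]; first by rewrite e eqxx in ij.
  apply: o2; rewrite (_ : (-1 == 1 :> R) = false) //.
  by apply/negbTE; rewrite lt_eqF //; lra.
have uF := good_unit (good_D HF Sw Gopen Gcsinh hD).
by rewrite (cc_ec H HF Sw Gopen Gcsinh okt) c1 mulmx1 mulmxV.
Qed.
End Paths.

(** * Spectral gap and uniform local data *)

Section Spectral.
Variables (R : realType) (n : nat) (y : prenormal R n).
Local Notation C := (Cx R).

Lemma common_pos (T : finType) (P : T -> R -> Prop) :
  (forall i c c', P i c -> 0 < c' <= c -> P i c') ->
  (forall i, exists2 c : R, 0 < c & P i c) -> exists2 c : R, 0 < c & forall i, P i c.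
Proof.
move=> mono ex; suff [c c0 hc] : exists2 c : R, 0 < c & forall i, i \in enum T -> P i c.
  by exists c => // i; apply: hc; rewrite mem_enum.
elim: (enum T) => [|i s [c c0 hc]]; first by exists 1.
have [c' c'0 hc'] := ex i; exists (Num.min c c'); first by rewrite lt_min c0.
move=> j; rewrite inE => /orP[/eqP ->|/hc hj]; [apply: mono hc' _|apply: mono hj _];
  by rewrite lt_min c0 c'0 ge_min lexx ?orbT.
Qed.

(** The directions of path pieces: real part 1, so that Re t is the parameter, and slope at most T.
    For T = tan phi0 this covers the horizontal direction and that of e^{i theta}. *)
Definition slope (T : R) (v : C) := reC v = 1 /\ `|imC v| <= T.

Lemma nc_slope T v : slope T v -> nc v <= 1 + T.
Proof. by case=> h1 h2; have := nc_le_reim v; rewrite h1 normr1; lra. Qed.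

Variable phi : R.
Hypothesis phi0 : 0 < phi.
Hypothesis phi_theta : phi < theta0 y.

(** An angle larger than phi in the set whose supremum is [theta0]. Its conditions for e^{i th} and
    e^{-i th} merge into one on the modulus of the imaginary part. *)
Lemma theta0_witness : exists th : R, [/\ phi < th, th < pi / 2 &
  forall i j : 'I_n, (i < j)%N ->
    `|imC (lam y i 0 0 - lam y j 0 0)| * sin th <= reC (lam y i 0 0 - lam y j 0 0) * cos th].
Proof.
move: phi_theta; rewrite /theta0; set S := [set th : R | _] => hs.
(* The supremum of the empty set is 0, which 0 < phi < theta0 excludes. *)
have S0 : S !=set0.
  by apply/set0P/eqP => e; move: hs; rewrite e sup0; have := phi0; lra.
have [th [/andP[t0 t1] hth] pth] := sup_gt S0 hs.
exists th; split=> // i j ij; have [h1 h2] := hth i j ij.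
have e1 : cexp (iC R * rc th) = mkC (cos th) (sin th).
  have -> : iC R * rc th = mkC 0 th.
    by apply: Cext; rewrite ?reM ?imM re_iC im_iC re_rc im_rc /=; lra.
  by apply: Cext; rewrite /= expR0 mul1r.
have e2 : cexp (- (iC R * rc th)) = mkC (cos th) (- sin th).
  have -> : - (iC R * rc th) = mkC 0 (- th).
    by apply: Cext; rewrite ?reN ?imN ?reM ?imM re_iC im_iC re_rc im_rc /=; lra.
  by apply: Cext; rewrite /= expR0 mul1r ?cosN ?sinN.
move: h1 h2; rewrite e1 e2 !reM /=; set d := lam y i 0 0 - _.
have s0 : 0 <= sin th by apply: sin_ge0_pi; apply/andP; split; [exact: ltW|lra].
by rewrite -[X in `|_| * X](ger0_norm s0) -normrM => h1 h2; rewrite ler_norml; apply/andP; split; lra.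
Qed.

Lemma phi_lt_halfpi : phi < pi / 2.
Proof. by have [th [h1 h2 _]] := theta0_witness; lra. Qed.

Lemma tan_phi_ge0 : 0 <= tan phi.
Proof.
have p2 := phi_lt_halfpi; rewrite /tan divr_ge0 // ltW //.
  by apply: sin_gt0_pi; rewrite phi0 /=; have := pi_gt0 R; lra.
by apply: cos_gt0_pihalf; rewrite p2 andbT; have := phi0; lra.
Qed.

(** With d the difference of eigenvalues, |Im d| <= Re d / tan th, so the real part of v d is at
    least Re d (1 - tan phi / tan th), positive because phi < th. *)
Lemma gap0 (i j : 'I_n) : (i < j)%N -> exists2 c : R, 0 < c & forall v, slope (tan phi) v ->
  c <= reC (v * (lam y i 0 0 - lam y j 0 0)).
Proof.
move=> ij; have [th [pt1 pt2 hth]] := theta0_witness; have p0 := phi0.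
have hd := hth i j ij; set d := lam y i 0 0 - lam y j 0 0 in hd *.
have d0 : 0 < reC d by rewrite /d /lam !mulr0 !addr0; exact: L0_ordered.
have pp := pi_gt0 R.
have c1 : 0 < cos th by apply: cos_gt0_pihalf; apply/andP; split; lra.
have c2 : 0 < cos phi by apply: cos_gt0_pihalf; apply/andP; split; lra.
have s1 : 0 < sin th by apply: sin_gt0_pi; apply/andP; split; lra.
have s2 : 0 < sin phi by apply: sin_gt0_pi; apply/andP; split; lra.
have sd : 0 < sin th * cos phi - cos th * sin phi.
  by rewrite -sinB; apply: sin_gt0_pi; apply/andP; split; lra.
exists (reC d * (sin th * cos phi - cos th * sin phi) / (sin th * cos phi)).
  by rewrite divr_gt0 // mulr_gt0.
move=> v [v1 v2]; rewrite reM v1 mul1r.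
have h1 : imC v * imC d <= tan phi * `|imC d|.
  by apply: le_trans (ler_norm _) _; rewrite normrM ler_wpM2r.
have h2 : tan phi * `|imC d| <= sin phi / cos phi * (reC d * cos th / sin th).
  by rewrite /tan ler_wpM2l ?(divr_ge0 (ltW s2) (ltW c2)) // ler_pdivlMr.
have -> : reC d * (sin th * cos phi - cos th * sin phi) / (sin th * cos phi) =
  reC d - sin phi / cos phi * (reC d * cos th / sin th).
  by field; rewrite !gt_eqF.
lra.
Qed.

Lemma lam_cont0 (i : 'I_n) (e : R) : 0 < e -> exists2 d : R, 0 < d & forall u x : C, nc u < d -> nc x < d ->
  nc (lam y i u x - lam y i 0 0) < e.
Proof.
move=> e0; have e20 : 0 < e / 2 by rewrite divr_gt0.
have cL (L : C -> 'rV[C]_n) : (\forall u \near (0 : C), differentiable L u) ->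
    forall e' : R, 0 < e' -> exists2 d : R, 0 < d & forall u, nc u < d -> nc (L u 0 i - L 0 0 i) < e'.
  move=> /nbhs_singleton/derivable1_diffP/derivable_mdiff/(_ 0 i)/cdiff_cont h e' /h[d d0 hd].
  by exists d => // u hu; apply: hd; rewrite subr0.
have [d1 d10 h1] := cL _ (L0_analytic y) _ e20.
have [d2 d20 h2] := cL _ (L1_analytic y) 1 ltr01.
set K := nc (L1 y 0 0 i) + 1; have K0 : 0 < K by rewrite ltr_wpDl ?nc_ge0.
exists (Num.min (Num.min d1 d2) (e / (2 * K))).
  by rewrite !lt_min d10 d20 divr_gt0 // mulr_gt0.
move=> u x; rewrite !lt_min => /andP[/andP[u1 u2] _] /andP[_ x1].
have -> : lam y i u x - lam y i 0 0 = (L0 y u 0 i - L0 y 0 0 i) + L1 y u 0 i * x.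
  by rewrite /lam mulr0 addr0; ring.
have h3 := h1 u u1; have h4 := h2 u u2.
apply: le_lt_trans (ncD _ _) _; rewrite ncM.
have h5 : nc (L1 y u 0 i) <= K by have := nc_lower (L1 y u 0 i) (L1 y 0 0 i); rewrite /K; lra.
have h6 : nc (L1 y u 0 i) * nc x <= K * (e / (2 * K)).
  by apply: ler_pM; rewrite ?nc_ge0 // ltW.
have h7 : K * (e / (2 * K)) = e / 2 by field; rewrite gt_eqF.
lra.
Qed.

Lemma gap_near (i j : 'I_n) : (i < j)%N -> exists2 c : R, 0 < c & forall u x : C, nc u < c -> nc x < c ->
  forall v, slope (tan phi) v -> c <= reC (v * (lam y i u x - lam y j u x)).
Proof.
move=> ij; have [c c0 hc] := gap0 ij; have tp := tan_phi_ge0.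
set K := 1 + tan phi; have K0 : 0 < K by rewrite /K; lra.
have e0 : 0 < c / (4 * K) by rewrite divr_gt0 // mulr_gt0.
have [d1 d10 h1] := lam_cont0 i e0; have [d2 d20 h2] := lam_cont0 j e0.
exists (Num.min (c / 2) (Num.min d1 d2)); first by rewrite !lt_min d10 d20 divr_gt0.
move=> u x; rewrite !lt_min => /and3P[_ u1 u2] /and3P[_ x1 x2] v sv.
have := hc v sv; set D := lam y i 0 0 - _; set D' := lam y i u x - _ => h0.
have hD : nc (D' - D) <= c / (2 * K).
  have -> : D' - D = (lam y i u x - lam y i 0 0) - (lam y j u x - lam y j 0 0) by rewrite /D /D'; ring.
  apply: le_trans (ncB _ _) _; have := h1 u x u1 x1; have := h2 u x u2 x2.
  have -> : c / (2 * K) = c / (4 * K) + c / (4 * K) by field; rewrite gt_eqF.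
  lra.
have h3 : nc (v * (D' - D)) <= c / 2.
  have -> : c / 2 = K * (c / (2 * K)) by field; rewrite gt_eqF.
  by rewrite ncM; apply: ler_pM; rewrite ?nc_ge0 //; exact: nc_slope.
have := re_le_nc (v * (D' - D)); rewrite ler_norml => /andP[h4 _].
have -> : v * D' = v * D + v * (D' - D) by ring.
rewrite reD; apply: (@le_trans _ _ (c / 2)); first by rewrite ge_min lexx.
lra.
Qed.

Lemma Rem_cont (e x : C) (i j : 'I_n) : differentiable (fun p : C * C => Rem y p.1 p.2) (e, x) ->
  forall eta : R, 0 < eta -> exists2 d : R, 0 < d & forall u z : C, nc (u - e) < d -> nc (z - x) < d ->
    nc (Rem y u z i j - Rem y e x i j) < eta.
Proof.
move=> /differentiable_continuous h eta eta0.
have /mx_cvgP/(_ i j)/cvg_nc/(_ eta eta0) : (fun p : C * C => Rem y p.1 p.2) @ (e, x) --> Rem y e x by exact: h.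
move=> [[A B] /= [/nbhs_nc[d1 d10 h1] /nbhs_nc[d2 d20 h2]] hAB].
exists (Num.min d1 d2); first by rewrite lt_min d10.
move=> u z; rewrite !lt_min => /andP[u1 _] /andP[_ z2].
by apply: (hAB (u, z)); split; [exact: h1|exact: h2].
Qed.

Definition local_data (cs r1 KR : R) := [/\
  forall u x : C, nc u < r1 -> nc x < r1 -> forall i j : 'I_n, (i < j)%N ->
     forall v, slope (tan phi) v -> cs <= reC (v * (lam y i u x - lam y j u x)),
  forall u x : C, nc u < r1 -> nc x < r1 -> forall i j, nc (Rem y u x i j) <= KR,
  forall u x : C, nc u < r1 -> nc x < r1 -> differentiable (fun p : C * C => Rem y p.1 p.2) (u, x) &
  forall u : C, nc u < r1 -> differentiable (L0 y) u /\ differentiable (L1 y) u].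

Lemma spectral : exists cs r1 KR : R, [/\ 0 < cs, 0 < r1, 0 < KR & local_data cs r1 KR].
Proof.
have [c c0 hc] : exists2 c : R, 0 < c & forall p : 'I_n * 'I_n, (p.1 < p.2)%N ->
    forall u x : C, nc u < c -> nc x < c ->
    forall v, slope (tan phi) v -> c <= reC (v * (lam y p.1 u x - lam y p.2 u x)).
  apply: common_pos => [p c c' h /andP[c'0 c'c] hp u x u1 x1 v sv|p].
    by apply: (le_trans c'c); apply: h => //; [apply: lt_le_trans u1 _|apply: lt_le_trans x1 _].
  have [lt|ge] := ltnP p.1 p.2; last by exists 1.
  by have [c c0 h] := gap_near lt; exists c.
have [d d0 hd] : exists2 d : R, 0 < d & forall p : 'I_n * 'I_n, forall u x : C, nc u < d -> nc x < d ->
    nc (Rem y u x p.1 p.2 - Rem y 0 0 p.1 p.2) < 1.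
  apply: common_pos => [p c1 c' h /andP[c'0 c'c] u x u1 x1|p].
    by apply: h; [apply: lt_le_trans u1 _|apply: lt_le_trans x1 _].
  have [d d0 h] := Rem_cont p.1 p.2 (nbhs_singleton (Rem_analytic y)) ltr01.
  by exists d => // u x u1 x1; apply: h; rewrite subr0.
have [[A B] /= [/nbhs_nc[d1 d10 h1] /nbhs_nc[d2 d20 h2]] hAB] := Rem_analytic y.
have /nbhs_nc[d3 d30 h3] := L0_analytic y; have /nbhs_nc[d4 d40 h4] := L1_analytic y.
exists c, (Num.min (Num.min c d) (Num.min (Num.min d1 d2) (Num.min d3 d4))),
  (\sum_(p : 'I_n * 'I_n) nc (Rem y 0 0 p.1 p.2) + 1).
have lt (u : R) : u < Num.min (Num.min c d) (Num.min (Num.min d1 d2) (Num.min d3 d4)) ->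
  [/\ u < c, u < d, u < d1, u < d2 & u < d3 /\ u < d4].
  by rewrite !lt_min => /andP[/andP[-> ->] /andP[/andP[-> ->] /andP[-> ->]]].
split=> //.
- by rewrite !lt_min c0 d0 d10 d20 d30 d40.
- by rewrite ltr_wpDl // sumr_ge0 // => p _; exact: nc_ge0.
split.
- by move=> u x /lt[u1 _ _ _ _] /lt[x1 _ _ _ _] i j ij v; exact: (hc (i, j)).
- move=> u x /lt[_ u1 _ _ _] /lt[_ x1 _ _ _] i j.
  have := hd (i, j) u x u1 x1; have := nc_lower (Rem y u x i j) (Rem y 0 0 i j).
  rewrite (bigD1 (i, j)) //= => k1 k2.
  have : 0 <= \sum_(p : 'I_n * 'I_n | p != (i, j)) nc (Rem y 0 0 p.1 p.2).
    by apply: sumr_ge0 => p _; exact: nc_ge0.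
  lra.
- move=> u x /lt[_ _ u1 _ _] /lt[_ _ _ x2 _]; apply: (hAB (u, x)); split=> /=.
    by apply: h1; rewrite subr0.
  by apply: h2; rewrite subr0.
- by move=> u /lt[_ _ _ _ [u3 u4]]; split; [apply: h3|apply: h4]; rewrite subr0.
Qed.
End Spectral.

(** * Paths made of segments of bounded slope *)

Section Legs.
Variable R : realType.
Local Notation C := (Cx R).

(** The decomposition into segments is kept as a derivation, so that the estimates on one segment
    extend to the path by induction. *)
Inductive legs (T : R) (P : R -> C) : R -> R -> Prop :=
| leg_line a b p v : a <= b -> slope T v -> (forall s, a <= s <= b -> P s = pt p v s) -> legs T P a b
| leg_cat a x b : legs T P a x -> legs T P x b -> legs T P a b.

Variables (T : R) (P : R -> C).

Lemma legs_le a b : legs T P a b -> a <= b.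
Proof. by elim=> // ? ? ? _ h1 _ h2; exact: le_trans h2. Qed.

(** The bound at b is carried through the right piece to the junction and from there through the
    left piece. The factor 1 + T bounds |v| for a direction v of slope at most T. *)
Lemma legs_grow (h : C -> C) (mu g : R -> C) (c A B a b : R) : 0 < c -> A <= c * B -> legs T P a b ->
  (forall s, a <= s <= b -> cdiff h (P s) (mu s * h (P s) + g s)) ->
  (forall s v, a <= s <= b -> slope T v -> c <= reC (v * mu s)) ->
  (forall s, a <= s <= b -> (1 + T) * nc (g s) <= A) ->
  nc (h (P b)) <= B -> forall s, a <= s <= b -> nc (h (P s)) <= B.
Proof.
move=> c0 AB; elim=> {a b} [a b p v ab sv hP|a x b l1 IH1 l2 IH2] H Hm Hg hb s hs.
  have bb : a <= b <= b by rewrite ab lexx.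
  rewrite hP //; apply: (@line_grow _ h p v (fun s => mu s * h (P s) + g s) (fun s => v * mu s)
    (fun s => v * g s) c A B a b c0 AB) => //.
  - by move=> u hu; rewrite -hP //; exact: H.
  - by move=> u hu; rewrite -hP //; ring.
  - by move=> u hu; exact: Hm.
  - move=> u hu; rewrite ncM; apply: le_trans (Hg u hu).
    by rewrite ler_wpM2r ?nc_ge0 //; exact: nc_slope.
  - by rewrite -hP.
have ax := legs_le l1; have xb := legs_le l2.
have s1 u : a <= u <= x -> a <= u <= b by move=> /andP[-> h1]; exact: le_trans xb.
have s2 u : x <= u <= b -> a <= u <= b by move=> /andP[h1 ->]; rewrite (le_trans ax).
have hx : nc (h (P x)) <= B.
  apply: IH2 => [u /s2|u v /s2|u /s2||]; [exact: H|exact: Hm|exact: Hg|exact: hb|by rewrite lexx].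
case/andP: hs => as' sb; have [sx|xs] := leP s x.
  by apply: IH1 => [u /s1|u v /s1|u /s1||]; [exact: H|exact: Hm|exact: Hg| |rewrite as'].
by apply: IH2 => [u /s2|u v /s2|u /s2||]; [exact: H|exact: Hm|exact: Hg|exact: hb|rewrite (ltW xs)].
Qed.

Lemma legs_decay (h : C -> C) (mu g : R -> C) (c A B a b : R) : 0 < c -> A <= c * B -> legs T P a b ->
  (forall s, a <= s <= b -> cdiff h (P s) (mu s * h (P s) + g s)) ->
  (forall s v, a <= s <= b -> slope T v -> reC (v * mu s) <= - c) ->
  (forall s, a <= s <= b -> (1 + T) * nc (g s) <= A) ->
  nc (h (P a)) <= B -> forall s, a <= s <= b -> nc (h (P s)) <= B.
Proof.
move=> c0 AB; elim=> {a b} [a b p v ab sv hP|a x b l1 IH1 l2 IH2] H Hm Hg hb s hs.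
  have aa : a <= a <= b by rewrite ab lexx.
  rewrite hP //; apply: (@line_decay _ h p v (fun s => mu s * h (P s) + g s) (fun s => v * mu s)
    (fun s => v * g s) c A B a b c0 AB) => //.
  - by move=> u hu; rewrite -hP //; exact: H.
  - by move=> u hu; rewrite -hP //; ring.
  - by move=> u hu; exact: Hm.
  - move=> u hu; rewrite ncM; apply: le_trans (Hg u hu).
    by rewrite ler_wpM2r ?nc_ge0 //; exact: nc_slope.
  - by rewrite -hP.
have ax := legs_le l1; have xb := legs_le l2.
have s1 u : a <= u <= x -> a <= u <= b by move=> /andP[-> h1]; exact: le_trans xb.
have s2 u : x <= u <= b -> a <= u <= b by move=> /andP[h1 ->]; rewrite (le_trans ax).
have hx : nc (h (P x)) <= B.
  apply: IH1 => [u /s1|u v /s1|u /s1||]; [exact: H|exact: Hm|exact: Hg|exact: hb|by rewrite ax lexx].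
case/andP: hs => as' sb; have [sx|xs] := leP s x.
  by apply: IH1 => [u /s1|u v /s1|u /s1||]; [exact: H|exact: Hm|exact: Hg|exact: hb|rewrite as'].
by apply: IH2 => [u /s2|u v /s2|u /s2||]; [exact: H|exact: Hm|exact: Hg| |rewrite (ltW xs)].
Qed.

Lemma legs_diag (h : C -> C) (g : R -> C) (f f' : R -> R) (a b : R) : legs T P a b ->
  (forall s, a <= s <= b -> cdiff h (P s) (g s)) ->
  (forall s, a <= s <= b -> rdiff f s (f' s)) ->
  (forall s, a <= s <= b -> (1 + T) * nc (g s) <= f' s) ->
  forall s s', a <= s -> s <= s' -> s' <= b -> nc (h (P s') - h (P s)) <= f s' - f s.
Proof.
elim=> {a b} [a b p v ab sv hP|a x b l1 IH1 l2 IH2] H Hf Hg s s' as' ss' sb.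
  have sub u : s <= u <= s' -> a <= u <= b.
    by move=> /andP[h1 h2]; rewrite (le_trans as') // (le_trans h2).
  rewrite !hP ?as' ?sb ?andbT ?(le_trans ss') ?(le_trans as') //.
  apply: (@line_mvt _ h p v g f f' s s') => // u /sub hu.
  - by rewrite -hP //; exact: H.
  - exact: Hf.
  - rewrite ncM mulrC; apply: le_trans (Hg u hu).
    by rewrite ler_wpM2r ?nc_ge0 //; exact: nc_slope.
have ax := legs_le l1; have xb := legs_le l2.
have s1 u : a <= u <= x -> a <= u <= b by move=> /andP[-> h1]; exact: le_trans xb.
have s2 u : x <= u <= b -> a <= u <= b by move=> /andP[h1 ->]; rewrite (le_trans ax).
have k1 := IH1 (fun u hu => H u (s1 u hu)) (fun u hu => Hf u (s1 u hu)) (fun u hu => Hg u (s1 u hu)).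
have k2 := IH2 (fun u hu => H u (s2 u hu)) (fun u hu => Hf u (s2 u hu)) (fun u hu => Hg u (s2 u hu)).
have [sx|xs] := leP s' x; first exact: k1.
have [xs'|/ltW sx] := leP x s; first by apply: k2 => //; exact: ltW.
have h1 := k1 s x as' sx (lexx _); have h2 := k2 x s' (lexx _) (ltW xs) sb.
have -> : h (P s') - h (P s) = (h (P s') - h (P x)) + (h (P x) - h (P s)) by ring.
by apply: le_trans (ncD _ _) _; lra.
Qed.

Lemma legs_lipschitz a b : 0 <= T -> legs T P a b ->
  forall s s', a <= s <= b -> a <= s' <= b -> nc (P s' - P s) <= (1 + T) * `|s' - s|.
Proof.
move=> T0 hl; have h s s' : a <= s -> s <= s' -> s' <= b -> nc (P s' - P s) <= (1 + T) * s' - (1 + T) * s.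
  apply: (@legs_diag id (fun=> 1) (fun s => (1 + T) * s) (fun=> (1 + T)) a b hl) => u _.
  - exact: cdiff_id.
  - by apply: rdiff_val (rdiff_scale (1 + T) (rdiff_id u)); rewrite mulr1.
  - by rewrite nc1 mulr1.
move=> s s' /andP[h1 h2] /andP[h3 h4]; have [le|/ltW le] := leP s s'.
  by rewrite ger0_norm ?subr_ge0 // mulrBr; exact: h.
by rewrite ncBC distrC ger0_norm ?subr_ge0 // mulrBr; exact: h.
Qed.

Lemma legs_continuous (f : C -> R) a b : 0 <= T -> legs T P a b ->
  (forall s, a <= s <= b -> forall e : R, 0 < e -> exists2 d : R, 0 < d &
     forall u, nc (u - P s) < d -> `|f u - f (P s)| < e) ->
  {within `[a, b], continuous (fun s => f (P s))}.
Proof.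
move=> T0 hl hf; apply/subspace_continuousP => s; rewrite /= in_itv /= => hs.
apply/cvgrPdist_lt => e e0; have [d d0 hd] := hf s hs e e0.
have K0 : 0 < 1 + T by lra.
rewrite near_withinE; near=> u; rewrite /= in_itv /= => hu; rewrite distrC; apply: hd.
apply: (le_lt_trans (legs_lipschitz T0 hl hs hu)); rewrite mulrC -ltr_pdivlMr //.
near: u; apply/nbhs_ballP; exists (d / (1 + T)) => /=; first by rewrite divr_gt0.
by move=> u; rewrite /ball /= distrC.
Unshelve. all: by end_near.
Qed.
End Legs.

(** * A priori bounds for a matrix system along a path *)

Section PathSystem.
Variables (R : realType) (n : nat).
Local Notation C := (Cx R).
Local Notation M := 'M[C]_n.

Definition entries (A : M) : R := \sum_(i < n) \sum_(j < n) nc (A i j).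

Lemma entry_le (A : M) i j : nc (A i j) <= entries A.
Proof.
rewrite /entries (bigD1 i) //= (bigD1 j) //= -addrA lerDl addr_ge0 // ?sumr_ge0 // => [k _|k _].
  exact: nc_ge0.
by apply: sumr_ge0 => l _; exact: nc_ge0.
Qed.
Lemma entries_ge0 A : 0 <= entries A.
Proof. by apply: sumr_ge0 => i _; apply: sumr_ge0 => j _; exact: nc_ge0. Qed.
Lemma entries_bound (A : M) (B : R) : (forall i j, nc (A i j) <= B) -> entries A <= n%:R ^+ 2 * B.
Proof.
move=> h; rewrite /entries; apply: (@le_trans _ _ (\sum_(i < n) \sum_(j < n) B)).
  by apply: ler_sum => i _; apply: ler_sum => j _; exact: h.
by rewrite !sumr_const card_ord -mulrnA -[X in X <= _]mulr_natl natrM expr2.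
Qed.

(** x^2 - eps will be bounded by the weight om^2 / (1 + (om u)^2), which is the derivative of om
    atan (om u). Its integral is at most om pi, whatever the length of the path. *)
Lemma rdiff_atan (om s : R) : rdiff (fun u => atan (om * u)) s (om / (1 + (om * s) ^+ 2)).
Proof.
have h1 := is_derive_rdiff (is_derive1_atan (om * s)).
have h2 : rdiff (fun u => om * u) s (om * 1) := rdiff_scale om (rdiff_id s).
by apply: rdiff_val (rdiff_comp h2 h1); rewrite mulr1 mulrC.
Qed.

Variables (T c : R) (P : R -> C) (a b : R) (X : C -> M) (mu G : 'I_n -> 'I_n -> R -> C) (Cf om zeta : R).
Hypothesis T0 : 0 <= T.
Hypothesis c0 : 0 < c.
Hypothesis Cf0 : 0 <= Cf.
Hypothesis om0 : 0 < om.
Hypothesis zeta0 : 0 <= zeta.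
Hypothesis hP : legs T P a b.
Hypothesis ode : forall i j s, a <= s <= b ->
  cdiff (fun t => X t i j) (P s) (mu i j s * X (P s) i j + G i j s).
Hypothesis mu_diag : forall j s, a <= s <= b -> mu j j s = 0.
Hypothesis mu_up : forall (i j : 'I_n) s v, (i < j)%N -> a <= s <= b -> slope T v -> c <= reC (v * mu i j s).
Hypothesis mu_down : forall (i j : 'I_n) s v, (j < i)%N -> a <= s <= b -> slope T v -> reC (v * mu i j s) <= - c.
Hypothesis G_bound : forall i j s, a <= s <= b ->
  nc (G i j s) <= Cf * (om ^+ 2 / (1 + (om * s) ^+ 2)) * entries (X (P s)) + zeta.

Let den s : 1 <= 1 + (om * s) ^+ 2.
Proof. by rewrite lerDl sqr_ge0. Qed.

Lemma path_max : exists2 s0, a <= s0 <= b & forall s, a <= s <= b -> entries (X (P s)) <= entries (X (P s0)).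
Proof.
have ab := legs_le hP.
have cont : {within `[a, b], continuous (fun s => entries (X (P s)))}.
  apply: (@legs_continuous _ T P (fun t => entries (X t))) => // s hs e e0.
  have n0 : 0 < n%:R ^+ 2 + 1 :> R by rewrite ltr_wpDl ?sqr_ge0.
  have e'0 : 0 < e / (n%:R ^+ 2 + 1) by rewrite divr_gt0.
  have [d d0 hd] : exists2 d : R, 0 < d & forall p : 'I_n * 'I_n, forall u, nc (u - P s) < d ->
      nc (X u p.1 p.2 - X (P s) p.1 p.2) < e / (n%:R ^+ 2 + 1).
    apply: common_pos => [p d d' h /andP[d'0 d'd] u hu|p]; first by apply: h; exact: lt_le_trans d'd.
    exact: cdiff_cont (ode p.1 p.2 hs) _ e'0.
  exists d => // u hu; rewrite /entries -sumrB; apply: (@le_lt_trans _ _ (n%:R ^+ 2 * (e / (n%:R ^+ 2 + 1)))).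
    apply: le_trans (entries_bound (A := X u - X (P s)) _).
      apply: le_trans (ler_norm_sum _ _ _) _; apply: ler_sum => i _; rewrite -sumrB.
      apply: le_trans (ler_norm_sum _ _ _) _; apply: ler_sum => j _; rewrite !mxE.
      by rewrite ler_norml; have := nc_lower (X u i j) (X (P s) i j); have := nc_lower (X (P s) i j) (X u i j);
        rewrite (ncBC (X (P s) i j)) => *; apply/andP; split; lra.
    by move=> i j; rewrite !mxE; apply: ltW; exact: (hd (i, j)).
  by rewrite mulrA ltr_pdivrMr // mulrC ltr_pM2l // ltrDl.
have [s0 hs0 hmax] := EVT_max ab cont.
by exists s0 => [|s hs]; [move: hs0; rewrite in_itv|apply: hmax; rewrite in_itv].
Qed.

Section Bounded.
Variable Mx : R.
Hypothesis Mx_bound : forall s, a <= s <= b -> entries (X (P s)) <= Mx.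

Let Mx0 : 0 <= Mx.
Proof. by apply: le_trans (Mx_bound (s := a) _); rewrite ?entries_ge0 // lexx (legs_le hP). Qed.

Let K0 : 0 < 1 + T.
Proof. by have := T0; lra. Qed.

Let G_bound_M i j s : a <= s <= b -> nc (G i j s) <= Cf * (om ^+ 2 / (1 + (om * s) ^+ 2)) * Mx + zeta.
Proof.
move=> hs; apply: le_trans (G_bound i j hs) _; rewrite lerD2r ler_wpM2l ?Mx_bound //.
by rewrite mulr_ge0 // divr_ge0 ?sqr_ge0 // (le_trans ler01).
Qed.

Let AB (beta phi : R) : 0 <= beta -> (1 + T) * (Cf * phi * Mx + zeta) <= c * (beta + (1 + T) * (Cf * phi * Mx + zeta) / c).
Proof.
move=> b0; rewrite [X in _ <= X](_ : _ = c * beta + (1 + T) * (Cf * phi * Mx + zeta)); last first.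
  by field; rewrite gt_eqF.
by rewrite lerDr mulr_ge0 // ltW.
Qed.

Variable Phi : R.
Hypothesis Phi0 : 0 <= Phi.

Let g0 : 0 <= (1 + T) * (Cf * Phi * Mx + zeta) / c.
Proof.
apply: divr_ge0; last exact: ltW.
apply: mulr_ge0; first exact: ltW.
by apply: addr_ge0 => //; apply: mulr_ge0 => //; exact: mulr_ge0.
Qed.

Let G_Phi i j s : a <= s <= b -> om ^+ 2 / (1 + (om * s) ^+ 2) <= Phi ->
  (1 + T) * nc (G i j s) <= (1 + T) * (Cf * Phi * Mx + zeta).
Proof.
move=> hs hphi; rewrite ler_pM2l //; apply: le_trans (G_bound_M i j hs) _.
by rewrite lerD2r ler_wpM2r // ler_wpM2l.
Qed.

(** [Phi] bounds the weight on [x, b] only. For x far from 0 it is small there, and so are the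
    entries above the diagonal. *)
Lemma path_up (i j : 'I_n) (x beta : R) : (i < j)%N -> a <= x -> legs T P x b ->
  (forall s, x <= s <= b -> om ^+ 2 / (1 + (om * s) ^+ 2) <= Phi) ->
  nc (X (P b) i j) <= beta -> forall s, x <= s <= b ->
  nc (X (P s) i j) <= beta + (1 + T) * (Cf * Phi * Mx + zeta) / c.
Proof.
move=> ij ax hl hphi hb; have b0 : 0 <= beta := le_trans (nc_ge0 _) hb.
have sub s : x <= s <= b -> a <= s <= b by move=> /andP[h1 ->]; rewrite (le_trans ax).
apply: (@legs_grow _ T P (fun t => X t i j) (mu i j) (G i j) c _ _ x b c0 (AB Phi b0) hl).
- by move=> s /sub; exact: ode.
- by move=> s v /sub; exact: mu_up.
- by move=> s hs; apply: G_Phi; [exact: sub|exact: hphi].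
- by apply: (le_trans hb); rewrite lerDl.
Qed.

Lemma path_down (i j : 'I_n) (x beta : R) : (j < i)%N -> x <= b -> legs T P a x ->
  (forall s, a <= s <= x -> om ^+ 2 / (1 + (om * s) ^+ 2) <= Phi) ->
  nc (X (P a) i j) <= beta -> forall s, a <= s <= x ->
  nc (X (P s) i j) <= beta + (1 + T) * (Cf * Phi * Mx + zeta) / c.
Proof.
move=> ij xb hl hphi hb; have b0 : 0 <= beta := le_trans (nc_ge0 _) hb.
have sub s : a <= s <= x -> a <= s <= b by move=> /andP[-> h1]; exact: le_trans xb.
apply: (@legs_decay _ T P (fun t => X t i j) (mu i j) (G i j) c _ _ a x c0 (AB Phi b0) hl).
- by move=> s /sub; exact: ode.
- by move=> s v /sub; exact: mu_down.
- by move=> s hs; apply: G_Phi; [exact: sub|exact: hphi].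
- by apply: (le_trans hb); rewrite lerDl.
Qed.

Lemma path_diag (j : 'I_n) (s s' : R) : a <= s -> s <= s' -> s' <= b ->
  nc (X (P s') j j - X (P s) j j) <=
  (1 + T) * (Cf * om * Mx * (atan (om * s') - atan (om * s)) + zeta * (s' - s)).
Proof.
move=> as' ss' sb.
pose f u := (1 + T) * (Cf * om * Mx * atan (om * u) + zeta * u).
have -> : (1 + T) * (Cf * om * Mx * (atan (om * s') - atan (om * s)) + zeta * (s' - s)) = f s' - f s.
  by rewrite /f; ring.
apply: (@legs_diag _ T P (fun t => X t j j) (G j j) f
  (fun u => (1 + T) * (Cf * om * Mx * (om / (1 + (om * u) ^+ 2)) + zeta * 1)) a b hP) => // u hu.
- by apply: cdiff_val (ode j j hu); rewrite mu_diag // mul0r add0r.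
- exact: rdiff_scale (rdiff_add (rdiff_scale _ (rdiff_atan om u)) (rdiff_scale _ (rdiff_id u))).
- rewrite ler_pM2l //; apply: le_trans (G_bound_M j j hu) _.
  by rewrite mulr1 lerD2r expr2 le_eqVlt; apply/orP; left; apply/eqP; ring.
Qed.
End Bounded.

(* If M is the maximum of the entries, the estimates above give M <= B + M / 2. *)
Lemma path_absorb (s0 beta betad : R) : a <= s0 <= b -> 0 <= beta -> 0 <= betad ->
  n%:R ^+ 2 * ((1 + T) * (Cf * om * (om / c + pi))) <= 1 / 2 ->
  (forall i j : 'I_n, (i < j)%N -> nc (X (P b) i j) <= beta) ->
  (forall i j : 'I_n, (j < i)%N -> nc (X (P a) i j) <= beta) ->
  (forall j, nc (X (P s0) j j) <= betad) ->
  forall s, a <= s <= b ->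
  entries (X (P s)) <= 2 * (n%:R ^+ 2 * (beta + betad + (1 + T) * zeta * (c^-1 + (b - a)))).
Proof.
move=> hs0 b0 bd0 small hup hdown hdg.
have ab := legs_le hP; have T1 := T0.
have [x hx hmax] := path_max; set Mx := entries (X (P x)) in hmax *.
have Mx0 : 0 <= Mx := entries_ge0 _.
have om2 : 0 <= om ^+ 2 := sqr_ge0 om.
have hphi s : om ^+ 2 / (1 + (om * s) ^+ 2) <= om ^+ 2.
  by rewrite ler_pdivrMr ?(lt_le_trans ltr01) // ler_peMr.
pose Y := (1 + T) * (Cf * om * (om / c + pi)).
pose Z := (1 + T) * zeta * (c^-1 + (b - a)).
have off_le : (1 + T) * (Cf * om ^+ 2 * Mx + zeta) / c <= Y * Mx + Z.
  have -> : Y * Mx + Z = (1 + T) * (Cf * om ^+ 2 * Mx + zeta) / c +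
    ((1 + T) * (Cf * om * pi * Mx) + (1 + T) * (zeta * (b - a))).
    by rewrite /Y /Z; move: (pi : R) => p; field; rewrite gt_eqF.
  rewrite lerDl; have p0 := pi_ge0 R.
  apply: addr_ge0; apply: mulr_ge0; try lra.
    by rewrite !mulr_ge0 // ltW.
  by rewrite mulr_ge0 ?subr_ge0.
have diag_le (s s' : R) : a <= s -> s <= s' -> s' <= b ->
    (1 + T) * (Cf * om * Mx * (atan (om * s') - atan (om * s)) + zeta * (s' - s)) <= Y * Mx + Z.
  move=> h1 h2 h3.
  have k1 : Cf * om * Mx * (atan (om * s') - atan (om * s)) <= Cf * om * Mx * pi.
    rewrite ler_wpM2l //; first by rewrite !mulr_ge0 // ltW.
    have := atan_ltpi2 (om * s'); have := atan_gtNpi2 (om * s); lra.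
  have k2 : zeta * (s' - s) <= zeta * (b - a) by rewrite ler_wpM2l //; lra.
  have -> : Y * Mx + Z = (1 + T) * (Cf * om * Mx * pi + zeta * (b - a)) +
     ((1 + T) * (Cf * om ^+ 2 * Mx + zeta) / c).
    by rewrite /Y /Z; move: (pi : R) => p; field; rewrite gt_eqF.
  apply: (@le_trans _ _ ((1 + T) * (Cf * om * Mx * pi + zeta * (b - a)))).
    by rewrite ler_wpM2l; lra.
  rewrite lerDl; apply: divr_ge0; last exact: ltW.
  apply: mulr_ge0; first lra.
  by apply: addr_ge0 => //; apply: mulr_ge0 => //; exact: mulr_ge0.
have ent i j : nc (X (P x) i j) <= (beta + betad + Z) + Y * Mx.
  have [ij|ji|/val_inj e] := ltngtP i j.
  - have := path_up hmax om2 ij (lexx a) hP (fun s _ => hphi s) (hup i j ij) hx; lra.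
  - have := path_down hmax om2 ji (lexx b) hP (fun s _ => hphi s) (hdown i j ji) hx; lra.
  - rewrite e; case/andP: hx => ax xb; case/andP: hs0 => as0 s0b; have hd := hdg j.
    have [le|/ltW le] := leP x s0.
      have := path_diag hmax j ax le s0b; rewrite ncBC; have := diag_le _ _ ax le s0b.
      have := nc_lower (X (P x) j j) (X (P s0) j j); lra.
    have := path_diag hmax j as0 le xb; have := diag_le _ _ as0 le xb.
    have := nc_lower (X (P x) j j) (X (P s0) j j); lra.
move=> s hs; apply: le_trans (hmax s hs) _.
have := entries_bound ent; rewrite -/Mx mulrDr => k.
have k2 : n%:R ^+ 2 * (Y * Mx) <= 1 / 2 * Mx by rewrite mulrA ler_wpM2r.
rewrite -/Z; lra.
Qed.
End PathSystem.

(** * The tail of the arctangent and the path around the disc *)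

Section PathExt.
Variable R : realType.
Local Notation C := (Cx R).

Lemma legs_ext (T : R) (P P' : R -> C) a b : legs T P a b ->
  (forall u, a <= u <= b -> P u = P' u) -> legs T P' a b.
Proof.
elim=> {a b} [a b p v ab sv hP|a x b l1 IH1 l2 IH2] e.
  by apply: leg_line ab sv _ => s hs; rewrite -e // hP.
apply: (@leg_cat _ _ _ a x b); [apply: IH1|apply: IH2] => u /andP[h1 h2]; apply: e.
  by rewrite h1 (le_trans h2) ?(legs_le l2).
by rewrite h2 andbT (le_trans _ h1) ?(legs_le l1).
Qed.

Lemma leg_affine (T : R) (f : R -> R) (p0 tau a b : R) : a <= b -> `|tau| <= T ->
  (forall u, a <= u <= b -> f u = p0 + tau * u) -> legs T (fun u => mkC u (f u)) a b.
Proof.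
move=> ab ht hf; apply: (@leg_line _ _ _ _ _ (mkC 0 p0) (mkC 1 tau)) => // u hu.
by apply: Cext; rewrite ?reC_pt ?imC_pt /= ?hf //; ring.
Qed.

(** For t < 0 the function -1 / (om t) - atan (om t) is nondecreasing: the tail of the integral of
    the weight is at most the integral of 1 / (om t^2). *)
Lemma atan_diff_neg (om v u : R) : 0 < om -> v <= u -> u < 0 ->
  atan (om * u) - atan (om * v) <= (om * - u)^-1.
Proof.
move=> om0 vu u0; pose g t := - ((om ^-1) * t^-1) - atan (om * t).
have hg t : v <= t <= u -> rdiff g t (- (om^-1 * - t ^- 2) - om / (1 + (om * t) ^+ 2)).
  move=> /andP[_ tu]; have t0 : t != 0 by rewrite lt_eqF //; lra.
  apply: rdiff_sub (rdiff_atan om t); apply: rdiff_opp; exact: rdiff_scale (rdiff_inv t0).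
have h1 : g v <= g u.
  apply: (rdiff_mono vu hg) => t /andP[_ tu].
  have t20 : 0 < t ^+ 2 by rewrite -sqrrN exprn_gt0 //; lra.
  have o20 : 0 < om ^+ 2 by rewrite exprn_gt0.
  have tn : t != 0 by rewrite lt_eqF //; lra.
  have p1 : 0 < 1 + (om * t) ^+ 2 by rewrite ltr_pwDl ?sqr_ge0.
  rewrite mulrN opprK subr_ge0 ler_pdivrMr //.
  have -> : om^-1 / t ^+ 2 * (1 + (om * t) ^+ 2) = om^-1 / t ^+ 2 + om.
    by field; rewrite tn gt_eqF.
  by rewrite lerDr divr_ge0 ?invr_ge0 ?ltW.
have h2 : 0 <= - (om^-1 * v^-1).
  by rewrite -mulrN mulr_ge0 ?invr_ge0 ?(ltW om0) // oppr_ge0 invr_le0; lra.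
have -> : (om * - u)^-1 = - (om^-1 * u^-1) by rewrite mulrN invrN invfM mulrC.
by move: h1; rewrite /g; lra.
Qed.
Variables (T L : R).
Hypothesis T0 : 0 < T.

(* A tent of slope T that avoids the disc around t = 0 on the side of Gamma_s. *)
Definition bump s (u : R) : R := sgs R s * (T * Num.max 0 (L - `|u|)).
Definition path0 s u : C := mkC u (bump s u).

Lemma bump_far s u : L <= `|u| -> bump s u = 0.
Proof. by move=> h1; rewrite /bump (max_idPl _) ?mulr0 // subr_le0. Qed.
Lemma bump_near s u : `|u| <= L -> bump s u = sgs R s * (T * (L - `|u|)).
Proof. by move=> h1; rewrite /bump (max_idPr _) // subr_ge0. Qed.

Lemma sgs_sqr s : sgs R s ^+ 2 = 1.
Proof. by case: s; rewrite /sgs ?sqrrN expr1n. Qed.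

Lemma bump_side s u : 0 <= sgs R s * bump s u.
Proof. by rewrite mulrA -expr2 sgs_sqr mul1r mulr_ge0 ?le_max ?lexx // ltW. Qed.

Hypothesis L0 : 0 < L.

(** By Cauchy-Schwarz T L = T |u| + T (L - |u|) is at most sqrt (1 + T^2) times the modulus of the
    point of the tent. Half of this bound, for L, and half of the obvious one, for u, give the
    constant. *)
Lemma path0_norm s u : T ^+ 2 / (2 * (1 + T ^+ 2)) * (L ^+ 2 + u ^+ 2) <= nc (path0 s u) ^+ 2.
Proof.
have TT : 0 < 1 + T ^+ 2 by rewrite ltr_pwDl ?sqr_ge0.
have k0_half : T ^+ 2 / (2 * (1 + T ^+ 2)) <= 1 / 2.
  by rewrite ler_pdivrMr ?mulr_gt0 // mulrA divfK ?pnatr_eq0 // mul1r lerDr.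
have u2 := sqr_ge0 u; have l2 := sqr_ge0 L.
rewrite nc_sqr /=; have [uL|Lu] := leP `|u| L; last first.
  have : L ^+ 2 <= u ^+ 2 by rewrite -(real_normK (num_real u)) ler_sqr ?nnegrE ?normr_ge0 // ltW.
  have : T ^+ 2 / (2 * (1 + T ^+ 2)) * (L ^+ 2 + u ^+ 2) <= 1 / 2 * (L ^+ 2 + u ^+ 2).
    by rewrite ler_wpM2r // addr_ge0.
  have := sqr_ge0 (bump s u); lra.
rewrite bump_near // [(sgs R s * _) ^+ 2]exprMn sgs_sqr mul1r -(real_normK (num_real u)).
move: `|u| => a; set b := T * (L - a).
have e1 : T * L = T * a + b by rewrite /b; ring.
have e2 : T ^+ 2 * L ^+ 2 <= (1 + T ^+ 2) * (a ^+ 2 + b ^+ 2).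
  rewrite -exprMn e1 -subr_ge0.
  have -> : (1 + T ^+ 2) * (a ^+ 2 + b ^+ 2) - (T * a + b) ^+ 2 = (a - T * b) ^+ 2 by ring.
  exact: sqr_ge0.
have e3 : T ^+ 2 / (1 + T ^+ 2) * L ^+ 2 <= a ^+ 2 + b ^+ 2.
  by rewrite mulrAC ler_pdivrMr // [X in _ <= X]mulrC.
have e4 : T ^+ 2 / (2 * (1 + T ^+ 2)) * L ^+ 2 = T ^+ 2 / (1 + T ^+ 2) * L ^+ 2 / 2.
  by field; rewrite gt_eqF.
have e5 : T ^+ 2 / (2 * (1 + T ^+ 2)) * a ^+ 2 <= 1 / 2 * a ^+ 2 by rewrite ler_wpM2r ?sqr_ge0.
have := sqr_ge0 b; rewrite mulrDr; lra.
Qed.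

Lemma path0_continuous s : continuous (path0 s).
Proof.
move=> u U /nbhs_nc[d d0 hU]; have K0 : 0 < 1 + T by have := T0; lra.
exists (d / (1 + T)) => /=; first by rewrite divr_gt0.
move=> v /=; rewrite distrC ltr_pdivlMr // mulrC => hv; apply: hU.
apply: le_lt_trans hv; apply: (le_trans (nc_le_reim _)); rewrite reB imB /=.
have nb : `|bump s v - bump s u| <= T * `|v - u|.
  rewrite /bump -mulrBr -mulrBr !normrM (gtr0_norm T0).
  have -> : `|sgs R s| = 1 by case: (s); rewrite /sgs ?normrN normr1.
  rewrite mul1r ler_pM2l //; apply: le_trans (max_lipschitz _ _ _) _.
  have -> : L - `|v| - (L - `|u|) = `|u| - `|v| by ring.
  by apply: le_trans (ler_dist_dist _ _) _; rewrite distrC.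
by rewrite mulrDl mul1r lerD2l.
Qed.
End PathExt.

(** * Bounds for H_s along paths, uniform in eps *)

Section Transport.
Variables (R : realType) (gamma r h kappa c0 : R) (w : Cx R).
Local Notation C := (Cx R).
Local Notation phi0 := (gamma * (1 + 2 * gamma / pi)).
Local Notation q := (sqe w).
Local Notation Q := (nc (sqe w)).
Local Notation th := (theta gamma w).
Local Notation N := (Nset r w).
Local Notation ht := (height gamma w).
Local Notation sg := (sigma gamma c0 w).
Local Notation mm := (c0 / nc (sqe w)).
Local Notation hh := (hP gamma w).
Local Notation T := (tan phi0).
Local Notation kp := (kap gamma).
Hypothesis gamma0 : 0 < gamma.
Hypothesis phi_lt : phi0 < pi / 2.
Hypothesis argw : pi - 2 * gamma < imC w < 3 * pi + 2 * gamma.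
Hypothesis r0 : 0 < r.
Hypothesis h_range : 0 < h < r^-1.
Hypothesis kappa_range : 0 < kappa < 1 / 2.
Hypothesis c0_gt0 : 0 < c0.
Hypothesis approx : forall t, t != 0 -> nc t <= 2 / r ->
  csinh (q * t) != 0 /\ nc (xq q t + t^-1) <= eta0 r h / nc t.
Hypothesis Q_small : Q ^+ 2 <= amin r h * r ^+ 3 / 64.
Hypothesis m_big : 2 / r <= mm.
Hypothesis hh_big1 : h + mm * tan phi0 < (1 / 2 - kappa) * hh.
Hypothesis hh_big2 : 2 / r <= (1 / 2 - kappa) * hh.
Local Notation Gam := (Gamma gamma r h kappa c0).
Variables (n : nat) (y : prenormal R n) (rho delta : R).
Local Notation M := 'M[C]_n.
Variables (F H : sect -> C -> C -> M).
Hypothesis HF : model_solutions gamma rho r delta h kappa c0 y F.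
Hypothesis HH : normalizing gamma rho r h kappa c0 y F H.
Hypothesis Sw : Sdom gamma rho w.
Variables (cs r1 KR : R).
Hypothesis cs0 : 0 < cs.
Hypothesis KR0 : 0 < KR.
Hypothesis r10 : 0 < r1.
Hypothesis LD : local_data y phi0 cs r1 KR.
Hypothesis eps_small : nc (eps w) < r1.
Local Notation x_ := (xt w).
Local Notation Hs_ := (Hs H w).
Local Notation good_ := (good y F w).
Local Notation phi om u := (om ^+ 2 / (1 + (om * u) ^+ 2)).

Let T0 : 0 <= T := le_trans (normr_ge0 _) (tan_theta gamma0 phi_lt argw).
Let cth : 0 < cos th := cos_theta_gt0 gamma0 phi_lt argw.
Let cthn : cos th != 0.
Proof. by rewrite gt_eqF. Qed.
Let hh0 : 0 < hh := hP_gt0 gamma0 phi_lt argw.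
Let Q0 : 0 < Q := Q_gt0 w.
Let kp0 : 0 < kp.
Proof. by have /andP[] := kap_range gamma0 phi_lt. Qed.
Let Gopen := @Gamma_open _ _ r h kappa _ _ gamma0 phi_lt argw c0_gt0.
Let Gcsinh := @Gamma_csinh _ _ _ _ _ _ _ gamma0 phi_lt argw h_range kappa_range c0_gt0 hh_big1.

(** [om] is the inverse of the length scale of the path: |sqrt(eps)| for the line [mid], 1/L for
    [path1]. *)
Definition path_ok s (P : R -> C) om Cx a b := legs T P a b /\
  forall u, a <= u <= b -> [/\ Gam s w (P u), good_ s (P u), nc (x_ (P u)) < r1 &
     nc (x_ (P u) ^+ 2 - eps w) <= Cx * phi om u].

Lemma Rem_mul_bound e x (A : M) i j : nc e < r1 -> nc x < r1 -> nc ((Rem y e x *m A) i j) <= KR * entries A.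
Proof.
move=> e1 x1; have [_ hR _ _] := LD; rewrite mxE; apply: le_trans (nc_sum _ _ _) _.
apply: (@le_trans _ _ (\sum_(k < n) KR * nc (A k j))).
  by apply: ler_sum => k _; rewrite ncM ler_wpM2r ?nc_ge0 // hR.
rewrite -mulr_sumr ler_wpM2l ?(ltW KR0) // /entries; apply: ler_sum => k _.
by rewrite (bigD1 j) //= lerDl sumr_ge0 // => l _; exact: nc_ge0.
Qed.

Lemma Hs_entry s t i j : Gam s w t -> good_ s t ->
  cdiff (fun u => Hs_ s u i j) t ((lam y i (eps w) (x_ t) - lam y j (eps w) (x_ t)) * Hs_ s t i j +
    (x_ t ^+ 2 - eps w) * (Rem y (eps w) (x_ t) *m Hs_ s t) i j).
Proof.
move=> ht' gt; have [_ /(_ i j)] := Hs_ode HH Sw Gcsinh ht' gt; apply: cdiff_val.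
rewrite /Bmx /Lam mulmxDl mul_diag_mx mul_mx_diag -scalemxAl.
by move: (Rem y _ _ *m _) => A; rewrite !mxE; ring.
Qed.

Section OnPath.
Variables (s : sect) (P : R -> C) (om Cx a b : R).
Hypothesis om0 : 0 < om.
Hypothesis Cx0 : 0 <= Cx.
Hypothesis pok : path_ok s P om Cx a b.
Let mu i j u := lam y i (eps w) (x_ (P u)) - lam y j (eps w) (x_ (P u)).
Let G i j u := (x_ (P u) ^+ 2 - eps w) * (Rem y (eps w) (x_ (P u)) *m Hs_ s (P u)) i j.
Let Cf := Cx * KR.
Let Cf0 : 0 <= Cf.
Proof. by rewrite mulr_ge0 // ltW. Qed.

Let ode i j u : a <= u <= b ->
  cdiff (fun t => Hs_ s t i j) (P u) (mu i j u * Hs_ s (P u) i j + G i j u).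
Proof. by move=> /pok.2[hG hg _ _]; exact: Hs_entry. Qed.

Let mu_diag j u : a <= u <= b -> mu j j u = 0.
Proof. by rewrite /mu subrr. Qed.

Let mu_up (i j : 'I_n) u v : (i < j)%N -> a <= u <= b -> slope T v -> cs <= reC (v * mu i j u).
Proof. by move=> ij /pok.2[_ _ hx _] sv; have [h1 _ _ _] := LD; exact: h1. Qed.

Let mu_down (i j : 'I_n) u v : (j < i)%N -> a <= u <= b -> slope T v -> reC (v * mu i j u) <= - cs.
Proof. by move=> ij hu sv; rewrite /mu -opprB mulrN reN lerN2; exact: mu_up. Qed.

Let G_bound i j u : a <= u <= b -> nc (G i j u) <= Cf * phi om u * entries (Hs_ s (P u)) + 0.
Proof.
move=> /pok.2[_ _ hx h2]; rewrite addr0 /G ncM /Cf.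
have -> : Cx * KR * phi om u * entries (Hs_ s (P u)) = (Cx * phi om u) * (KR * entries (Hs_ s (P u))) by ring.
by apply: ler_pM; rewrite ?nc_ge0 //; exact: Rem_mul_bound.
Qed.

Lemma transport_bound (s0 beta betad : R) : a <= s0 <= b -> 0 <= beta -> 0 <= betad ->
  n%:R ^+ 2 * ((1 + T) * (Cx * KR * om * (om / cs + pi))) <= 1 / 2 ->
  (forall i j : 'I_n, (i < j)%N -> nc (Hs_ s (P b) i j) <= beta) ->
  (forall i j : 'I_n, (j < i)%N -> nc (Hs_ s (P a) i j) <= beta) ->
  (forall j, nc (Hs_ s (P s0) j j) <= betad) ->
  forall u, a <= u <= b -> entries (Hs_ s (P u)) <= 2 * (n%:R ^+ 2 * (beta + betad)).
Proof.
move=> h1 h2 h3 h4 h5 h6 h7 u hu.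
have := path_absorb T0 cs0 Cf0 om0 (lexx 0) pok.1 ode mu_diag mu_up mu_down G_bound h1 h2 h3 h4 h5 h6 h7 hu.
by rewrite mulr0 mul0r addr0.
Qed.

Variable Mx : R.
Hypothesis Mx_bound : forall u, a <= u <= b -> entries (Hs_ s (P u)) <= Mx.

Lemma transport_diag j u v : a <= u -> u <= v -> v <= b ->
  nc (Hs_ s (P v) j j - Hs_ s (P u) j j) <= (1 + T) * (Cx * KR * om * Mx * (atan (om * v) - atan (om * u))).
Proof.
move=> h1 h2 h3.
have := path_diag T0 Cf0 pok.1 ode mu_diag G_bound Mx_bound j h1 h2 h3.
by rewrite mul0r addr0.
Qed.

Lemma transport_up (Phi : R) (i j : 'I_n) (x beta : R) : 0 <= Phi -> (i < j)%N -> a <= x -> legs T P x b ->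
  (forall u, x <= u <= b -> phi om u <= Phi) -> nc (Hs_ s (P b) i j) <= beta ->
  nc (Hs_ s (P x) i j) <= beta + (1 + T) * (Cx * KR * Phi * Mx) / cs.
Proof.
move=> h0 h1 h2 h3 h4 h5.
have := path_up T0 cs0 Cf0 (lexx 0) pok.1 ode mu_up G_bound Mx_bound h0 h1 h2 h3 h4 h5 (s := x).
by rewrite addr0; apply; rewrite lexx (legs_le h3).
Qed.

Lemma transport_down (Phi : R) (i j : 'I_n) (x beta : R) : 0 <= Phi -> (j < i)%N -> x <= b -> legs T P a x ->
  (forall u, a <= u <= x -> phi om u <= Phi) -> nc (Hs_ s (P a) i j) <= beta ->
  nc (Hs_ s (P x) i j) <= beta + (1 + T) * (Cx * KR * Phi * Mx) / cs.
Proof.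
move=> h0 h1 h2 h3 h4 h5.
have := path_down T0 cs0 Cf0 (lexx 0) pok.1 ode mu_down G_bound Mx_bound h0 h1 h2 h3 h4 h5 (s := x).
by rewrite addr0; apply; rewrite lexx (legs_le h3).
Qed.
End OnPath.

Definition sing_of (sgn : R) : sing := if sgn == 1 then pL else pR.

Lemma ray_value s (K : M) t sgn : sgn = 1 \/ sgn = -1 ->
  (forall a, 0 <= a -> Gam s w (t + rc (sgn * a) * edir gamma w)) ->
  H s w @ within (Omega gamma r h kappa c0 s w) (nbhs (xs (sing_of sgn) w)) --> K ->
  forall e : R, 0 < e -> exists X0 : R, forall a, X0 <= a -> forall i j,
    nc (Hs_ s (t + rc (sgn * a) * edir gamma w) i j - K i j) < e.
Proof.
move=> hsg hG hK e e0.
have ptE a : pt t (rc sgn * edir gamma w) a = t + rc (sgn * a) * edir gamma w.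
  by rewrite /pt rcM mulrA [rc a * _]mulrC.
have xsE : xs (sing_of sgn) w = rc sgn * sqe w.
  rewrite /sing_of; case: hsg => ->; first by rewrite eqxx rc1 mul1r.
  have -> : (-1 == 1 :> R) = false by apply/negbTE; rewrite lt_eqF //; lra.
  by rewrite rcN rc1 mulN1r.
have hlim : (fun a => Hs_ s (pt t (rc sgn * edir gamma w) a)) @ +oo --> K.
  apply: Hs_ray hK => [a a0|e' e'0]; first by rewrite ptE; exact: hG.
  have [S0 hS] := ray_limit gamma0 phi_lt argw t hsg e'0.
  by exists S0 => a /hS; rewrite xsE ptE.
have : \forall a \near +oo, forall ij : 'I_n * 'I_n,
    nc (Hs_ s (pt t (rc sgn * edir gamma w) a) ij.1 ij.2 - K ij.1 ij.2) < e.
  apply: filter_forall => ij.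
  by have /mx_cvgP/(_ ij.1 ij.2)/cvg_nc/(_ e e0) := hlim.
case=> X0 [_ hX]; exists (X0 + 1) => a ha i j; have := hX a ltac:(lra) (i, j).
by rewrite ptE.
Qed.

Let Cm : R := 4 / kp ^+ 2.
Hypothesis Q_le1 : Q <= 1.
Hypothesis small_mid : n%:R ^+ 2 * ((1 + T) * (Cm * KR * Q * (Q / cs + pi))) <= 1 / 2.
Hypothesis x_mid : Q ^+ 2 * (Cm + 1) < r1 ^+ 2.

(** The rate at which the limits at x_L and x_R approach 1: 4 n^2 bounds the entries of H_D on
    [mid], pi the variation of the arctangent, and the final 1 pays for stopping at a finite point
    of the line. *)
Definition CK : R := (1 + T) * (Cm * KR * (4 * n%:R ^+ 2) * pi) + 1.

Let mid u : C := rc (-1 / 2) * per w + rc u * (1 + iC R * rc (tan th)).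

Let midE u : mid u = rc (-1 / 2) * per w + rc (u / cos th) * edir gamma w.
Proof. by rewrite /mid (slope_edir gamma0 phi_lt argw) rcM mulrA. Qed.

Let mid_high a : Gam sD w (rc (-1 / 2) * per w + rc a * edir gamma w).
Proof.
apply: high_D => //; rewrite /high /= !heightD !heightZ height_edir -/(hP gamma w) mulr0 addr0.
by case/andP: kappa_range => k0 k1; have := mulr_gt0 k0 hh0; move=> *; apply/andP; split; lra.
Qed.

Let Cm0 : 0 < Cm.
Proof. by rewrite divr_gt0 // exprn_gt0. Qed.

Lemma mid_ok X : 0 <= X -> path_ok sD mid Q Cm (- X) X.
Proof.
move=> X0; split.
  apply: (@leg_line _ _ _ _ _ (rc (-1 / 2) * per w) (1 + iC R * rc (tan th))); first lra.
    split; first by rewrite reD reM re_iC im_iC im_rc mul0r mulr0 subr0 addr0.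
    rewrite imD imM re_iC im_iC im_rc re_rc mul0r mul1r !add0r.
    exact: (tan_theta gamma0 phi_lt argw).
  by [].
move=> u _; have hG : Gam sD w (mid u) by rewrite midE.
have [_ hb] := midline_bound gamma0 phi_lt argw (u / cos th) (or_intror (erefl (-1 : R))).
have hb2 : nc (x_ (mid u) ^+ 2 - eps w) <= Cm * phi Q u.
  rewrite midE eps_sqe; apply: (le_trans hb); rewrite -/Cm ler_pM2l // ler_wpM2l ?sqr_ge0 //.
  rewrite lef_pV2 ?posrE ?ltr_pwDl ?sqr_ge0 // lerD2l ![(Q * _) ^+ 2]exprMn ler_wpM2l ?sqr_ge0 //.
  have c2 : cos th ^+ 2 <= 1 by rewrite expr_le1 ?cos_le1 // ltW.
  by rewrite [(u / _) ^+ 2]exprMn ler_peMr ?sqr_ge0 // exprVn invf_ge1 ?exprn_gt0.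
split=> //; first exact: (good_D HF Sw Gopen Gcsinh).
rewrite -ltr_sqr ?nnegrE ?nc_ge0 ?(ltW r10) //; apply: le_lt_trans x_mid.
rewrite -ncX; have := nc_lower (x_ (mid u) ^+ 2) (eps w); rewrite eps_sqe ncX -eps_sqe => k1.
have : Cm * phi Q u <= Cm * Q ^+ 2.
  rewrite ler_pM2l // ler_pdivrMr ?ltr_pwDl ?sqr_ge0 // ler_peMr ?sqr_ge0 // lerDl sqr_ge0 //.
have eQ : nc (eps w) = Q ^+ 2 by rewrite eps_sqe ncX.
have -> : nc (eps w) * (Cm + 1) = Cm * Q ^+ 2 + Q ^+ 2 by rewrite eQ; ring.
rewrite eQ in k1; lra.
Qed.

(** Along [mid] the integral of |x^2 - eps| is O(|sqrt(eps)|), because the scale there is 1 /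
    |sqrt(eps)|; a diagonal entry thus moves that little between x = 0 and the ends. As the limits
    do not depend on s, a line in Gamma_D suffices. *)
Lemma K_near1 : exists K : sing -> M, [/\
  forall l i j, i != j -> K l i j = 0, forall l j, nc (K l j j - 1) <= CK * Q &
  forall l s, H s w @ within (Omega gamma r h kappa c0 s w) (nbhs (xs l w)) --> K l].
Proof.
have [K [HK _ _]] := H_lim HH; exists (fun l => K l w).
have hlim l s : H s w @ within (Omega gamma r h kappa c0 s w) (nbhs (xs l w)) --> K l w.
  by have [_ _] := HK l w Sw; apply.
have Koff l i j : i != j -> K l w i j = 0.
  by move=> ij; have [/is_diag_mxP hd _ _] := HK l w Sw; exact: hd.
split=> // l j.
have rayv sgn : sgn = 1 \/ sgn = -1 -> exists X0 : R, forall a, X0 <= a -> forall i k,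
    nc (Hs_ sD (rc (-1 / 2) * per w + rc (sgn * a) * edir gamma w) i k - K (sing_of sgn) w i k) < Q.
  by move=> hsg; apply: ray_value => // a _; exact: mid_high.
have s1 : (1 : R) = 1 \/ (1 : R) = -1 by left.
have s2 : (-1 : R) = 1 \/ (-1 : R) = -1 by right.
have [Xp hXp] := rayv _ s1; have [Xm hXm] := rayv _ s2.
have l1 : sing_of 1 = pL by rewrite /sing_of eqxx.
have l2 : sing_of (-1) = pR.
  by rewrite /sing_of (_ : (-1 == 1 :> R) = false) //; apply/negbTE; rewrite lt_eqF //; lra.
rewrite l1 in hXp; rewrite l2 in hXm.
pose a := Num.max 0 (Num.max Xp Xm).
have a0 : 0 <= a by rewrite /a le_max lexx.
have ap : Xp <= a by rewrite /a !le_max lexx orbT.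
have am : Xm <= a by rewrite /a !le_max lexx !orbT.
pose X := a * cos th.
have X0 : 0 <= X by rewrite mulr_ge0 // ltW.
have eP : mid X = rc (-1 / 2) * per w + rc (1 * a) * edir gamma w.
  by rewrite midE /X mulfK // mul1r.
have eM : mid (- X) = rc (-1 / 2) * per w + rc (-1 * a) * edir gamma w.
  have e' : - X / cos th = -1 * a by rewrite /X; field.
  by rewrite midE e'.
have vp i k : nc (Hs_ sD (mid X) i k - K pL w i k) < Q by rewrite eP; exact: hXp.
have vm i k : nc (Hs_ sD (mid (- X)) i k - K pR w i k) < Q by rewrite eM; exact: hXm.
have m0 : Hs_ sD (mid 0) = H sD w 0.
  rewrite /Hs /mid rc0 mul0r addr0; congr (H sD w _).
  by have := midline_zero w (or_intror (erefl (-1 : R))).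
have hok := mid_ok X0.
have z0 : - X <= 0 <= X by apply/andP; split; lra.
have Mb := @transport_bound sD mid Q Cm (- X) X Q0 (ltW Cm0) hok 0 Q 1 z0 (ltW Q0) ler01 small_mid.
have Mb2 u : - X <= u <= X -> entries (Hs_ sD (mid u)) <= 4 * n%:R ^+ 2.
  move=> hu; apply: le_trans (Mb _ _ _ u hu) _.
  - move=> i k ik; have := vp i k; rewrite Koff ?subr0; first by move/ltW.
    by apply/eqP => e; rewrite e ltnn in ik.
  - move=> i k ik; have := vm i k; rewrite Koff ?subr0; first by move/ltW.
    by apply/eqP => e; rewrite e ltnn in ik.
  - by move=> k; rewrite m0 (H_normal HH) // nc1.
  - have -> : 4 * n%:R ^+ 2 = 2 * (n%:R ^+ 2 * 2) :> R by ring.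
    by rewrite ler_pM2l // ler_wpM2l ?sqr_ge0 //; have := Q_le1; lra.
have XX : - X <= X by lra.
have dg u v : - X <= u -> u <= v -> v <= X -> nc (Hs_ sD (mid v) j j - Hs_ sD (mid u) j j) <=
    (1 + T) * (Cm * KR * (4 * n%:R ^+ 2) * pi) * Q.
  move=> h1 h2 h3; apply: (le_trans (transport_diag (ltW Cm0) hok Mb2 j h1 h2 h3)).
  rewrite -[X in _ <= X]mulrA; apply: ler_wpM2l; first by have := T0; lra.
  have k := atan_ltpi2 (Q * v); have k' := atan_gtNpi2 (Q * u).
  have -> : Cm * KR * (4 * n%:R ^+ 2) * pi * Q = Cm * KR * Q * (4 * n%:R ^+ 2) * pi.
    by move: (pi : R) => p; ring.
  apply: ler_wpM2l; last by lra.
  exact: (mulr_ge0 (mulr_ge0 (mulr_ge0 (ltW Cm0) (ltW KR0)) (ltW Q0)) (mulr_ge0 (ler0n _ 4) (sqr_ge0 _))).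
have n1 : Hs_ sD (mid 0) j j = 1 by rewrite m0 (H_normal HH).
have CKE : CK * Q = (1 + T) * (Cm * KR * (4 * n%:R ^+ 2) * pi) * Q + Q by rewrite /CK mulrDl mul1r.
rewrite CKE; case: l.
  have := dg 0 X ltac:(lra) X0 (lexx _); rewrite n1 => k1; have := vp j j; rewrite ncBC => k2.
  have -> : K pL w j j - 1 = (K pL w j j - Hs_ sD (mid X) j j) + (Hs_ sD (mid X) j j - 1) by ring.
  by apply: le_trans (ncD _ _) _; lra.
have := dg (- X) 0 (lexx _) ltac:(lra) X0; rewrite n1 ncBC => k1; have := vm j j; rewrite ncBC => k2.
have -> : K pR w j j - 1 = (K pR w j j - Hs_ sD (mid (- X)) j j) + (Hs_ sD (mid (- X)) j j - 1) by ring.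
by apply: le_trans (ncD _ _) _; lra.
Qed.

Variable L : R.
Local Notation k0 := (T ^+ 2 / (2 * (1 + T ^+ 2))).
(** 16 / kap^2 comes from [strip_bound]. Division by the constant of [path0_norm] replaces 1 / |t|^2
    by 1 / (L^2 + u^2), the weight for om = 1/L. *)
Definition Cb : R := 16 / kp ^+ 2 / k0.
Hypothesis L_ge1 : 1 <= L.
Hypothesis L_m : L <= mm.
Hypothesis L_far : (2 / r) ^+ 2 <= k0 * L ^+ 2.
Hypothesis c0_small : c0 * T <= kp / 8.
Hypothesis small_out : n%:R ^+ 2 * ((1 + T) * (Cb * KR * L^-1 * (L^-1 / cs + pi))) <= 1 / 2.
Hypothesis x_out : Q ^+ 2 + Cb / L ^+ 2 < r1 ^+ 2.

(** For |u| <= m it coincides with [path0], which does not depend on eps; on this part H_s(eps, .)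
    and H_s(0, .) can be compared. *)
Definition path1 s u : C := mkC u (sg u + bump T L s u).

Let T1 : 0 < T.
Proof.
have g1 : 0 < phi0.
  by rewrite mulr_gt0 // ltr_wpDr // divr_ge0 ?pi_ge0 // mulr_ge0 // ltW.
have p1 := phi_lt; have pp := pi_gt0 R; rewrite /tan divr_gt0 //.
  by apply: sin_gt0_pi; rewrite g1 /=; lra.
by apply: cos_gt0_pihalf; rewrite p1 andbT; lra.
Qed.
Let L0 : 0 < L.
Proof. by apply: lt_le_trans L_ge1. Qed.
Let mm0 : 0 < mm.
Proof. exact: lt_le_trans L_m. Qed.
Let TT : 0 < 1 + T ^+ 2.
Proof. by rewrite ltr_pwDl ?sqr_ge0. Qed.
Let k00 : 0 < k0.
Proof. exact: divr_gt0 (exprn_gt0 2 T1) (mulr_gt0 (ltr0Sn _ 1) TT). Qed.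
Let k0_half : k0 <= 1 / 2.
Proof. by rewrite ler_pdivrMr ?mulr_gt0 // mulrA divfK ?pnatr_eq0 // mul1r lerDr. Qed.
Let Cb0 : 0 < Cb.
Proof. exact: divr_gt0 (divr_gt0 (ltr0Sn _ 15) (exprn_gt0 2 kp0)) k00. Qed.

Lemma path01 s u : `|u| <= mm -> path1 s u = path0 T L s u.
Proof. by move=> hu; rewrite /path1 sigma_small // add0r. Qed.

Lemma path_norm s u : k0 * (L ^+ 2 + u ^+ 2) <= nc (path1 s u) ^+ 2.
Proof.
have [uL|Lu] := leP `|u| L.
  by rewrite path01; [exact: path0_norm|exact: le_trans L_m].
have u2 := sqr_ge0 u; have l2 := sqr_ge0 L; rewrite nc_sqr /=.
have : L ^+ 2 <= u ^+ 2 by rewrite -(real_normK (num_real u)) ler_sqr ?nnegrE ?normr_ge0 // ltW.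
have : k0 * (L ^+ 2 + u ^+ 2) <= 1 / 2 * (L ^+ 2 + u ^+ 2) by rewrite ler_wpM2r // addr_ge0.
have := sqr_ge0 (sg u + bump T L s u); lra.
Qed.

Lemma path_far s u : 2 / r <= nc (path1 s u).
Proof.
have rr : 0 <= 2 / r by rewrite divr_ge0 // ltW.
rewrite -ler_sqr ?nnegrE ?nc_ge0 //; apply: (le_trans L_far).
by apply: le_trans (path_norm s u); rewrite ler_pM2l // lerDl sqr_ge0.
Qed.

Let htE t : ht t = cos th * (imC t - reC t * tan th) := height_slope gamma0 phi_lt argw t.
Let cos1 : cos th <= 1 := cos_le1 th.
Let Tth : `|tan th| <= T := tan_theta gamma0 phi_lt argw.

Lemma path_height s u : `|ht (path1 s u)| <= mm * T.
Proof.
rewrite htE normrM (gtr0_norm cth) /=.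
suff h1 : `|sg u + bump T L s u - u * tan th| <= mm * T.
  by apply: le_trans h1; rewrite ler_piMl ?normr_ge0.
have [uL|Lu] := leP `|u| L; last by rewrite bump_far ?addr0 ?(ltW Lu) //; exact: sigma_slope.
rewrite sigma_small ?add0r //; last exact: le_trans L_m.
rewrite bump_near //; apply: le_trans (ler_normB _ _) _.
have n1 : `|sgs R s| = 1 by case: (s); rewrite /sgs ?normrN normr1.
have k0 := T0; have k3 := L_m; have k4 := normr_ge0 u; move: Tth k0 => k1 k0.
move: (tan phi0) (tan th) k0 k1 => T' t' k0 k1.
rewrite !normrM n1 mul1r (ger0_norm k0) (ger0_norm (x := L - _)) ?subr_ge0 //.
have : `|u| * `|t'| <= `|u| * T' by rewrite ler_wpM2l.
have : L * T' <= mm * T' by rewrite ler_wpM2r.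
by rewrite mulrBr [T' * L]mulrC [T' * `|u|]mulrC; lra.
Qed.

Lemma path_side s (sgn u : R) : sgn = 1 \/ sgn = -1 -> L <= sgn * u ->
  side gamma r h kappa c0 w sgn (path1 s u).
Proof.
move=> hsg hu; have uL : L <= `|u|.
  apply: le_trans hu _; case: hsg => ->; first by rewrite mul1r ler_norm.
  by rewrite mulN1r -(normrN u) ler_norm.
apply: side_strip => //=; first by apply: (far_not_N (h := h)) => //; exact: path_far.
  by rewrite bump_far // addr0 subrr normr0; case/andP: h_range.
exact: lt_le_trans hu.
Qed.

Let far_cases u : L <= `|u| -> exists2 sgn : R, sgn = 1 \/ sgn = -1 & L <= sgn * u.
Proof.
move=> hu; have [u0|/ltW u0] := leP 0 u.
  by exists 1; [left|rewrite mul1r -(ger0_norm u0)].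
by exists (-1); [right|rewrite mulN1r -(ler0_norm u0)].
Qed.

Lemma path_Gam s u : Gam s w (path1 s u).
Proof.
have [uL|/ltW/far_cases[sgn hsg hu]] := leP `|u| L; last first.
  by have [h1 h2 _] := path_side s hsg hu; case: s {hu} h1 h2.
apply/GammaP; split; first by apply: (far_not_N (h := h)) => //; exact: path_far.
  rewrite /= addrAC subrr add0r bump_near // mulrA -expr2 sgs_sqr mul1r.
  by have : 0 <= T * (L - `|u|); [rewrite mulr_ge0 ?subr_ge0|case/andP: h_range => *; lra].
have hb1 := hh_big1; case/andP: kappa_range => kk0 kk1; case/andP: h_range => hk0 _.
have := path_height s u; rewrite ler_norml => /andP[k1 k2].
have : 0 < kappa * hh by rewrite mulr_gt0.
by case: s k1 k2; rewrite /sgs ?mulN1r ?mul1r => k1 k2 *; lra.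
Qed.

Lemma path_good s u : good_ s (path1 s u).
Proof.
case: s; first by apply: (good_D HF Sw Gopen Gcsinh); exact: path_Gam.
have [uL|/ltW/far_cases[sgn hsg hu]] := leP `|u| L; last first.
  exact: (good_side gamma0 phi_lt argw r0 h_range kappa_range c0_gt0 approx Q_small m_big hh_big1 hh_big2 HF Sw hsg
    (path_side sU hsg hu)).
have b0 : 0 <= bump T L sU u by rewrite bump_near // /sgs mul1r mulr_ge0 ?subr_ge0.
have s0 : sg u = 0 by apply: sigma_small => //; exact: le_trans L_m.
apply: (good_above gamma0 phi_lt argw r0 h_range kappa_range c0_gt0 approx m_big hh_big1 hh_big2 HF Sw).
- exact: path_far.
- by rewrite /= s0 add0r.
- by rewrite /= s0 add0r.
have := path_height sU u; rewrite ler_norml => /andP[_ k2]; have hb1 := hh_big1.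
case/andP: kappa_range => kk0 kk1; case/andP: h_range => hk0 _.
have : 0 < kappa * hh by rewrite mulr_gt0.
lra.
Qed.

Lemma path_xbound s u : nc (x_ (path1 s u) ^+ 2 - eps w) <= Cb * phi L^-1 u.
Proof.
have nz : path1 s u != 0 by rewrite -nc_gt0; apply: lt_le_trans (path_far s u); rewrite divr_gt0.
have sb : Q * `|ht (path1 s u)| <= kp / 8.
  apply: le_trans c0_small; apply: (@le_trans _ _ (Q * (mm * T))).
    by rewrite ler_pM2l //; exact: path_height.
  by rewrite mulrA [Q * mm]mulrC divfK ?gt_eqF.
have [_ hb] := strip_bound gamma0 phi_lt argw nz sb.
rewrite eps_sqe; apply: (le_trans hb).
have -> : Cb * phi L^-1 u = 16 / kp ^+ 2 / (k0 * (L ^+ 2 + u ^+ 2)).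
  have p1 : 0 < 1 + (L^-1 * u) ^+ 2 by rewrite ltr_pwDl ?sqr_ge0.
  have p2 : 0 < L ^+ 2 + u ^+ 2 by rewrite ltr_pwDl ?sqr_ge0 ?exprn_gt0.
  have -> : phi L^-1 u = (L ^+ 2 + u ^+ 2)^-1.
    rewrite (_ : L ^+ 2 + u ^+ 2 = L ^+ 2 * (1 + (L^-1 * u) ^+ 2)); last by field; rewrite gt_eqF.
    by rewrite invfM exprVn.
  by rewrite /Cb (invfM k0) mulrA.
have p2 : 0 < L ^+ 2 + u ^+ 2 by rewrite ltr_pwDl ?sqr_ge0 ?exprn_gt0.
have p3 := mulr_gt0 k00 p2; have p4 := path_norm s u.
have p5 : 0 < 16 / kp ^+ 2 by rewrite divr_gt0 ?exprn_gt0.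
by rewrite ler_pM2l // lef_pV2 // posrE; exact: lt_le_trans p4.
Qed.

Let phi_le1 u : phi L^-1 u <= (L ^+ 2)^-1.
Proof.
rewrite exprVn ler_pdivrMr ?ltr_pwDl ?sqr_ge0 // ler_peMr ?invr_ge0 ?sqr_ge0 //.
by rewrite lerDl sqr_ge0.
Qed.

Lemma path_xsmall s u : nc (x_ (path1 s u)) < r1.
Proof.
rewrite -ltr_sqr ?nnegrE ?nc_ge0 ?(ltW r10) //; apply: le_lt_trans x_out.
have := nc_lower (x_ (path1 s u) ^+ 2) (eps w); rewrite (ncX (x_ _)).
have := path_xbound s u; have : Cb * phi L^-1 u <= Cb / L ^+ 2 by rewrite ler_pM2l.
have -> : nc (eps w) = Q ^+ 2 by rewrite eps_sqe ncX.
lra.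
Qed.

Let legs_mid s : legs T (path1 s) (- L) L.
Proof.
have Ls u : - L <= u <= L -> `|u| <= mm /\ `|u| <= L.
  by move=> /andP[? ?]; have -> : `|u| <= L by [rewrite ler_norml; apply/andP; split; lra];
     rewrite (le_trans _ L_m) // ler_norml; apply/andP; split; lra.
have nT c : c = 1 \/ c = -1 -> `|c * T| <= T.
  by case=> ->; rewrite ?mul1r ?mulN1r ?normrN ger0_norm.
apply: (@leg_cat _ _ _ _ 0).
  apply: (leg_affine (p0 := sgs R s * (T * L)) (tau := sgs R s * T)); first by have := L0; lra.
    by apply: nT; case: s; rewrite /sgs; [right|left].
  move=> u /andP[u1 u2]; have [|k1 k2] := Ls u; first by have := L0; move=> ?; apply/andP; split; lra.
  by rewrite sigma_small // add0r bump_near // ler0_norm //; ring.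
apply: (leg_affine (p0 := sgs R s * (T * L)) (tau := - sgs R s * T)); first by have := L0; lra.
  by apply: nT; case: s; rewrite /sgs ?opprK; [left|right].
move=> u /andP[u1 u2]; have [|k1 k2] := Ls u; first by have := L0; move=> ?; apply/andP; split; lra.
by rewrite sigma_small // add0r bump_near // ger0_norm //; ring.
Qed.

Let legs_flat s a b : a <= b -> (forall u, a <= u <= b -> L <= `|u| <= mm) -> legs T (path1 s) a b.
Proof.
move=> ab hu; apply: (leg_affine (p0 := 0) (tau := 0)) => //; first by rewrite normr0.
move=> u /hu/andP[h1 h2]; rewrite sigma_small // bump_far // mul0r addr0 //.
Qed.

Lemma legs_right s A X : L <= A <= mm -> mm <= X -> legs T (path1 s) A X.
Proof.
move=> /andP[h1 h2] h3; apply: (@leg_cat _ _ _ _ mm).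
  apply: legs_flat => // u /andP[k1 k2]; rewrite ger0_norm; last by have := L0; lra.
  by apply/andP; split; lra.
apply: (leg_affine (p0 := - mm * tan th) (tau := tan th)) => // u /andP[k1 k2].
have m0 := mm0; rewrite sigma_right // bump_far; first by ring.
by rewrite ger0_norm; [exact: le_trans L_m k1|lra].
Qed.

Lemma legs_left s A X : L <= A <= mm -> mm <= X -> legs T (path1 s) (- X) (- A).
Proof.
move=> /andP[h1 h2] h3; have l0 := L0; have m0 := mm0.
apply: (@leg_cat _ _ _ _ (- mm)); last first.
  apply: legs_flat; first lra.
  by move=> u /andP[k1 k2]; rewrite ler0_norm; [apply/andP; split; lra|lra].
apply: (leg_affine (p0 := mm * tan th) (tau := tan th)) => //; first lra.
move=> u /andP[k1 k2]; rewrite sigma_left //.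
have k3 := L_m; rewrite bump_far; first by ring.
by rewrite ler0_norm; lra.
Qed.

Lemma legs_core s A : L <= A <= mm -> legs T (path1 s) (- A) A.
Proof.
move=> /andP[h1 h2]; have l0 := L0; apply: (@leg_cat _ _ _ _ (- L)).
  apply: legs_flat; first lra.
  by move=> u /andP[k1 k2]; rewrite ler0_norm; [apply/andP; split; lra|lra].
apply: leg_cat (legs_mid s) _; apply: legs_flat => // u /andP[k1 k2].
by rewrite ger0_norm; [apply/andP; split; lra|lra].
Qed.

Lemma path1_ok s X : mm <= X -> path_ok s (path1 s) L^-1 Cb (- X) X.
Proof.
move=> hX; have Lm : L <= L <= mm by rewrite lexx L_m.
split; last first.
  by move=> u _; split; [exact: path_Gam|exact: path_good|exact: path_xsmall|exact: path_xbound].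
exact: leg_cat (legs_left s Lm hX) (leg_cat (legs_mid s) (legs_right s Lm hX)).
Qed.

(** Its terms are the distance to the limits at the ends, the off-diagonal estimate and the diagonal
    one. 8 n^2 = 2 n^2 (1 + 3) bounds the entries of H_s on the path: at its right end the
    off-diagonal entries are at most 1 and the diagonal ones at most 3. *)
Definition Bb : R := 1 + (1 + T) * (Cb * KR * (8 * n%:R ^+ 2)) / cs + (1 + T) * (Cb * KR * (8 * n%:R ^+ 2)).
Hypothesis CK_small : CK * Q <= 1.

(* The entries above, below and on the diagonal are controlled from the right end, the left end, and
   either end of the path, where H tends to a diagonal matrix close to 1. *)
Lemma H_near1 s A : L <= A <= mm -> [/\
  forall i j : 'I_n, (i < j)%N -> nc (Hs_ s (path1 s A) i j) <= Bb / A,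
  forall i j : 'I_n, (j < i)%N -> nc (Hs_ s (path1 s (- A)) i j) <= Bb / A &
  forall j : 'I_n, nc (Hs_ s (path1 s (- A)) j j - 1) <= CK * Q + Bb / A].
Proof.
move=> hA; case/andP: (hA) => LA Am; have A1 : 1 <= A := le_trans L_ge1 LA.
have A0 : 0 < A by apply: lt_le_trans A1.
have [K [Koff Kdiag Klim]] := K_near1.
have e0 : 0 < (A ^+ 2)^-1 by rewrite invr_gt0 exprn_gt0.
have e1 : (A ^+ 2)^-1 <= A^-1 by rewrite lef_pV2 ?posrE ?exprn_gt0 // expr2 ler_peMr // ltW.
have e2 : A^-1 <= 1 by rewrite invf_le1.
have s1 : (1 : R) = 1 \/ (1 : R) = -1 by left.
have s2 : (-1 : R) = 1 \/ (-1 : R) = -1 by right.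
have rayv sgn : sgn = 1 \/ sgn = -1 -> exists X0 : R, forall a, X0 <= a -> forall i k,
    nc (Hs_ s (rc (sgn * mm) + rc (sgn * a) * edir gamma w) i k - K (sing_of sgn) i k) < (A ^+ 2)^-1.
  move=> hsg; apply: ray_value => // a a0.
  have [] := side_ray gamma0 phi_lt argw r0 h_range kappa_range c0_gt0 approx m_big hh_big1 hsg a0.
  have -> : pt (rc (sgn * mm)) (rc sgn * edir gamma w) a = rc (sgn * mm) + rc (sgn * a) * edir gamma w.
    by rewrite /pt (rcM sgn a) mulrA [rc a * _]mulrC.
  by case: (s).
have [Xp hXp] := rayv _ s1; have [Xm hXm] := rayv _ s2.
pose a := Num.max 0 (Num.max Xp Xm).
have a0 : 0 <= a by rewrite /a le_max lexx.
have ap : Xp <= a by rewrite /a !le_max lexx orbT.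
have am : Xm <= a by rewrite /a !le_max lexx !orbT.
(* The abscissa at distance a on the ray, so far out that H_s is within A^-2 of its limits at both
   ends. No bound below depends on X. *)
pose X := mm + a * cos th.
have mX : mm <= X by rewrite lerDl mulr_ge0 // ltW.
have tanc : tan th * cos th = sin th by rewrite /tan divfK.
have eP : path1 s X = rc (1 * mm) + rc (1 * a) * edir gamma w.
  rewrite /path1 sigma_right // bump_far; last by rewrite ger0_norm ?(le_trans L_m) // (le_trans (ltW mm0)).
  rewrite edirE; apply: Cext; rewrite ?reD ?imD ?reM ?imM !re_rc !im_rc /= /X -?tanc; ring.
have eM : path1 s (- X) = rc (-1 * mm) + rc (-1 * a) * edir gamma w.
  rewrite /path1 sigma_left //; last lra.
  rewrite bump_far; last by rewrite normrN ger0_norm ?(le_trans L_m) // (le_trans (ltW mm0)).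
  rewrite edirE; apply: Cext; rewrite ?reD ?imD ?reM ?imM !re_rc !im_rc /= /X -?tanc; ring.
have vp i k : nc (Hs_ s (path1 s X) i k - K (sing_of 1) i k) < (A ^+ 2)^-1 by rewrite eP; exact: hXp.
have vm i k : nc (Hs_ s (path1 s (- X)) i k - K (sing_of (-1)) i k) < (A ^+ 2)^-1 by rewrite eM; exact: hXm.
have hok := path1_ok s mX.
have li0 : 0 < L^-1 by rewrite invr_gt0.
have X0 : 0 <= X by apply: le_trans mX; exact: ltW.
have XX : - X <= X <= X by apply/andP; split; lra.
have ev : (A ^+ 2)^-1 <= 1 by lra.
have offp (i j : 'I_n) : (i < j)%N -> nc (Hs_ s (path1 s X) i j) <= (A ^+ 2)^-1.
  move=> ij; have := vp i j; rewrite Koff ?subr0; first by move/ltW.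
  by apply/eqP => e; rewrite e ltnn in ij.
have offm (i j : 'I_n) : (j < i)%N -> nc (Hs_ s (path1 s (- X)) i j) <= (A ^+ 2)^-1.
  move=> ij; have := vm i j; rewrite Koff ?subr0; first by move/ltW.
  by apply/eqP => e; rewrite e ltnn in ij.
have dgp j : nc (Hs_ s (path1 s X) j j) <= 3.
  have k1 := vp j j; have k2 := Kdiag (sing_of 1) j; have k3 := CK_small.
  have k4 := nc_lower (Hs_ s (path1 s X) j j) (K (sing_of 1) j j).
  have k5 := nc_lower (K (sing_of 1) j j) 1; rewrite nc1 in k5; lra.
have Mb u : - X <= u <= X -> entries (Hs_ s (path1 s u)) <= 8 * n%:R ^+ 2.
  move=> hu.
  have := transport_bound li0 (ltW Cb0) hok XX (ltW e0) (ler0n _ 3) small_out offp offm dgp hu.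
  move=> k; apply: (le_trans k); have -> : 8 * n%:R ^+ 2 = 2 * (n%:R ^+ 2 * 4) :> R by ring.
  by rewrite ler_pM2l // ler_wpM2l ?sqr_ge0 //; lra.
have phA u : A ^+ 2 <= u ^+ 2 -> phi L^-1 u <= (A ^+ 2)^-1.
  move=> hu; have u20 : 0 < u ^+ 2 by apply: lt_le_trans hu; rewrite exprn_gt0.
  apply: (@le_trans _ _ (u ^+ 2)^-1); last by rewrite lef_pV2 // posrE exprn_gt0.
  rewrite ler_pdivrMr ?ltr_pwDl ?sqr_ge0 // ler_pdivlMl // [(L^-1 * u) ^+ 2]exprMn mulrC.
  by rewrite lerDr.
have Z0 : 0 <= (1 + T) * (Cb * KR * (8 * n%:R ^+ 2)).
  apply: mulr_ge0; first by have := T0; lra.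
  exact: (mulr_ge0 (mulr_ge0 (ltW Cb0) (ltW KR0)) (mulr_ge0 (ler0n _ 8) (sqr_ge0 _))).
have Zc0 : 0 <= (1 + T) * (Cb * KR * (8 * n%:R ^+ 2)) / cs by rewrite divr_ge0 // ltW.
have off_le : (A ^+ 2)^-1 + (1 + T) * (Cb * KR * (A ^+ 2)^-1 * (8 * n%:R ^+ 2)) / cs <= Bb / A.
  have -> : (A ^+ 2)^-1 + (1 + T) * (Cb * KR * (A ^+ 2)^-1 * (8 * n%:R ^+ 2)) / cs =
     (1 + (1 + T) * (Cb * KR * (8 * n%:R ^+ 2)) / cs) * (A ^+ 2)^-1 by ring.
  apply: ler_pM => //; rewrite ?addr_ge0 ?(ltW e0) // /Bb lerDl //.
split.
- move=> i j ij; apply: le_trans off_le.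
  apply: (transport_up (ltW Cb0) hok Mb (ltW e0) ij _ (legs_right s hA mX) _ (offp i j ij)); first lra.
  by move=> u /andP[k1 _]; apply: phA; rewrite ler_sqr ?nnegrE ?(ltW A0) // (le_trans (ltW A0)).
- move=> i j ij; apply: le_trans off_le.
  apply: (transport_down (ltW Cb0) hok Mb (ltW e0) ij _ (legs_left s hA mX) _ (offm i j ij)); first lra.
  by move=> u /andP[_ k1]; rewrite lerNr in k1; apply: phA; rewrite -(sqrrN u) ler_sqr ?nnegrE ?(ltW A0) // (le_trans (ltW A0)).
- move=> j; have XA : - X <= - A by rewrite lerN2; exact: le_trans mX.
  have AX : - A <= X by lra.
  have k1 := transport_diag (ltW Cb0) hok Mb j (lexx _) XA AX.
  have k2 := vm j j; have k3 := Kdiag (sing_of (-1)) j.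
  have nA : - A < 0 by lra.
  have k4 := atan_diff_neg li0 XA nA; rewrite opprK invfM invrK in k4.
  have k5 : (1 + T) * (Cb * KR * L^-1 * (8 * n%:R ^+ 2) * (atan (L^-1 * - A) - atan (L^-1 * - X))) <=
      (1 + T) * (Cb * KR * (8 * n%:R ^+ 2)) / A.
    have -> : (1 + T) * (Cb * KR * (8 * n%:R ^+ 2)) / A =
      (1 + T) * (Cb * KR * L^-1 * (8 * n%:R ^+ 2) * (L / A)) by field; rewrite !gt_eqF.
    apply: ler_wpM2l; first by have := T0; lra.
    apply: ler_wpM2l k4.
    exact: (mulr_ge0 (mulr_ge0 (mulr_ge0 (ltW Cb0) (ltW KR0)) (ltW li0)) (mulr_ge0 (ler0n _ 8) (sqr_ge0 _))).
  set u1 := Hs_ s (path1 s (- A)) j j in k1 *; set u2 := Hs_ s (path1 s (- X)) j j in k1 k2 *.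
  set u3 := K _ j j in k2 k3.
  have -> : u1 - 1 = (u1 - u2) + ((u2 - u3) + (u3 - 1)) by ring.
  apply: le_trans (ncD _ _) _; have k6 := ncD (u2 - u3) (u3 - 1).
  have -> : Bb / A = A^-1 + (1 + T) * (Cb * KR * (8 * n%:R ^+ 2)) / cs / A +
     (1 + T) * (Cb * KR * (8 * n%:R ^+ 2)) / A by rewrite /Bb !mulrDl mul1r.
  have : 0 <= (1 + T) * (Cb * KR * (8 * n%:R ^+ 2)) / cs / A by rewrite divr_ge0 // ltW.
  lra.
Qed.

(* h0 solves the same system up to an error zeta; it stands for the normalizing matrix at eps = 0. *)
Lemma H_compare s A (h0 : C -> M) (D : 'I_n -> 'I_n -> R -> C) (beta0 zeta : R) :
  L <= A <= mm -> 0 <= zeta -> 0 <= beta0 ->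
  (forall i j u, - A <= u <= A -> cdiff (fun t => h0 t i j) (path0 T L s u) (D i j u)) ->
  (forall i j u, - A <= u <= A ->
     nc ((lam y i (eps w) (x_ (path0 T L s u)) - lam y j (eps w) (x_ (path0 T L s u))) * h0 (path0 T L s u) i j +
         (x_ (path0 T L s u) ^+ 2 - eps w) * (Rem y (eps w) (x_ (path0 T L s u)) *m h0 (path0 T L s u)) i j - D i j u) <= zeta) ->
  (forall i j, nc (h0 (path0 T L s A) i j - (i == j)%:R) <= beta0) ->
  (forall i j, nc (h0 (path0 T L s (- A)) i j - (i == j)%:R) <= beta0) ->
  forall u, - A <= u <= A ->
  entries (Hs_ s (path0 T L s u) - h0 (path0 T L s u)) <=
    2 * (n%:R ^+ 2 * (Bb / A + beta0 + (CK * Q + Bb / A + beta0) + (1 + T) * zeta * (cs^-1 + (A - - A)))).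
Proof.
move=> hA z0 bt0 hD hz bA bmA.
case/andP: (hA) => LA Am; have A0 : 0 < A by exact: lt_le_trans L0 LA.
have uA u : - A <= u <= A -> path1 s u = path0 T L s u.
  by move=> hu; apply: path01; apply: le_trans Am; rewrite ler_norml.
have AA : - A <= A <= A by apply/andP; split; lra.
have mAA : - A <= - A <= A by apply/andP; split; lra.
have [up down dg] := H_near1 s hA.
have bb0 : 0 <= Bb / A.
  rewrite divr_ge0 ?(ltW A0) // /Bb.
  have Z0 : 0 <= (1 + T) * (Cb * KR * (8 * n%:R ^+ 2)).
    apply: mulr_ge0; first by have := T0; lra.
    exact: (mulr_ge0 (mulr_ge0 (ltW Cb0) (ltW KR0)) (mulr_ge0 (ler0n _ 8) (sqr_ge0 _))).
  by rewrite !addr_ge0 // divr_ge0 // ltW.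
have hl : legs T (path0 T L s) (- A) A by exact: legs_ext (legs_core s hA) uA.
pose X t : M := Hs_ s t - h0 t.
pose mu (i j : 'I_n) u := lam y i (eps w) (x_ (path0 T L s u)) - lam y j (eps w) (x_ (path0 T L s u)).
(* The forcing in the equation of H_s - h0: a part linear in this difference, to be absorbed, and
   the defect of h0, at most zeta. *)
pose G i j u := (x_ (path0 T L s u) ^+ 2 - eps w) * (Rem y (eps w) (x_ (path0 T L s u)) *m X (path0 T L s u)) i j +
   (mu i j u * h0 (path0 T L s u) i j +
    (x_ (path0 T L s u) ^+ 2 - eps w) * (Rem y (eps w) (x_ (path0 T L s u)) *m h0 (path0 T L s u)) i j - D i j u).
have ode i j u : - A <= u <= A -> cdiff (fun t => X t i j) (path0 T L s u) (mu i j u * X (path0 T L s u) i j + G i j u).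
  move=> hu; have hG := path_Gam s u; have hg := path_good s u; rewrite uA // in hG hg.
  have k := cdiff_sub (Hs_entry i j hG hg) (hD i j u hu).
  apply: (@cdiff_ext _ (fun t => Hs_ s t i j - h0 t i j)); first by move=> t; rewrite /X !mxE.
  apply: cdiff_val k; rewrite /G /X mulmxBr /mu.
  move: (Rem y _ _ *m Hs_ s _) (Rem y _ _ *m h0 _) => B1 B2; rewrite !mxE; ring.
have mud j u : - A <= u <= A -> mu j j u = 0 by rewrite /mu subrr.
have mup (i j : 'I_n) u v : (i < j)%N -> - A <= u <= A -> slope T v -> cs <= reC (v * mu i j u).
  move=> ij hu sv; have [h1 _ _ _] := LD; have hx := path_xsmall s u; rewrite uA // in hx; exact: h1.
have mdn (i j : 'I_n) u v : (j < i)%N -> - A <= u <= A -> slope T v -> reC (v * mu i j u) <= - cs.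
  by move=> ij hu sv; rewrite /mu -opprB mulrN reN lerN2; exact: mup.
have Gb i j u : - A <= u <= A -> nc (G i j u) <= Cb * KR * phi L^-1 u * entries (X (path0 T L s u)) + zeta.
  move=> hu; apply: le_trans (ncD _ _) _; apply: lerD (hz i j u hu); rewrite ncM.
  have -> : Cb * KR * phi L^-1 u * entries (X (path0 T L s u)) = (Cb * phi L^-1 u) * (KR * entries (X (path0 T L s u))) by ring.
  have hx := path_xsmall s u; have hb := path_xbound s u; rewrite uA // in hx hb.
  by apply: ler_pM; rewrite ?nc_ge0 //; exact: Rem_mul_bound.
have li0 : 0 < L^-1 by rewrite invr_gt0.
have Cf0 : 0 <= Cb * KR by rewrite mulr_ge0 ?ltW.
have b00 : 0 <= Bb / A + beta0 by rewrite addr_ge0.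
have CK0 : 0 <= CK * Q.
  apply: mulr_ge0 (ltW Q0); apply: addr_ge0 => //; apply: mulr_ge0; first by have := T0; lra.
  exact: (mulr_ge0 (mulr_ge0 (mulr_ge0 (ltW Cm0) (ltW KR0)) (mulr_ge0 (ler0n _ 4) (sqr_ge0 _))) (pi_ge0 R)).
have b01 : 0 <= CK * Q + Bb / A + beta0 by rewrite !addr_ge0.
apply: (path_absorb T0 cs0 Cf0 li0 z0 hl ode mud mup mdn Gb mAA b00 b01 small_out).
- move=> i j ij; rewrite !mxE; have := bA i j.
  have -> : (i == j) = false by apply/negbTE/eqP => e; rewrite e ltnn in ij.
  rewrite subr0 => k1; have := up i j ij; rewrite uA // => k2.
  by apply: le_trans (ncB _ _) _; exact: lerD.
- move=> i j ij; rewrite !mxE; have := bmA i j.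
  have -> : (i == j) = false by apply/negbTE/eqP => e; rewrite e ltnn in ij.
  rewrite subr0 => k1; have := down i j ij; rewrite uA // => k2.
  by apply: le_trans (ncB _ _) _; exact: lerD.
- move=> j; rewrite !mxE; have := bmA j j; rewrite eqxx => k1; have := dg j; rewrite uA // => k2.
  set a1 := Hs_ s _ _ _ in k2 *; set a2 := h0 _ _ _ in k1 *.
  have -> : a1 - a2 = (a1 - 1) - (a2 - 1) by ring.
  by apply: le_trans (ncB _ _) _; exact: lerD.
Qed.
End Transport.

(** * The normalizing matrices at eps = 0 *)

Section AtZero.
Variables (R : realType) (n : nat) (y : prenormal R n) (r delta h : R).
Local Notation C := (Cx R).
Local Notation M := 'M[C]_n.
Variable H0 : sect -> C -> M.
Hypothesis HH0 : normalizing0 r delta y H0.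
Hypothesis OS : forall s, Omega0 r h s `<=` Sect r delta s.
Hypothesis r0 : 0 < r.

Definition h0 s (t : C) : M := H0 s (x0 t).
(** The derivative of [h0] in t, written like that of [Hs] with eps replaced by 0, so that the two
    can be subtracted term by term. *)
Definition h0' s t (i j : 'I_n) : C := (lam y i 0 (x0 t) - lam y j 0 (x0 t)) * h0 s t i j +
  (x0 t ^+ 2 - 0) * (Rem y 0 (x0 t) *m h0 s t) i j.

Lemma Gamma0_nc s t : Gamma0 r h s t -> r^-1 < nc t.
Proof. by case; rewrite norm_nc rc_lt. Qed.

Lemma Gamma0_neq0 s t : Gamma0 r h s t -> t != 0.
Proof. by move=> /Gamma0_nc ht; rewrite -nc_gt0; apply: lt_trans ht; rewrite invr_gt0. Qed.

Lemma cdiff_x0 (t : C) : t != 0 -> cdiff (@x0 R) t (x0 t ^+ 2).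
Proof.
by move=> t0; have := cdiff_opp (cdiff_inv t0); apply: cdiff_val; rewrite /x0 opprK sqrrN.
Qed.

Lemma Gamma0_Sect s t : Gamma0 r h s t -> Sect r delta s (x0 t).
Proof. by move=> ht; apply: OS; exists t. Qed.

Lemma h0_entry s t i j : Gamma0 r h s t -> cdiff (fun u => h0 s u i j) t (h0' s t i j).
Proof.
move=> ht; have hS := Gamma0_Sect ht.
have dH : derivable (H0 s) (x0 t) 1 by apply/derivable1_diffP; exact: (H0_analytic HH0).
have := mdiff_comp (cdiff_x0 (Gamma0_neq0 ht)) (derivable_mdiff dH).
rewrite (H0_conj HH0 hS) => /(_ i j); apply: cdiff_val.
rewrite /h0' /h0 /Bmx /Lam mulmxDl mul_diag_mx mul_mx_diag -scalemxAl.
by move: (Rem y _ _ *m _) => A; rewrite !mxE; ring.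
Qed.

(** The asymptotic expansion is truncated after its constant term I, and |x| = 1 / |t|. *)
Lemma h0_near1 : exists ca e : R, [/\ 0 < ca, 0 < e & forall s t, Gamma0 r h s t -> e < nc t ->
  forall i j, nc (h0 s t i j - (i == j)%:R) <= ca / nc t].
Proof.
have [a a0 ha] := H0_asymp HH0.
have one s : exists2 ca : R, 0 < ca & exists2 e : R, 0 < e & forall t, Gamma0 r h s t -> e < nc t ->
    forall i j, nc (h0 s t i j - (i == j)%:R) <= ca / nc t.
  have [c [e [e0 hc]]] := ha s 1%N; have [d d0 eE] := rc_gt0P e0.
  exists (nc c + 1); first by rewrite ltr_wpDl ?nc_ge0.
  exists d^-1; first by rewrite invr_gt0.
  move=> t ht dt i j; have t0 := Gamma0_neq0 ht; have nt : 0 < nc t by rewrite nc_gt0.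
  have nx : nc (x0 t) = (nc t)^-1 by rewrite /x0 ncN ncV.
  have := hc (x0 t) (Gamma0_Sect ht).
  rewrite norm_nc eE rc_lt nx => /(_ ltac:(by rewrite -[d]invrK ltf_pV2 ?posrE ?invr_gt0)).
  rewrite big_ord_recl big_ord0 addr0 expr0 scale1r a0 expr1 => hn.
  have hlt : `|h0 s t - 1%:M| < rc ((nc c + 1) / nc t).
    apply: (@le_lt_trans _ _ (rc (nc c / nc t))).
      apply: (le_trans hn); rewrite -[c * _]ger0_norm; last exact: le_trans (normr_ge0 _) hn.
      by rewrite normrM norm_nc rcM ger0_norm ?rc_le ?invr_ge0 ?nc_ge0 // -rc0 rc_le invr_ge0 nc_ge0.
    by rewrite rc_lt ltr_pM2r ?invr_gt0 // ltrDl.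
  have : ball (h0 s t) (rc ((nc c + 1) / nc t)) (1%:M : M) by rewrite mx_norm_ball.
  by case=> _ /(_ i j); rewrite /ball /= norm_nc rc_lt mxE => /ltW.
have [c1 c10 [e1 e10 h1]] := one sD; have [c2 c20 [e2 e20 h2]] := one sU.
exists (Num.max c1 c2), (Num.max e1 e2); split; rewrite ?lt_max ?c10 ?e10 //.
move=> s t ht; rewrite gt_max => /andP[k1 k2] i j.
have nt : 0 < nc t by rewrite nc_gt0 (Gamma0_neq0 ht).
by case: s ht => ht; [apply: (le_trans (h1 t ht k1 i j))|apply: (le_trans (h2 t ht k2 i j))];
  rewrite ler_pM2r ?invr_gt0 // le_max lexx ?orbT.
Qed.
End AtZero.

(** * The filter of small eps in the sector *)

Section EpsFilter.
Variables (R : realType) (gamma rho : R).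
Local Notation C := (Cx R).
Local Notation to0 := (eps_to0 gamma rho).

Lemma eps_to0_filter : Filter to0.
Proof.
apply: filter_from_filter; first by exists (1 : R); exact: ltr01.
move=> a b /= a0 b0; exists (Num.min a b); first by rewrite /= lt_min a0.
move=> w /= [Sw]; rewrite norm_nc rc_lt lt_min => /andP[h1 h2].
by split; split=> //; rewrite rc_lt.
Qed.

Lemma near_eps (P : C -> Prop) (eta : R) : 0 < eta ->
  (forall w, Sdom gamma rho w -> nc (sqe w) < eta -> P w) -> \forall w \near to0, P w.
Proof.
move=> e0 h; exists (eta ^+ 2) => /=; first by rewrite exprn_gt0.
move=> w /= [Sw]; rewrite norm_nc rc_lt eps_sqe ncX ltr_sqr ?nnegrE ?nc_ge0 ?(ltW e0) //.
exact: h.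
Qed.
End EpsFilter.

(** * The defect of the matrix at eps = 0 in the equation at eps *)

Section Forcing.
Variables (R : realType) (n : nat) (y : prenormal R n) (gamma rho r delta h : R).
Local Notation C := (Cx R).
Local Notation M := 'M[C]_n.
Local Notation to0 := (eps_to0 gamma rho).
Variable H0 : sect -> C -> M.
Hypothesis HH0 : normalizing0 r delta y H0.
Hypothesis OS : forall s, Omega0 r h s `<=` Sect r delta s.
Hypothesis r0 : 0 < r.
Variables (P : R -> C) (s : sect) (r1 : R).
Hypothesis P_cont : continuous P.
Hypothesis P_Gamma : forall u, Gamma0 r h s (P u).
Hypothesis Rem_diff : forall u x : C, nc u < r1 -> nc x < r1 -> differentiable (fun p : C * C => Rem y p.1 p.2) (u, x).
Hypothesis r10 : 0 < r1.
Hypothesis P_small : forall u, nc (x0 (P u)) < r1.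

(** What is left when [h0] is put in the equation at eps, that is, the quantity bounded by zeta in
    [H_compare]. *)
Definition force w u (i j : 'I_n) : C :=
  (lam y i (eps w) (xt w (P u)) - lam y j (eps w) (xt w (P u))) * h0 H0 s (P u) i j +
  (xt w (P u) ^+ 2 - eps w) * (Rem y (eps w) (xt w (P u)) *m h0 H0 s (P u)) i j - h0' y H0 s (P u) i j.

Let to0_filter : Filter to0 := @eps_to0_filter R gamma rho.
#[local] Existing Instance to0_filter.

Section AtPoint.
Variable u : R.
Local Notation FF := (filter_prod (nbhs u) to0).

Let snd_near (A : C -> Prop) : (\forall v \near to0, A v) -> \forall p \near FF, A p.2.
Proof. exact: (@cvg_snd _ _ (nbhs u) to0 _ A). Qed.

Let cE : (fun p : R * C => eps p.2) @ FF --> (0 : C).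
Proof.
apply/cvg_nc => e e0; apply: (snd_near (A := fun v => nc (eps v - 0) < e)).
apply: (@near_eps _ _ _ _ (Num.min 1 e)) => [|w _]; first by rewrite lt_min ltr01.
rewrite lt_min => /andP[q1 qe]; rewrite subr0 eps_sqe ncX expr2; apply: le_lt_trans qe.
by rewrite ler_piMl ?nc_ge0 // ltW.
Qed.

Let cP : (fun p : R * C => P p.1) @ FF --> P u.
Proof. by apply: (cvg_comp _ _ (@cvg_fst _ _ (nbhs u) to0 _)); exact: P_cont. Qed.

Let cX0 : (fun p : R * C => x0 (P p.1)) @ FF --> x0 (P u).
Proof.
apply: (cvg_comp _ _ cP).
exact: cdiff_continuous (cdiff_x0 (Gamma0_neq0 r0 (P_Gamma u))).
Qed.

Let cX : (fun p : R * C => xt p.2 (P p.1)) @ FF --> x0 (P u).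
Proof.
have -> : x0 (P u) = x0 (P u) + 0 by rewrite addr0.
have -> : (fun p : R * C => xt p.2 (P p.1)) = (fun p => x0 (P p.1) + (xt p.2 (P p.1) + (P p.1)^-1)).
  by apply/funext => p; rewrite /x0 addrC addrK.
apply: (cvgD cX0); apply/cvg_nc => e e0.
have e'0 : 0 < e / 2 * r^-1 by rewrite mulr_gt0 ?divr_gt0 ?invr_gt0.
have [del del0 hdel] := xq_near0 e'0.
have N0 : 0 < nc (P u) + 1 by rewrite ltr_wpDl ?nc_ge0.
have hP : \forall p \near FF, nc (P p.1) < nc (P u) + 1.
  have /cvg_nc/(_ 1 ltr01) := cP; apply: filterS => p hp.
  by have := nc_lower (P p.1) (P u); lra.
have hq : \forall p \near FF, nc (sqe p.2) < del / (nc (P u) + 1).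
  apply: (snd_near (A := fun v => nc (sqe v) < _)); apply: (@near_eps _ _ _ _ (del / (nc (P u) + 1))) => //.
  by rewrite divr_gt0.
near=> p.
have h1 : nc (P p.1) < nc (P u) + 1 by near: p.
have h2 : nc (sqe p.2) < del / (nc (P u) + 1) by near: p.
have Pg := P_Gamma p.1; have Pn := Gamma0_nc Pg; have P0 := Gamma0_neq0 r0 Pg.
have [|_ h3] := hdel (sqe p.2) (P p.1) (sqe_neq0 _) P0.
  rewrite ncM; rewrite ltr_pdivlMr // in h2; apply: le_lt_trans h2.
  by rewrite ler_wpM2l ?nc_ge0 // ltW.
rewrite subr0; apply: (le_lt_trans h3).
rewrite ltr_pdivrMr ?nc_gt0 //; apply: (@lt_trans _ _ (e * r^-1)).
  by rewrite ltr_pM2r ?invr_gt0 //; lra.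
by rewrite ltr_pM2l.
Unshelve. all: by end_near.
Qed.

Let lam_lim (f : R * C -> C) (e : R * C -> C) i x : f @ FF --> x -> e @ FF --> (0 : C) ->
  (fun p => lam y i (e p) (f p)) @ FF --> lam y i 0 x.
Proof.
move=> hf he.
have cL (L : C -> 'rV[C]_n) : (\forall v \near (0 : C), differentiable L v) ->
    (fun p => L (e p) 0 i) @ FF --> L 0 0 i.
  move=> /nbhs_singleton/derivable1_diffP/derivable_mdiff/(_ 0 i) h1.
  exact: cvg_comp _ _ he (cdiff_continuous h1).
exact: cvgD (cL _ (L0_analytic y)) (cvgM (cL _ (L1_analytic y)) hf).
Qed.

Let Rem_lim (f : R * C -> C) (e : R * C -> C) : f @ FF --> x0 (P u) -> e @ FF --> (0 : C) ->
  (fun p => Rem y (e p) (f p)) @ FF --> Rem y 0 (x0 (P u)).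
Proof.
move=> hf he; apply/mx_cvgP => i j; apply/cvg_nc => eta eta0.
have n0 : nc (0 : C) < r1 by rewrite nc0.
have [d d0 hd] := Rem_cont i j (Rem_diff n0 (P_small u)) eta0.
have /cvg_nc/(_ d d0) k1 := hf; have /cvg_nc/(_ d d0) k2 := he.
near=> p; apply: hd; [near: p; exact: k2|near: p; exact: k1].
Unshelve. all: by end_near.
Qed.

Let h0_lim : (fun p : R * C => h0 H0 s (P p.1)) @ FF --> h0 H0 s (P u).
Proof.
apply/mx_cvgP => i j.
exact: cvg_comp _ _ cP (cdiff_continuous (h0_entry HH0 OS r0 i j (P_Gamma u))).
Qed.

Lemma force_cvg i j : (fun p : R * C => force p.2 p.1 i j) @ FF --> (0 : C).
Proof.
have c0 : (fun _ : R * C => 0 : C) @ FF --> (0 : C) by exact: cvg_cst.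
have hh : (fun p : R * C => h0 H0 s (P p.1) i j) @ FF --> h0 H0 s (P u) i j.
  by have /mx_cvgP := h0_lim; apply.
have rh : (fun p : R * C => (Rem y (eps p.2) (xt p.2 (P p.1)) *m h0 H0 s (P p.1)) i j) @ FF -->
    (Rem y 0 (x0 (P u)) *m h0 H0 s (P u)) i j.
  exact: ((mx_cvgP _ _).1 (mx_cvg_mul (Rem_lim cX cE) h0_lim) i j).
have rh0 : (fun p : R * C => (Rem y 0 (x0 (P p.1)) *m h0 H0 s (P p.1)) i j) @ FF -->
    (Rem y 0 (x0 (P u)) *m h0 H0 s (P u)) i j.
  exact: ((mx_cvgP _ _).1 (mx_cvg_mul (Rem_lim cX0 c0) h0_lim) i j).
rewrite -[X in _ --> X](subrr ((lam y i 0 (x0 (P u)) - lam y j 0 (x0 (P u))) * h0 H0 s (P u) i j +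
   (x0 (P u) * x0 (P u) - 0) * (Rem y 0 (x0 (P u)) *m h0 H0 s (P u)) i j)).
have -> : (fun p : R * C => force p.2 p.1 i j) = (fun p =>
   ((lam y i (eps p.2) (xt p.2 (P p.1)) - lam y j (eps p.2) (xt p.2 (P p.1))) * h0 H0 s (P p.1) i j +
   (xt p.2 (P p.1) * xt p.2 (P p.1) - eps p.2) * (Rem y (eps p.2) (xt p.2 (P p.1)) *m h0 H0 s (P p.1)) i j) -
   ((lam y i 0 (x0 (P p.1)) - lam y j 0 (x0 (P p.1))) * h0 H0 s (P p.1) i j +
   (x0 (P p.1) * x0 (P p.1) - 0) * (Rem y 0 (x0 (P p.1)) *m h0 H0 s (P p.1)) i j)).
  by apply/funext => p; rewrite /force /h0' !expr2.
exact: cvgB (cvgD (cvgM (cvgB (@lam_lim _ _ i _ cX cE) (@lam_lim _ _ j _ cX cE)) hh)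
    (cvgM (cvgB (cvgM cX cX) cE) rh))
  (cvgD (cvgM (cvgB (@lam_lim _ _ i _ cX0 c0) (@lam_lim _ _ j _ cX0 c0)) hh)
    (cvgM (cvgB (cvgM cX0 cX0) c0) rh0)).
Qed.
End AtPoint.

(** [force_cvg] is a limit in (u, w) jointly, near each u; compactness of [a, b] turns it into
    smallness for all u at once. *)
Lemma force_small (a b zeta : R) : 0 < zeta ->
  \forall w \near to0, forall u, a <= u <= b -> forall i j, nc (force w u i j) <= zeta.
Proof.
move=> z0; have := (compact_near_coveringP `[a, b]).1 (@segment_compact R a b) C to0
  (fun w u => forall ij : 'I_n * 'I_n, nc (force w u ij.1 ij.2) <= zeta) to0_filter.
case=> [u _|e e0 he].
  have : \forall p \near filter_prod (nbhs u) to0, forall ij : 'I_n * 'I_n,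
      nc (force p.2 p.1 ij.1 ij.2) <= zeta.
    apply: filter_forall => ij; have /cvg_nc/(_ zeta z0) := @force_cvg u ij.1 ij.2.
    by apply: filterS => p; rewrite subr0 => /ltW.
  by [].
exists e => // w hw u hu i j; apply: (he w hw u _ (i, j)).
by rewrite /= in_itv.
Qed.
End Forcing.

(** * Convergence of H_s at the base points *)

Section HLimit.
Variables (R : realType) (n : nat) (y : prenormal R n) (gamma rho r delta h kappa c0 : R).
Local Notation C := (Cx R).
Local Notation M := 'M[C]_n.
Local Notation phi0 := (gamma * (1 + 2 * gamma / pi)).
Local Notation T := (tan phi0).
Local Notation k0 := (T ^+ 2 / (2 * (1 + T ^+ 2))).
Local Notation to0 := (eps_to0 gamma rho).
Variables (cs r1 KR L : R).

(** All the smallness conditions on one eps required by the geometry and the estimates.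
    [admissible_small] derives them from a bound on |sqrt(eps)|, once L and c0 are fixed. *)
Record admissible (w : C) : Prop := Admissible {
  ad_approx : forall t, t != 0 -> nc t <= 2 / r ->
    csinh (sqe w * t) != 0 /\ nc (xq (sqe w) t + t^-1) <= eta0 r h / nc t;
  ad_amin : nc (sqe w) ^+ 2 <= amin r h * r ^+ 3 / 64;
  ad_m : 2 / r <= c0 / nc (sqe w);
  ad_hP1 : h + c0 / nc (sqe w) * T < (1 / 2 - kappa) * hP gamma w;
  ad_hP2 : 2 / r <= (1 / 2 - kappa) * hP gamma w;
  ad_eps : nc (eps w) < r1;
  ad_q : nc (sqe w) < r1;
  ad_Q1 : nc (sqe w) <= 1;
  ad_mid : n%:R ^+ 2 * ((1 + T) * (4 / kap gamma ^+ 2 * KR * nc (sqe w) * (nc (sqe w) / cs + pi))) <= 1 / 2;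
  ad_xmid : nc (sqe w) ^+ 2 * (4 / kap gamma ^+ 2 + 1) < r1 ^+ 2;
  ad_L : L <= c0 / nc (sqe w);
  ad_xout : nc (sqe w) ^+ 2 + Cb gamma / L ^+ 2 < r1 ^+ 2;
  ad_CK : CK gamma n KR * nc (sqe w) <= 1
}.

Hypothesis gamma0 : 0 < gamma.
Hypothesis phi_lt : phi0 < pi / 2.
Hypothesis r0 : 0 < r.
Hypothesis h_range : 0 < h < r^-1.
Hypothesis kappa_range : 0 < kappa < 1 / 2.
Hypothesis c0_gt0 : 0 < c0.
Hypothesis cs0 : 0 < cs.
Hypothesis KR0 : 0 < KR.
Hypothesis r10 : 0 < r1.
Hypothesis LD : local_data y phi0 cs r1 KR.
Hypothesis T0 : 0 < T.
Hypothesis L_ge1 : 1 <= L.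
Hypothesis L_far : (2 / r) ^+ 2 <= k0 * L ^+ 2.
Hypothesis L_x0 : (k0 * L ^+ 2)^-1 < r1 ^+ 2.
Hypothesis c0_small : c0 * T <= kap gamma / 8.
Hypothesis small_out :
  n%:R ^+ 2 * ((1 + T) * (Cb gamma * KR * L^-1 * (L^-1 / cs + pi))) <= 1 / 2.
Hypothesis adm : forall w, Sdom gamma rho w -> admissible w.
Variables (F H : sect -> C -> C -> M).
Hypothesis HF : model_solutions gamma rho r delta h kappa c0 y F.
Hypothesis HH : normalizing gamma rho r h kappa c0 y F H.
Variable H0 : sect -> C -> M.
Hypothesis HH0 : normalizing0 r delta y H0.
Hypothesis OS : forall s, Omega0 r h s `<=` Sect r delta s.

Let L0 : 0 < L.
Proof. exact: lt_le_trans L_ge1. Qed.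

Let k00 : 0 < k0.
Proof. by apply: divr_gt0 (exprn_gt0 2 T0) (mulr_gt0 (ltr0Sn _ 1) _); rewrite ltr_pwDl ?sqr_ge0. Qed.

Lemma path0_norm_ge s u : k0 * L ^+ 2 <= nc (path0 T L s u) ^+ 2.
Proof.
apply: (@le_trans _ _ (k0 * (L ^+ 2 + u ^+ 2))); last exact: path0_norm.
by rewrite ler_pM2l // lerDl sqr_ge0.
Qed.

Lemma path0_Gamma0 s u : Gamma0 r h s (path0 T L s u).
Proof.
split.
  rewrite norm_nc rc_lt; apply: (@lt_le_trans _ _ (2 / r)).
    by rewrite ltr_pMl ?invr_gt0 //; lra.
  rewrite -ler_sqr ?nnegrE ?nc_ge0 ?divr_ge0 ?(ltW r0) //.
  exact: le_trans L_far (path0_norm_ge s u).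
have := bump_side L T0 s u; case/andP: h_range => hk _.
by case: s; rewrite /sgs /= => k; lra.
Qed.

Lemma path0_x0 s u : nc (x0 (path0 T L s u)) < r1.
Proof.
rewrite -ltr_sqr ?nnegrE ?nc_ge0 ?(ltW r10) //; apply: le_lt_trans L_x0.
have p1 : 0 < k0 * L ^+ 2 := mulr_gt0 k00 (exprn_gt0 2 L0).
have p2 := path0_norm_ge s u.
rewrite /x0 ncN ncV exprVn lef_pV2 // posrE; exact: lt_le_trans p2.
Qed.

Lemma path0_base s u : L <= `|u| -> path0 T L s u = rc u.
Proof. by move=> hu; rewrite /path0 bump_far. Qed.

Lemma exists_small (X e : R) : 0 <= X -> 0 < e -> exists2 d : R, 0 < d & X * d < e.
Proof.
move=> X0 e0; exists (e / (X + 1)); first by rewrite divr_gt0 // ltr_wpDl.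
by rewrite mulrA ltr_pdivrMr ?ltr_wpDl // mulrC ltr_pM2l // ltrDl.
Qed.

Lemma quarters (a a' b b' c e : R) : a <= a' -> b <= b' -> a' < e / 4 -> b' < e / 4 -> c < e / 4 ->
  0 < e -> a + b + c < e.
Proof. by move=> *; lra. Qed.

(** The errors are of three kinds: O(1/A) from the ends, O(|sqrt(eps)|) from the diagonal limits,
    and zeta times a multiple of 1/cs + 2 A. So A is chosen first, then zeta in terms of A, and
    finally eps. *)
Lemma H_limit s sgn : sgn = 1 \/ sgn = -1 ->
  (fun w => H s w (xt w (rc (sgn * L)))) @ to0 --> H0 s (x0 (rc (sgn * L))).
Proof.
move=> hsg; have FF := @eps_to0_filter R gamma rho.
apply/mx_cvgP => i j; apply/cvg_nc => e e0.
have e40 : 0 < e / 4 by rewrite divr_gt0.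
have [ca [ea [ca0 ea0 hca]]] := h0_near1 HH0 OS r0.
set nn := n%:R ^+ 2 : R; have nn0 : 0 <= nn := sqr_ge0 _.
have kp0 : 0 < kap gamma by have /andP[] := kap_range gamma0 phi_lt.
have Cb0 : 0 <= Cb gamma by exact: ltW (divr_gt0 (divr_gt0 (ltr0Sn _ 15) (exprn_gt0 2 kp0)) k00).
have Bb0 : 0 <= Bb gamma n cs KR.
  have Z0 : 0 <= (1 + T) * (Cb gamma * KR * (8 * nn)).
    apply: mulr_ge0; first by have := T0; lra.
    exact: (mulr_ge0 (mulr_ge0 Cb0 (ltW KR0)) (mulr_ge0 (ler0n _ 8) nn0)).
  by rewrite /Bb !addr_ge0 // divr_ge0 // ltW.
have CK0 : 0 <= CK gamma n KR.
  apply: addr_ge0 => //; apply: mulr_ge0; first by have := T0; lra.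
  apply: mulr_ge0 (pi_ge0 R); apply: mulr_ge0 (mulr_ge0 (ler0n _ 4) nn0).
  by apply: mulr_ge0 (ltW KR0); rewrite divr_ge0 ?sqr_ge0.
have X1 : 0 <= 4 * nn * (Bb gamma n cs KR + ca).
  exact: mulr_ge0 (mulr_ge0 (ler0n _ 4) nn0) (addr_ge0 Bb0 (ltW ca0)).
have X2 : 0 <= 2 * nn * CK gamma n KR := mulr_ge0 (mulr_ge0 (ler0n _ 2) nn0) CK0.
have [d d0 hd] := exists_small X1 e40.
(* At least L, to start beyond the tent; at least 1/d, for an error O(1/A) below e / 4; more than
   ea, for [h0_near1] to hold at the ends. *)
pose A := Num.max (Num.max L d^-1) (ea + 1).
have LA : L <= A by rewrite !le_max lexx.
have A0 : 0 < A by exact: lt_le_trans L0 LA.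
have dA : A^-1 <= d.
  have : d^-1 <= A by rewrite !le_max lexx orbT.
  by rewrite -[X in _ <= X]invrK lef_pV2 ?posrE ?invr_gt0.
have eA : ea < A by rewrite !lt_max (_ : ea < ea + 1) ?orbT // ltrDl.
have [dq dq0 hdq] := exists_small X2 e40.
pose Y := 2 * nn * ((1 + T) * (cs^-1 + (A - - A))).
have Y0 : 0 <= Y.
  apply: mulr_ge0 (mulr_ge0 (ler0n _ 2) nn0) _.
  by apply: mulr_ge0; [have := T0; lra|rewrite opprK !addr_ge0 ?invr_ge0 // ltW].
have [zeta z0 hz] := exists_small Y0 e40.
have pc : continuous (path0 T L s) by exact: path0_continuous.
have hforce := force_small gamma rho HH0 OS r0 pc (path0_Gamma0 s)
  (let: And4 _ _ hR _ := LD in hR) r10 (path0_x0 s) (- A) A z0.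
have hw : \forall w \near to0, [/\ Sdom gamma rho w, nc (sqe w) < dq & A <= c0 / nc (sqe w)].
  apply: (@near_eps _ _ _ _ (Num.min dq (c0 / A))); first by rewrite lt_min dq0 divr_gt0.
  move=> w Sw; rewrite lt_min => /andP[q1 q2]; split=> //.
  by rewrite ler_pdivlMr ?Q_gt0 // mulrC -ler_pdivlMr // ltW.
near=> w.
have [Sw qw Aw] : [/\ Sdom gamma rho w, nc (sqe w) < dq & A <= c0 / nc (sqe w)] by near: w.
have fw : forall u, - A <= u <= A -> forall i j, nc (force y H0 (path0 T L s) s w u i j) <= zeta by near: w.
have [a1 a2 a3 a4 a5 a6 a7 a8 a9 a10 a11 a12 a13] := adm Sw.
have bnd u : A <= `|u| -> forall i j, nc (h0 H0 s (path0 T L s u) i j - (i == j)%:R) <= ca / `|u|.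
  move=> hu i' j'; have E := path0_base s (le_trans LA hu).
  have := hca s _ (path0_Gamma0 s u); rewrite E nc_rc; apply; exact: lt_le_trans hu.
have nA : `|A| = A by rewrite gtr0_norm.
have bA : forall i j, nc (h0 H0 s (path0 T L s A) i j - (i == j)%:R) <= ca / A.
  by have := bnd A; rewrite nA; apply.
have bmA : forall i j, nc (h0 H0 s (path0 T L s (- A)) i j - (i == j)%:R) <= ca / A.
  by have := bnd (- A); rewrite normrN nA; apply.
have LAw : L <= A <= c0 / nc (sqe w) by rewrite LA Aw.
have caA : 0 <= ca / A by rewrite divr_ge0 // ltW.
have aL : `|sgn * L| = L by rewrite normrM (gtr0_norm L0); case: hsg => ->; rewrite ?normrN normr1 mul1r.
have hu : - A <= sgn * L <= A by rewrite -ler_norml aL.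
have nL : L <= `|sgn * L| by rewrite aL.
have key := H_compare gamma0 phi_lt (let: conj _ hi := Sw in hi) r0 h_range kappa_range c0_gt0 a1 a2 a3 a4 a5
  HF HH Sw cs0 KR0 r10 LD a6 a8 a9 a10 L_ge1 a11 L_far c0_small small_out a12 a13 LAw (ltW z0) caA
  (fun i j u _ => h0_entry HH0 OS r0 i j (path0_Gamma0 s u)) (fun i j u hu => fw u hu i j) bA bmA hu.
rewrite (path0_base s nL) in key.
have := le_trans (entry_le (Hs H w s (rc (sgn * L)) - h0 H0 s (rc (sgn * L))) i j) key.
rewrite (_ : (Hs H w s (rc (sgn * L)) - h0 H0 s (rc (sgn * L))) i j =
  H s w (xt w (rc (sgn * L))) i j - H0 s (x0 (rc (sgn * L))) i j); last by rewrite !mxE.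
move=> /le_lt_trans; apply.
have -> : 2 * (n%:R ^+ 2 * (Bb gamma n cs KR / A + ca / A +
    (CK gamma n KR * nc (sqe w) + Bb gamma n cs KR / A + ca / A) + (1 + T) * zeta * (cs^-1 + (A - - A)))) =
  4 * nn * (Bb gamma n cs KR + ca) * A^-1 + 2 * nn * CK gamma n KR * nc (sqe w) + Y * zeta.
  by rewrite /Y -/nn; ring.
have k1 : 4 * nn * (Bb gamma n cs KR + ca) * A^-1 <= 4 * nn * (Bb gamma n cs KR + ca) * d.
  exact: ler_wpM2l X1 _ _ dA.
have k2 : 2 * nn * CK gamma n KR * nc (sqe w) <= 2 * nn * CK gamma n KR * dq.
  exact: ler_wpM2l X2 _ _ (ltW qw).
exact: quarters k1 k2 hd hdq hz e0.
Unshelve. all: by end_near.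
Qed.
End HLimit.

(** * Admissibility for small eps *)

Section Thresholds.
Variable R : realType.
Local Notation C := (Cx R).

Lemma common_lower (s : seq R) : all (fun d => 0 < d) s -> exists2 q0 : R, 0 < q0 & all (fun d => q0 <= d) s.
Proof.
elim: s => [|d s IH] /=; first by exists 1.
move=> /andP[d0 /IH[q0 q00 hq]]; exists (Num.min d q0); first by rewrite lt_min d0.
rewrite ge_min lexx /=; apply: sub_all hq => x; apply: le_trans.
by rewrite ge_min lexx orbT.
Qed.

Variables (n : nat) (gamma r h kappa c0 cs r1 KR L : R).
Local Notation phi0 := (gamma * (1 + 2 * gamma / pi)).
Local Notation T := (tan phi0).
Hypothesis gamma0 : 0 < gamma.
Hypothesis phi_lt : phi0 < pi / 2.
Hypothesis r0 : 0 < r.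
Hypothesis h_range : 0 < h < r^-1.
Hypothesis kappa_range : 0 < kappa < 1 / 2.
Hypothesis c0_gt0 : 0 < c0.
Hypothesis cs0 : 0 < cs.
Hypothesis KR0 : 0 < KR.
Hypothesis r10 : 0 < r1.
Hypothesis T0 : 0 < T.
Hypothesis L0 : 0 < L.
Hypothesis c0_hP : c0 * T <= (1 / 2 - kappa) * (pi * kap gamma) / 2.
Hypothesis L_out : Cb gamma / L ^+ 2 <= r1 ^+ 2 / 2.

(** Each condition has its own threshold for |sqrt(eps)|, and [common_lower] takes their minimum. In
    [ad_hP1] both m tan phi0 = c0 T / |sqrt(eps)| and the period, at least pi kap / |sqrt(eps)|
    high, have the same order, so [c0_hP] must compare them beforehand; it keeps half of the margin
    for h. *)
Lemma admissible_small : exists2 q0 : R, 0 < q0 & forall w,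
  pi - 2 * gamma < imC w < 3 * pi + 2 * gamma -> nc (sqe w) < q0 ->
  admissible n gamma r h kappa c0 cs r1 KR L w.
Proof.
have [eta00 _ _ _] := eta_range r0 h_range; have am0 := amin_gt0 h_range.
have [del del0 hdel] := xq_near0 eta00.
have kp0 : 0 < kap gamma by have /andP[] := kap_range gamma0 phi_lt.
have pp := pi_gt0 R; have T1 : 0 < 1 + T by have := T0; lra.
have c0h := c0_hP; set G := (1 / 2 - kappa) * (pi * kap gamma) in c0h.
have G0 : 0 < G by rewrite mulr_gt0 ?mulr_gt0 //; case/andP: kappa_range; lra.
have h0 : 0 < h by case/andP: h_range.
have half0 : 0 < 1 / 2 :> R by rewrite divr_gt0.
have nn0 : 0 <= n%:R ^+ 2 :> R := sqr_ge0 _.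
set Cm := 4 / kap gamma ^+ 2; have Cm0 : 0 < Cm by rewrite divr_gt0 ?exprn_gt0.
set X1 := n%:R ^+ 2 * ((1 + T) * (Cm * KR * (cs^-1 + pi))).
have X10 : 0 <= X1.
  apply: (mulr_ge0 nn0 (mulr_ge0 (ltW T1) (mulr_ge0 (mulr_ge0 (ltW Cm0) (ltW KR0)) _))).
  by rewrite addr_ge0 ?invr_ge0 // ltW.
have CK0 : 0 <= CK gamma n KR.
  apply: addr_ge0 => //; apply: (mulr_ge0 (ltW T1)).
  exact: (mulr_ge0 (mulr_ge0 (mulr_ge0 (ltW Cm0) (ltW KR0)) (mulr_ge0 (ler0n _ 4) nn0)) (ltW pp)).
have [d1 d10 hd1] := exists_small X10 half0.
have [d2 d20 hd2] := exists_small (ltW (addr_gt0 Cm0 ltr01)) (exprn_gt0 2 r10).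
have [d3 d30 hd3] := exists_small CK0 ltr01.
have p2 : 0 < del * r / 2 by rewrite divr_gt0 // mulr_gt0.
have p3 : 0 < amin r h * r ^+ 3 / 64 by rewrite divr_gt0 // mulr_gt0 // exprn_gt0.
have p4 : 0 < c0 * r / 2 by rewrite divr_gt0 // mulr_gt0.
have p5 : 0 < G / (2 * h) by rewrite divr_gt0 // mulr_gt0.
have p6 : 0 < G * r / 2 by rewrite divr_gt0 // mulr_gt0.
have p10 : 0 < c0 / L by rewrite divr_gt0.
have p11 : 0 < r1 ^+ 2 / 2 by rewrite divr_gt0 // exprn_gt0.
have [q0 q00] := @common_lower [:: 1; del * r / 2; amin r h * r ^+ 3 / 64; c0 * r / 2; G / (2 * h);
  G * r / 2; r1; d1; d2; c0 / L; r1 ^+ 2 / 2; d3]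
  ltac:(by rewrite /= ltr01 p2 p3 p4 p5 p6 p10 p11 r10 d10 d20 d30).
move=> /= /and5P[b1 b2 b3 b4 /and5P[b5 b6 b7 b8 /and5P[b9 b10 b11 b12 _]]].
exists q0; first exact: q00.
move=> w argw qw; have Q0 := Q_gt0 w; set Q := nc (sqe w) in qw Q0.
have lt d : q0 <= d -> Q < d by exact: lt_le_trans.
have Q1 := lt _ b1; have Q2 : Q ^+ 2 <= Q by rewrite expr2 ler_piMl // ltW.
have /andP[hPl _] := hP_range gamma0 phi_lt argw; rewrite -/Q in hPl.
have hG : G / Q <= (1 / 2 - kappa) * hP gamma w.
  rewrite /G -mulrA ler_pM2l //; case/andP: kappa_range; lra.
split; rewrite -/Q.
- move=> t t0 ht; apply: hdel => //; first exact: sqe_neq0.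
  rewrite ncM; apply: (@le_lt_trans _ _ (Q * (2 / r))); first by rewrite ler_pM2l.
  have := lt _ b2; rewrite mulrA ltr_pdivrMr // ltr_pdivlMr //; lra.
- by apply: (le_trans Q2); apply: ltW; exact: lt.
- by rewrite ler_pdivlMr // mulrC mulrA ler_pdivrMr // -ler_pdivlMr //; apply: ltW; exact: lt.
- apply: lt_le_trans hG; rewrite ltr_pdivlMr // mulrDl.
  have -> : c0 / Q * T * Q = c0 * T by field; rewrite gt_eqF.
  have := lt _ b5; rewrite ltr_pdivlMr ?mulr_gt0 //; lra.
- apply: le_trans hG; rewrite ler_pdivlMr // mulrC mulrA ler_pdivrMr // -ler_pdivlMr //.
  by apply: ltW; exact: lt.
- by rewrite eps_sqe ncX; apply: (le_lt_trans Q2); exact: lt.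
- exact: lt.
- exact: ltW.
- have k1 : n%:R ^+ 2 * ((1 + T) * (Cm * KR * Q * (Q / cs + pi))) <= X1 * Q.
    have -> : X1 * Q = n%:R ^+ 2 * ((1 + T) * (Cm * KR * Q * (cs^-1 + pi))) by rewrite /X1; ring.
    apply: (ler_wpM2l nn0); apply: (ler_wpM2l (ltW T1)).
    apply: ler_wpM2l; first exact: (mulr_ge0 (mulr_ge0 (ltW Cm0) (ltW KR0)) (ltW Q0)).
    by rewrite lerD2r ler_piMl ?invr_ge0 // ltW.
  apply: (le_trans k1); apply: ltW; apply: le_lt_trans hd1; apply: (ler_wpM2l X10); exact: ltW (lt _ b8).
- apply: le_lt_trans hd2; rewrite mulrC ler_pM2l ?addr_gt0 //; apply: (le_trans Q2); exact: ltW (lt _ b9).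
- by rewrite ler_pdivlMr // mulrC -ler_pdivlMr //; exact: ltW (lt _ b10).
- have := lt _ b11; have := L_out; lra.
- by apply: le_trans (ltW hd3); apply: (ler_wpM2l CK0); exact: ltW (lt _ b12).
Qed.
End Thresholds.

(** * Choice of the length L *)

Section ExistsL.
Variable R : realType.

(** For L >= 1 one has L <= L^2 and 1/L <= 1, so each condition follows from a lower bound on L. The
    sum of these bounds is taken. *)
Lemma exists_L (r k r1 X Y Z : R) : 0 < r -> 0 < k -> 0 < r1 -> 0 <= X -> 0 <= Y -> 0 <= Z ->
  exists L : R, [/\ 1 <= L, (2 / r) ^+ 2 <= k * L ^+ 2, (k * L ^+ 2)^-1 < r1 ^+ 2,
    X / L ^+ 2 <= r1 ^+ 2 / 2 & Y * L^-1 * (L^-1 * Z + pi) <= 1 / 2].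
Proof.
move=> r0 k0 r10 X0 Y0 Z0; have pp := pi_gt0 R.
pose B1 := (2 / r) ^+ 2 / k; pose B2 := (k * r1 ^+ 2)^-1; pose B3 := X / (r1 ^+ 2 / 2).
pose B4 := 2 * (Y * (Z + pi)).
have r12 : 0 < r1 ^+ 2 by rewrite exprn_gt0.
have b1 : 0 <= B1 by rewrite divr_ge0 ?sqr_ge0 // ltW.
have b2 : 0 <= B2 by rewrite invr_ge0 mulr_ge0 // ltW.
have b3 : 0 <= B3 by rewrite divr_ge0 // divr_ge0 // ltW.
have b4 : 0 <= B4 by rewrite !mulr_ge0 // addr_ge0 // ltW.
pose L := 2 + B1 + B2 + B3 + B4.
have L1 : 1 <= L by rewrite /L; lra.
have L0 : 0 < L by lra.
have L2 : L <= L ^+ 2 by rewrite expr2 ler_peMl // ltW.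
have L20 : 0 < L ^+ 2 by rewrite exprn_gt0.
exists L; split=> //.
- rewrite [k * _]mulrC -ler_pdivrMr // -/B1.
  by apply: le_trans L2; rewrite /L; lra.
- rewrite -[X in _ < X]invrK ltf_pV2 ?posrE ?invr_gt0 ?mulr_gt0 // [k * _]mulrC -ltr_pdivrMr //.
  have -> : (r1 ^+ 2)^-1 / k = B2 by rewrite /B2 [in RHS]invfM mulrC.
  by apply: lt_le_trans L2; rewrite /L; lra.
- rewrite ler_pdivrMr // [X in _ <= X]mulrC -ler_pdivrMr ?divr_gt0 // -/B3.
  by apply: le_trans L2; rewrite /L; lra.
- have iL : L^-1 <= 1 by rewrite invf_le1.
  have k1 : L^-1 * Z + pi <= Z + pi by rewrite lerD2r ler_piMl.
  apply: (@le_trans _ _ (Y * L^-1 * (Z + pi))).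
    by apply: (ler_wpM2l _ k1); rewrite mulr_ge0 // invr_ge0 ltW.
  rewrite mulrAC ler_pdivrMr //.
  have : B4 <= L by rewrite /L; lra.
  by rewrite /B4; lra.
Qed.
End ExistsL.

(** * Analyticity and limit of the jump matrix in eps at a fixed time *)

Section InEpsilon.
Variables (R : realType) (n : nat) (y : prenormal R n) (gamma rho r delta h kappa c0 : R).
Local Notation C := (Cx R).
Local Notation M := 'M[C]_n.
Local Notation S := (Sdom gamma rho).
Local Notation to0 := (eps_to0 gamma rho).
Local Notation Gam := (Gamma gamma r h kappa c0).

Lemma Sdom_open w : S w -> exists2 d : R, 0 < d & forall v, nc (v - w) < d -> S v.
Proof.
move=> [hr /andP[a1 a2]]; rewrite norm_nc rc_lt in hr.
have e0 : 0 < rho - nc (eps w) by rewrite subr_gt0.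
have [d d0 hd] := cdiff_cont (cdiff_cexp w) e0.
exists (Num.min d (Num.min (imC w - (pi - 2 * gamma)) (3 * pi + 2 * gamma - imC w))).
  by rewrite !lt_min d0 !subr_gt0 a1.
move=> v; rewrite !lt_min => /and3P[v1 v2 v3]; split.
  by rewrite norm_nc rc_lt; have := hd v v1; have := nc_lower (eps v) (eps w); rewrite -/(eps v) -/(eps w); lra.
have := im_le_nc (v - w); rewrite imB ler_norml => /andP[k1 k2].
by apply/andP; split; lra.
Qed.

Lemma cdiff_sqe (w : C) : cdiff (@sqe R) w (sqe w / 2).
Proof.
have h1 : cdiff (fun v : C => 2^-1 * v) w 2^-1 by apply: cdiff_val (cdiff_scale 2^-1 (cdiff_id w)); rewrite mulr1.
apply: (@cdiff_ext _ (fun v => cexp (2^-1 * v))); first by move=> v; rewrite /sqe mulrC.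
by apply: cdiff_val (cdiff_cexpf h1); rewrite /sqe mulrC [2^-1 * w]mulrC mulrC.
Qed.

Variable t : C.
Hypothesis csinh_t : forall w, S w -> csinh (sqe w * t) != 0.

Lemma cdiff_xt_param w : S w -> exists D, cdiff (fun v => xt v t) w D.
Proof.
move=> Sw; have h1 : cdiff (fun v => sqe v * t) w (sqe w / 2 * t + sqe w * 0) := cdiff_mul (cdiff_sqe w) (cdiff_cst t w).
have h2 := cdiff_comp h1 (cdiff_csinh _); have h3 := cdiff_comp h1 (cdiff_ccosh _).
eexists; apply: cdiff_opp; apply: (cdiff_mul (cdiff_mul (cdiff_sqe w) h3)).
exact: (@cdiff_invf R (fun v => csinh (sqe v * t)) w _ (csinh_t Sw) h2).
Qed.

Hypothesis Gam_t : forall s w, S w -> Gam s w t.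
Variables (F H : sect -> C -> C -> M).
Hypothesis HF : model_solutions gamma rho r delta h kappa c0 y F.
Hypothesis HH : normalizing gamma rho r h kappa c0 y F H.
Hypothesis H_unit : forall w, S w -> H sD w (xt w t) \in unitmx.
Hypothesis L_diff : forall w, S w -> differentiable (L0 y) (eps w) /\ differentiable (L1 y) (eps w).

Lemma H_param s w : S w -> exists D, mdiff (fun v => H s v (xt v t)) w D.
Proof.
move=> Sw; have [D hD] := cdiff_xt_param Sw; have [dx _] := cdiff_is_derive hD.
have dp : differentiable (fun v : C => (v, xt v t)) w.
  by apply: differentiable_pair; [exact/derivable1_diffP/derivable_id|exact/derivable1_diffP].
have hj : differentiable (fun p : C * C => H s p.1 p.2) (w, xt w t).
  by apply: (H_analytic HH); split=> //=; exists t => //; exact: Gam_t.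
have hc := @differentiable_comp _ _ _ _ (fun v : C => (v, xt v t)) (fun p : C * C => H s p.1 p.2) _ dp hj.
eexists; apply: derivable_mdiff; apply/derivable1_diffP; exact: hc.
Qed.

(** At fixed t the branch [ell] is a continuous logarithm of x^2 - eps as a function of w, and
    [log_cdiff] applies again, now in w. Its limit is the one prescribed by [logD_lim]. *)
Lemma F_param : exists f : C -> 'I_n -> C, [/\
  forall w, S w -> F sD w (xt w t) = diag_mx (\row_j cexp (f w j)),
  forall w j, S w -> exists D, cdiff (fun v => f v j) w D &
  forall Lg, Gamma0 r h sD t -> cexp Lg = x0 t -> logsect r delta sD Lg ->
    forall j, (fun w => f w j) @ to0 --> t * L0 y 0 0 j + Lg * L1 y 0 0 j].
Proof.
have [ell [lc le ll] HFD] := FD_branch HF.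
exists (fun w j => t * L0 y (eps w) 0 j + ell (w, t) / 2 * L1 y (eps w) 0 j); split.
- by move=> w Sw; rewrite HFD //; exact: Gam_t.
- move=> w j Sw; have [d d0 hd] := Sdom_open Sw; have [D hD] := cdiff_xt_param Sw.
  have [/derivable1_diffP/derivable_mdiff/(_ 0 j) k0 /derivable1_diffP/derivable_mdiff/(_ 0 j) k1] := L_diff Sw.
  have e0 := cdiff_comp (cdiff_cexp w) k0; have e1 := cdiff_comp (cdiff_cexp w) k1.
  have lcw (e : R) : 0 < e -> exists2 del : R, 0 < del & forall v, nc (v - w) < del -> nc (ell (v, t) - ell (w, t)) < e.
    move=> ee0; pose A := [set p : C * C | S p.1 /\ Gam sD p.1 p.2].
    have Aw : A (w, t) by split=> //; exact: Gam_t.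
    have : (ell @ within A (nbhs (w, t))) [set z | nc (z - ell (w, t)) < e].
      by rewrite (nbhs_subspace_in Aw); apply: (lc (w, t)); apply/nbhs_nc; exists e.
    move=> -[[U V] /= [hU hV] hUV]; have /nbhs_nc[d1 d10 hd1] := hU.
    exists (Num.min d1 d) => [|v]; first by rewrite lt_min d10.
    rewrite lt_min => /andP[/hd1 Uv /hd Sv].
    apply: (hUV (v, t)); first by split=> //=; exact: nbhs_singleton.
    exact: (conj Sv (Gam_t sD Sv)).
  have hg := cdiff_sub (cdiff_comp hD (cdiff_sqr _)) (cdiff_cexp w).
  have hl := log_cdiff d0 lcw (fun v hv => le v t (hd v hv) (Gam_t sD (hd v hv))) hg.
  eexists; apply: cdiff_add; first exact: cdiff_mul (cdiff_cst t w) e0.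
  exact: cdiff_mul (cdiff_mul hl (cdiff_cst 2^-1 w)) e1.
- move=> Lg ht hL hs j; have FF := @eps_to0_filter R gamma rho.
  have cE : (@eps R) @ to0 --> (0 : C).
    apply/cvg_nc => e e0; apply: (@near_eps _ _ _ _ (Num.min 1 e)) => [|w _]; first by rewrite lt_min ltr01.
    rewrite lt_min => /andP[q1 qe]; rewrite subr0 eps_sqe ncX expr2; apply: le_lt_trans qe.
    by rewrite ler_piMl ?nc_ge0 // ltW.
  have cL (L : C -> 'rV[C]_n) : (\forall v \near (0 : C), differentiable L v) ->
      (fun w => L (eps w) 0 j) @ to0 --> L 0 0 j.
    move=> /nbhs_singleton/derivable1_diffP/derivable_mdiff/(_ 0 j) h1.
    exact: cvg_comp _ _ cE (cdiff_continuous h1).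
  have cl : (fun w => ell (w, t) / 2) @ to0 --> Lg.
    have -> : Lg = 2 * Lg / 2 by field.
    exact: cvgM (ll t Lg ht hL hs) (cvg_cst _).
  exact: cvgD (cvgM (cvg_cst t) (cL _ (L0_analytic y))) (cvgM cl (cL _ (L1_analytic y))).
Qed.

Lemma diag_cexp_unit (d : 'I_n -> C) : diag_mx (\row_j cexp (d j)) \in unitmx.
Proof.
rewrite unitmxE unitfE det_diag; apply/prodf_neq0 => i _; rewrite mxE; exact: cexp_neq0.
Qed.

Lemma jump_holo : holo S (fun w => cc F H w 0 t).
Proof.
move=> w Sw; have [f [fE fD _]] := F_param; have [d d0 hd] := Sdom_open Sw.
have [Df hDf] : exists D, mdiff (fun v => F sD v (xt v t)) w D.
  have /choice[D hD] := fun j => fD w j Sw.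
  eexists; apply: (mdiff_near d0 _ (mdiff_diag (fun j => cdiff_cexpf (hD j)))) => v /hd Sv.
  by rewrite fE.
have uF : F sD w (xt w t) \in unitmx by rewrite fE //; exact: diag_cexp_unit.
have [Dfi hDfi] := mdiff_inv_ex uF hDf.
have [D1 hD1] := H_param sD Sw; have [D2 hD2] := H_param sU Sw.
have [D1i hD1i] := mdiff_inv_ex (H_unit Sw) hD1.
have := mdiff_mul (mdiff_mul hDfi (mdiff_mul hD1i hD2)) hDf.
move=> /mdiff_is_derive[dv _]; apply/derivable1_diffP.
have -> : (fun v => cc F H v 0 t) =
  (fun v => invmx (F sD v (xt v t)) *m (invmx (H sD v (xt v t)) *m H sU v (xt v t)) *m F sD v (xt v t)).
  by apply/funext => v; rewrite /cc /ec /Fs /Hs addr0.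
exact: dv.
Qed.

Variable H0 : sect -> C -> M.
Hypothesis HH0 : normalizing0 r delta y H0.

(** At the point [x0 t] the Stokes relation is solved for [Cl]. This writes [Cl] as the same product
    of H_D, H_U and F_D as the jump matrix, and the factors converge one by one. *)
Lemma jump_limit l (Cl : M) (Lg : C) : Gamma0 r h sD t -> Gamma0 r h sU t ->
  (if l is pL then 0 < reC t else reC t < 0) -> cexp Lg = x0 t -> logsect r delta sD Lg ->
  (forall s, Sect r delta s (x0 t)) ->
  (forall s, (fun w => H s w (xt w t)) @ to0 --> H0 s (x0 t)) ->
  stokes_matrix r delta h y H0 l Cl -> (fun w => cc F H w 0 t) @ to0 --> Cl.
Proof.
move=> hD hU hl hL hs hS hH st; have FF := @eps_to0_filter R gamma rho.
have t0 : t != 0 by apply/eqP => e; move: hl; rewrite e; case: (l); rewrite /= ltxx.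
have ll : Omega0_l r h l (cexp Lg).
  rewrite hL; split; first by exists t.
  split; first by exists t.
  have nt : 0 < nc t ^+ 2 by rewrite exprn_gt0 // nc_gt0.
  rewrite /x0 reN reV; case: l hl {st} => hl.
    by rewrite oppr_lt0 divr_gt0.
  by rewrite oppr_gt0 pmulr_llt0 ?invr_gt0.
have [f [fE _ fL]] := F_param; have {}fL := fL Lg hD hL hs.
have F0E : F0 y Lg = diag_mx (\row_j cexp (t * L0 y 0 0 j + Lg * L1 y 0 0 j)).
  by rewrite /F0 /modelF hL /x0 invrN invrK opprK.
have uF0 : F0 y Lg \in unitmx by rewrite F0E; exact: diag_cexp_unit.
have cF : (fun w => F sD w (xt w t)) @ to0 --> F0 y Lg.
  have : (fun w => diag_mx (\row_j cexp (f w j))) @ to0 --> F0 y Lg.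
    rewrite F0E; apply/mx_cvgP => i j; rewrite !mxE; under eq_fun do rewrite !mxE.
    case: eqVneq => [->|_]; rewrite ?mulr1n ?mulr0n; last exact: cvg_cst.
    exact: cvg_comp _ _ (fL j) (cdiff_continuous (cdiff_cexp _)).
  apply: cvg_trans; apply: near_eq_cvg; apply: (@near_eps _ _ _ _ 1) => // w Sw _.
  by rewrite fE.
have uH : H0 sD (x0 t) \in unitmx by exact: (H0_unit HH0).
have e1 : Cl = invmx (F0 y Lg) *m (invmx (H0 sD (x0 t)) *m H0 sU (x0 t)) *m F0 y Lg.
  have := st Lg hs ll; rewrite hL => ->.
  by rewrite !mulmxA mulVmx // mul1mx -mulmxA mulVmx // mulmx1.
rewrite e1.
have -> : (fun w => cc F H w 0 t) =
  (fun v => invmx (F sD v (xt v t)) *m (invmx (H sD v (xt v t)) *m H sU v (xt v t)) *m F sD v (xt v t)).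
  by apply/funext => v; rewrite /cc /ec /Fs /Hs addr0.
exact: (mx_cvg_mul (mx_cvg_mul (mx_cvg_inv uF0 cF) (mx_cvg_mul (mx_cvg_inv uH (hH sD)) (hH sU))) cF).
Qed.
End InEpsilon.

(** * Logarithms of the base points *)

Section Logarithms.
Variable R : realType.
Local Notation C := (Cx R).

Lemma cexp_ln (a : R) : 0 < a -> cexp (rc (ln a)) = rc a :> C.
Proof.
move=> a0; apply: Cext; rewrite /= lnK ?posrE // ?cos0 ?sin0 ?mulr1 ?mulr0 //.
Qed.

(* On the right side of the t-plane x0 t = -1/t has argument - pi in the branch of F_D. *)
Lemma log_x0 (r delta L : R) (sgn : R) : sgn = 1 \/ sgn = -1 -> 0 < L -> L^-1 < r -> 0 < delta ->
  exists Lg : C, cexp Lg = x0 (rc (sgn * L)) /\ logsect r delta sD Lg.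
Proof.
move=> hsg L0 Lr d0; have iL0 : 0 < L^-1 by rewrite invr_gt0.
have pp := pi_gt0 R.
case: hsg => ->.
  exists (rc (ln L^-1) - iC R * rc pi).
  have E : cexp (rc (ln L^-1) - iC R * rc pi) = - rc L^-1.
    by rewrite cexpD cexpN cexp_pi cexp_ln // invrN invr1 mulrN1.
  split; first by rewrite E /x0 mul1r rcV.
  split; first by rewrite E norm_nc ncN nc_rc rc_lt gtr0_norm.
  by rewrite imB imM re_iC im_iC re_rc !im_rc mul0r mul1r; apply/andP; split; lra.
exists (rc (ln L^-1)); split; first by rewrite cexp_ln // /x0 mulN1r rcN invrN opprK rcV.
split; first by rewrite cexp_ln // norm_nc nc_rc rc_lt gtr0_norm.
by rewrite im_rc; apply/andP; split; lra.
Qed.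
End Logarithms.

(** * The jump matrices at an admissible eps *)

Section Jump.
Variables (R : realType) (n : nat) (y : prenormal R n) (gamma rho r delta h kappa c0 : R).
Local Notation C := (Cx R).
Local Notation M := 'M[C]_n.
Local Notation phi0 := (gamma * (1 + 2 * gamma / pi)).
Local Notation T := (tan phi0).
Variables (cs r1 KR L : R).
Hypothesis gamma0 : 0 < gamma.
Hypothesis phi_lt : phi0 < pi / 2.
Hypothesis r0 : 0 < r.
Hypothesis h_range : 0 < h < r^-1.
Hypothesis kappa_range : 0 < kappa < 1 / 2.
Hypothesis c0_gt0 : 0 < c0.
Hypothesis cs0 : 0 < cs.
Hypothesis LD : local_data y phi0 cs r1 KR.
Hypothesis L_r : 2 / r <= L.
Variable w : C.
Hypothesis Sw : Sdom gamma rho w.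
Hypothesis adm : admissible n gamma r h kappa c0 cs r1 KR L w.
Variables (F H : sect -> C -> C -> M).
Hypothesis HF : model_solutions gamma rho r delta h kappa c0 y F.
Hypothesis HH : normalizing gamma rho r h kappa c0 y F H.
Local Notation Gam := (Gamma gamma r h kappa c0).

Let argw : pi - 2 * gamma < imC w < 3 * pi + 2 * gamma := let: conj _ hi := Sw in hi.
Let a1 := ad_approx adm.
Let a2 := ad_amin adm.
Let a3 := ad_m adm.
Let a4 := ad_hP1 adm.
Let a5 := ad_hP2 adm.
Let LL : 2 / r <= L <= c0 / nc (sqe w).
Proof. by rewrite L_r (ad_L adm). Qed.
Let Gopen := @Gamma_open _ _ r h kappa _ _ gamma0 phi_lt argw c0_gt0.
Let Gcsinh := @Gamma_csinh _ _ _ _ _ _ _ gamma0 phi_lt argw h_range kappa_range c0_gt0 a4.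

Lemma base_side sgn : sgn = 1 \/ sgn = -1 -> side gamma r h kappa c0 w sgn (rc (sgn * L)).
Proof. by move=> hsg; exact: (side_base gamma0 phi_lt argw r0 h_range kappa_range c0_gt0 a1 a4). Qed.

Lemma base_Gamma s sgn : sgn = 1 \/ sgn = -1 -> Gam s w (rc (sgn * L)).
Proof. by move=> /base_side[]; case: s. Qed.

Lemma base_csinh sgn : sgn = 1 \/ sgn = -1 -> csinh (sqe w * rc (sgn * L)) != 0.
Proof. by move=> hsg; exact: (Gcsinh (base_Gamma sD hsg)). Qed.

Lemma base_unit sgn : sgn = 1 \/ sgn = -1 -> H sD w (xt w (rc (sgn * L))) \in unitmx.
Proof.
move=> hsg; have hG := base_Gamma sD hsg.
by have [] := Hs_ode HH Sw Gcsinh hG (good_D HF Sw Gopen Gcsinh hG).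
Qed.

(** The gap of [local_data] is for directions of real part 1; the passage to the unit vector e^{i
    theta} costs the factor cos theta. *)
Let gap x : nc x < r1 -> forall i j : 'I_n, (i < j)%N ->
  cos (theta gamma w) * cs <= reC (edir gamma w * (lam y i (eps w) x - lam y j (eps w) x)).
Proof.
move=> hx i j ij; have cth := cos_theta_gt0 gamma0 phi_lt argw.
have [h1 _ _ _] := LD.
have sl : slope T (1 + iC R * rc (tan (theta gamma w))).
  split; first by rewrite reD reM re_iC im_iC im_rc mul0r mulr0 subr0 addr0.
  by rewrite imD imM re_iC im_iC im_rc re_rc mul0r mul1r !add0r; exact: tan_theta.
have := h1 (eps w) x (ad_eps adm) hx i j ij _ sl.
rewrite (slope_edir gamma0 phi_lt argw) -mulrA reM re_rc im_rc mul0r subr0 mulrC => k.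
by rewrite mulrC -ler_pdivlMr.
Qed.

Let cg0 : 0 < cos (theta gamma w) * cs.
Proof. by rewrite mulr_gt0 // cos_theta_gt0. Qed.

Lemma jump_shape sgn : sgn = 1 \/ sgn = -1 ->
  (forall i, cc F H w 0 (rc (sgn * L)) i i = 1) /\
  (forall i j : 'I_n, (if sgn == 1 then (i < j)%N else (j < i)%N) -> cc F H w 0 (rc (sgn * L)) i j = 0).
Proof.
move=> hsg; exact: (jump_triangular gamma0 phi_lt argw r0 h_range kappa_range c0_gt0 a1 a2 a3 a4 a5 HF HH Sw
  cg0 gap (ad_q adm) hsg (base_side hsg)).
Qed.

Lemma jump_side l x : Omega_l gamma r h kappa c0 l w x ->
  invmx (H sD w x) *m H sU w x =
  F sD w x *m cc F H w 0 (rc ((if l is pL then 1 else -1) * L)) *m invmx (F sD w x).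
Proof.
move=> [t /Gamma_l_sign[hD hU ht] <-].
set sgn : R := if l is pL then 1 else -1.
have hsg : sgn = 1 \/ sgn = -1 by rewrite /sgn; case: (l); [left|right].
have St : side gamma r h kappa c0 w sgn t.
  by split=> //; move: ht; rewrite /sgn; case: (l) => k; lra.
rewrite -(jump_base gamma0 phi_lt argw r0 h_range kappa_range c0_gt0 a1 a2 a3 a4 a5 HF HH Sw hsg LL St).
have okt := ok_side gamma0 phi_lt argw r0 h_range kappa_range c0_gt0 a1 a2 a3 a4 a5 HF Sw hsg St.
by have := cc_ec H HF Sw Gopen Gcsinh okt; rewrite /ec /Hs /Fs addr0.
Qed.

Lemma jump_trivial x : Omega_C gamma r h kappa c0 w x -> invmx (H sD w x) *m H sU w x = 1%:M.
Proof.
move=> [t [hD hU] <-].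
have := jump_center gamma0 phi_lt argw r0 h_range kappa_range c0_gt0 a1 a3 a4 a5 HF HH Sw
  cg0 gap (ad_q adm) hD hU.
by rewrite /ec /Hs (_ : xt w (t + per w) = xt w t) //; exact: (xq_per t (sqe_per w)).
Qed.
End Jump.

(** * Choice of the constants and conclusion *)

Theorem theorem4p25 (R : realType) (n : nat) (y : prenormal R n) (gamma : R) :
  (2 <= n)%N ->
  0 < gamma -> gamma * (1 + 2 * gamma / pi) < theta0 y ->
  exists2 r0 : R, 0 < r0 & forall r delta h kappa : R,
  0 < r < r0 -> 0 < delta -> ray_free r delta y ->
  0 < h < r^-1 -> (forall s, Omega0 r h s `<=` Sect r delta s) ->
  0 < kappa < 1 / 2 ->
  exists2 c1 : R, 0 < c1 & forall c0 : R, 0 < c0 < c1 ->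
  exists2 rho0 : R, 0 < rho0 & forall rho : R, 0 < rho < rho0 ->
  lam_gap gamma rho y ->
  forall F H : sect -> Cx R -> Cx R -> 'M[Cx R]_n,
  model_solutions gamma rho r delta h kappa c0 y F ->
  normalizing gamma rho r h kappa c0 y F H ->
  forall (H0 : sect -> Cx R -> 'M[Cx R]_n) (C_R C_L : 'M[Cx R]_n),
  normalizing0 r delta y H0 ->
  stokes_matrix r delta h y H0 pR C_R ->
  stokes_matrix r delta h y H0 pL C_L ->
  exists hC_R hC_L : Cx R -> 'M[Cx R]_n,
    [/\ forall w, Sdom gamma rho w ->
          [/\ forall x, Omega_l gamma r h kappa c0 pR w x ->
                invmx (H sD w x) *m H sU w x
                = F sD w x *m hC_R w *m invmx (F sD w x),
              forall x, Omega_l gamma r h kappa c0 pL w x ->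
                invmx (H sD w x) *m H sU w x
                = F sD w x *m hC_L w *m invmx (F sD w x) &
              forall x, Omega_C gamma r h kappa c0 w x ->
                invmx (H sD w x) *m H sU w x = 1%:M],
        forall w, Sdom gamma rho w ->
          upper_unipotent (hC_R w) /\ lower_unipotent (hC_L w),
        holo (Sdom gamma rho) hC_R /\ holo (Sdom gamma rho) hC_L &
        hC_R @ eps_to0 gamma rho --> C_R /\ hC_L @ eps_to0 gamma rho --> C_L].
Proof.
move=> _ gamma0 phi_theta.
set phi0 := gamma * (1 + 2 * gamma / pi) in phi_theta.
have pp := pi_gt0 R.
have phi00 : 0 < phi0 by rewrite mulr_gt0 // ltr_wpDr // divr_ge0 ?ltW // mulr_gt0.
have phi_lt := phi_lt_halfpi phi00 phi_theta.
have [cs [r1 [KR [cs0 r10 KR0 LD]]]] := spectral phi00 phi_theta.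
set T := tan phi0.
have T0 : 0 < T.
  rewrite /T /tan divr_gt0 //; first by apply: sin_gt0_pi; rewrite phi00 /=; lra.
  by apply: cos_gt0_pihalf; rewrite phi_lt andbT; lra.
have kp0 : 0 < kap gamma by have /andP[] := kap_range gamma0 phi_lt.
pose k0 := T ^+ 2 / (2 * (1 + T ^+ 2)).
have k00 : 0 < k0 by apply: divr_gt0 (exprn_gt0 2 T0) (mulr_gt0 (ltr0Sn _ 1) _); rewrite ltr_pwDl ?sqr_ge0.
have k0_half : k0 <= 1.
  by rewrite ler_pdivrMr ?mulr_gt0 ?ltr_pwDl ?sqr_ge0 // mul1r; have := sqr_ge0 T; lra.
have Cb0 : 0 <= Cb gamma by exact: ltW (divr_gt0 (divr_gt0 (ltr0Sn _ 15) (exprn_gt0 2 kp0)) k00).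
exists 1 => // r delta h kappa /andP[r0 _] delta0 _ h_range OS kappa_range.
have Y0 : 0 <= n%:R ^+ 2 * ((1 + T) * (Cb gamma * KR)).
  apply: mulr_ge0 (sqr_ge0 _) (mulr_ge0 _ (mulr_ge0 Cb0 (ltW KR0))); lra.
have Z0 : 0 <= cs^-1 by rewrite invr_ge0 ltW.
(* L is fixed before c0 and rho, so that the base points and the path of comparison are common to
   all eps. *)
have [L [L_ge1 L_far L_x0 L_out L_small]] := exists_L r0 k00 r10 Cb0 Y0 Z0.
have Lpos : 0 < L by exact: lt_le_trans L_ge1.
have L_r : 2 / r <= L.
  rewrite -ler_sqr ?nnegrE ?(ltW Lpos) ?divr_ge0 ?(ltW r0) //; apply: (le_trans L_far).
  by rewrite ler_piMl ?sqr_ge0.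
have G0 : 0 < (1 / 2 - kappa) * (pi * kap gamma) / 2.
  by rewrite divr_gt0 // mulr_gt0 ?mulr_gt0 //; case/andP: kappa_range => *; lra.
(* The first bound keeps the path in the strip where |x^2 - eps| = O(1 / |t|^2); the second keeps it
   low against the period. *)
exists (Num.min (kap gamma / 8 / T) ((1 / 2 - kappa) * (pi * kap gamma) / 2 / T)).
  by rewrite lt_min (divr_gt0 (divr_gt0 kp0 (ltr0Sn _ 7)) T0) (divr_gt0 G0 T0).
move=> c0 /andP[c0_gt0]; rewrite lt_min !(ltr_pdivlMr _ _ T0) => /andP[/ltW c0_small /ltW c0_hP].
have [q0 q00 hadm] := admissible_small n gamma0 phi_lt r0 h_range kappa_range c0_gt0 cs0 KR0 r10 T0 Lpos c0_hP L_out.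
exists (q0 ^+ 2) => [|rho /andP[_ rho_lt] _ F H HF HH H0 C_R C_L HH0 stR stL]; first by rewrite exprn_gt0.
have adm w : Sdom gamma rho w -> admissible n gamma r h kappa c0 cs r1 KR L w.
  move=> [hw argw]; apply: hadm => //; move: hw.
  rewrite norm_nc rc_lt eps_sqe ncX => hw.
  by have := lt_trans hw rho_lt; rewrite ltr_sqr ?nnegrE ?nc_ge0 ?(ltW q00).
have small_out : n%:R ^+ 2 * ((1 + T) * (Cb gamma * KR * L^-1 * (L^-1 / cs + pi))) <= 1 / 2.
  by move: L_small; rewrite -!mulrA.
have s1 : (1 : R) = 1 \/ (1 : R) = -1 by left.
have s2 : (-1 : R) = 1 \/ (-1 : R) = -1 by right.
have Gb s sgn : sgn = 1 \/ sgn = -1 -> Gamma0 r h s (rc (sgn * L)).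
  move=> hsg; have := path0_Gamma0 r0 h_range T0 L_ge1 L_far s (sgn * L).
  rewrite path0_base // normrM (gtr0_norm Lpos).
  by case: hsg => ->; rewrite ?normrN normr1 mul1r.
have Ldiff w : Sdom gamma rho w -> differentiable (L0 y) (eps w) /\ differentiable (L1 y) (eps w).
  by move=> /adm aw; have [_ _ _ hL] := LD; apply: hL; exact: ad_eps aw.
have csinh_t sgn : sgn = 1 \/ sgn = -1 -> forall w, Sdom gamma rho w -> csinh (sqe w * rc (sgn * L)) != 0.
  move=> hsg w Sw.
  exact: (base_csinh gamma0 phi_lt r0 h_range kappa_range c0_gt0 L_r Sw (adm w Sw) hsg).
have Gam_t sgn : sgn = 1 \/ sgn = -1 -> forall s w, Sdom gamma rho w -> Gamma gamma r h kappa c0 s w (rc (sgn * L)).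
  move=> hsg s w Sw.
  exact: (base_Gamma gamma0 phi_lt r0 h_range kappa_range c0_gt0 L_r Sw (adm w Sw) s hsg).
have H_unit sgn : sgn = 1 \/ sgn = -1 -> forall w, Sdom gamma rho w -> H sD w (xt w (rc (sgn * L))) \in unitmx.
  move=> hsg w Sw.
  exact: (base_unit gamma0 phi_lt r0 h_range kappa_range c0_gt0 L_r Sw (adm w Sw) HF HH hsg).
have hol sgn (hsg : sgn = 1 \/ sgn = -1) : holo (Sdom gamma rho) (fun w => cc F H w 0 (rc (sgn * L))).
  exact: (jump_holo (csinh_t sgn hsg) (Gam_t sgn hsg) HF HH (H_unit sgn hsg) Ldiff).
have lim l sgn Cl (hsg : sgn = 1 \/ sgn = -1) : (if l is pL then 0 < sgn else sgn < 0) ->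
    stokes_matrix r delta h y H0 l Cl -> (fun w => cc F H w 0 (rc (sgn * L))) @ eps_to0 gamma rho --> Cl.
  move=> hl st.
  have Lr : L^-1 < r.
    rewrite -[r]invrK ltf_pV2 ?posrE ?invr_gt0 //; apply: lt_le_trans L_r.
    by rewrite ltr_pMl ?invr_gt0 //; lra.
  have [Lg [hL hs]] := log_x0 hsg Lpos Lr delta0.
  have inS s : Sect r delta s (x0 (rc (sgn * L))) by apply: OS; exists (rc (sgn * L)) => //; exact: Gb.
  have conv s : (fun w => H s w (xt w (rc (sgn * L)))) @ eps_to0 gamma rho --> H0 s (x0 (rc (sgn * L))).
    exact: (H_limit gamma0 phi_lt r0 h_range kappa_range c0_gt0 cs0 KR0 r10 LD T0 L_ge1 L_far L_x0
      c0_small small_out adm HF HH HH0 OS hsg).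
  apply: (jump_limit (csinh_t sgn hsg) (Gam_t sgn hsg) HF Ldiff HH0 (Gb sD sgn hsg) (Gb sU sgn hsg)
    _ hL hs inS conv st).
  by rewrite re_rc; case: (l) hl => hl; [rewrite mulr_gt0|rewrite nmulr_rlt0].
(* As x(t) is close to -1/t, the component of x_R is on the left of the t-plane: its matrix is read
   at -L and the other one at L. *)
exists (fun w => cc F H w 0 (rc (-1 * L))), (fun w => cc F H w 0 (rc (1 * L))); split.
- move=> w Sw; have aw := adm w Sw; split=> x hx.
  + exact: (jump_side gamma0 phi_lt r0 h_range kappa_range c0_gt0 L_r Sw aw HF HH hx).
  + exact: (jump_side gamma0 phi_lt r0 h_range kappa_range c0_gt0 L_r Sw aw HF HH hx).
  + exact: (jump_trivial gamma0 phi_lt r0 h_range kappa_range c0_gt0 cs0 LD Sw aw HF HH hx).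
- move=> w Sw; have aw := adm w Sw.
  have sh sgn (hsg : sgn = 1 \/ sgn = -1) :=
    jump_shape gamma0 phi_lt r0 h_range kappa_range c0_gt0 cs0 LD L_r Sw aw HF HH hsg.
  have [dp tp] := sh _ s1; have [dm tm] := sh _ s2.
  have e1 : (-1 == 1 :> R) = false by apply/negbTE; rewrite lt_eqF //; lra.
  rewrite eqxx in tp; rewrite e1 in tm.
  split; split.
  + by apply/is_trig_mxP => i j ij; rewrite mxE; exact: tm.
  + by move=> j; rewrite mxE; exact: dm.
  + by apply/is_trig_mxP => i j ij; exact: tp.
  + exact: dp.
- by split; exact: hol.
- by split; [apply: lim stR => //; lra|apply: lim stL => //; exact: ltr01].
Qed.
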